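(* Let $\Gamma_1,\Gamma_2$ be two locally perturbed sound-hard surfaces (Neumann boundary condition) with regions $\Omega_j=\{x\in\mathbb R^3: x_3>f_j(\tilde x)\}$, $j=1,2$. Let $d\in\mathbb S^2_-$ and suppose $u^{sc}_{1,\infty}(\hat x;d)=u^{sc}_{2,\infty}(\hat x;d)$ for all $\hat x\in\mathbb S^2_+$. Then $u^{sc}_1(x;d)=u^{sc}_2(x;d)$ for all $x\in\Omega_1\cap\Omega_2$.
   Context: Fix a wave number $k>0$. Write $x=(\tilde x,x_3)\in\mathbb R^3$ with $\tilde x=(x_1,x_2)$, and $\mathbb S^2_\pm=\{x\in\mathbb R^3:|x|=1,\ \pm x_3>0\}$. A locally perturbed surface is $\Gamma=\{(\tilde x,f(\tilde x)):\tilde x\in\mathbb R^2\}$, where $f:\mathbb R^2\to\mathbb R$ is Lipschitz continuous and $f(\tilde x)=0$ for $|\tilde x|>R$ for some $R>\max|f|$; $\Omega=\{x:x_3>f(\tilde x)\}$ is the region above $\Gamma$ and $\nu$ is the unit normal on $\Gamma$ pointing into $\Omega$. For $d=(\alpha,\beta,-\gamma)\in\mathbb S^2_-$ the incident plane wave is $u^{in}(x;d)=e^{ikx\cdot d}$ and its reflected wave from the flat plane $\{x_3=0\}$ is $u^{re}(x;d)=-e^{ik(\alpha x_1+\beta x_2+\gamma x_3)}$ in the Dirichlet case and $u^{re}(x;d)=+e^{ik(\alpha x_1+\beta x_2+\gamma x_3)}$ in the Neumann case. The total field is $u=u^{in}+u^{re}+u^{sc}$, where $u$ satisfies $\Delta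 u+k^2u=0$ in $\Omega$, the boundary condition $u=0$ on $\Gamma$ (sound-soft/Dirichlet) or $\partial_\nu u=0$ on $\Gamma$ (sound-hard/Neumann), and the scattered field $u^{sc}$ satisfies the Sommerfeld radiation condition $\lim_{r\to\infty}r(\partial_ru^{sc}-iku^{sc})=0$, $r=|x|$, $x\in\Omega$; this problem is uniquely solvable. Then $u^{sc}(x;d)=\frac{e^{ik|x|}}{|x|}\{u^{sc}_\infty(\hat x;d)+O(1/|x|)\}$ as $|x|\to\infty$ in $\Omega$, $\hat x=x/|x|\in\mathbb S^2_+$, and $u^{sc}_\infty(\cdot;d)$ is the far-field pattern. Quantities associated with a surface $\Gamma_j=\{x_3=f_j(\tilde x)\}$ carry the index $j$. *)

(* Defs.v *)
From HB Require Import structures.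
From mathcomp Require Import all_boot all_order all_algebra.
From mathcomp Require Import all_classical all_reals all_analysis.
Set Implicit Arguments. Unset Strict Implicit. Unset Printing Implicit Defensive.
Import Order.TTheory GRing.Theory Num.Theory.
Import numFieldNormedType.Exports.
Local Open Scope classical_set_scope.
Local Open Scope ring_scope.

Section Defs.
Variable R : realType.

(* points of R^3 : x = ((x1, x2), x3) ; x~ = x.1 *)
Definition pt := ((R * R) * R)%type.
(* complex numbers represented as (real part, imaginary part) *)
Definition cplx := (R * R)%type.

Definition mkpt (a b c : R) : pt := ((a, b), c).
Definition e1 : pt := mkpt 1 0 0.
Definition e2 : pt := mkpt 0 1 0.
Definition e3 : pt := mkpt 0 0 1.

Definition enorm2 (y : R * R) : R := Num.sqrt (y.1 ^+ 2 + y.2 ^+ 2).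
Definition enorm3 (x : pt) : R := Num.sqrt (x.1.1 ^+ 2 + x.1.2 ^+ 2 + x.2 ^+ 2).

Definition cmul (z w : cplx) : cplx := (z.1 * w.1 - z.2 * w.2, z.1 * w.2 + z.2 * w.1).
Definition cexpi (t : R) : cplx := (cos t, sin t).
Definition cabs (z : cplx) : R := enorm2 z.

Definition leb3 := ((@lebesgue_measure R \x @lebesgue_measure R) \x @lebesgue_measure R)%E.

Definition locally_perturbed (f : R * R -> R) : Prop :=
  (exists L : R, forall a b : R * R, `|f a - f b| <= L * enorm2 (a.1 - b.1, a.2 - b.2)) /\
  (exists Rr : R, (forall y, `|f y| < Rr) /\ (forall y, Rr < enorm2 y -> f y = 0)).

Definition Omega (f : R * R -> R) : set pt := [set x | f x.1 < x.2].

Definition S2plus : set pt := [set x | enorm3 x = 1 /\ 0 < x.2].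
Definition S2minus : set pt := [set x | enorm3 x = 1 /\ x.2 < 0].

(* incident plane wave e^{i k x.d} and its reflection (Neumann case:
   + e^{i k (alpha x1 + beta x2 + gamma x3)}, d = (alpha, beta, -gamma)) *)
Definition u_in (k : R) (d : pt) (x : pt) : cplx :=
  cexpi (k * (d.1.1 * x.1.1 + d.1.2 * x.1.2 + d.2 * x.2)).
Definition u_re_N (k : R) (d : pt) (x : pt) : cplx :=
  cexpi (k * (d.1.1 * x.1.1 + d.1.2 * x.1.2 - d.2 * x.2)).

Definition pd (e : pt) (u : pt -> cplx) (x : pt) : cplx := 'D_e u x.

(* u is (classically) differentiable in D and u, grad u are square integrable
   on D /\ B for every ball B  (H^1_loc up to the boundary) *)
Definition H1loc (u : pt -> cplx) (D : set pt) : Prop :=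
  (forall x, D x -> differentiable u x) /\
  forall rb : R,
    let DB := D `&` [set x | enorm3 x < rb] in
    (forall g : pt -> R,
       g = (fun x => (u x).1) \/ g = (fun x => (u x).2) \/
       (exists e, (e = e1 \/ e = e2 \/ e = e3) /\
          (g = (fun x => (pd e u x).1) \/ g = (fun x => (pd e u x).2))) ->
       leb3.-integrable DB (fun x => ((g x) ^+ 2)%:E)).

(* C^1 test functions with compact support in R^3 (not required to vanish on Gamma) *)
Definition test_fun (phi : pt -> R) : Prop :=
  (forall x, differentiable phi x) /\
  (forall e, (e = e1 \/ e = e2 \/ e = e3) -> continuous (fun x => 'D_e phi x)) /\
  (exists rb : R, forall x, rb < enorm3 x -> phi x = 0).

(* weak form of  Delta u + k^2 u = 0 in D,  d_nu u = 0 on the boundary of D: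
   int_D grad u . grad phi - k^2 u phi = 0 for every test function phi
   (real and imaginary parts) *)
Definition weak_helmholtz_neumann (k : R) (u : pt -> cplx) (D : set pt) : Prop :=
  forall phi, test_fun phi ->
    (\int[leb3]_(x in D)
       (((pd e1 u x).1 * 'D_e1 phi x + (pd e2 u x).1 * 'D_e2 phi x
          + (pd e3 u x).1 * 'D_e3 phi x - k ^+ 2 * (u x).1 * phi x)%:E) = 0)%E /\
    (\int[leb3]_(x in D)
       (((pd e1 u x).2 * 'D_e1 phi x + (pd e2 u x).2 * 'D_e2 phi x
          + (pd e3 u x).2 * 'D_e3 phi x - k ^+ 2 * (u x).2 * phi x)%:E) = 0)%E.

(* Sommerfeld radiation condition  r (d_r u - i k u) -> 0, r = |x| -> oo, x in D *)
Definition radiating (k : R) (u : pt -> cplx) (D : set pt) : Prop :=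
  forall eps : R, 0 < eps -> exists r0 : R, forall x, D x -> r0 < enorm3 x ->
    let r := enorm3 x in
    let dru := 'D_(r^-1 *: x) u x in
    cabs (r * (dru.1 + k * (u x).2), r * (dru.2 - k * (u x).1)) < eps.

Definition scat_sol_N (k : R) (f : R * R -> R) (d : pt) (us : pt -> cplx) : Prop :=
  let D := Omega f in
  let u := fun x => u_in k d x + u_re_N k d x + us x in
  H1loc us D /\ weak_helmholtz_neumann k u D /\ radiating k us D.

(* F is the far-field pattern of u:
   u(x) = e^{ik|x|}/|x| (F(xh) + O(1/|x|)), i.e. for each xh in S^2_+,
   | r e^{-ikr} u(r xh) - F(xh) | <= C / r for r large *)
Definition far_field (k : R) (u : pt -> cplx) (F : pt -> cplx) : Prop :=
  forall xh, S2plus xh -> exists C r0 : R, forall r : R, r0 <= r -> 0 < r ->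
    cabs (cmul (r, 0) (cmul (cexpi (- (k * r))) (u (r *: xh))) - F xh) <= C / r.

End Defs.

(* Main.v *)
Require Import Defs.
From HB Require Import structures.
From mathcomp Require Import all_boot all_order all_algebra.
From mathcomp Require Import all_classical all_reals all_analysis.
From mathcomp Require Import measurable_realfun.
From mathcomp Require Import ring lra zify.
Set Implicit Arguments. Unset Strict Implicit. Unset Printing Implicit Defensive.
Import Order.TTheory GRing.Theory Num.Theory.
Import numFieldNormedType.Exports.
Local Open Scope classical_set_scope.
Local Open Scope ring_scope.

(** Two effects of the boundary shape the proof. Moving both derivatives onto a test function leaves
    a boundary term, the solution times the normal derivative of the test function, and over a graph
    this is controlled only on the flat part, by tests whose vertical derivative vanishes there.
    Hence the exterior argument uses only monomials of even degree in x3, its concentrating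
    polynomial is built from x3^2, and the mean value kernel is added to its mirror image. Tests
    must vanish near the rest of the boundary, so the exterior of a ball and balls inside N are
    treated separately. Secondly, [H1loc] provides fields that are differentiable with square
    integrable but possibly discontinuous gradients, and no traces. Integration by parts is
    therefore done line by line, with a fundamental theorem of calculus for everywhere existing
    integrable derivatives.

    Monomials replace spherical harmonics: they are not harmonic, but the Laplacian of a monomial
    has lower degree, so an induction on the degree absorbs the error and no series expansion is
    needed. The plane waves are the same for both surfaces and cancel when the two weak equations
    are subtracted. *)

(* The difference w of the two scattered fields is a Neumann solution of the
   Helmholtz equation in the common region N, whose boundary is flat outside a
   ball. Put a radial profile times a monomial in the weak form: the moments
   T(h) = int_N w h(|x - c|^2) (x - c)^alpha vanish on the image of the ordinary
   differential operator 4 s g'' + (4 |alpha| + 6) g' + k^2 g modulo moments of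
   lower degree. Its solutions are the s-derivatives of cos(k sqrt s) and
   sin(k sqrt s), so h can be solved for explicitly, with a cutoff placed where
   the moment is already known or asymptotically negligible; and if all moments
   with profile h vanish, then w vanishes on the support of h, by concentrating
   polynomials at a point. This gives unique continuation from a smaller to a
   larger concentric ball in N, and, when the cutoff is sent to infinity, w = 0
   outside a ball as soon as the L^1 norm of w over the shell |x| ~ n is o(n^2).

   For the decay, equality of the far fields only gives |x| w(x) -> 0 along each
   ray, with no uniformity up to the flat boundary. A reflected mean value
   formula extends w to a C^1 function across that boundary, so the flux
   int_N Im(conj(w) x.grad w) psi_n(|x|^2) over shells is constant; with the
   radiation condition it bounds the L^2 norm of w over the shell by C sqrt n,
   and domination in L^2 turns the pointwise limits into the required L^1 decay.
   A chain of balls descending vertically then carries w = 0 to all of N. *)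

(** * Integrals over the line, the plane and space *)

(* Not found by canonical inference, which only tries the instance on products of subprobabilities. *)
Definition sfprod (R : realType) d1 d2 (T1 : measurableType d1) (T2 : measurableType d2)
    (m1 : {sigma_finite_measure set T1 -> \bar R}) (m2 : {sigma_finite_measure set T2 -> \bar R}) :
    {sigma_finite_measure set (T1 * T2)%type -> \bar R} :=
  HB.pack (m1 \x m2)%E
    (lebesgue_integral_fubini.measure_function_Measure_isSigmaFinite__to__measure_function_isSFinite m1 m2)
    (lebesgue_integral_fubini.measure_function_Measure_isSigmaFinite__to__measure_function_isSigmaFinite m1 m2).

Definition mu1 (R : realType) : {sigma_finite_measure set (measurableTypeR R) -> \bar R} :=
  @lebesgue_measure R.
Definition mu2 (R : realType) := sfprod (mu1 R) (mu1 R).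
Definition mu3 (R : realType) := sfprod (mu2 R) (mu1 R).
Arguments mu1 {R}. Arguments mu2 {R}. Arguments mu3 {R}.

Section L1.
Variable R : realType.
Context d (T : measurableType d) (mu : {measure set T -> \bar R}).
Implicit Types f g : T -> R.

(** Domains enter as indicator factors, so every integral is over the whole space and linearity
    carries no domain. *)
Definition L1 f := mu.-integrable setT (EFin \o f).
Definition J f : R := \int[mu]_x f x.

Lemma L1_meas f : L1 f -> measurable_fun setT f.
Proof. by move=> /integrableP[/measurable_EFinP]. Qed.

Lemma L1_le f g : measurable_fun setT f -> (forall x, `|f x| <= g x) ->
  L1 g -> L1 f.
Proof.
move=> mf fg Lg; apply: (le_integrable measurableT _ _ Lg).
  exact/measurable_EFinP.
move=> x _ /=; rewrite lee_fin; apply: (le_trans (fg x)); exact: ler_norm.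
Qed.

Lemma L1_eq f g : f =1 g -> L1 f -> L1 g.
Proof. by move=> fg; rewrite (_ : g = f)//; apply/funext => x; rewrite fg. Qed.

Lemma J_eq f g : f =1 g -> J f = J g.
Proof. by move=> fg; congr J; apply/funext. Qed.

Lemma L1_D f g : L1 f -> L1 g -> L1 (fun x => f x + g x).
Proof. by move=> Lf Lg; have := integrableD measurableT Lf Lg. Qed.

Lemma L1_Z f c : L1 f -> L1 (fun x => c * f x).
Proof. by move=> Lf; have := integrableZl measurableT c Lf. Qed.

Lemma L1_N f : L1 f -> L1 (fun x => - f x).
Proof. by move=> /(@L1_Z f (-1)); apply: L1_eq => x; rewrite mulN1r. Qed.

Lemma L1_B f g : L1 f -> L1 g -> L1 (fun x => f x - g x).
Proof. by move=> Lf Lg; apply: L1_D => //; exact: L1_N. Qed.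

Lemma L1_norm f : L1 f -> L1 (fun x => `|f x|).
Proof. exact: integrable_norm. Qed.

Lemma J_0 : J (fun=> 0) = 0.
Proof. by rewrite /J/Rintegral integral0. Qed.

Lemma J_D f g : L1 f -> L1 g -> J (fun x => f x + g x) = J f + J g.
Proof. by move=> Lf Lg; rewrite /J RintegralD. Qed.

Lemma J_Z f c : L1 f -> J (fun x => c * f x) = c * J f.
Proof. by move=> Lf; rewrite /J RintegralZl. Qed.

Lemma J_N f : L1 f -> J (fun x => - f x) = - J f.
Proof.
by move=> Lf; rewrite -mulN1r -J_Z//; apply: J_eq => x; rewrite mulN1r.
Qed.

Lemma J_B f g : L1 f -> L1 g -> J (fun x => f x - g x) = J f - J g.
Proof. by move=> Lf Lg; rewrite J_D ?J_N//; exact: L1_N. Qed.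

Lemma J_le f g : L1 f -> L1 g -> (forall x, f x <= g x) -> J f <= J g.
Proof. by move=> Lf Lg fg; rewrite /J le_Rintegral. Qed.

Lemma J_ge0 f : (forall x, 0 <= f x) -> 0 <= J f.
Proof. by move=> f0; rewrite /J Rintegral_ge0. Qed.

Lemma J_norm f : L1 f -> `|J f| <= J (fun x => `|f x|).
Proof. by move=> Lf; rewrite /J; apply: le_normr_Rintegral. Qed.

Lemma J_EFin f : L1 f -> (\int[mu]_x (f x)%:E)%E = (J f)%:E.
Proof. by move=> Lf; rewrite /J /Rintegral fineK// integrable_fin_num. Qed.

Lemma L1_bounded f (A : set T) M : measurable A -> (mu A < +oo)%E ->
  measurable_fun setT f -> (forall x, `|f x| <= M) -> (forall x, ~ A x -> f x = 0) ->
  L1 f.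
Proof.
move=> mA Aoo mf fM fA.
have : mu.-integrable A (EFin \o f).
  apply: measurable_bounded_integrable => //.
    exact: measurable_funTS.
  exists M; split; first exact: num_real.
  by move=> y My x _ /=; apply: (le_trans (fM x)); exact: ltW.
move/integrable_mkcond => /(_ mA).
rewrite /L1 (_ : (EFin \o f) \_ A = EFin \o f)//.
apply/funext => x; rewrite patchE; case: ifPn => // /negP xA.
by rewrite /= fA// => ?; apply: xA; rewrite inE.
Qed.

Lemma L1_indic (A : set T) : measurable A -> (mu A < +oo)%E -> L1 \1_A.
Proof.
move=> mA Aoo; apply: (L1_bounded mA Aoo (M := 1)); first exact: measurable_indic.
  by move=> x; rewrite indicE; case: (_ \in _); rewrite ?normr1 ?normr0.
by move=> x xA; rewrite indicE memNset.
Qed.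

Lemma integral_indicT (A : set T) : measurable A ->
  (\int[mu]_x (\1_A x)%:E)%E = mu A.
Proof. by move=> mA; rewrite integral_indic// setIT. Qed.

Lemma J_indic (A : set T) : measurable A -> J \1_A = fine (mu A).
Proof. by move=> mA; rewrite /J/Rintegral integral_indic// setIT. Qed.

Lemma J_ge_indic f (A : set T) c : measurable A -> (mu A < +oo)%E -> L1 f ->
  (forall x, 0 <= f x) -> (forall x, A x -> c <= f x) -> c * fine (mu A) <= J f.
Proof.
move=> mA Aoo Lf f0 fA; rewrite -J_indic// -J_Z; last exact: L1_indic.
apply: J_le => //; first by apply: L1_Z; exact: L1_indic.
move=> x; rewrite indicE; have [xA|xA] := boolP (x \in A).
  by rewrite mulr1 fA//; exact/set_mem.
by rewrite mulr0.
Qed.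

Lemma L1_mkcond (D : set T) f : measurable D -> mu.-integrable D (EFin \o f) ->
  L1 (fun x => \1_D x * f x).
Proof.
move=> mD /(integrable_mkcond _ mD); rewrite /L1; congr (integrable _ _ _).
apply/funext => x; rewrite patchE /= indicE; case: (_ \in _); by rewrite ?mul1r ?mul0r.
Qed.

Lemma J_dominated (f_ : nat -> T -> R) f g :
  (forall n, measurable_fun setT (f_ n)) -> L1 g ->
  (forall x, (fun n => f_ n x) @ \oo --> f x) ->
  (forall n x, `|f_ n x| <= g x) ->
  L1 f /\ (fun n => J (f_ n)) @ \oo --> J f.
Proof.
move=> mf Lg ff fg.
have mf' n : measurable_fun setT (EFin \o f_ n) by exact/measurable_EFinP.
have mlim : measurable_fun setT f by apply: (measurable_fun_cvg mf) => x _.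
have mlim' : measurable_fun setT (EFin \o f) by exact/measurable_EFinP.
have [||Lf _ c] := dominated_convergence measurableT mf' mlim' _ Lg.
- by apply: aeW => x _; apply/fine_cvgP; split; [near=> n; rewrite //|exact: ff].
- by apply: aeW => x n _ /=; rewrite lee_fin.
split=> //; rewrite /J /Rintegral.
by apply: fine_cvg; rewrite fineK//; exact: integrable_fin_num.
Unshelve. all: by end_near. Qed.

End L1.

(** * Measurability of open sets and continuous functions in space *)

Section CountableBase.
Variable (T : topologicalType) (M : set (set T)).
(** The sigma-algebra on triples is a product one, not defined from open sets. A countable base
    whose members are measurable, here rational boxes, makes open sets measurable. *)
Definition cbase (B : nat -> set T) :=
  (forall n, M (B n)) /\ forall x U, nbhs x U -> exists n, B n x /\ B n `<=` U.
End CountableBase.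

Lemma cbase_prod (T1 T2 : topologicalType) M1 M2 (M : set (set (T1 * T2)))
  B1 B2 : cbase M1 B1 -> cbase M2 B2 ->
  (forall A B, M1 A -> M2 B -> M (A `*` B)) -> exists B, cbase M B.
Proof.
move=> [m1 b1] [m2 b2] mX.
exists (fun n => let p := odflt (0%N, 0%N) (unpickle n) in B1 p.1 `*` B2 p.2).
split=> [n|[x y] U [[U1 U2] /= [n1 n2] sU]]; first by apply: mX.
have [i [ix iU]] := b1 x U1 n1; have [j [jx jU]] := b2 y U2 n2.
exists (pickle (i, j)); rewrite pickleK /=; split => //.
by move=> [a b] /= [ia jb]; apply: sU; split; [exact: iU|exact: jU].
Qed.

Section MeasPt.
Variable R : realType.

Lemma cbaseR : exists B, cbase (fun A : set R => measurable A) B.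
Proof.
pose B n : set R := let p := odflt (0, 0)%R (unpickle n : option (rat * rat)) in
   [set x | ratr p.1 < x < ratr p.2].
exists B; split=> [n|x U].
  by rewrite /B -set_itvoo; exact: measurable_itv.
rewrite -nbhs_ballE => -[e /= e0 eU].
have xe1 : x - e < x by rewrite ltrBlDr ltrDl.
have xe2 : x < x + e by rewrite ltrDl.
have [a ha] := rat_in_itvoo xe1; have [b hb] := rat_in_itvoo xe2.
exists (pickle (a, b)); rewrite /B pickleK /=.
move: ha hb; rewrite !in_itv /= => /andP[a1 a2] /andP[b1 b2].
split; first by rewrite a2 b1.
move=> z /= /andP[az zb]; apply: eU => /=; rewrite /ball/= ltr_distlC.
by rewrite (lt_trans a1 az) (lt_trans zb b2).
Qed.

Lemma open_measurable_of (T : topologicalType) d (T' : measurableType d) (f : T' -> T) B :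
  cbase (fun A => measurable (f @^-1` A)) B -> forall O, open O -> measurable (f @^-1` O).
Proof.
move=> [mB bB] O oO.
rewrite (_ : f @^-1` O = \bigcup_(n in [set n | B n `<=` O]) (f @^-1` B n)).
  by apply: bigcup_measurable => n _; exact: mB.
apply/seteqP; split=> [x Ox|x [n /= nO]]; last exact: nO.
by have [n [nx nO]] := bB _ _ (open_nbhs_nbhs (conj oO Ox)); exists n.
Qed.

Lemma open_measurable3 (O : set (pt R)) : open O -> measurable O.
Proof.
have [B1 b1] := cbaseR.
have [B2 b2] : exists B, cbase (fun A : set (R * R) => measurable A) B.
  by apply: (cbase_prod b1 b1) => A B mA mB; exact: measurableX.
have [B3 b3] : exists B, cbase (fun A : set (R * R * R) => measurable (id @^-1` A)) B.
  by apply: (cbase_prod b2 b1) => A B mA mB; exact: measurableX.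
exact: open_measurable_of b3 O.
Qed.

Lemma open_continuous_measurable3 (D : set (pt R)) (f : pt R -> R) : open D ->
  (forall x, D x -> {for x, continuous f}) -> measurable_fun D f.
Proof.
move=> oD cf; apply: (measurability _ (RGenOpens.measurableE R)).
move=> _ [_ [a [b ->] <-]].
apply: open_measurable3.
rewrite openE => x [Dx fx].
have /cf fc := Dx.
have : nbhs (f x) `]a, b[%classic by apply: open_nbhs_nbhs; split => //; exact: interval_open.
move/fc => h; near=> y; split.
  by near: y; apply: open_nbhs_nbhs.
by near: y.
Unshelve. all: by end_near. Qed.

Lemma continuous_measurable3 (f : pt R -> R) : continuous f -> measurable_fun setT f.
Proof.
move=> cf; have oT : open [set: pt R] by exact: openT.
by apply: (open_continuous_measurable3 oT) => x _; exact: cf.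
Qed.

End MeasPt.

(** * The fundamental theorem of calculus for integrable derivatives *)

Section FTC.
Variable R : realType.
Local Notation mu := (@mu1 R).

(* Right-growth argument: it is enough to control [F] by [G] immediately to the
   right of each point, since [G] is monotone and [F] is left-continuous. *)
Lemma right_growth (G F : R -> R) a b : a <= b ->
  (forall x y, a <= x -> x <= y -> y <= b -> G x <= G y) ->
  (forall x, a <= x <= b -> {for x, continuous F}) ->
  (forall x, a <= x < b -> exists2 e, 0 < e & forall t, x < t < x + e -> t <= b ->
     F t - F x <= G t - G x) ->
  F b - F a <= G b - G a.
Proof.
move=> ab Gnd cF loc.
pose S := [set x | a <= x <= b /\ F x - F a <= G x - G a].
have Sa : S a by split; rewrite ?lexx ?ab// !subrr.
have Sub : ubound S b by move=> x [/andP[]].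
have hS : has_sup S by split; [exists a|exists b].
pose c := sup S.
have ac : a <= c by apply: (ub_le_sup (proj2 hS)).
have cb : c <= b by apply: ge_sup => //; exists a.
have Sc : S c.
  split; rewrite ?ac ?cb//; apply/ler_addgt0Pr => e e0.
  have /cF/cvgrPdist_lt/(_ e e0) : a <= c <= b by rewrite ac cb.
  move=> /nbhs_ballP[d /= d0 dF].
  have [y Sy yd] := sup_adherent d0 hS.
  have yc : y <= c by apply: (ub_le_sup (proj2 hS)).
  have := dF y; rewrite /ball/= => /(_ _)/ltr_normlP[].
    by rewrite ltr_norml; move: yd; rewrite -/c => yd; apply/andP; split; lra.
  move=> _ h; case: Sy => /andP[ay yb] Sy.
  have := Gnd y c ay yc cb; lra.
have [cltb|] := ltP c b; last first.
  by move=> bc; case: Sc => _; rewrite (_ : c = b)//; apply/eqP; rewrite eq_le cb bc.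
have [|e e0 he] := loc c; first by rewrite ac cltb.
pose t := Num.min (c + e / 2) b.
have ct : c < t by rewrite lt_min cltb andbT; lra.
have tb : t <= b by rewrite ge_min lexx orbT.
have te : t < c + e by rewrite gt_min; apply/orP; left; lra.
have St : S t.
  split; first by rewrite tb andbT (le_trans ac)// ltW.
  have := he t; rewrite ct te => /(_ isT tb); case: Sc => _; lra.
by have := ub_le_sup (proj2 hS) St; rewrite -/c leNgt ct.
Qed.

Lemma le_mu (A B : set R) : measurable A -> measurable B -> A `<=` B ->
  (mu A <= mu B)%E.
Proof. by move=> mA mB AB; apply: le_measure; rewrite ?inE. Qed.

Lemma mu_itv (a b : R) : a <= b -> mu `[a, b]%classic = (b - a)%:E.
Proof.
rewrite le_eqVlt => /orP[/eqP<-|ab].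
  by rewrite set_itv1 subrr; exact: lebesgue_measure_set1.
by rewrite /= lebesgue_measure_itv /= lte_fin ab EFinN EFinB.
Qed.

Lemma mu_itv_fin (a b : R) : (mu `[a, b]%classic < +oo)%E.
Proof.
have [ab|ba] := leP a b; first by rewrite mu_itv// ltry.
by rewrite set_itv_ge -?leNgt ?bnd_simp -?ltNge// measure0.
Qed.

Lemma L1_itv (a b : R) : L1 mu \1_(`[a, b]).
Proof. by apply: L1_indic; [exact: measurable_itv|exact: mu_itv_fin]. Qed.

Lemma J_itv (a b : R) : a <= b -> J mu \1_(`[a, b]) = b - a.
Proof. by move=> ab; rewrite J_indic//; have := mu_itv ab => /= ->. Qed.

(** The sum counts the levels n e below h. Its term number K is nonzero only if K e < h, and the
    count up to then is at most K, hence at most h / e. *)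
Lemma sum_levels_le (h e : R) K : 0 < e -> 0 <= h ->
  \sum_(n < K) ((n%:R * e < h)%R%:R : R) <= h / e + 1.
Proof.
move=> e0 h0; elim: K => [|K IH].
  by rewrite big_ord0 addr_ge0// divr_ge0// ltW.
rewrite big_ord_recr/=; have [Kh|] := boolP (K%:R * e < h); last by rewrite addr0.
have : \sum_(n < K) ((n%:R * e < h)%R%:R : R) <= K%:R.
  rewrite -[in leRHS](card_ord K) -sum1_card natr_sum; apply: ler_sum => i _.
  by rewrite ler_nat leq_b1.
move=> /(lerD)/(_ (lexx 1))/le_trans; apply.
by rewrite lerD2r ler_pdivlMr// ltW.
Qed.

(** An integrated form of the Vitali-Caratheodory theorem. Each superlevel set {n e < h} is enclosed
    in an open set [U n] of slightly larger measure, and G is the primitive of e times the sum of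
    the indicators of the [U n]. Openness makes G grow at rate at least h(x) immediately to the
    right of x, while its total growth exceeds the integral of h only by a multiple of e. *)
Lemma lsc_primitive (h : R -> R) (a b e : R) : a < b -> 0 < e <= 1 ->
  L1 mu h -> (forall x, 0 <= h x) -> (forall x, ~ (a <= x <= b) -> h x = 0) ->
  exists G : R -> R,
   [/\ forall x y, a <= x -> x <= y -> y <= b -> G x <= G y,
     forall x, a <= x < b -> exists2 d, 0 < d & forall t, x < t < x + d -> t <= b ->
       h x * (t - x) <= G t - G x
     & G b - G a <= J mu h + e * (b - a + 2)].
Proof.
move=> ab /andP[e0 e1] Lh h0 hab.
pose E n : set R := [set x | n%:R * e < h x].
have mh := L1_meas Lh.
have mE n : measurable (E n).
  have := mh measurableT `]n%:R * e, +oo[%classic (measurable_itv _).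
  rewrite setTI; congr measurable; apply/seteqP; split => x /=; rewrite in_itv/= andbT//.
have Eab n : E n `<=` `[a, b]%classic.
  move=> x; rewrite /E /= in_itv /= => nx; apply/negP => /negP xab; move: nx.
  by rewrite hab; [rewrite ltNge mulr_ge0// ltW|exact/negP].
have muab := mu_itv (ltW ab).
have Iab := L1_itv a b.
have Eoo n : (mu (E n) < +oo)%E.
  apply: (@le_lt_trans _ _ (mu `[a, b]%classic)); last by rewrite muab ltry.
  exact: le_mu.
(* The excess measures e / 2^(n+1) sum to e over all levels. *)
have ep n : 0 < e / (2 ^ n.+1)%:R by rewrite divr_gt0// ltr0n expn_gt0.
pose U n := projT1 (cid (lebesgue_regularity_outer (mE n) (Eoo n) (ep n))).
have oU n : open (U n) by rewrite /U; case: cid => x /= [].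
have EU n : E n `<=` U n by rewrite /U; case: cid => x /= [].
have mUE n : (mu (U n `\` E n) < (e / (2 ^ n.+1)%:R)%:E)%E.
  by rewrite /U; case: cid => x /= [].
have mU n : measurable (U n) by exact: open_measurable.
pose s (A : set R) := (\sum_(0 <= n <oo) mu (U n `&` A))%E.
have s_le A B : measurable A -> measurable B -> A `<=` B -> (s A <= s B)%E.
  move=> mA mB AB; apply: lee_nneseries => // n _.
  by apply: le_mu; [exact: measurableI|exact: measurableI|exact: setIS].
have s_fin : (s `[a, b]%classic <= (J mu h / e + (b - a) + e)%:E)%E.
  have bE n : (mu (U n `&` `[a, b]) <= mu (E n) + (e / (2 ^ n.+1)%:R)%:E)%E.
    apply: (@le_trans _ _ (mu (U n))).
      by apply: le_mu; [exact: measurableI|exact: mU|exact: subIsetl].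
    rewrite -{1}(setDUK (EU n)); have mD := measurableD (mU n) (mE n).
    apply: (le_trans (measureU2 mu (mE n) mD)).
    by apply: leeD2l; apply: ltW; exact: mUE.
  apply: (@le_trans _ _ (\sum_(0 <= n <oo) (mu (E n) + (e / (2 ^ n.+1)%:R)%:E))%E).
    by apply: lee_nneseries => // n _; exact: bE.
  apply: (le_trans (epsilon_trick _ _ _)) => //; first exact: ltW.
  rewrite EFinD leeD2r//.
  apply: lime_le; first exact: is_cvg_nneseries.
  near=> K.
  rewrite (eq_bigr (fun i => (\int[mu]_x ((\1_(E i) x)%:E))%E)); last first.
    by move=> i _; rewrite integral_indicT; [|exact: mE].
  rewrite -ge0_integral_sum//; last first.
    by move=> i; apply/measurable_EFinP; apply: measurable_indic; exact: mE.
  pose q (x : R) : R := e^-1 * h x + \1_(`[a, b]) x.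
  have Lq : L1 mu q.
    by apply: L1_D; [exact: L1_Z|exact: Iab].
  have -> : (J mu h / e + (b - a))%:E = (\int[mu]_x (q x)%:E)%E.
    rewrite J_EFin//; congr EFin.
    rewrite /q J_D; [|exact: L1_Z|exact: Iab].
    by rewrite J_Z// J_itv ?(ltW ab)// mulrC.
  apply: ge0_le_integral => //.
  - by move=> x _; apply: sume_ge0 => i _; rewrite lee_fin indicE.
  - apply: emeasurable_sum => i; apply/measurable_EFinP.
    by apply: measurable_indic; exact: mE.
  - by apply/measurable_EFinP; exact: L1_meas Lq.
  - move=> x _; rewrite sumEFin lee_fin /q big_mkord.
    have [xab|xab] := boolP (x \in `[a, b]%classic).
      have -> : \1_(`[a, b]) x = 1 :> R by rewrite indicE xab.
      rewrite mulrC; apply: le_trans (sum_levels_le K e0 (h0 x)).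
      by apply: ler_sum => i _; rewrite indicE /E mem_setE.
    rewrite big1 => [|i _]; last first.
      rewrite indicE memNset// => /Eab xx; move/negP: xab; apply; exact/mem_set.
    by rewrite addr_ge0// ?mulr_ge0 ?invr_ge0 ?indicE// ltW.
have sfin A : measurable A -> A `<=` `[a, b]%classic -> s A \is a fin_num.
  move=> mA Aab; rewrite ge0_fin_numE; last exact: nneseries_ge0.
  by apply: (le_lt_trans (s_le _ _ _ _ Aab)) => //; apply: (le_lt_trans s_fin); rewrite ltry.
have sD x t : a <= x -> x <= t -> t <= b ->
    s `[a, t]%classic = (s `[a, x]%classic + s `]x, t]%classic)%E.
  move=> ax xt tb; rewrite /s -nneseriesD//; apply: eq_eseriesr => n _.
  have m1 := measurableI _ _ (mU n) (measurable_itv `[a, x]).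
  have m2 := measurableI _ _ (mU n) (measurable_itv `]x, t]).
  rewrite -(measureU mu m1 m2); last first.
    rewrite -subset0 => y [[_ /=]]; rewrite !in_itv/= => /andP[_ yx].
    by move=> [_]; rewrite ltNge yx.
  rewrite -setIUr; congr (mu (_ `&` _)); apply/seteqP; split => y /=; rewrite !in_itv/=.
    by move=> /andP[-> ->]; rewrite andbT /=; have [|] := leP y x; [left|right].
  by move=> [/andP[-> /le_trans ->]|/andP[/ltW/(le_trans ax) -> ->]].
exists (fun x => e * fine (s `[a, x]%classic)).
have sub x y : a <= x -> y <= b -> `]x, y]%classic `<=` `[a, b]%classic.
  move=> ax yb z /=; rewrite !in_itv/= => /andP[xz zy].
  by rewrite (le_trans ax (ltW xz)) (le_trans zy yb).
have sub' y : y <= b -> `[a, y]%classic `<=` `[a, b]%classic.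
  move=> yb z /=; rewrite !in_itv/= => /andP[xz zy].
  by rewrite xz (le_trans zy yb).
have dG x y : a <= x -> x <= y -> y <= b ->
    e * fine (s `[a, y]%classic) - e * fine (s `[a, x]%classic) = e * fine (s `]x, y]%classic).
  move=> ax xy yb; rewrite (sD x y)// fineD; first by rewrite mulrDr addrAC subrr add0r.
    by apply: sfin => //; apply: sub'; apply: (le_trans xy).
  by apply: sfin => //; apply: sub.
split.
- move=> x y ax xy yb; rewrite -subr_ge0 dG// mulr_ge0 ?fine_ge0//; first exact: ltW.
  exact: nneseries_ge0.
- move=> x /andP[ax xb].
  (* m is the least number of levels of height e that reach h x. All levels below m lie strictly
     under h x, so x belongs to [U n] for every n < m. *)
  have [m hm mh'] : exists2 m : nat, h x <= m%:R * e & forall n, (n < m)%N -> n%:R * e < h x.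
    have ex : exists m : nat, h x <= m%:R * e.
      exists (Num.truncn (h x / e)).+1; rewrite -ler_pdivrMr// ltW//.
      by apply: truncnS_gt.
    exists (ex_minn ex); case: ex_minnP => // m hm min n nm.
    by rewrite ltNge; apply/negP => /min; rewrite leqNgt nm.
  have [d d0 hd] : exists2 d, 0 < d & forall n, (n < m)%N -> `]x, x + d[%classic `<=` U n.
    elim: m mh' {hm} => [|m IH] mh'; first by exists 1.
    have [|d1 d10 hd1] := IH; first by move=> n nm; apply: mh'; rewrite ltnW.
    have : nbhs x (U m) by apply: open_nbhs_nbhs; split => //; apply: EU; exact: mh'.
    rewrite -nbhs_ballE => -[d2 /= d20 hd2].
    exists (Num.min d1 d2); first by rewrite lt_min d10.
    move=> n; rewrite ltnS leq_eqVlt => /orP[/eqP ->|nm].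
      move=> z /=; rewrite in_itv/= => /andP[xz zd]; apply: hd2; rewrite /ball/=.
      have zd2 : z < x + d2 by apply: (lt_le_trans zd); rewrite lerD2l ge_min lexx orbT.
      by rewrite ltr_distlC; apply/andP; split; lra.
    apply: subset_trans (hd1 _ nm); move=> z /=; rewrite !in_itv/= => /andP[-> /=].
    by rewrite -ltrBlDl lt_min => /andP[+ _]; rewrite ltrBlDl.
  exists d => // t /andP[xt td] tb; rewrite dG// ?(ltW xt)//.
  apply: (@le_trans _ _ (e * (m%:R * (t - x)))).
    by rewrite mulrA (mulrC e) ler_wpM2r// subr_ge0 ltW.
  rewrite ler_pM2l// -lee_fin fineK; last by apply: sfin => //; exact: sub.
  apply: le_trans (nneseries_lim_ge m _); last by [].
  rewrite big_mkord (eq_bigr (fun=> (t - x)%:E)) => [|i _].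
    by rewrite sumEFin sumr_const card_ord mulr_natl.
  rewrite setIidr; first by rewrite /= lebesgue_measure_itv /= lte_fin xt EFinN EFinB.
  apply: subset_trans (hd _ (ltn_ord i)) => z /=; rewrite !in_itv/= => /andP[-> /=].
  by move=> /le_lt_trans; apply.
- rewrite dG// ?(ltW ab)//.
  have : fine (s `]a, b]%classic) <= J mu h / e + (b - a) + e.
    rewrite -lee_fin fineK; last by apply: sfin => //; exact: sub.
    by apply: (le_trans _ s_fin); apply: s_le => //; exact: sub.
  rewrite -(ler_pM2l e0) => /le_trans; apply.
  rewrite 2!mulrDr mulrCA divff ?gt_eqF// mulr1.
  have : e * e <= e * 1 by rewrite ler_pM2l.
  by lra.
Unshelve. all: by end_near. Qed.

Lemma is_derive_right_bound (F : R -> R) (x l e : R) : is_derive x (1 : R) F l -> 0 < e ->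
  exists2 d, 0 < d & forall t, x < t < x + d -> F t - F x <= (l + e) * (t - x).
Proof.
move=> [dF lE] e0.
have := dF; rewrite /derivable => /cvg_ex[l' hl'].
have ll : l' = l.
  by rewrite -lE; apply/esym; rewrite /derive; apply: cvg_lim => //; exact: norm_hausdorff.
move: hl'; rewrite ll => /cvgrPdist_lt/(_ e e0).
rewrite /dnbhs /within /= -nbhs_nearE -nbhs_ballE => -[d /= d0 hd].
exists d => // t /andP[xt td].
have tx : 0 < t - x by rewrite subr_gt0.
have := hd (t - x); rewrite /ball /= sub0r normrN gtr0_norm// => /(_ _ _).
rewrite scaler1 subrK => h.
have /ltr_distlCBl h2 : `|l - (t - x)^-1 *: (F t - F x)| < e.
  by apply: h; [rewrite ltrBlDl|rewrite gt_eqF].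
rewrite -ler_pdivrMr// mulrC; move: h2; rewrite /GRing.scale /=; lra.
Qed.

(** Truncating f below at -N and adding N makes the integrand nonnegative, so [lsc_primitive]
    supplies a monotone G that dominates the growth of F on the right of each point, and
    [right_growth] compares the increments. Dominated convergence then removes N. *)
Lemma FTC_le (F f : R -> R) (a b : R) : a < b -> L1 mu f ->
  (forall x, a <= x <= b -> is_derive x (1 : R) F (f x)) ->
  F b - F a <= J mu (fun x => f x * \1_(`[a, b]) x).
Proof.
move=> ab Lf dF.
pose i x : R := \1_(`[a, b]) x.
have Ii := L1_itv a b.
have i01 x : 0 <= i x <= 1 by rewrite /i indicE; case: (_ \in _); rewrite ?lexx ?ler01.
have iin x : a <= x <= b -> i x = 1.
  by move=> xab; rewrite /i indicE mem_set//= in_itv.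
have iout x : ~ (a <= x <= b) -> i x = 0.
  by move=> xab; rewrite /i indicE memNset//= in_itv.
have mi : measurable_fun setT i by exact: L1_meas Ii.
have mf := L1_meas Lf.
pose q (N : nat) (x : R) : R := Num.max (f x) (- N%:R) * i x.
have mq N : measurable_fun setT (q N).
  by apply: measurable_funM => //; apply: measurable_maxr.
have qle N x : `|q N x| <= `|f x|.
  rewrite /q normrM; apply: (@le_trans _ _ (`|Num.max (f x) (- N%:R)| * 1)).
    by rewrite ler_wpM2l// ger0_norm; case/andP: (i01 x).
  rewrite mulr1; have [fN|fN] := leP (f x) (- N%:R); last by [].
  have N0 : (0 : R) <= N%:R by rewrite ler0n.
  by rewrite normrN !ler_normr ger0_norm//; apply/orP; right; lra.
have [_ cq] : L1 mu (fun x => f x * i x) /\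
    (fun N => J mu (q N)) @ \oo --> J mu (fun x => f x * i x).
  have cq x : (fun N => q N x) @ \oo --> f x * i x.
    apply: cvg_near_cst; near=> N; rewrite /q max_l//.
    rewrite lerNl; near: N; exact: nbhs_infty_ger.
  exact: (J_dominated (mu := mu) mq (L1_norm Lf) cq qle).
(* The error collects e (b - a + 2) from G, e (b - a) from the slope given up below, and e from
   replacing the truncated integral by its limit. *)
have main (e : R) : 0 < e <= 1 ->
    F b - F a <= J mu (fun x => f x * i x) + e * (2 * (b - a) + 3).
  move=> /andP[e0 e1].
  have := cq; move/cvgrPdist_lt/(_ e e0) => [N _ /(_ N (leqnn N)) /= hN].
  have Lq : L1 mu (q N) by apply: (L1_le (mu := mu) (mq N) (qle N)); exact: L1_norm.
  pose h x := q N x + N%:R * i x.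
  have Lh : L1 mu h by apply: L1_D => //; exact: L1_Z.
  have JhE : J mu h = J mu (q N) + N%:R * (b - a).
    by rewrite J_D ?J_Z ?J_itv//; [exact: ltW|exact: L1_Z].
  have h0 x : 0 <= h x.
    rewrite /h /q -mulrDl; apply: mulr_ge0; last by case/andP: (i01 x).
    by have := le_max (- N%:R) (f x) (- N%:R); rewrite lexx orbT; lra.
  have hout x : ~ (a <= x <= b) -> h x = 0.
    by move=> /iout; rewrite /h /q => ->; rewrite !mulr0 addr0.
  have e01 : 0 < e <= 1 by rewrite e0.
  have [G [Gnd Gloc Gtot]] := lsc_primitive ab e01 Lh h0 hout.
  (* The slope is lowered by e in advance, to pay for the e lost when the derivative is replaced by
     a difference quotient. *)
  have dF2 x : a <= x <= b -> is_derive x (1 : R) (fun x => F x + (N%:R - e) * x) (f x + (N%:R - e)).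
    move=> /dF dFx; apply: is_deriveD.
    by have := is_deriveZ (N%:R - e) (is_derive_id x (1:R)); rewrite /GRing.scale /= mulr1.
  have cF2 x : a <= x <= b -> {for x, continuous (fun x => F x + (N%:R - e) * x)}.
    move=> /dF2 [dd _]; apply: differentiable_continuous.
    exact/derivable1_diffP.
  have loc x : a <= x < b -> exists2 d, 0 < d & forall t, x < t < x + d -> t <= b ->
      F t + (N%:R - e) * t - (F x + (N%:R - e) * x) <= G t - G x.
    move=> /andP[ax xb].
    have xab : a <= x <= b by rewrite ax ltW.
    have [d1 d10 h1] := is_derive_right_bound (dF2 x xab) e0.
    have [d2 d20 h2] := Gloc x (ltac:(by rewrite ax xb)).
    exists (Num.min d1 d2); first by rewrite lt_min d10.
    move=> t /andP[xt td] tb.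
    have td1 : t < x + d1 by apply: (lt_le_trans td); rewrite lerD2l ge_min lexx.
    have td2 : t < x + d2 by apply: (lt_le_trans td); rewrite lerD2l ge_min lexx orbT.
    have := h1 t; rewrite xt td1 => /(_ isT) /le_trans; apply.
    have := h2 t; rewrite xt td2 => /(_ isT tb); apply: le_trans.
    rewrite ler_wpM2r//; first by rewrite subr_ge0 ltW.
    rewrite /h /q iin// !mulr1.
    by have := le_max (f x) (f x) (- N%:R); rewrite lexx /=; lra.
  have hh := right_growth (ltW ab) Gnd cF2 loc.
  move: Gtot; rewrite JhE => Gtot.
    move: hN => /ltr_distlCBl hN; lra.
apply/ler_addgt0Pr => e e0.
pose c := 2 * (b - a) + 3.
have c0 : 0 < c by rewrite /c; lra.
pose e' := Num.min 1 (e / c).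
have e'0 : 0 < e' <= 1 by rewrite lt_min ltr01 divr_gt0//= ge_min lexx.
apply: (le_trans (main e' e'0)); rewrite lerD2l -/c -ler_pdivlMr//.
by rewrite /e' ge_min lexx orbT.
Unshelve. all: by end_near. Qed.

(** No continuity of f is assumed: an everywhere existing integrable derivative is enough, and this
    is all that [H1loc] gives on almost every line. The equality is [FTC_le] for F and for -F. *)
Theorem FTC_L1 (F f : R -> R) (a b : R) : a <= b -> L1 mu f ->
  (forall x, a <= x <= b -> is_derive x (1 : R) F (f x)) ->
  J mu (fun x => f x * \1_(`[a, b]) x) = F b - F a.
Proof.
rewrite le_eqVlt => /orP[/eqP <- _ _|ab Lf dF].
  rewrite subrr /J /Rintegral (_ : (fun x => _) = (fun x => (f x * \1_[set a] x)%:E)); last first.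
    by apply/funext => x; rewrite set_itv1.
  rewrite (_ : (fun x => _) = (EFin \o f) \_ [set a]).
    rewrite -integral_mkcond integral_set1//.
  apply/funext => x; rewrite patchE indicE; case: (_ \in _); by rewrite ?mulr1 ?mulr0.
apply/eqP; rewrite eq_le FTC_le// andbT.
have dFN x : a <= x <= b -> is_derive x (1 : R) (fun x => - F x) (- f x).
  by move=> /dF dFx; exact: is_deriveN.
have := FTC_le ab (L1_N Lf) dFN.
have Li : L1 mu (fun x => f x * \1_(`[a, b]) x).
  apply: (L1_le (mu := mu) _ _ (L1_norm Lf)).
    by apply: measurable_funM; [exact: L1_meas Lf|exact: (L1_meas (L1_itv a b))].
  move=> x; rewrite normrM indicE; case: (_ \in _); rewrite ?normr1 ?normr0 ?mulr1 ?mulr0//.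
have -> : J mu (fun x => - f x * \1_(`[a, b]) x) = - J mu (fun x => f x * \1_(`[a, b]) x).
  by rewrite -J_N//; apply: J_eq => x; rewrite mulNr.
lra.
Qed.
End FTC.

Section DerMul.
Variables (R : realType) (V : normedModType R).
Lemma is_dM (f g : V -> R) (x v : V) (df dg : R) :
  is_derive x v f df -> is_derive x v g dg ->
  is_derive x v (fun y => f y * g y) (df * g x + f x * dg).
Proof.
move=> hf hg; have h := is_deriveM hf hg.
by apply: (is_derive_eq h); rewrite /GRing.scale/= addrC (mulrC (g x)).
Qed.
End DerMul.

Lemma is_derive1_continuous (R : realType) (f : R -> R) (x l : R) :
  is_derive x (1 : R) f l -> {for x, continuous f}.
Proof. by move=> [df _]; apply: differentiable_continuous; exact/derivable1_diffP. Qed.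

Section IBP1.
Variable R : realType.
Local Notation mu := (@mu1 R).

Lemma J_derive0 (F f : R -> R) (M : R) : L1 mu f ->
  (forall x, is_derive x (1 : R) F (f x)) -> 
  (forall x, M <= `|x| -> F x = 0 /\ f x = 0) -> J mu f = 0.
Proof.
move=> Lf dF F0.
pose K := Num.max M 0.
have MK : M <= K by rewrite le_max lexx.
have K0 : 0 <= K by rewrite le_max lexx orbT.
have KK : - K <= K by lra.
have -> : J mu f = J mu (fun x => f x * \1_(`[- K, K]) x).
  apply: J_eq => x; rewrite indicE; have [|xK] := boolP (x \in _); first by rewrite mulr1.
  rewrite mulr0; apply: (proj2 (F0 x _)); rewrite leNgt; apply/negP => xM.
  move/negP: xK; apply; apply/mem_set; rewrite /= in_itv /= -ler_norml.
  exact: (le_trans (ltW xM)).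
rewrite (FTC_L1 KK Lf (fun x _ => dF x)).
by rewrite !(proj1 (F0 _ _)) ?subrr// ?normrN (le_trans MK)// ler_norm.
Qed.

(** The function p need not have a limit prescribed at m, but it stays bounded there because p' is
    integrable up to m. As q vanishes at m, the boundary term p q at points decreasing to m tends to
    0, and the other end contributes nothing since q vanishes from M on. *)
Lemma J_ibp_halfline (i p p' q q' : R -> R) (m M : R) :
  (forall t, m < t -> i t = 1) -> (forall t, t <= m -> i t = 0) ->
  (forall t, m < t -> is_derive t (1 : R) p (p' t)) ->
  (forall t, is_derive t (1 : R) q (q' t)) -> q m = 0 ->
  (forall t, M <= t -> q t = 0 /\ q' t = 0) ->
  L1 mu (fun t => i t * (p' t * q t + p t * q' t)) ->
  L1 mu (fun t => i t * (t <= M)%R%:R * p' t) ->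
  J mu (fun t => i t * (p' t * q t + p t * q' t)) = 0.
Proof.
move=> i1 i0 dp dq qm qM Lg Lp.
have [Mm|mM] := leP M m.
  rewrite (_ : (fun t => _) = fun=> 0) ?J_0//; apply/funext => t.
  have [mt|tm] := ltP m t; last by rewrite i0// mul0r.
  have [|-> ->] := qM t; first by rewrite (le_trans Mm)// ltW.
  by rewrite !mulr0 addr0 mulr0.
set g := (fun t => _) in Lg *.
pose c (n : nat) := m + (M - m) / n.+1%:R.
have mc n : m < c n by rewrite ltrDl divr_gt0// subr_gt0.
have cM n : c n <= M.
  rewrite /c -lerBrDl ler_pdivrMr// ler_peMr ?ler1n//; lra.
pose g_ n (t : R) : R := g t * \1_(`[c n, M]) t.
have c_m : c @ \oo --> m.
  rewrite -[X in _ --> X]addr0; apply: cvgD; first exact: cvg_cst.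
  rewrite -[X in _ --> X](mulr0 (M - m)); apply: cvgM; first exact: cvg_cst.
  exact: cvg_harmonic.
have mg := L1_meas Lg.
have mg_ n : measurable_fun setT (g_ n).
  apply: measurable_funM; first exact: mg.
  exact: (L1_meas (L1_itv (c n) M)).
have gle n t : `|g_ n t| <= `|g t|.
  rewrite /g_ normrM indicE; case: (_ \in _); by rewrite ?normr1 ?normr0 ?mulr1 ?mulr0.
have gc t : (fun n => g_ n t) @ \oo --> g t.
  apply: cvg_near_cst; rewrite /g_ /g.
  have [mt|tm] := ltP m t; last by near=> n; rewrite i0// !mul0r.
  have [Mt|tM] := ltP M t.
    have [|-> ->] := qM t; first exact: ltW.
    by near=> n; rewrite !mulr0 addr0 mulr0 mul0r.
  near=> n; rewrite indicE mem_set ?mulr1//= in_itv/= tM andbT.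
  near: n; have := c_m; move/cvgrPdist_lt/(_ (t - m)); rewrite subr_gt0 => /(_ mt).
  apply: filterS => n; rewrite ltr_distlC => /andP[_]; rewrite addrC subrK => /ltW.
  by [].
have [_ cJ] := J_dominated (mu := mu) mg_ (L1_norm Lg) gc gle.
set P := (fun t => i t * _ * _) in Lp.
(* A bound for p at all the points [c n], obtained by integrating p' back from M. *)
pose K := `|p M| + J mu (fun t => `|P t|).
have pc n : `|p (c n)| <= K.
  have dp' x : c n <= x <= M -> is_derive x (1 : R) p (P x).
    move=> /andP[cx xM]; have mx : m < x by apply: (lt_le_trans (mc n)).
    by rewrite /P i1// xM mul1r mul1r; exact: dp.
  have E := FTC_L1 (cM n) Lp dp'.
  rewrite (_ : p (c n) = p M - J mu (fun x => P x * \1_(`[c n, M]) x)); last by rewrite E; ring.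
  apply: (le_trans (ler_normB _ _)); rewrite lerD2l.
  have L : L1 mu (fun x => P x * \1_(`[c n, M]) x).
    apply: (L1_le (mu := mu) _ _ (L1_norm Lp)).
      by apply: measurable_funM; [exact: L1_meas Lp|exact: (L1_meas (L1_itv (c n) M))].
    move=> x; rewrite normrM indicE; case: (_ \in _); by rewrite ?normr1 ?normr0 ?mulr1 ?mulr0.
  apply: (le_trans (J_norm L)); apply: J_le; [exact: L1_norm|exact: L1_norm|].
  move=> x; rewrite normrM indicE; case: (_ \in _); by rewrite ?normr1 ?normr0 ?mulr1 ?mulr0.
have Jn n : J mu (g_ n) = - (p (c n) * q (c n)).
  have dg x : c n <= x <= M -> is_derive x (1 : R) (fun x => p x * q x) (g x).
    move=> /andP[cx xM]; have mx : m < x by apply: (lt_le_trans (mc n)).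
    rewrite /g i1// mul1r.
    exact: is_dM (dp x mx) (dq x).
  rewrite (FTC_L1 (cM n) Lg dg).
  by rewrite (proj1 (qM M (lexx M))) mulr0 sub0r.
have qc : (fun n => q (c n)) @ \oo --> (0 : R).
  rewrite -qm; apply: (cvg_comp _ _ c_m).
  exact: (is_derive1_continuous (dq m)).
have J0 : (fun n => J mu (g_ n)) @ \oo --> (0 : R).
  apply/cvgr0Pnorm_lt => e e0.
  have K0 : 0 < K + 1.
    by rewrite ltr_wpDl// addr_ge0// J_ge0.
  have : 0 < e / (K + 1) by rewrite divr_gt0.
  move/cvgr0Pnorm_lt : qc => /[apply]; apply: filterS => n.
  rewrite ltr_pdivlMr// => h; rewrite Jn normrN normrM; apply: le_lt_trans h.
  rewrite mulrC ler_wpM2l//; apply: (le_trans (pc n)); lra.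
exact: (cvg_unique _ cJ J0).
Unshelve. all: by end_near. Qed.
End IBP1.

(** * Integration by parts in space *)

Section Fubini0.
Variable R : realType.
Context d1 d2 (T1 : measurableType d1) (T2 : measurableType d2).
Variable m1 : {sigma_finite_measure set T1 -> \bar R}.
Variable m2 : {sigma_finite_measure set T2 -> \bar R}.
Variables q q' : T1 * T2 -> R.
Hypothesis Lq : L1 (sfprod m1 m2) q.
Hypothesis Lq' : L1 (sfprod m1 m2) q'.

(** The companion q' is there so that almost every section of it is integrable as well: on a
    half-line, integration by parts needs the derivative alone to be integrable, not only the
    product being integrated. *)
Lemma J_prod1_0 : (forall x, L1 m2 (fun y => q (x, y)) -> L1 m2 (fun y => q' (x, y)) ->
   J m2 (fun y => q (x, y)) = 0) -> J (sfprod m1 m2) q = 0.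
Proof.
move=> h; rewrite /J /Rintegral -(integral12_prod_meas1 Lq).
rewrite (_ : integral _ _ _ = 0%E)//.
have : (\int[m1]_x fubini_F m2 (EFin \o q) x = \int[m1]_x (cst 0 x))%E; last first.
  by move=> ->; rewrite integral0.
apply: ae_eq_integral => //; first exact: measurable_fubini_F Lq.
have h1 := ae_integrable1 Lq; have h2 := ae_integrable1 Lq'.
apply: filterS2 h1 h2 => x /= i1 i2 _.
have i1' : L1 m2 (fun y => q (x, y)) by [].
by have := h x i1 i2 => E; rewrite /fubini_F /= (J_EFin i1') E.
Qed.

Lemma J_prod2_0 : (forall y, L1 m1 (fun x => q (x, y)) -> L1 m1 (fun x => q' (x, y)) ->
   J m1 (fun x => q (x, y)) = 0) -> J (sfprod m1 m2) q = 0.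
Proof.
move=> h; rewrite /J /Rintegral -(integral21_prod_meas1 Lq).
rewrite (_ : integral _ _ _ = 0%E)//.
have : (\int[m2]_x fubini_G m1 (EFin \o q) x = \int[m2]_x (cst 0 x))%E; last first.
  by move=> ->; rewrite integral0.
apply: ae_eq_integral => //; first exact: measurable_fubini_G Lq.
have h1 := ae_integrable2 Lq; have h2 := ae_integrable2 Lq'.
apply: filterS2 h1 h2 => x /= i1 i2 _.
have i1' : L1 m1 (fun y => q (y, x)) by [].
by have := h x i1 i2 => E; rewrite /fubini_G /= (J_EFin i1') E.
Qed.
End Fubini0.

Section Lines.
Variable R : realType.
Local Notation pt := (pt R).

Lemma is_derive_line (g : R -> pt) (t : R) (v : pt) (f : pt -> R) (l : R) :
  (forall h : R, g (h *: (1 : R) + t) = h *: v + g t) ->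
  is_derive (g t) v f l -> is_derive t (1 : R) (fun s => f (g s)) l.
Proof.
move=> gE [df dE].
have E : (fun h : R => h^-1 *: ((fun s => f (g s)) (h *: (1 : R) + t) - f (g t))) =
  (fun h : R => h^-1 *: (f (h *: v + g t) - f (g t))).
  by apply/funext => h; rewrite gE.
split; first by move: df; rewrite /derivable /= /comp /= E.
by move: dE; rewrite /derive /= /comp /= E.
Qed.

Lemma line1 (f : pt -> R) (a b c l : R) :
  is_derive ((a, b), c) (e1 R) f l -> is_derive a (1 : R) (fun s => f ((s, b), c)) l.
Proof.
move=> h; apply: (@is_derive_line (fun s => ((s, b), c)) a (e1 R)) => // s.
congr (_, _, _); rewrite /GRing.scale /=; ring.
Qed.

Lemma line2 (f : pt -> R) (a b c l : R) :
  is_derive ((a, b), c) (e2 R) f l -> is_derive b (1 : R) (fun s => f ((a, s), c)) l.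
Proof.
move=> h; apply: (@is_derive_line (fun s => ((a, s), c)) b (e2 R)) => // s.
congr (_, _, _); rewrite /GRing.scale /=; ring.
Qed.

Lemma line3 (f : pt -> R) (y : R * R) (c l : R) :
  is_derive (y, c) (e3 R) f l -> is_derive c (1 : R) (fun s => f (y, s)) l.
Proof.
case: y => a b.
move=> h; apply: (@is_derive_line (fun s => ((a, b), s)) c (e3 R)) => // s.
congr (_, _, _); rewrite /GRing.scale /=; ring.
Qed.

Lemma J3_derive1 (F q : pt -> R) (M : R) : L1 mu3 q ->
  (forall x, is_derive x (e1 R) F (q x)) ->
  (forall x, M <= `|x.1.1| -> F x = 0 /\ q x = 0) -> J mu3 q = 0.
Proof.
move=> Lq dF F0; apply: (J_prod2_0 Lq Lq) => c Lc _.
apply: (J_prod2_0 Lc Lc) => b Lb _.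
apply: (J_derive0 (F := fun s => F ((s, b), c)) (M := M) Lb).
  by move=> x; apply: line1; exact: dF.
by move=> x Mx; apply: F0.
Qed.

Lemma J3_derive2 (F q : pt -> R) (M : R) : L1 mu3 q ->
  (forall x, is_derive x (e2 R) F (q x)) ->
  (forall x, M <= `|x.1.2| -> F x = 0 /\ q x = 0) -> J mu3 q = 0.
Proof.
move=> Lq dF F0; apply: (J_prod2_0 Lq Lq) => c Lc _.
apply: (J_prod1_0 Lc Lc) => b Lb _.
apply: (J_derive0 (F := fun s => F ((b, s), c)) (M := M) Lb).
  by move=> x; apply: line2; exact: dF.
by move=> x Mx; apply: F0.
Qed.

Lemma J3_derive3 (F q : pt -> R) (M : R) : L1 mu3 q ->
  (forall x, is_derive x (e3 R) F (q x)) ->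
  (forall x, M <= `|x.2| -> F x = 0 /\ q x = 0) -> J mu3 q = 0.
Proof.
move=> Lq dF F0; apply: (J_prod1_0 Lq Lq) => y Ly _.
apply: (J_derive0 (F := fun s => F (y, s)) (M := M) Ly).
  by move=> x; apply: line3; exact: dF.
by move=> x Mx; apply: F0.
Qed.

(* [c] cuts the domain off horizontally, since [p'] is only locally integrable. *)
Lemma J3_ibp_graph (i c p p' q q' : pt -> R) (m : R * R -> R) (M : R) :
  (forall x, m x.1 < x.2 -> i x = 1) -> (forall x, x.2 <= m x.1 -> i x = 0) ->
  (forall x, m x.1 < x.2 -> is_derive x (e3 R) p (p' x)) ->
  (forall x, is_derive x (e3 R) q (q' x)) -> (forall y, q (y, m y) = 0) ->
  (forall x, M <= x.2 -> q x = 0 /\ q' x = 0) ->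
  L1 mu3 (fun x => i x * (p' x * q x + p x * q' x)) ->
  L1 mu3 (fun x => c x * (i x * p' x)) ->
  (forall y, (forall t, c (y, t) = (t <= M)%R%:R) \/
             (forall t, q (y, t) = 0 /\ q' (y, t) = 0)) ->
  J mu3 (fun x => i x * (p' x * q x + p x * q' x)) = 0.
Proof.
move=> i1 i0 dp dq qm qM Lg Lp ch; apply: (J_prod1_0 Lg Lp) => y Ly Ly'.
have [cy|qy] := ch y; last first.
  rewrite (_ : (fun t => _) = fun=> 0) ?J_0//; apply/funext => t.
  by case: (qy t) => -> ->; rewrite !mulr0 addr0 mulr0.
apply: (J_ibp_halfline (m := m y) (M := M)) => //.
- by move=> t mt; apply: i1.
- by move=> t mt; apply: i0.
- by move=> t mt; apply: line3; apply: dp.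
- by move=> t; apply: line3; apply: dq.
- by move=> t Mt; apply: qM.
- by apply: (L1_eq _ Ly') => t; rewrite cy mulrCA mulrA.
Qed.

Lemma is_derive_near0 (V : normedModType R) (f : V -> R) (x v : V) (l : R) : is_derive x v f l ->
  (\forall y \near x, f y = 0) -> l = 0.
Proof.
move=> [df dE] f0; rewrite -dE -(@derive_cst R V R 0 x v).
by apply: near_eq_derive.
Qed.

Lemma box_compact (M : R) : compact [set x : pt | [/\ `|x.1.1| <= M, `|x.1.2| <= M & `|x.2| <= M]].
Proof.
rewrite (_ : [set _ | _] = (`[- M, M] `*` `[- M, M]) `*` `[- M, M]).
  by apply: compact_setX; [apply: compact_setX|]; exact: segment_compact.
apply/seteqP; split => -[[a b] c] /=; rewrite !in_itv/= -!ler_norml.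
  by case.
by case; case.
Qed.

Lemma compact_support_bounded (f : pt -> R) (M : R) : continuous f ->
  (forall x, ~ [/\ `|x.1.1| <= M, `|x.1.2| <= M & `|x.2| <= M] -> f x = 0) ->
  exists2 C, 0 <= C & forall x, `|f x| <= C.
Proof.
move=> cf f0.
have cK := @box_compact M.
have := @continuous_compact _ _ f _ (continuous_subspaceT cf) cK.
move=> /compact_bounded[C0 [_ hC]].
have h1 := hC (`|C0| + 1) (ltac:(by rewrite ltr_pwDr// ler_norm)).
exists (`|C0| + 1); first by rewrite addr_ge0.
move=> x; have [xK|xK] := pselect [/\ `|x.1.1| <= M, `|x.1.2| <= M & `|x.2| <= M].
  by apply: h1; exists x.
by rewrite f0// normr0 addr_ge0.
Qed.
End Lines.

(** * Rules for directional derivatives and continuity *)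

Section Calculus.
Variables (R : realType) (V : normedModType R).
Implicit Types (f g : V -> R) (x v : V).

Lemma is_dD f g x v (df dg : R) : is_derive x v f df -> is_derive x v g dg ->
  is_derive x v (fun y => f y + g y) (df + dg).
Proof. by move=> hf hg; exact: is_deriveD. Qed.

Lemma is_dN f x v (df : R) : is_derive x v f df ->
  is_derive x v (fun y => - f y) (- df).
Proof. by move=> hf; exact: is_deriveN. Qed.

Lemma is_dB f g x v (df dg : R) : is_derive x v f df -> is_derive x v g dg ->
  is_derive x v (fun y => f y - g y) (df - dg).
Proof. by move=> hf hg; apply: is_dD => //; exact: is_dN. Qed.

Lemma is_dZ f x v (c df : R) : is_derive x v f df ->
  is_derive x v (fun y => c * f y) (c * df).
Proof. by move=> hf; have := is_deriveZ c hf. Qed.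

Lemma is_dC (c : R) x v : is_derive x v (fun=> c) (0 : R).
Proof. exact: is_derive_cst. Qed.

Lemma is_derive_lineP f x v (l : R) :
  is_derive x v f l <-> is_derive (0 : R) (1 : R) (fun h => f (h *: v + x)) l.
Proof.
have E : (fun h : R => h^-1 *: ((fun h => f (h *: v + x)) (h *: (1 : R) + 0) - f (0 *: v + x))) =
  (fun h : R => h^-1 *: (f (h *: v + x) - f x)).
  by apply/funext => h; rewrite scale0r add0r addr0 /GRing.scale/= mulr1.
split=> -[d e]; split.
- by move: d; rewrite /derivable /= /comp /= E.
- by move: e; rewrite /derive /= /comp /= E.
- by move: d; rewrite /derivable /= /comp /= E.
- by move: e; rewrite /derive /= /comp /= E.
Qed.

Lemma is_dcomp (g : R -> R) f x v (dg df : R) :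
  is_derive (f x) (1 : R) g dg -> is_derive x v f df ->
  is_derive x v (fun y => g (f y)) (dg * df).
Proof.
move=> hg /is_derive_lineP hf; apply/is_derive_lineP.
apply: (@is_derive1_comp _ g (fun h => f (h *: v + x))) => //.
by rewrite scale0r add0r.
Qed.

End Calculus.

Section Calculus2.
Variables (R : realType) (V : normedModType R).
Implicit Types (f g : V -> R) (x v : V).

Lemma is_derive_affine f x v (l : R) :
  (forall h : R, f (h *: v + x) = f x + h * l) -> is_derive x v f l.
Proof.
move=> fE; apply/is_derive_lineP.
rewrite (_ : (fun _ => _) = fun h : R => f x + h * l); last by apply/funext.
have h1 := is_dC (f x) (0 : R) (1 : R).
have h2 := is_dM (is_derive_id (0 : R) (1 : R)) (is_dC l (0 : R) (1 : R)).
by apply: (is_derive_eq (is_dD h1 h2)) => /=; ring.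
Qed.

Lemma diffD f g x : differentiable f x -> differentiable g x ->
  differentiable (fun y => f y + g y) x.
Proof. by move=> df dg; exact: differentiableD. Qed.

Lemma diffM f g x : differentiable f x -> differentiable g x ->
  differentiable (fun y => f y * g y) x.
Proof. by move=> df dg; exact: differentiableM. Qed.

Lemma diffcomp (g : R -> R) f x (l : R) : differentiable f x -> is_derive (f x) (1 : R) g l ->
  differentiable (fun y => g (f y)) x.
Proof.
by move=> df [dg _]; apply: (differentiable_comp df); exact/derivable1_diffP.
Qed.

Lemma cD (T : topologicalType) (f g : T -> R) : continuous f -> continuous g ->
  continuous (fun y => f y + g y).
Proof. by move=> cf cg x; apply: cvgD; [exact: cf|exact: cg]. Qed.

Lemma cM (T : topologicalType) (f g : T -> R) : continuous f -> continuous g ->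
  continuous (fun y => f y * g y).
Proof. by move=> cf cg x; apply: cvgM; [exact: cf|exact: cg]. Qed.

Lemma cN (T : topologicalType) (f : T -> R) : continuous f -> continuous (fun y => - f y).
Proof. by move=> cf x; apply: cvgN; exact: cf. Qed.

Lemma cC (T : topologicalType) (c : R) : continuous (fun _ : T => c).
Proof. by move=> x; exact: cvg_cst. Qed.

Lemma ccomp (T : topologicalType) (g : R -> R) (f : T -> R) :
  continuous g -> continuous f -> continuous (fun y => g (f y)).
Proof. by move=> cg cf x; apply: continuous_comp; [exact: cf|exact: cg]. Qed.

Lemma cX (T : topologicalType) (f : T -> R) n : continuous f -> continuous (fun y => f y ^+ n).
Proof.
move=> cf; elim: n => [|n IH]; first exact: cC.
rewrite (_ : (fun _ => _) = fun y => f y * f y ^+ n); first exact: cM.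
by apply/funext => y; rewrite exprS.
Qed.

End Calculus2.

Section Pair.
Variables (R : realType) (V : normedModType R).

Lemma is_derive_pair (u : V -> R * R) (x v : V) (l1 l2 : R) :
  is_derive x v (fun y => (u y).1) l1 -> is_derive x v (fun y => (u y).2) l2 ->
  is_derive x v u (l1, l2).
Proof.
have hausd : hausdorff_space (R * R)%type by exact: norm_hausdorff.
move=> [d1 e1] [d2 e2].
have c1 : (fun h : R => h^-1 *: ((u (h *: v + x)).1 - (u x).1)) @ 0^' --> l1.
  by rewrite -e1; exact: d1.
have c2 : (fun h : R => h^-1 *: ((u (h *: v + x)).2 - (u x).2)) @ 0^' --> l2.
  by rewrite -e2; exact: d2.
have c : (fun h : R => h^-1 *: (u (h *: v + x) - u x)) @ 0^' --> (l1, l2).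
  rewrite (_ : (fun h => _) = fun h : R => (h^-1 *: ((u (h *: v + x)).1 - (u x).1),
    h^-1 *: ((u (h *: v + x)).2 - (u x).2))); last by [].
  exact: (cvg_pair (F := 0^') c1 c2).
split; first by apply/cvg_ex; exists (l1, l2).
exact: cvg_lim.
Qed.

Lemma derivable_fst (u : V -> R * R) (x v : V) : derivable u x v ->
  is_derive x v (fun y => (u y).1) ('D_v u x).1.
Proof.
move=> du; have c : (fun h : R => h^-1 *: (u (h *: v + x) - u x)) @ 0^' --> 'D_v u x.
  exact: du.
have c1 : (fun h : R => h^-1 *: ((u (h *: v + x)).1 - (u x).1)) @ 0^' --> ('D_v u x).1.
  exact: (cvg_comp _ _ c (@cvg_fst _ _ _ _ _)).
split; first by apply/cvg_ex; exists ('D_v u x).1.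
by apply: cvg_lim => //; exact: norm_hausdorff.
Qed.

Lemma derivable_snd (u : V -> R * R) (x v : V) : derivable u x v ->
  is_derive x v (fun y => (u y).2) ('D_v u x).2.
Proof.
move=> du; have c : (fun h : R => h^-1 *: (u (h *: v + x) - u x)) @ 0^' --> 'D_v u x.
  exact: du.
have c1 : (fun h : R => h^-1 *: ((u (h *: v + x)).2 - (u x).2)) @ 0^' --> ('D_v u x).2.
  exact: (cvg_comp _ _ c (@cvg_snd _ _ _ _ _)).
split; first by apply/cvg_ex; exists ('D_v u x).2.
by apply: cvg_lim => //; exact: norm_hausdorff.
Qed.
End Pair.

(** * Coordinates, Euclidean norm and balls *)

Section Coordinates.
Variable R : realType.
Local Notation pt := (pt R).
Definition co1 (x : pt) : R := x.1.1.
Definition co2 (x : pt) : R := x.1.2.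
Definition co3 (x : pt) : R := x.2.

Lemma is_d_co1 x v : is_derive x v co1 v.1.1.
Proof. by apply: is_derive_affine => h; rewrite addrC. Qed.
Lemma is_d_co2 x v : is_derive x v co2 v.1.2.
Proof. by apply: is_derive_affine => h; rewrite addrC. Qed.
Lemma is_d_co3 x v : is_derive x v co3 v.2.
Proof. by apply: is_derive_affine => h; rewrite addrC. Qed.

Lemma c_fst (T U : topologicalType) : continuous (@fst T U).
Proof. by move=> x; exact: cvg_fst. Qed.
Lemma c_snd (T U : topologicalType) : continuous (@snd T U).
Proof. by move=> x; exact: cvg_snd. Qed.
Lemma c_co1 : continuous co1.
Proof. by move=> x; apply: (@continuous_comp _ _ _ fst fst); exact: c_fst. Qed.
Lemma c_co2 : continuous co2.
Proof. by move=> x; apply: (@continuous_comp _ _ _ fst snd); [exact: c_fst|exact: c_snd]. Qed.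
Lemma c_co3 : continuous co3. Proof. exact: c_snd. Qed.

Lemma lin_diff (f : pt -> R) x : linear f -> continuous f -> differentiable f x.
Proof.
move=> lf cf.
pose F : {linear pt -> R} := HB.pack f (GRing.isLinear.Build _ _ _ _ f lf).
exact: (@linear_differentiable _ _ _ F).
Qed.
Lemma diff_co1 x : differentiable co1 x.
Proof. by apply: lin_diff => //; exact: c_co1. Qed.
Lemma diff_co2 x : differentiable co2 x.
Proof. by apply: lin_diff => //; exact: c_co2. Qed.
Lemma diff_co3 x : differentiable co3 x.
Proof. by apply: lin_diff => //; exact: c_co3. Qed.

Definition nrm2 (x : pt) : R := x.1.1 ^+ 2 + x.1.2 ^+ 2 + x.2 ^+ 2.
Lemma nrm2_ge0 x : 0 <= nrm2 x.
Proof. by rewrite /nrm2 !addr_ge0// sqr_ge0. Qed.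
Lemma enorm3E x : enorm3 x = Num.sqrt (nrm2 x). Proof. by []. Qed.
Lemma enorm3_ge0 (x : pt) : 0 <= enorm3 x. Proof. exact: sqrtr_ge0. Qed.
Lemma enorm3_sqr (x : pt) : enorm3 x ^+ 2 = nrm2 x.
Proof. by rewrite enorm3E sqr_sqrtr// nrm2_ge0. Qed.
Lemma c_nrm2 : continuous nrm2.
Proof.
apply: cD; [apply: cD|]; apply: cX; [exact: c_co1|exact: c_co2|exact: c_co3].
Qed.
Lemma c_enorm3 : continuous (@enorm3 R).
Proof. by apply: ccomp; [exact: sqrt_continuous|exact: c_nrm2]. Qed.

Lemma co_le_enorm3 (x : pt) : [/\ `|x.1.1| <= enorm3 x, `|x.1.2| <= enorm3 x & `|x.2| <= enorm3 x].
Proof.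
have h (a : R) : a ^+ 2 <= nrm2 x -> `|a| <= enorm3 x.
  by move=> ha; rewrite -sqrtr_sqr ler_wsqrtr.
split; apply: h; rewrite /nrm2; nra.
Qed.

Lemma enorm3_lt (x : pt) (r : R) : 0 < r -> (enorm3 x < r) = (nrm2 x < r ^+ 2).
Proof.
move=> r0; rewrite -enorm3_sqr ltr_pXn2r// ?nnegrE ?enorm3_ge0// ltW//.
Qed.

Lemma enorm3_le (x : pt) (r : R) : 0 <= r -> (enorm3 x <= r) = (nrm2 x <= r ^+ 2).
Proof.
by move=> r0; rewrite -enorm3_sqr ler_pXn2r// ?nnegrE ?enorm3_ge0.
Qed.

Definition ball0 (r : R) : set pt := [set x | enorm3 x < r].
Lemma open_ball0 r : open (ball0 r).
Proof.
rewrite (_ : ball0 r = (@enorm3 R) @^-1` [set y | y < r]); last by [].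
by apply: open_comp; [move=> x _; exact: c_enorm3|exact: open_lt].
Qed.
Lemma meas_ball0 r : measurable (ball0 r).
Proof. by apply: open_measurable3; exact: open_ball0. Qed.

Lemma mu3_box_fin (M : R) :
  (mu3 (((`[(- M)%R, M] `*` `[(- M)%R, M]) `*` `[(- M)%R, M])%classic) < +oo)%E.
Proof.
have m1 : measurable (`[- M, M]%classic : set R) by exact: measurable_itv.
have m2 : measurable ((`[- M, M] `*` `[- M, M])%classic : set (R * R)) by exact: measurableX.
rewrite /mu3 /= product_measure1E//.
have := mu_itv_fin (- M) M; rewrite -ge0_fin_numE// => f1.
rewrite -ge0_fin_numE; last by rewrite mule_ge0.
apply: fin_numM => //.
by rewrite /mu2 /= product_measure1E//; exact: fin_numM.
Qed.

Lemma mu3_ball0_fin r : (mu3 (ball0 r) < +oo)%E.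
Proof.
apply: le_lt_trans (mu3_box_fin r); apply: le_measure; rewrite ?inE.
- exact: meas_ball0.
- by apply: measurableX; [apply: measurableX|]; exact: measurable_itv.
- move=> x /= /ltW xr; have [h1 h2 h3] := co_le_enorm3 x.
  rewrite !in_itv/= -!ler_norml; split; [split|]; exact: le_trans xr.
Qed.

End Coordinates.

(** * Local integrability up to the boundary *)

Section Lloc.
Variable R : realType.
Local Notation pt := (pt R).
Implicit Types f g psi : pt -> R.

Lemma indic01 (A : set pt) x : 0 <= (\1_A x : R) <= 1.
Proof. by rewrite indicE; case: (_ \in _); rewrite ?lexx ?ler01. Qed.

Lemma indic1 (A : set pt) x : A x -> \1_A x = 1 :> R.
Proof. by move=> Ax; rewrite indicE mem_set. Qed.

Lemma indic0' (A : set pt) x : ~ A x -> \1_A x = 0 :> R.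
Proof. by move=> Ax; rewrite indicE memNset. Qed.

Lemma norm_indicM (A : set pt) x (y : R) : `|\1_A x * y| <= `|y|.
Proof.
by rewrite normrM ler_piMl// ger0_norm; case/andP: (indic01 A x).
Qed.

Lemma meas_indicM (N : set pt) f : open N -> (forall x, N x -> {for x, continuous f}) ->
  measurable_fun setT (fun x => \1_N x * f x).
Proof.
move=> oN cf; have mN := open_measurable3 oN.
have := open_continuous_measurable3 oN cf.
move=> /(measurable_restrictT _ mN).
congr measurable_fun; apply/funext => x; rewrite patchE indicE.
by case: (x \in N); rewrite ?mul1r ?mul0r.
Qed.

Lemma shift_continuous (c : pt) : continuous (fun x : pt => x + c).
Proof. by move=> x; apply: cvgD; [exact: cvg_id|exact: cvg_cst]. Qed.

(** [H1loc] states integrability of the squares only, which does not give measurability of the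
    derivatives. They are pointwise limits of difference quotients with step 1 / (n + 1), formed
    with f extended by 0 outside N; near a point of N the extension is eventually invisible. *)
Lemma meas_indic_derive (N : set pt) f f' (e : pt) : open N ->
  (forall x, N x -> {for x, continuous f}) ->
  (forall x, N x -> is_derive x e f (f' x)) ->
  measurable_fun setT (fun x => \1_N x * f' x).
Proof.
move=> oN cf df.
pose h (n : nat) : R := n.+1%:R^-1.
have h0 n : h n != 0 by rewrite invr_eq0 pnatr_eq0.
pose fN x := \1_N x * f x.
pose F n x := \1_N x * ((h n)^-1 * (fN (x + h n *: e) - fN x)).
have mS n : measurable_fun setT (fun x : pt => fN (x + h n *: e)).
  pose S := (fun x : pt => x + h n *: e) @^-1` N.
  have oS : open S by apply: open_comp => // x _; exact: shift_continuous.
  rewrite (_ : (fun _ => _) = fun x : pt => \1_S x * f (x + h n *: e)).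
    apply: meas_indicM => // x Sx.
    by apply: (@continuous_comp _ _ _ (fun x : pt => x + h n *: e) f); [exact: shift_continuous|exact: cf].
  apply/funext => x; rewrite /fN; have [xN|xN] := pselect (N (x + h n *: e)).
    by rewrite (indic1 xN) (@indic1 S).
  by rewrite (indic0' xN) (@indic0' S).
have mF n : measurable_fun setT (F n).
  apply: measurable_funM; first exact: measurable_indic (open_measurable3 oN).
  apply: measurable_funM; first exact: measurable_cst.
  by apply: measurable_funB; [exact: mS|exact: meas_indicM].
apply: (measurable_fun_cvg mF) => x _.
have [xN|xN] := pselect (N x); last first.
  rewrite /F indic0'// mul0r; under eq_fun do rewrite mul0r; exact: cvg_cst.
rewrite /F indic1//; under eq_fun do rewrite mul1r; rewrite mul1r.
have [d1 d2] := df x xN.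
have c : (fun t : R => t^-1 *: (f (t *: e + x) - f x)) @ 0^' --> f' x.
  by rewrite -d2; exact: d1.
have hc : h @ \oo --> 0^'.
  move=> A hA; have h1 : h @ \oo --> (0 : R) by exact: cvg_harmonic.
  have hA' : \forall y \near (0 : R), y != 0 -> A y by exact: hA.
  have h2 : \forall n \near \oo, h n != 0 -> A (h n) by exact: h1 _ hA'.
  by apply: filterS h2 => n; apply; exact: h0.
have c2 := cvg_comp _ _ hc c.
apply: cvg_trans c2; apply: near_eq_cvg.
have nN : \forall n \near \oo, N (x + h n *: e).
  have cc : (fun n => (x : pt) + h n *: e) @ \oo --> (x : pt) + (0 : R) *: e.
    apply: cvgD; first exact: cvg_cst.
    by apply: cvgZr_tmp; exact: cvg_harmonic.
  rewrite scale0r addr0 in cc.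
  by apply: cc; exact: open_nbhs_nbhs.
near=> n; rewrite /= /fN !indic1 ?mul1r//; last by near: n.
by have -> : (x : pt) + h n *: e = h n *: e + x by rewrite addrC.
Unshelve. all: by end_near. Qed.

(** The balls are centred at the origin and not confined to the domain. Applied to [\1_N] times a
    function, this means integrability up to the boundary of N. *)
Definition Lloc g := forall r, L1 mu3 (fun x => \1_(ball0 r) x * g x).

Lemma Lloc_meas g : Lloc g -> measurable_fun setT g.
Proof.
move=> Lg; apply: (measurable_fun_cvg (h := fun n x => \1_(ball0 n%:R) x * g x)).
  by move=> n; exact: (L1_meas (Lg n%:R)).
move=> x _; apply: cvg_near_cst; near=> n; rewrite indic1 ?mul1r//=.
rewrite /ball0 /=; near: n; exact: nbhs_infty_gtr.
Unshelve. all: by end_near. Qed.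

Lemma Lloc_L1 g psi (C r : R) : Lloc g -> measurable_fun setT psi ->
  (forall x, `|psi x| <= C) -> (forall x, r <= enorm3 x -> psi x = 0) ->
  L1 mu3 (fun x => g x * psi x).
Proof.
move=> Lg mpsi pC p0; have C0 : 0 <= C by apply: le_trans (pC 0).
apply: (L1_le (mu := mu3) (g := fun x => C * `|\1_(ball0 r) x * g x|)).
- by apply: measurable_funM => //; exact: Lloc_meas.
- move=> x; have [xr|rx] := ltP (enorm3 x) r; last first.
    by rewrite p0// mulr0 normr0 mulr_ge0.
  by rewrite indic1// mul1r normrM mulrC ler_wpM2r.
- apply: L1_Z; apply: L1_norm; exact: Lg.
Qed.

Lemma Lloc_D g1 g2 : Lloc g1 -> Lloc g2 -> Lloc (fun x => g1 x + g2 x).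
Proof.
by move=> L1' L2' r; apply: (L1_eq _ (L1_D (L1' r) (L2' r))) => x; rewrite mulrDr.
Qed.

Lemma Lloc_N g : Lloc g -> Lloc (fun x => - g x).
Proof. by move=> L r; apply: (L1_eq _ (L1_N (L r))) => x; rewrite mulrN. Qed.

Lemma Lloc_le g g' : measurable_fun setT g -> (forall x, `|g x| <= g' x) ->
  Lloc g' -> Lloc g.
Proof.
move=> mg gg' Lg r; apply: (L1_le (mu := mu3) _ _ (Lg r)).
  by apply: measurable_funM => //; exact: measurable_indic (meas_ball0 r).
move=> x; case/andP: (indic01 (ball0 r) x) => i0 _.
by rewrite normrM ger0_norm// ler_wpM2l.
Qed.

Lemma Lloc_cst c : Lloc (fun=> c).
Proof.
move=> r; have h : L1 mu3 (fun x : pt => c * \1_(ball0 r) x).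
  by apply: L1_Z; apply: L1_indic; [exact: meas_ball0|exact: mu3_ball0_fin].
by apply: (L1_eq _ h) => x; rewrite mulrC.
Qed.

Lemma Lloc_sqr g : measurable_fun setT g -> Lloc (fun x => g x ^+ 2) -> Lloc g.
Proof.
move=> mg Lg; apply: (Lloc_le mg (g' := fun x => 1 + g x ^+ 2)).
  by move=> x; rewrite -real_normK ?num_real//; have := normr_ge0 (g x); nra.
apply: Lloc_D => //; exact: Lloc_cst.
Qed.

Definition csupp (f : pt -> R) (r : R) := forall x, r <= enorm3 x -> f x = 0.

Lemma csupp_bounded f r : continuous f -> csupp f r -> exists2 C, 0 <= C & forall x, `|f x| <= C.
Proof.
move=> cf f0; apply: (compact_support_bounded (M := r) cf) => x xb; apply: f0.
rewrite leNgt; apply/negP => /ltW xr; apply: xb.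
by have [h1 h2 h3] := co_le_enorm3 x; split; exact: le_trans xr.
Qed.

Lemma Lloc_csupp g f r : Lloc g -> continuous f -> csupp f r -> L1 mu3 (fun x => g x * f x).
Proof.
move=> Lg cf f0; have [C C0 fC] := csupp_bounded cf f0.
exact: (Lloc_L1 Lg (continuous_measurable3 cf) fC f0).
Qed.

Lemma Lloc_indic (N : set pt) : measurable N -> Lloc \1_N.
Proof.
move=> mN; apply: (Lloc_le (g' := fun=> 1)); first exact: measurable_indic mN.
  by move=> x; have /andP[h1 h2] := indic01 N x; rewrite ger0_norm.
exact: Lloc_cst.
Qed.

Lemma J_indic_of_integral (D : set pt) g : (\int[leb3 (R := R)]_(x in D) (g x)%:E = 0)%E ->
  J mu3 (fun x => \1_D x * g x) = 0.
Proof.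
rewrite integral_mkcond => h; rewrite /J /Rintegral.
rewrite (_ : (fun x => (\1_D x * g x)%:E) = (fun x => (g x)%:E) \_ D); last first.
  apply/funext => x; rewrite patchE indicE; case: (_ \in _); by rewrite ?mul1r ?mul0r.
by have -> : (\int[mu3]_x ((fun x => (g x)%:E) \_ D) x = 0)%E by exact: h.
Qed.

End Lloc.

(** * Test functions and the weak equation *)

Section Jets.
Variable R : realType.
Local Notation pt := (pt R).

(* A function with its partial derivatives as data; off the [isC1] or [isC2] predicate
   the fields are unrelated. *)
Record jet := Jet { jf : pt -> R;
  j1 : pt -> R; j2 : pt -> R; j3 : pt -> R;
  j11 : pt -> R; j22 : pt -> R; j33 : pt -> R }.

Record isC1 (j : jet) : Prop := IsC1 {
  C1diff : forall x, differentiable (jf j) x;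
  C1d1 : forall x, is_derive x (e1 R) (jf j) (j1 j x);
  C1d2 : forall x, is_derive x (e2 R) (jf j) (j2 j x);
  C1d3 : forall x, is_derive x (e3 R) (jf j) (j3 j x);
  C1c1 : continuous (j1 j); C1c2 : continuous (j2 j); C1c3 : continuous (j3 j) }.

Record isC2 (j : jet) : Prop := IsC2 {
  C2C1 :> isC1 j;
  C2d1 : forall x, is_derive x (e1 R) (j1 j) (j11 j x);
  C2d2 : forall x, is_derive x (e2 R) (j2 j) (j22 j x);
  C2d3 : forall x, is_derive x (e3 R) (j3 j) (j33 j x);
  C2c1 : continuous (j11 j); C2c2 : continuous (j22 j); C2c3 : continuous (j33 j) }.

Lemma C1c j : isC1 j -> continuous (jf j).
Proof. by move=> h x; apply: differentiable_continuous; exact: C1diff h x. Qed.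

Definition lap j x := j11 j x + j22 j x + j33 j x.

Definition jmul (a b : jet) : jet := Jet (fun x => jf a x * jf b x)
  (fun x => j1 a x * jf b x + jf a x * j1 b x)
  (fun x => j2 a x * jf b x + jf a x * j2 b x)
  (fun x => j3 a x * jf b x + jf a x * j3 b x)
  (fun x => j11 a x * jf b x + j1 a x * j1 b x + (j1 a x * j1 b x + jf a x * j11 b x))
  (fun x => j22 a x * jf b x + j2 a x * j2 b x + (j2 a x * j2 b x + jf a x * j22 b x))
  (fun x => j33 a x * jf b x + j3 a x * j3 b x + (j3 a x * j3 b x + jf a x * j33 b x)).

Definition jadd (a b : jet) : jet := Jet (fun x => jf a x + jf b x)
  (fun x => j1 a x + j1 b x) (fun x => j2 a x + j2 b x) (fun x => j3 a x + j3 b x)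
  (fun x => j11 a x + j11 b x) (fun x => j22 a x + j22 b x) (fun x => j33 a x + j33 b x).

Lemma isC1_mul a b : isC1 a -> isC1 b -> isC1 (jmul a b).
Proof.
move=> ha hb; have ca := C1c ha; have cb := C1c hb; case: ha hb => da a1 a2 a3 c1 c2 c3 [db b1 b2 b3 c1' c2' c3'].
by split => /=; first (by move=> x; apply: diffM); try (by move=> x; apply: is_dM);
   apply: cD; apply: cM.
Qed.

Lemma isC1_add a b : isC1 a -> isC1 b -> isC1 (jadd a b).
Proof.
move=> [da a1 a2 a3 c1 c2 c3] [db b1 b2 b3 c1' c2' c3'].
by split => /=; first (by move=> x; apply: diffD); try (by move=> x; apply: is_dD);
   apply: cD.
Qed.

Lemma isC2_mul a b : isC2 a -> isC2 b -> isC2 (jmul a b).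
Proof.
move=> [ha A1 A2 A3 C1 C2 C3] [hb B1 B2 B3 D1 D2 D3].
have ca := C1c ha; have cb := C1c hb.
case: (ha) (hb) => da a1 a2 a3 c1 c2 c3 [db b1 b2 b3 c1' c2' c3'].
split => /=; first exact: isC1_mul.
- by move=> x; apply: is_dD; apply: is_dM.
- by move=> x; apply: is_dD; apply: is_dM.
- by move=> x; apply: is_dD; apply: is_dM.
- by apply: cD; apply: cD; apply: cM.
- by apply: cD; apply: cD; apply: cM.
- by apply: cD; apply: cD; apply: cM.
Qed.

Lemma isC2_add a b : isC2 a -> isC2 b -> isC2 (jadd a b).
Proof.
move=> [ha A1 A2 A3 C1 C2 C3] [hb B1 B2 B3 D1 D2 D3].
split => /=; first exact: isC1_add.
- by move=> x; apply: is_dD.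
- by move=> x; apply: is_dD.
- by move=> x; apply: is_dD.
- exact: cD.
- exact: cD.
- exact: cD.
Qed.

Lemma isC1_near0 j (x : pt) : isC1 j -> (\forall y \near x, jf j y = 0) ->
  \forall y \near x, [/\ jf j y = 0, j1 j y = 0, j2 j y = 0 & j3 j y = 0].
Proof.
move=> h /near_join; apply: filterS => y h0; split.
- exact: nbhs_singleton h0.
- exact: is_derive_near0 (C1d1 h y) h0.
- exact: is_derive_near0 (C1d2 h y) h0.
- exact: is_derive_near0 (C1d3 h y) h0.
Qed.

Lemma isC2_near0 j (x : pt) : isC2 j -> (\forall y \near x, jf j y = 0) ->
  [/\ jf j x = 0, [/\ j1 j x = 0, j2 j x = 0 & j3 j x = 0] &
      [/\ j11 j x = 0, j22 j x = 0 & j33 j x = 0]].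
Proof.
move=> h h0; have h1 := isC1_near0 h h0.
have [e0 e1 e2 e3] := nbhs_singleton h1; split => //; split.
- by apply: is_derive_near0 (C2d1 h x) _; apply: filterS h1 => y [].
- by apply: is_derive_near0 (C2d2 h x) _; apply: filterS h1 => y [].
- by apply: is_derive_near0 (C2d3 h x) _; apply: filterS h1 => y [].
Qed.

Lemma csupp_near0 (f : pt -> R) r (x : pt) : csupp f r -> r < enorm3 x -> \forall y \near x, f y = 0.
Proof.
move=> f0 rx; have : \forall y \near x, r < enorm3 y.
  have := c_enorm3 (x := x); move/cvgrPdist_lt/(_ (enorm3 x - r)); rewrite subr_gt0 => /(_ rx).
  by apply: filterS => y; rewrite ltr_norml => /andP[_ h]; lra.
by apply: filterS => y /ltW; exact: f0.
Qed.

End Jets.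

Section Geometry.
Variable R : realType.
Local Notation pt := (pt R).

Lemma locally_perturbed_continuous (f : R * R -> R) : locally_perturbed f -> continuous f.
Proof.
move=> [[L fL] _] a.
pose g (b : R * R) : R := L * enorm2 (a.1 - b.1, a.2 - b.2).
have cg : {for a, continuous g}.
  apply: cvgM; first exact: cvg_cst.
  apply: (@continuous_comp _ _ _ (fun b : R * R => (a.1 - b.1) ^+ 2 + (a.2 - b.2) ^+ 2) Num.sqrt).
    by apply: cD; apply: cX; apply: cD; [exact: cC|apply: cN; exact: c_fst|exact: cC|apply: cN; exact: c_snd].
  exact: sqrt_continuous.
have g0 : g a = 0 by rewrite /g !subrr /enorm2 /= expr0n /= addr0 sqrtr0 mulr0.
apply/cvgrPdist_lt => e e0.
have := cg; move/cvgrPdist_lt/(_ e e0); rewrite g0; apply: filterS => b.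
rewrite sub0r normrN => h; apply: (le_lt_trans (fL a b)).
exact: (le_lt_trans (ler_norm _) h).
Qed.

Lemma open_Omega (f : R * R -> R) : continuous f -> open (Omega f).
Proof.
move=> cf; rewrite (_ : Omega f = (fun x : pt => x.2 - f x.1) @^-1` [set y | 0 < y]).
  apply: open_comp; last exact: open_gt.
  move=> x _; apply: cD; first exact: c_snd.
  apply: cN => y; apply: continuous_comp; [exact: c_fst|exact: cf].
by apply/seteqP; split => x; rewrite /Omega /= subr_gt0.
Qed.

(* [pr true] is the real part, [pr false] the imaginary part. *)
Definition pr (b : bool) (z : R * R) : R := if b then z.1 else z.2.

Lemma is_d_pr b (u : pt -> R * R) (x e : pt) : derivable u x e ->
  is_derive x e (fun y => pr b (u y)) (pr b ('D_e u x)).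
Proof. by case: b => h; [exact: derivable_fst|exact: derivable_snd]. Qed.

Lemma c_pr b : continuous (pr b).
Proof. by case: b; [exact: c_fst|exact: c_snd]. Qed.

(** Derivatives are read off where the function vanishes in a whole neighbourhood, hence strictly
    outside radius r; r + 1 is a convenient such radius. *)
Lemma isC1_csupp (j : jet R) r : isC1 j -> csupp (jf j) r ->
  [/\ csupp (jf j) (r + 1), csupp (j1 j) (r + 1), csupp (j2 j) (r + 1) & csupp (j3 j) (r + 1)].
Proof.
move=> h h0.
have n x : r + 1 <= enorm3 x -> [/\ jf j x = 0, j1 j x = 0, j2 j x = 0 & j3 j x = 0].
  move=> rx; have xr : r < enorm3 x by apply: lt_le_trans rx; rewrite ltrDl.
  exact: nbhs_singleton (isC1_near0 h (csupp_near0 h0 xr)).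
by split => x /n[].
Qed.

Lemma isC2_csupp (j : jet R) r : isC2 j -> csupp (jf j) r ->
  [/\ csupp (j11 j) (r + 1), csupp (j22 j) (r + 1) & csupp (j33 j) (r + 1)].
Proof.
move=> h h0.
have n x : r + 1 <= enorm3 x -> [/\ j11 j x = 0, j22 j x = 0 & j33 j x = 0].
  move=> rx; have xr : r < enorm3 x by apply: lt_le_trans rx; rewrite ltrDl.
  by have [_ _] := isC2_near0 h (csupp_near0 h0 xr).
by split => x /n[].
Qed.

Lemma isC1_test (j : jet R) r : isC1 j -> csupp (jf j) r -> test_fun (jf j).
Proof.
move=> h h0; split; first exact: C1diff h.
split; last by exists r => x /ltW /h0.
move=> e [->|[->|->]].
- rewrite (_ : (fun _ => _) = j1 j); first exact: C1c1 h.
  by apply/funext => x; case: (C1d1 h x).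
- rewrite (_ : (fun _ => _) = j2 j); first exact: C1c2 h.
  by apply/funext => x; case: (C1d2 h x).
- rewrite (_ : (fun _ => _) = j3 j); first exact: C1c3 h.
  by apply/funext => x; case: (C1d3 h x).
Qed.

End Geometry.

(** * The weak equation for one surface, on a smaller domain *)

Section Weak.
Variables (R : realType) (k : R).
Local Notation pt := (pt R).

Definition Wf (p p1 p2 p3 : pt -> R) (j : jet R) (x : pt) : R :=
  p1 x * j1 j x + p2 x * j2 j x + p3 x * j3 j x - k ^+ 2 * p x * jf j x.

Lemma Wf_alg (i p p1 p2 p3 j j1 j2 j3 : R) :
  i * p1 * j1 + i * p2 * j2 + i * p3 * j3 + - k ^+ 2 * (i * p * j) =
  i * (p1 * j1 + p2 * j2 + p3 * j3 - k ^+ 2 * p * j).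
Proof. ring. Qed.

Lemma L1_Wf_of (N : set pt) (p p1 p2 p3 : pt -> R) (j : jet R) r :
  Lloc (fun x => \1_N x * p x) -> Lloc (fun x => \1_N x * p1 x) ->
  Lloc (fun x => \1_N x * p2 x) -> Lloc (fun x => \1_N x * p3 x) ->
  isC1 j -> csupp (jf j) r -> L1 mu3 (fun x => \1_N x * Wf p p1 p2 p3 j x).
Proof.
move=> L L1' L2' L3' hj hs; have [s0 s1 s2 s3] := isC1_csupp hj hs.
have Z := L1_Z (- k ^+ 2) (Lloc_csupp L (C1c hj) s0).
have D1 := Lloc_csupp L1' (C1c1 hj) s1.
have D2 := Lloc_csupp L2' (C1c2 hj) s2.
have D3 := Lloc_csupp L3' (C1c3 hj) s3.
have D := L1_D (L1_D (L1_D D1 D2) D3) Z.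
apply: (@L1_eq _ _ _ mu3 _ _ _ D) => x; exact: Wf_alg.
Qed.

Lemma Wf_split (v v1 v2 v3 s s1 s2 s3 j j1 j2 j3 : R) :
  v1 * j1 + v2 * j2 + v3 * j3 - k ^+ 2 * v * j +
  (s1 * j1 + s2 * j2 + s3 * j3 - k ^+ 2 * s * j) =
  (v1 + s1) * j1 + (v2 + s2) * j2 + (v3 + s3) * j3 - k ^+ 2 * (v + s) * j.
Proof. ring. Qed.

Lemma Wf_zero (i p1 p2 p3 p : R) : 0 = i * (p1 * 0 + p2 * 0 + p3 * 0 - p * 0).
Proof. ring. Qed.

Section PlaneWaves.
Variable d : pt.
Definition phase (s : R) (x : pt) : R := k * (d.1.1 * x.1.1 + d.1.2 * x.1.2 + s * x.2).
Definition vin (x : pt) : cplx R := u_in k d x + u_re_N k d x.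

Lemma vinE x : vin x = (cos (phase d.2 x) + cos (phase (- d.2) x),
                        sin (phase d.2 x) + sin (phase (- d.2) x)).
Proof. by rewrite /vin /u_in /u_re_N /cexpi /phase mulNr. Qed.

Lemma phase_d s x e : is_derive x e (phase s) (phase s e).
Proof. by apply: is_derive_affine => h; rewrite /phase /= /GRing.scale /=; ring. Qed.

Lemma c_phase s : continuous (phase s).
Proof.
apply: cM; first exact: cC.
by apply: cD; [apply: cD|]; apply: cM; [exact: cC|exact: c_co1|exact: cC|exact: c_co2|exact: cC|exact: c_co3].
Qed.

Definition dvin (e x : pt) : cplx R :=
  (- sin (phase d.2 x) * phase d.2 e + - sin (phase (- d.2) x) * phase (- d.2) e,
   cos (phase d.2 x) * phase d.2 e + cos (phase (- d.2) x) * phase (- d.2) e).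

Lemma vin_d e x : is_derive x e vin (dvin e x).
Proof.
rewrite (_ : vin = fun x => (cos (phase d.2 x) + cos (phase (- d.2) x),
                        sin (phase d.2 x) + sin (phase (- d.2) x))); last first.
  by apply/funext => y; rewrite vinE.
apply: is_derive_pair => /=; apply: is_dD; apply: is_dcomp; try exact: phase_d.
all: by [exact: is_derive_cos|exact: is_derive_sin].
Qed.

Lemma c_vin b : continuous (fun x => pr b (vin x)).
Proof.
rewrite (_ : vin = fun x => (cos (phase d.2 x) + cos (phase (- d.2) x),
                        sin (phase d.2 x) + sin (phase (- d.2) x))); last first.
  by apply/funext => y; rewrite vinE.
have cs := @continuous_sin R; have cc := @continuous_cos R.
by case: b; apply: cD; apply: ccomp => //; exact: c_phase.
Qed.

Lemma c_dvin b e : continuous (fun x => pr b (dvin e x)).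
Proof.
have cs := @continuous_sin R; have cc := @continuous_cos R.
case: b; apply: cD; apply: cM; try exact: cC; try apply: cN; by apply: ccomp => //; exact: c_phase.
Qed.
End PlaneWaves.

Section OneSurface.
Variables (f : R * R -> R) (d : pt) (us : pt -> cplx R) (N : set pt).
Hypotheses (cf : continuous f) (sol : scat_sol_N k f d us).
Hypotheses (oN : open N) (NO : N `<=` Omega f).

Lemma us_derivable x e : Omega f x -> derivable us x e.
Proof. by case: sol => -[h _] _ Ox; apply: diff_derivable; exact: h. Qed.

Lemma us_pr_d b x e : Omega f x -> is_derive x e (fun y => pr b (us y)) (pr b (pd e us x)).
Proof. by move=> Ox; apply: is_d_pr; exact: us_derivable. Qed.

Lemma us_pr_c b x : Omega f x -> {for x, continuous (fun y => pr b (us y))}.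
Proof.
case: sol => -[h _] _ Ox.
apply: continuous_comp; last exact: c_pr.
by apply: differentiable_continuous; exact: h.
Qed.

Lemma sq_Lloc (g : pt -> R) : measurable_fun setT (fun x => \1_N x * g x) ->
  (forall r, (leb3 (R := R)).-integrable (Omega f `&` [set x | enorm3 x < r]) (fun x => ((g x) ^+ 2)%:E)) ->
  Lloc (fun x => \1_N x * g x).
Proof.
move=> mg ig; apply: Lloc_sqr => // r.
have mO : measurable (Omega f) by apply: open_measurable3; exact: open_Omega.
have mD := measurableI _ _ mO (meas_ball0 r).
pose h (x : pt) : R := \1_(Omega f `&` ball0 r) x * g x ^+ 2.
have Lh : L1 mu3 h.
  have hh := @L1_mkcond _ _ _ mu3 _ (fun x : pt => g x ^+ 2) mD.
  by apply: hh; exact: ig.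
apply: (L1_le (mu := mu3) _ _ Lh).
  apply: measurable_funM; first exact: measurable_indic (meas_ball0 r).
  by apply: measurable_funX.
move=> x; have [xB|xB] := pselect (ball0 r x); last first.
  by rewrite (indic0' xB) mul0r normr0 /h mulr_ge0 ?sqr_ge0//; case/andP: (indic01 (Omega f `&` ball0 r) x).
have [xN|xN] := pselect (N x); last first.
  by rewrite (indic0' xN) mul0r expr0n /= mulr0 normr0 /h mulr_ge0 ?sqr_ge0//; case/andP: (indic01 (Omega f `&` ball0 r) x).
rewrite (indic1 xB) (indic1 xN) /h indic1; last by split => //; exact: NO.
by rewrite !mul1r ger0_norm// sqr_ge0.
Qed.

Lemma us_Lloc b : Lloc (fun x => \1_N x * pr b (us x)).
Proof.
apply: sq_Lloc; first by apply: meas_indicM => // x /NO; exact: us_pr_c.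
move=> r; case: sol => -[_ h] _; apply: (h r (fun x => pr b (us x))).
by case: b; [left|right; left].
Qed.

Lemma dus_Lloc b e : e = e1 R \/ e = e2 R \/ e = e3 R ->
  Lloc (fun x => \1_N x * pr b (pd e us x)).
Proof.
move=> he; apply: sq_Lloc.
  apply: (meas_indic_derive (f := fun x => pr b (us x)) (e := e) oN).
    by move=> x /NO; exact: us_pr_c.
  by move=> x /NO; exact: us_pr_d.
move=> r; case: sol => -[_ h] _; apply: (h r (fun x => pr b (pd e us x))).
by right; right; exists e; split => //; case: b; [left|right].
Qed.

(** A test function that vanishes near [Omega f] minus N does not see the difference of the two
    domains, so the weak equation restricts to N. The first integral involves the plane waves alone
    and does not depend on f, which is what makes it cancel between two surfaces. *)
Lemma weak_one b (j : jet R) r : isC1 j -> csupp (jf j) r ->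
  (forall x, Omega f x -> ~ N x -> \forall y \near x, jf j y = 0) ->
  J mu3 (fun x => \1_N x * Wf (fun x => pr b (vin d x)) (fun x => pr b (dvin d (e1 R) x))
     (fun x => pr b (dvin d (e2 R) x)) (fun x => pr b (dvin d (e3 R) x)) j x) +
  J mu3 (fun x => \1_N x * Wf (fun x => pr b (us x)) (fun x => pr b (pd (e1 R) us x))
     (fun x => pr b (pd (e2 R) us x)) (fun x => pr b (pd (e3 R) us x)) j x) = 0.
Proof.
move=> hj hs hn.
have [s0 s1 s2 s3] := isC1_csupp hj hs.
have LN : Lloc (\1_N : pt -> R) by apply: Lloc_indic; exact: open_measurable3.
rewrite -J_D; last 2 first.
- have cj := C1c hj; case: (hj) => _ _ _ _ c1 c2 c3.
  pose F := fun x => Wf (fun x => pr b (vin d x)) (fun x => pr b (dvin d (e1 R) x))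
     (fun x => pr b (dvin d (e2 R) x)) (fun x => pr b (dvin d (e3 R) x)) j x.
  apply: (Lloc_csupp (f := F) (r := r + 1) LN).
    apply: cD; [apply: cD; [apply: cD|]|]; [apply: cM| apply: cM| apply: cM|apply: cN; apply: cM; [apply: cM|]] => //;
    by [exact: c_dvin|exact: c_vin|exact: cC].
  by move=> x rx; rewrite /F /Wf s0// s1// s2// s3// !mulr0 !addr0 subrr.
- have c0 := C1c hj; case: (hj) => _ _ _ _ c1 c2 c3.
  have Z := L1_Z (- k ^+ 2) (Lloc_csupp (us_Lloc b) c0 s0).
  have D1 := Lloc_csupp (@dus_Lloc b (e1 R) ltac:(by left)) c1 s1.
  have D2 := Lloc_csupp (@dus_Lloc b (e2 R) ltac:(by right; left)) c2 s2.
  have D3 := Lloc_csupp (@dus_Lloc b (e3 R) ltac:(by right; right)) c3 s3.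
  have D := L1_D (L1_D (L1_D D1 D2) D3) Z.
  apply: (@L1_eq _ _ _ mu3 _ _ _ D) => x.
  exact: Wf_alg.
have [_ [wk _]] := sol.
have tf := isC1_test hj hs.
have D1 x : 'D_(e1 R) (jf j) x = j1 j x by case: (C1d1 hj x).
have D2 x : 'D_(e2 R) (jf j) x = j2 j x by case: (C1d2 hj x).
have D3 x : 'D_(e3 R) (jf j) x = j3 j x by case: (C1d3 hj x).
pose u := fun x => u_in k d x + u_re_N k d x + us x.
have : J mu3 (fun x => \1_(Omega f) x * (pr b (pd (e1 R) u x) * 'D_(e1 R) (jf j) x +
   pr b (pd (e2 R) u x) * 'D_(e2 R) (jf j) x + pr b (pd (e3 R) u x) * 'D_(e3 R) (jf j) x
   - k ^+ 2 * pr b (u x) * jf j x)) = 0.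
  by case: b; apply: J_indic_of_integral; case: (wk _ tf).
move=> <-; apply: J_eq => x; rewrite D1 D2 D3.
have [xN|xN] := pselect (N x); last first.
  rewrite (indic0' xN) !mul0r addr0.
  have [xO|xO] := pselect (Omega f x); last by rewrite indic0'// mul0r.
  have [-> -> -> ->] := nbhs_singleton (isC1_near0 hj (hn x xO xN)).
  exact: Wf_zero.
have xO := NO xN.
have pdE e : pd e u x = dvin d e x + pd e us x.
  have [dv Ev] := vin_d d e x.
  by rewrite /pd (deriveD dv (us_derivable xO)) Ev.
rewrite !indic1// !pdE /Wf !mul1r Wf_split.
by case: b.
Qed.
End OneSurface.
End Weak.

(** * Moving both derivatives onto the test function *)

Section Hsol.
Variables (R : realType) (k : R).
Local Notation pt := (pt R).

(* Horizontal integration by parts in the region above a graph would need the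
   normal of the graph, so a test function must vanish near the part of the
   boundary that is not flat. *)
Definition adm (N flat : set pt) (j : jet R) :=
  forall x : pt, [\/ N x, (\forall y \near x, jf j y = 0) | flat x].

Record hgeom (N flat : set pt) (m : R * R -> R) : Prop := HGeom {
  hg_open : open N;
  hg_graph : forall x, N x <-> m x.1 < x.2;
  hg_flat : forall x, flat x -> \forall y \near x, N y <-> 0 < y.2;
  hg_bound : exists M : R, forall y, `|m y| < M }.

(* [p1], [p2], [p3] are the partial derivatives of [p] in [N]; both the Helmholtz
   equation and the Neumann condition are carried by [hs_weak] alone. *)
Record hsol (N flat : set pt) (m : R * R -> R) (p p1 p2 p3 : pt -> R) : Prop := HSol {
  hs_geom :> hgeom N flat m;
  hs_c : forall x, N x -> {for x, continuous p};
  hs_d1 : forall x, N x -> is_derive x (e1 R) p (p1 x);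
  hs_d2 : forall x, N x -> is_derive x (e2 R) p (p2 x);
  hs_d3 : forall x, N x -> is_derive x (e3 R) p (p3 x);
  hs_L : Lloc (fun x => \1_N x * p x);
  hs_L1 : Lloc (fun x => \1_N x * p1 x);
  hs_L2 : Lloc (fun x => \1_N x * p2 x);
  hs_L3 : Lloc (fun x => \1_N x * p3 x);
  hs_weak : forall j r, isC1 j -> csupp (jf j) r -> adm N flat j ->
    J mu3 (fun x => \1_N x * Wf k p p1 p2 p3 j x) = 0 }.

Section Distribution.
Variables (N flat : set pt) (m : R * R -> R) (p p1 p2 p3 : pt -> R).
Hypothesis H : hsol N flat m p p1 p2 p3.

Lemma hs_indic1 x : m x.1 < x.2 -> \1_N x = 1 :> R.
Proof. by move=> h; rewrite indic1//; apply/(hg_graph H). Qed.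

Lemma hs_indic0 x : x.2 <= m x.1 -> \1_N x = 0 :> R.
Proof. by move=> h; rewrite indic0'//; move/(hg_graph H); rewrite ltNge h. Qed.

(** Cutting off by [\1_N] is harmless in horizontal directions: near a flat point N is the
    half-space x3 > 0, and a short horizontal segment lies either inside or outside it. The other
    two cases are interior points and points near which the test function vanishes. *)
Lemma flat_derive (e : pt) (p' q q' : pt -> R) (x : pt) : e.2 = 0 ->
  (forall x, N x -> is_derive x e p (p' x)) ->
  is_derive x e q (q' x) ->
  [\/ N x, [/\ (\forall y \near x, q y = 0) & q' x = 0] | flat x] ->
  is_derive x e (fun y => \1_N y * (p y * q y)) (\1_N x * (p' x * q x + p x * q' x)).
Proof.
move=> e20 dp dq [xN|[q0 q'0]|fx].
- have nN : \forall y \near x, N y by apply: open_nbhs_nbhs; split => //; exact: hg_open H.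
  rewrite indic1// mul1r.
  apply: (near_eq_is_derive (f := fun y => p y * q y)).
    by apply: filterS nN => y yN; rewrite indic1// mul1r.
  exact: is_dM (dp x xN) dq.
- rewrite (nbhs_singleton q0) q'0 !mulr0 addr0 mulr0.
  apply: (near_eq_is_derive (f := fun=> (0:R))).
    by apply: filterS q0 => y ->; rewrite !mulr0.
have fl := hg_flat H fx.
have [xN|xN] := ltP 0 x.2.
  have Nx : N x by apply/(nbhs_singleton fl).
  have nN : \forall y \near x, N y by apply: open_nbhs_nbhs; split => //; exact: hg_open H.
  rewrite indic1// mul1r.
  apply: (near_eq_is_derive (f := fun y => p y * q y)).
    by apply: filterS nN => y yN; rewrite indic1// mul1r.
  exact: is_dM (dp x Nx) dq.
have Nx : ~ N x by move/(nbhs_singleton fl); rewrite ltNge xN.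
rewrite (indic0' Nx) mul0r; apply/is_derive_lineP.
apply: (near_eq_is_derive (f := fun=> (0:R))).
have cl : (fun h : R => h *: e + x) @ (0 : R) --> x.
  have : (fun h : R => h *: e + x) @ (0 : R) --> (0 : R) *: e + x.
    by apply: cvgD; [apply: cvgZr_tmp; exact: cvg_id|exact: cvg_cst].
  by rewrite scale0r add0r.
have fl' : \forall h \near (0 : R), N (h *: e + x) <-> 0 < (h *: e + x).2 by exact: cl _ fl.
near=> h; have hh : N (h *: e + x) <-> 0 < (h *: e + x).2 by near: h.
rewrite indic0' ?mul0r// => /hh /=; rewrite e20 /GRing.scale /= mulr0 add0r.
by rewrite ltNge xN.
Unshelve. all: by end_near. Qed.

Lemma coord_csupp (f : pt -> R) r x (y : R) : csupp f r ->
  `|y| <= enorm3 x -> r <= `|y| -> f x = 0.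
Proof. by move=> f0 h1 h2; apply: f0; exact: le_trans h1. Qed.

Lemma L1_term (p' q q' : pt -> R) r : Lloc (fun x => \1_N x * p' x) ->
  continuous q -> continuous q' -> csupp q r -> csupp q' r ->
  L1 mu3 (fun x => \1_N x * (p' x * q x + p x * q' x)).
Proof.
move=> Lp' cq cq' q0 q'0.
have D := L1_D (Lloc_csupp Lp' cq q0) (Lloc_csupp (hs_L H) cq' q'0).
by apply: (@L1_eq _ _ _ mu3 _ _ _ D) => x; rewrite mulrDr !mulrA.
Qed.

Lemma ibp1 (j : jet R) r : isC2 j -> csupp (jf j) r -> adm N flat j ->
  L1 mu3 (fun x => \1_N x * (p1 x * j1 j x + p x * j11 j x)) /\
  J mu3 (fun x => \1_N x * (p1 x * j1 j x + p x * j11 j x)) = 0.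
Proof.
move=> hj hs ha; have [s0 s1 s2 s3] := isC1_csupp hj hs; have [t1 t2 t3] := isC2_csupp hj hs.
have L : L1 mu3 (fun x => \1_N x * (p1 x * j1 j x + p x * j11 j x)).
  by apply: L1_term s1 t1; [exact: hs_L1 H|exact: C1c1 hj|exact: C2c1 hj].
split => //; apply: (J3_derive1 (F := fun x => \1_N x * (p x * j1 j x)) (M := r + 1) L).
  move=> x; refine (flat_derive (e := e1 R) (erefl : (e1 R).2 = 0) (hs_d1 H) (C2d1 hj x) _).
  case: (ha x) => [xN|x0|xf]; [exact: Or31|apply: Or32|exact: Or33].
  split; first by apply: filterS (isC1_near0 hj x0) => y [].
  by case: (isC2_near0 hj x0) => _ _ [].
move=> x rx; have [h1 h2 h3] := co_le_enorm3 x.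
by rewrite (coord_csupp s1 h1 rx) (coord_csupp t1 h1 rx) !mulr0 addr0 mulr0.
Qed.

Lemma ibp2 (j : jet R) r : isC2 j -> csupp (jf j) r -> adm N flat j ->
  L1 mu3 (fun x => \1_N x * (p2 x * j2 j x + p x * j22 j x)) /\
  J mu3 (fun x => \1_N x * (p2 x * j2 j x + p x * j22 j x)) = 0.
Proof.
move=> hj hs ha; have [s0 s1 s2 s3] := isC1_csupp hj hs; have [t1 t2 t3] := isC2_csupp hj hs.
have L : L1 mu3 (fun x => \1_N x * (p2 x * j2 j x + p x * j22 j x)).
  by apply: L1_term s2 t2; [exact: hs_L2 H|exact: C1c2 hj|exact: C2c2 hj].
split => //; apply: (J3_derive2 (F := fun x => \1_N x * (p x * j2 j x)) (M := r + 1) L).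
  move=> x; refine (flat_derive (e := e2 R) (erefl : (e2 R).2 = 0) (hs_d2 H) (C2d2 hj x) _).
  case: (ha x) => [xN|x0|xf]; [exact: Or31|apply: Or32|exact: Or33].
  split; first by apply: filterS (isC1_near0 hj x0) => y [].
  by case: (isC2_near0 hj x0) => _ _ [].
move=> x rx; have [h1 h2 h3] := co_le_enorm3 x.
by rewrite (coord_csupp s2 h2 rx) (coord_csupp t2 h2 rx) !mulr0 addr0 mulr0.
Qed.

Lemma enorm3_le_sum (x : pt) : enorm3 x <= `|x.1.1| + `|x.1.2| + `|x.2|.
Proof.
rewrite enorm3_le ?addr_ge0// /nrm2 -(real_normK (num_real x.1.1)) -(real_normK (num_real x.1.2)) -(real_normK (num_real x.2)).
by have := normr_ge0 x.1.1; have := normr_ge0 x.1.2; have := normr_ge0 x.2; nra.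
Qed.

Lemma ibp3 (j : jet R) r : isC2 j -> csupp (jf j) r ->
  (forall y, j3 j (y, m y) = 0) ->
  L1 mu3 (fun x => \1_N x * (p3 x * j3 j x + p x * j33 j x)) /\
  J mu3 (fun x => \1_N x * (p3 x * j3 j x + p x * j33 j x)) = 0.
Proof.
move=> hj hs h0; have [s0 s1 s2 s3] := isC1_csupp hj hs; have [t1 t2 t3] := isC2_csupp hj hs.
have L : L1 mu3 (fun x => \1_N x * (p3 x * j3 j x + p x * j33 j x)).
  by apply: L1_term s3 t3; [exact: hs_L3 H|exact: C1c3 hj|exact: C2c3 hj].
split => //.
have [M0 hM0] := hg_bound H.
pose M := Num.max (r + 1) M0.
(* Unbounded below, so that on each vertical line over it the indicator is exactly that of t <= M.
   Its part in N is still bounded, because m > -M. Over the remaining base points the test function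
   vanishes on the whole line. *)
pose box : set pt := [set x | [/\ `|x.1.1| <= M, `|x.1.2| <= M & x.2 <= M]].
have mbox : measurable box.
  rewrite (_ : box = ((`[- M, M] `*` `[- M, M]) `*` `]-oo, M])%classic).
    by apply: measurableX; [apply: measurableX|]; exact: measurable_itv.
  apply/seteqP; split => -[[a b] c]; rewrite /box /= !in_itv/= -!ler_norml.
    by case.
  by case=> -[].
apply: (J3_ibp_graph (c := \1_box) (m := m) (M := M)) => //.
- exact: hs_indic1.
- exact: hs_indic0.
- by move=> x /(hg_graph H) xN; apply: (hs_d3 H).
- by move=> x; apply: (C2d3 hj).
- move=> x Mx; have [q1 q2 q3] := co_le_enorm3 x.
  have rx : r + 1 <= `|x.2|.
    by apply: (le_trans _ (ler_norm _)); apply: le_trans Mx; rewrite le_max lexx.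
  by rewrite (coord_csupp s3 q3 rx) (coord_csupp t3 q3 rx).
- apply: (L1_le (mu := mu3) (g := fun x => `|\1_(ball0 (M + M + M + 1)) x * (\1_N x * p3 x)|)).
  + apply: measurable_funM; first exact: measurable_indic mbox.
    exact: Lloc_meas (hs_L3 H).
  + move=> x; have [xN|xN] := ltP (m x.1) x.2; last by rewrite hs_indic0// !(mul0r, mulr0) normr0.
    have [xb|xb] := pselect (box x); last by rewrite (indic0' xb) mul0r normr0.
    rewrite (indic1 xb) (@indic1 _ (ball0 _)) ?mul1r//.
    case: xb => b1 b2 b3; apply: (le_lt_trans (enorm3_le_sum x)).
    have : `|x.2| <= M.
      rewrite ler_norml b3 andbT; have := hM0 x.1; rewrite ltr_norml => /andP[hm _].
      have : M0 <= M by rewrite /M le_max lexx orbT.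
      lra.
    lra.
  + by apply: L1_norm; exact: (hs_L3 H).
- move=> y; have [yM|yM] := pselect (`|y.1| <= M /\ `|y.2| <= M).
    left => t; have [tM|tM] := leP t M.
      by rewrite indic1//; case: yM.
    by rewrite indic0'// => -[_ _ /=]; rewrite leNgt tM.
  right => t; have [q1 q2 q3] := co_le_enorm3 ((y, t) : pt).
  have {}yM : r + 1 <= `|y.1| \/ r + 1 <= `|y.2|.
    have rM : r + 1 <= M by rewrite /M le_max lexx.
    have [h1|h1] := leP `|y.1| M; last by left; apply: (le_trans rM); exact: ltW.
    have [h2|h2] := leP `|y.2| M; last by right; apply: (le_trans rM); exact: ltW.
    by exfalso; apply: yM.
  case: yM => hr.
    by rewrite (coord_csupp s3 q1 hr) (coord_csupp t3 q1 hr).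
  by rewrite (coord_csupp s3 q2 hr) (coord_csupp t3 q2 hr).
Qed.

Lemma dist_alg (i w w1 w2 w3 u u1 u2 u3 u11 u22 u33 : R) :
  i * (w1 * u1 + w * u11) + i * (w2 * u2 + w * u22) + i * (w3 * u3 + w * u33)
  - i * (w1 * u1 + w2 * u2 + w3 * u3 - k ^+ 2 * w * u) =
  i * (w * (u11 + u22 + u33 + k ^+ 2 * u)).
Proof. ring. Qed.

Lemma L1_Wf (j : jet R) r : isC1 j -> csupp (jf j) r ->
  L1 mu3 (fun x => \1_N x * Wf k p p1 p2 p3 j x).
Proof. exact: L1_Wf_of (hs_L H) (hs_L1 H) (hs_L2 H) (hs_L3 H). Qed.

(** The three integrations by parts minus the weak equation. The Neumann condition of p is hidden in
    the weak equation; the boundary term left over is p times the vertical derivative of the test,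
    which the last hypothesis kills. *)
Theorem hs_dist (j : jet R) r : isC2 j -> csupp (jf j) r -> adm N flat j ->
  (forall y, j3 j (y, m y) = 0) ->
  J mu3 (fun x => \1_N x * (p x * (lap j x + k ^+ 2 * jf j x))) = 0.
Proof.
move=> hj hs ha h0.
have [L1' J1] := ibp1 hj hs ha; have [L2' J2] := ibp2 hj hs ha; have [L3' J3] := ibp3 hj hs h0.
have LW := L1_Wf hj hs; have JW := hs_weak H (C2C1 hj) hs ha.
have E : J mu3 (fun x => \1_N x * (p1 x * j1 j x + p x * j11 j x) +
    \1_N x * (p2 x * j2 j x + p x * j22 j x) + \1_N x * (p3 x * j3 j x + p x * j33 j x)
    - \1_N x * Wf k p p1 p2 p3 j x) = 0.
  rewrite (J_B (L1_D (L1_D L1' L2') L3') LW) (J_D (L1_D L1' L2') L3') (J_D L1' L2').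
  by rewrite J1 J2 J3 JW !addr0 subr0.
by rewrite -E; apply: J_eq => x; apply/esym; exact: dist_alg.
Qed.
End Distribution.
End Hsol.

(** * The radial operator and its solutions *)

Section Primitive.
Variable R : realType.
Local Notation mu := (@mu1 R).

Lemma L1_cont_csupp (q : R -> R) a b : continuous q ->
  (forall s, ~ (a <= s <= b) -> q s = 0) -> L1 mu q.
Proof.
move=> cq q0.
have i1 : (@lebesgue_measure R).-integrable `[a, b] (EFin \o q).
  apply: continuous_compact_integrable; first exact: segment_compact.
  exact: continuous_subspaceT.
have := L1_mkcond (mu := mu) (measurable_itv `[a, b]) i1.
apply: L1_eq => s; rewrite indicE; have [|sab] := boolP (s \in _); first by rewrite mul1r.
rewrite q0 ?mul0r ?mulr0// => h; move/negP: sab; apply; apply/mem_set.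
by rewrite /= in_itv.
Qed.

Lemma primitive (q : R -> R) a b : continuous q ->
  (forall s, ~ (a <= s <= b) -> q s = 0) ->
  exists Q : R -> R, (forall s, is_derive s (1 : R) Q (q s)) /\ (forall s, s < a -> Q s = 0).
Proof.
move=> cq q0; have Lq := L1_cont_csupp cq q0.
exists (fun x => \int[@lebesgue_measure R]_(t in [set` `]-oo, x]]) q t); split => s.
  have iq : (@lebesgue_measure R).-integrable [set` `]-oo, s + 1]] (EFin \o q).
    by apply: integrableS Lq => //; exact: measurable_itv.
  have s1 : s < s + 1 by rewrite ltrDl.
  have h := @continuous_FTC1 R q -oo%O s (s + 1) s1 iq.
  have [||d1 d2] := h; [by rewrite ltNyr|exact: cq|].
  by split; [exact: d1|rewrite -derive1E; exact: d2].
move=> sa; rewrite (@eq_Rintegral _ _ _ _ _ (fun=> 0)).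
  by rewrite /Rintegral integral0.
move=> t; rewrite inE /= in_itv /= => ts.
by rewrite q0// => /andP[]; rewrite leNgt (le_lt_trans ts sa).
Qed.

Lemma derive_ge0_le (F f : R -> R) : (forall s, is_derive s (1 : R) F (f s)) ->
  (forall s, 0 <= f s) -> forall a b, a <= b -> F a <= F b.
Proof.
move=> dF f0 a b ab.
have [|c _ E] := @MVT_segment R F f a b ab (fun x _ => dF x).
  apply: continuous_subspaceT => x; exact: (is_derive1_continuous (dF x)).
by rewrite -subr_ge0 E mulr_ge0// subr_ge0.
Qed.

Lemma derive_eq0_cst (F f : R -> R) a b : (forall s, is_derive s (1 : R) F (f s)) ->
  a <= b -> (forall s, a < s < b -> f s = 0) -> F a = F b.
Proof.
move=> dF; rewrite le_eqVlt => /orP[/eqP ->//|ab] f0.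
have [|c] := @MVT R F f a b ab (fun x _ => dF x).
  apply: continuous_subspaceT => x; exact: (is_derive1_continuous (dF x)).
rewrite in_itv /= => cab E; apply/esym/eqP; rewrite -subr_eq0 E f0// mul0r//.
Qed.

Lemma is_derive_quadratic (F : R -> R) (x l C : R) :
  (forall h, `|F (x + h) - F x - l * h| <= C * h ^+ 2) -> is_derive x (1 : R) F l.
Proof.
move=> hF; have C0 : 0 <= C.
  have h1 := hF 1; rewrite expr1n (mulr1 C) in h1; exact: (le_trans (normr_ge0 _) h1).
have c : (fun h : R => h^-1 *: (F (h *: (1 : R) + x) - F x)) @ 0^' --> l.
  apply/cvgrPdist_lt => e e0; have C1 : 0 < C + 1 by rewrite ltr_wpDl.
  have eC : 0 < e / (C + 1) by rewrite divr_gt0.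
  near=> h.
  have h0 : h != 0 by near: h; exact: nbhs_dnbhs_neq.
  have hn : 0 < `|h| by rewrite normr_gt0.
  rewrite /GRing.scale /= mulr1 (addrC h x).
  have E : l - h^-1 * (F (x + h) - F x) = - (h^-1 * (F (x + h) - F x - l * h)).
    by field.
  rewrite E normrN normrM normfV mulrC ltr_pdivrMr//.
  apply: (le_lt_trans (hF h)); rewrite -real_normK ?num_real// expr2 mulrA ltr_pM2r//.
  have hsmall : `|h| < e / (C + 1).
    near: h; apply: dnbhs0_lt; exact: eC.
  move: hsmall; rewrite ltr_pdivlMr// => hs.
  apply: le_lt_trans hs; rewrite mulrC ler_wpM2l//; lra.
split; first by apply/cvg_ex; exists l.
by apply: cvg_lim => //; exact: norm_hausdorff.
Unshelve. all: by end_near. Qed.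

End Primitive.

Section Cutoff.
Variable R : realType.

Lemma cont_csupp_bounded (f : R -> R) a b : continuous f ->
  (forall s, ~ (a <= s <= b) -> f s = 0) -> exists2 C : R, 0 <= C & forall s, `|f s| <= C.
Proof.
move=> cf f0.
have cK : compact `[a, b]%classic by exact: segment_compact.
have := @continuous_compact _ _ f _ (continuous_subspaceT cf) cK.
move=> /compact_bounded[C0 [_ hC]].
have h1 := hC (`|C0| + 1) (ltac:(by rewrite ltr_pwDr// ler_norm)).
exists (`|C0| + 1); first by rewrite addr_ge0.
move=> x; have [xK|xK] := pselect (a <= x <= b).
  by apply: h1; exists x => //=; rewrite in_itv.
by rewrite f0// normr0 addr_ge0.
Qed.

Definition ppart (t : R) : R := Num.max 0 t.

Lemma ppart_cont : continuous ppart.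
Proof.
move=> x; apply/cvgrPdist_lt => e e0; near=> y.
have h : `|x - y| < e by near: y; exact: cvgr_dist_lt (e0).
apply: le_lt_trans h; rewrite /ppart.
have [x0|x0] := leP x 0; have [y0|y0] := leP y 0.
- by rewrite subrr normr0.
- by rewrite sub0r normrN ger0_norm ?(ltW y0)// distrC ger0_norm; lra.
- by rewrite subr0 ger0_norm ?(ltW x0)// ger0_norm; lra.
- by [].
Unshelve. all: by end_near. Qed.

Lemma ppart_sqr_d (t : R) : is_derive t (1 : R) (fun s => ppart s ^+ 2) (2 * ppart t).
Proof.
apply: (@is_derive_quadratic _ _ _ _ 1) => h; rewrite mul1r ler_norml /ppart.
have [x0|x0] := leP t 0; have [y0|y0] := leP (t + h) 0; apply/andP; split; nra.
Qed.

Record cutoff (sg sg1 sg2 : R -> R) : Prop := Cutoff {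
  cut_d : forall s, is_derive s (1 : R) sg (sg1 s);
  cut_d1 : forall s, is_derive s (1 : R) sg1 (sg2 s);
  cut_c2 : continuous sg2;
  cut_0 : forall s, s <= 0 -> sg s = 0;
  cut_1 : forall s, 1 <= s -> sg s = 1;
  cut_01 : forall s, s <= 0 \/ 1 <= s -> sg1 s = 0 /\ sg2 s = 0;
  cut_ge0 : forall s, 0 <= sg1 s;
  cut_bd : exists C : R, forall s, [/\ `|sg s| <= C, `|sg1 s| <= C & `|sg2 s| <= C] }.

(** The normalised primitive of the squared positive part of s (1 - s), which is C^1 and vanishes
    outside [0, 1]. *)
Lemma cutoff_exists : exists sg sg1 sg2, cutoff sg sg1 sg2.
Proof.
pose w (s : R) : R := s * (1 - s).
pose q (s : R) : R := ppart (w s) ^+ 2.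
pose q' (s : R) : R := 2 * ppart (w s) * (1 - 2 * s).
have w0 s : s <= 0 \/ 1 <= s -> ppart (w s) = 0.
  by move=> h; rewrite /ppart /w; apply: max_l; case: h => h; nra.
have dw s : is_derive s (1 : R) w (1 - 2 * s).
  have h1 := is_derive_id s (1 : R).
  have h2 := is_dB (is_dC 1 s (1 : R)) h1.
  by apply: (is_derive_eq (is_dM h1 h2)) => /=; ring.
have dq s : is_derive s (1 : R) q (q' s).
  exact: (is_dcomp (ppart_sqr_d (w s)) (dw s)).
have cw : continuous w by move=> s; exact: is_derive1_continuous (dw s).
have cq : continuous q by move=> s; exact: is_derive1_continuous (dq s).
have cq' : continuous q'.
  apply: cM; first by apply: cM; [exact: cC|apply: ccomp; [exact: ppart_cont|exact: cw]].
  apply: cD; first exact: cC.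
  by apply: cN; apply: cM; [exact: cC|move=> s; exact: cvg_id].
have q0 s : s <= 0 \/ 1 <= s -> q s = 0 by move=> h; rewrite /q w0// expr0n.
have q'0 s : s <= 0 \/ 1 <= s -> q' s = 0 by move=> h; rewrite /q' w0// mulr0 mul0r.
have out (s : R) : ~ (0 <= s <= 1) -> s <= 0 \/ 1 <= s.
  have [h|h] := leP s 0; first by left.
  have [h'|h'] := leP 1 s; first by right.
  by move=> hh; exfalso; apply: hh; rewrite !ltW.
have [Q [dQ Q0]] := primitive cq (fun s h => q0 s (out s h)).
have Qle0 s : s <= 0 -> Q s = 0.
  move=> s0; rewrite -(Q0 (s - 1)); last by lra.
  apply/esym; apply: (derive_eq0_cst dQ); first by lra.
  by move=> t /andP[_ ts]; apply: q0; left; lra.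
have Qge1 s : 1 <= s -> Q s = Q 1.
  move=> s1; apply/esym; apply: (derive_eq0_cst dQ) => //.
  by move=> t /andP[ts _]; apply: q0; right; exact: ltW.
have qge0 s : 0 <= q s by exact: sqr_ge0.
have Qmon := derive_ge0_le dQ qge0.
have Q1 : 0 < Q 1.
  have [|c] := @MVT R Q q 0 1 ltr01 (fun x _ => dQ x).
    apply: continuous_subspaceT => x; exact: (is_derive1_continuous (dQ x)).
  rewrite in_itv /= => /andP[c0 c1]; rewrite (Qle0 0)// !subr0 mulr1 => ->.
  rewrite /q exprn_gt0// /ppart /w.
  have h : 0 < c * (1 - c) by rewrite mulr_gt0// subr_gt0.
  by rewrite max_r// ltW.
have Q1n : Q 1 != 0 by rewrite gt_eqF.
exists (fun s => (Q 1)^-1 * Q s), (fun s => (Q 1)^-1 * q s), (fun s => (Q 1)^-1 * q' s).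
split.
- by move=> s; exact: is_dZ.
- by move=> s; exact: is_dZ.
- by apply: cM; [exact: cC|].
- by move=> s s0; rewrite (Qle0 s s0) mulr0.
- by move=> s s1; rewrite (Qge1 s s1) mulVf.
- by move=> s h; rewrite q0// q'0// !mulr0.
- by move=> s; rewrite mulr_ge0// invr_ge0 ltW.
- have [C1 C10 h1] := cont_csupp_bounded cq (fun s h => q0 s (out s h)).
  have [C2 C20 h2] := cont_csupp_bounded cq' (fun s h => q'0 s (out s h)).
  have i0 : 0 <= (Q 1)^-1 by rewrite invr_ge0 ltW.
  exists ((Q 1)^-1 * (Q 1 + C1 + C2)) => s.
  have hM y : `|(Q 1)^-1 * y| = (Q 1)^-1 * `|y| by rewrite normrM ger0_norm.
  have hQ : `|Q s| <= Q 1.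
    have [s0|s0] := leP s 0; first by rewrite (Qle0 s s0) normr0 ltW.
    have Qs0 : 0 <= Q s by rewrite -(Qle0 0 (lexx _)) Qmon// ltW.
    rewrite ger0_norm//.
    have [s1|s1] := leP 1 s; first by rewrite (Qge1 s s1).
    by rewrite Qmon// ltW.
  by have := h1 s; have := h2 s; split; rewrite hM ler_wpM2l//; lra.
Qed.
End Cutoff.

Section Bessel.
Variables (R : realType) (k : R).
Hypothesis k0 : 0 < k.

(* Functions a(u) cos(k sqrt s) + b(u) sin(k sqrt s) with u = 1 / sqrt s and
   polynomials a, b, on s > 0; [bstep] is their derivative in s. *)
Definition bstep (P : {poly R} * {poly R}) : {poly R} * {poly R} :=
  (- (2^-1)%:P * 'X^3 * P.1^`() + (k / 2)%:P * 'X * P.2,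
   - (2^-1)%:P * 'X^3 * P.2^`() - (k / 2)%:P * 'X * P.1).

Definition bval (P : {poly R} * {poly R}) (s : R) : R :=
  let u := (Num.sqrt s)^-1 in
  P.1.[u] * cos (k * Num.sqrt s) + P.2.[u] * sin (k * Num.sqrt s).

(** The m-th derivative in s of the function coded by P. With P = [Pcos] or [Psin] these play the
    role of spherical Bessel functions, in the variable s = r^2. *)
Definition bes (P : {poly R} * {poly R}) (m : nat) := bval (iter m bstep P).

Lemma is_derive_inv (x : R) : x != 0 -> is_derive x (1 : R) (fun y => y^-1) (- x^-2).
Proof.
move=> x0; have h := @is_deriveV R id x 1 1 x0 (is_derive_id x 1).
by apply: (is_derive_eq h); rewrite /GRing.scale /= mulr1.
Qed.

Lemma bval_d P (s : R) : 0 < s -> is_derive s (1 : R) (bval P) (bval (bstep P) s).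
Proof.
move=> s0; have r0 : Num.sqrt s != 0 by rewrite gt_eqF// sqrtr_gt0.
have dr := is_derive1_sqrt s0.
have du := is_dcomp (is_derive_inv r0) dr.
have d1 := is_dcomp (f := fun y => (Num.sqrt y)^-1) (@is_derive_poly _ P.1 (Num.sqrt s)^-1) du.
have d2 := is_dcomp (f := fun y => (Num.sqrt y)^-1) (@is_derive_poly _ P.2 (Num.sqrt s)^-1) du.
have dk := is_dZ k dr.
have dc := is_dcomp (f := fun y => k * Num.sqrt y) (is_derive_cos (k * Num.sqrt s)) dk.
have ds := is_dcomp (f := fun y => k * Num.sqrt y) (is_derive_sin (k * Num.sqrt s)) dk.
apply: (is_derive_eq (is_dD (is_dM d1 dc) (is_dM d2 ds))).
rewrite /bval /bstep /= !hornerE /=.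
by field; exact: r0.
Qed.

Lemma bes_d P m (s : R) : 0 < s -> is_derive s (1 : R) (bes P m) (bes P m.+1 s).
Proof. by move=> s0; exact: bval_d. Qed.

Definition Pcos : {poly R} * {poly R} := (1, 0).
Definition Psin : {poly R} * {poly R} := (0, 1).

Lemma bes_ode0 P (s : R) : P = Pcos \/ P = Psin -> 0 < s ->
  4 * s * bes P 2 s + 2 * bes P 1 s + k ^+ 2 * bes P 0 s = 0.
Proof.
move=> hP s0; have r0 : Num.sqrt s != 0 by rewrite gt_eqF// sqrtr_gt0.
have sE : s = Num.sqrt s ^+ 2 by rewrite sqr_sqrtr// ltW.
case: hP => ->; rewrite /bes /= /bval /bstep /= !poly.derivE !hornerE /=;
  move: (cos _) (sin _) => c sn; move: sE r0; move: (Num.sqrt s) => r -> r0;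
  by field; exact: r0.
Qed.

(** In s = r^2 the radial Helmholtz operator in dimension D is 4 s g'' + 2 D g' + k^2 g. For D = 1
    it annihilates cos(k r) and sin(k r), and differentiating the equation in s raises D by 2; so
    the m-th derivatives solve it for D = 2 m + 1. *)
Lemma bes_ode P m (s : R) : P = Pcos \/ P = Psin -> 0 < s ->
  4 * s * bes P m.+2 s + (4 * m%:R + 2) * bes P m.+1 s + k ^+ 2 * bes P m s = 0.
Proof.
move=> hP; elim: m s => [|m IH] s s0; first by rewrite mulr0 add0r; exact: bes_ode0.
have d4 := is_dM (is_dZ 4 (is_derive_id s (1 : R))) (bes_d P m.+2 s0).
have d2 := is_dZ (4 * m%:R + 2) (bes_d P m.+1 s0).
have d0 := is_dZ (k ^+ 2) (bes_d P m s0).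
have [_ D] := is_dD (is_dD d4 d2) d0.
have nn : \forall y \near s, 4 * y * bes P m.+2 y + (4 * m%:R + 2) * bes P m.+1 y +
    k ^+ 2 * bes P m y = cst 0 y.
  by near=> y; apply: IH; near: y; exact: lt_nbhsr.
have h := near_eq_derive (1 : R) nn; rewrite D derive_cst in h.
by rewrite -h -natr1; ring.
Unshelve. all: by end_near. Qed.

Definition bY := bes Pcos.
Definition bZ := bes Psin.
Definition bW m s := bY m s * bZ m.+1 s - bY m.+1 s * bZ m s.

(** The equation expresses the derivatives of order m + 2 through lower ones. Their first-derivative
    terms cancel in the Wronskian, and only the k^2 terms remain. Starting from cos^2 + sin^2 = 1
    this gives positivity of every Wronskian. *)
Lemma bW_rec m (s : R) : 0 < s -> bW m.+1 s = k ^+ 2 / (4 * s) * bW m s.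
Proof.
move=> s0; have s00 : s != 0 by rewrite gt_eqF.
have hy := @bes_ode Pcos m s (or_introl erefl) s0.
have hz := @bes_ode Psin m s (or_intror erefl) s0.
rewrite /bW /bY /bZ.
have s4 : 4 * s != 0 by rewrite mulf_neq0// pnatr_eq0.
apply: (mulfI s4); rewrite [RHS]mulrA mulrCA mulfV// mulr1.
apply/eqP; rewrite -subr_eq0; apply/eqP.
rewrite -[RHS](subrr (0 : R)) -{1}(mulr0 (bes Pcos m.+1 s)) -{1}hz.
rewrite -(mulr0 (bes Psin m.+1 s)) -hy; ring.
Qed.

Lemma poly_bounded01 (p : {poly R}) : exists2 C : R, 0 <= C & forall u, 0 <= u <= 1 -> `|p.[u]| <= C.
Proof.
elim/poly_ind: p => [|p c [C C0 hC]].
  by exists 0 => // u _; rewrite horner0 normr0.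
exists (C + `|c|); first by rewrite addr_ge0.
move=> u u01; rewrite !hornerE; apply: (le_trans (ler_normD _ _)); rewrite lerD2r normrM.
have := hC u u01; case/andP: u01 => u0 u1; rewrite (ger0_norm u0) => h.
by apply: le_trans h; rewrite ler_piMr.
Qed.

Lemma bstep_alg1 (S : comNzRingType) (x y p p' n : S) :
  x ^+ 3 * ((n * y) * p + (x * y) * p') = x * (x * y) * ((n * x) * p + x ^+ 2 * p').
Proof. ring. Qed.

Lemma bstep_alg2 (S : comNzRingType) (x y a b u v x3 d : S) : x3 * d = x * y * u ->
  a * x3 * d + b * x * (y * v) = x * y * (a * u + b * v).
Proof. by move=> h; rewrite -mulrA h; ring. Qed.

(** Each derivative in s gains a factor u = 1 / sqrt s, either from the chain rule on cos and sin
    or, with room to spare, from differentiating the polynomial in u. This is the source of the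
    decay in [bes_bound]. *)
Lemma bstep_div P m : exists A B, iter m bstep P = ('X^m * A, 'X^m * B).
Proof.
elim: m => [|m [A [B E]]]; first by exists P.1, P.2; rewrite !expr0 !mul1r; case: P.
have dX (p : {poly R}) : 'X^3 * ('X^m * p)^`() = 'X^(m.+1) * (('X *+ m) * p + 'X^2 * p^`()).
  rewrite derivM derivXn; case: (m) => [|n].
    by rewrite !mulr0n !mul0r !add0r expr0 expr1 mul1r mulrA -exprS.
  rewrite -[n.+1.-1]/n -(mulr_natl 'X^n) -(mulr_natl 'X) (exprS 'X n.+1) (exprS 'X n).
  exact: bstep_alg1.
exists (- (2^-1)%:P * ('X *+ m * A + 'X^2 * A^`()) + (k / 2)%:P * B),
       (- (2^-1)%:P * ('X *+ m * B + 'X^2 * B^`()) + - (k / 2)%:P * A).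
rewrite iterS E /bstep /= (exprS 'X m); congr (_, _).
  by apply: bstep_alg2; rewrite dX exprS.
by rewrite -mulNr -mulNr; apply: bstep_alg2; rewrite dX exprS.
Qed.

Lemma bes_bound P m : exists2 C : R, 0 <= C &
  forall s, 1 <= s -> `|bes P m s| <= C * (Num.sqrt s)^-1 ^+ m.
Proof.
have [A [B E]] := bstep_div P m.
have [C1 C10 h1] := poly_bounded01 A; have [C2 C20 h2] := poly_bounded01 B.
exists (C1 + C2); first exact: addr_ge0.
move=> s s1; rewrite /bes E /bval /= !hornerE /=.
have r1 : 1 <= Num.sqrt s by rewrite -sqrtr1 ler_wsqrtr.
have r0 : 0 < Num.sqrt s by apply: lt_le_trans r1.
have u01 : 0 <= (Num.sqrt s)^-1 <= 1 by rewrite invr_ge0 (ltW r0) invf_le1.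
have a1 := h1 _ u01; have a2 := h2 _ u01.
move: (Num.sqrt s)^-1 u01 a1 a2 => u u01 a1 a2.
have um : 0 <= u ^+ m by apply: exprn_ge0; case/andP: u01.
apply: (le_trans (ler_normD _ _)); rewrite !normrM (ger0_norm um) mulrDl.
have cs (t : R) : `|cos t| <= 1 by rewrite ler_norml cos_geN1 cos_le1.
have sn (t : R) : `|sin t| <= 1 by rewrite ler_norml sin_geN1 sin_le1.
apply: lerD; rewrite -mulrA (mulrC (u ^+ m)); apply: ler_wpM2r => //.
  by rewrite -[C1]mulr1; apply: ler_pM.
by rewrite -[C2]mulr1; apply: ler_pM.
Qed.

End Bessel.

Section ContinuousAt.
Variables (R : realType) (T : topologicalType) (x : T).
Implicit Types f g : T -> R.
Lemma cDp f g : {for x, continuous f} -> {for x, continuous g} ->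
  {for x, continuous (fun y => f y + g y)}.
Proof. by move=> cf cg; apply: cvgD; [exact: cf|exact: cg]. Qed.
Lemma cBp f g : {for x, continuous f} -> {for x, continuous g} ->
  {for x, continuous (fun y => f y - g y)}.
Proof. by move=> cf cg; apply: cvgB; [exact: cf|exact: cg]. Qed.
Lemma cMp f g : {for x, continuous f} -> {for x, continuous g} ->
  {for x, continuous (fun y => f y * g y)}.
Proof. by move=> cf cg; apply: cvgM; [exact: cf|exact: cg]. Qed.
Lemma cVp f : f x != 0 -> {for x, continuous f} -> {for x, continuous (fun y => (f y)^-1)}.
Proof. by move=> f0 cf; apply: cvgV. Qed.
Lemma cCp (c : R) : {for x, continuous (fun _ : T => c)}.
Proof. exact: cvg_cst. Qed.
End ContinuousAt.
Lemma cIp (R : realType) (x : R) : {for x, continuous (fun y : R => y)}.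
Proof. exact: cvg_id. Qed.
Arguments cCp {R T} x c [t] _.
Arguments cIp {R} x [t] _.

(** * The inhomogeneous radial equation *)

Section OdeCut.
Variables (R : realType) (k : R).
Hypothesis k0 : 0 < k.

Record C2R (g g1 g2 : R -> R) : Prop := mkC2R {
  r_d : forall s, is_derive s (1 : R) g (g1 s);
  r_d1 : forall s, is_derive s (1 : R) g1 (g2 s);
  r_c2 : continuous g2 }.

Lemma r_c g g1 g2 : C2R g g1 g2 -> continuous g.
Proof. by move=> h s; exact: is_derive1_continuous (r_d h s). Qed.
Lemma r_c1 g g1 g2 : C2R g g1 g2 -> continuous g1.
Proof. by move=> h s; exact: is_derive1_continuous (r_d1 h s). Qed.

Definition supp (h : R -> R) (a b : R) := forall s, ~ (a <= s <= b) -> h s = 0.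

(* For a harmonic homogeneous polynomial P of degree n, (Lap + k^2) (g(|x|^2) P) =
   (Mop (n + 1) g)(|x|^2) P. *)
Definition Mop (m : nat) (g g1 g2 : R -> R) (s : R) : R :=
  4 * s * g2 s + (4 * m%:R + 2) * g1 s + k ^+ 2 * g s.

Lemma bW0 (s : R) : 0 < s -> bW k 0 s = k / 2 / Num.sqrt s.
Proof.
move=> s0; rewrite /bW /bY /bZ /bes /bval /bstep /= !poly.derivE !hornerE /=.
have := cos2Dsin2 (k * Num.sqrt s); set c := cos _; set sn := sin _ => h.
transitivity (k / 2 / Num.sqrt s * (c ^+ 2 + sn ^+ 2)); first by ring.
by rewrite h mulr1.
Qed.

Lemma bW_gt0 m (s : R) : 0 < s -> 0 < bW k m s.
Proof.
move=> s0; elim: m => [|m IH].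
  by rewrite bW0// divr_gt0 ?sqrtr_gt0// divr_gt0.
by rewrite bW_rec// mulr_gt0// divr_gt0 ?exprn_gt0// mulr_gt0.
Qed.

Lemma bY_d m (s : R) : 0 < s -> is_derive s (1 : R) (bY k m) (bY k m.+1 s).
Proof. exact: bes_d. Qed.
Lemma bZ_d m (s : R) : 0 < s -> is_derive s (1 : R) (bZ k m) (bZ k m.+1 s).
Proof. exact: bes_d. Qed.
Lemma bY_c m (s : R) : 0 < s -> {for s, continuous (bY k m)}.
Proof. by move=> s0; exact: is_derive1_continuous (bY_d m s0). Qed.
Lemma bZ_c m (s : R) : 0 < s -> {for s, continuous (bZ k m)}.
Proof. by move=> s0; exact: is_derive1_continuous (bZ_d m s0). Qed.
Arguments bY_c m {s} _ [t] _.
Arguments bZ_c m {s} _ [t] _.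
Lemma bW_c m (s : R) : 0 < s -> {for s, continuous (bW k m)}.
Proof.
move=> s0; have h := (cBp (cMp (bY_c m s0) (bZ_c m.+1 s0)) (cMp (bY_c m.+1 s0) (bZ_c m s0))).
exact: h.
Qed.

Arguments bW_c m {s} _ [t] _.
Lemma ode_q (f h : R -> R) m a b : (forall s, 0 < s -> {for s, continuous f}) ->
  continuous h -> 0 < a -> supp h a b ->
  continuous (fun s => h s * f s / (4 * s * bW k m s)).
Proof.
move=> cf ch a0 hs s.
have [s0|s0] := ltP 0 s.
  have d0 : 4 * s * bW k m s != 0.
    by rewrite mulf_neq0 ?mulf_neq0 ?gt_eqF//; exact: bW_gt0.
  have cd := cMp (cMp (cCp s (4 : R)) (cIp s)) (bW_c m s0).
  exact (cMp (cMp (ch s) (cf s s0)) (cVp (f := fun y : R => 4 * y * bW k m y) d0 cd)).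
have z t : t < a -> h t * f t / (4 * t * bW k m t) = 0.
  by move=> ta; rewrite hs ?mul0r// => /andP[]; rewrite leNgt ta.
rewrite /continuous_at z; last by apply: le_lt_trans a0.
apply: cvg_near_cst; near=> t; apply: z; near: t.
by apply: lt_nbhsl; apply: le_lt_trans a0.
Unshelve. all: by end_near. Qed.

(* Variation of constants, multiplied by a cutoff [x] vanishing near the singular
   point 0. *)
Lemma ode_cut (m : nat) (h : R -> R) a b (fwd : bool) : 0 < a -> a <= b ->
  continuous h -> supp h a b ->
  exists g g1 : R -> R,
  [/\ if fwd then forall s, s < a -> g s = 0 /\ g1 s = 0
      else forall s, b < s -> g s = 0 /\ g1 s = 0,
      (fwd -> exists2 C : R, 0 <= C & forall s, 1 <= s -> b < s ->
         `|g s| <= C * (Num.sqrt s)^-1 ^+ m /\ `|g1 s| <= C * (Num.sqrt s)^-1 ^+ m.+1) &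
      forall x x1 x2 a0, 0 < a0 -> C2R x x1 x2 ->
        (forall s, s < a0 -> [/\ x s = 0, x1 s = 0 & x2 s = 0]) ->
        exists y1 y2, C2R (fun s => x s * g s) y1 y2 /\
          forall s, Mop m (fun s => x s * g s) y1 y2 s =
            x s * h s + (8 * s * x1 s * g1 s + (4 * s * x2 s + (4 * m%:R + 2) * x1 s) * g s)].
Proof.
move=> a0 ab ch hs.
(* The coefficients of g = Z Q1 - Y Q2 have Q1' = h Y / (4 s W) and Q2' = h Z / (4 s W). Then Z Q1'
   = Y Q2', and the derivatives Z', Y' produce h / (4 s) through the Wronskian W. *)
pose q1 s := h s * bY k m s / (4 * s * bW k m s).
pose q2 s := h s * bZ k m s / (4 * s * bW k m s).
have cq1 : continuous q1 by apply: (ode_q _ ch a0 hs) => s; exact: bY_c.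
have cq2 : continuous q2 by apply: (ode_q _ ch a0 hs) => s; exact: bZ_c.
have sq1 : supp q1 a b by move=> s /hs; rewrite /q1 => ->; rewrite !mul0r.
have sq2 : supp q2 a b by move=> s /hs; rewrite /q2 => ->; rewrite !mul0r.
have [P1 [dP1 P10]] := primitive cq1 sq1.
have [P2 [dP2 P20]] := primitive cq2 sq2.
have cst (P q : R -> R) : (forall s, is_derive s (1 : R) P (q s)) -> supp q a b ->
    forall s, b < s -> P s = P b.
  move=> dP sq s bs; apply/esym; apply: (derive_eq0_cst dP); first exact: ltW.
  by move=> t /andP[bt _]; apply: sq => /andP[_]; rewrite leNgt bt.
(* The constants of integration choose the side on which g vanishes: to the left of a when [fwd]
   holds, to the right of b otherwise. In the first case g is, beyond b, a fixed combination of the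
   homogeneous solutions, hence decays. *)
pose c1 := if fwd then 0 else P1 b.
pose c2 := if fwd then 0 else P2 b.
pose Q1 s := P1 s - c1.
pose Q2 s := P2 s - c2.
have dQ1 s : is_derive s (1 : R) Q1 (q1 s).
  by apply: (is_derive_eq (is_dB (dP1 s) (is_dC c1 s 1))); rewrite subr0.
have dQ2 s : is_derive s (1 : R) Q2 (q2 s).
  by apply: (is_derive_eq (is_dB (dP2 s) (is_dC c2 s 1))); rewrite subr0.
have cQ1 : continuous Q1 by move=> s; exact: is_derive1_continuous (dQ1 s).
have cQ2 : continuous Q2 by move=> s; exact: is_derive1_continuous (dQ2 s).
pose g s := bZ k m s * Q1 s - bY k m s * Q2 s.
pose g1 s := bZ k m.+1 s * Q1 s - bY k m.+1 s * Q2 s.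
pose g2 s := bZ k m.+2 s * Q1 s - bY k m.+2 s * Q2 s + h s / (4 * s).
exists g, g1; split.
- rewrite /g /g1 /Q1 /Q2 /c1 /c2; case: (fwd) => s hsx.
    by rewrite P10// P20// !subr0 !mulr0 subrr.
  by rewrite (cst _ _ dP1 sq1)// (cst _ _ dP2 sq2)// !subrr !mulr0 subrr.
- move=> F.
  have [C1 C10 h1] := bes_bound k (Pcos R) m; have [C2 C20 h2] := bes_bound k (Psin R) m.
  have [C3 C30 h3] := bes_bound k (Pcos R) m.+1; have [C4 C40 h4] := bes_bound k (Psin R) m.+1.
  pose K := `|P1 b| + `|P2 b|.
  have K0 : 0 <= K by rewrite addr_ge0.
  exists ((C1 + C2 + C3 + C4) * K); first by rewrite mulr_ge0// !addr_ge0.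
  move=> s s1 bs; rewrite /g /g1 /Q1 /Q2 /c1 /c2 F !subr0 (cst _ _ dP1 sq1)// (cst _ _ dP2 sq2)//.
  have u0 : 0 <= (Num.sqrt s)^-1 by rewrite invr_ge0 sqrtr_ge0.
  have um : 0 <= (Num.sqrt s)^-1 ^+ m by exact: exprn_ge0.
  have um1 : 0 <= (Num.sqrt s)^-1 ^+ m.+1 by exact: exprn_ge0.
  have := h1 s s1; have := h2 s s1; have := h3 s s1; have := h4 s s1.
  rewrite -/(bY k m) -/(bZ k m) -/(bY k m.+1) -/(bZ k m.+1).
  move: (bY k m s) (bZ k m s) (bY k m.+1 s) (bZ k m.+1 s) um um1.
  move: (_ ^+ m) (_ ^+ m.+1) => U V y z y' z' U0 V0 i4 i3 i2 i1.
  have P1K : `|P1 b| <= K by rewrite lerDl.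
  have P2K : `|P2 b| <= K by rewrite lerDr.
  have bd (D E W p q : R) : 0 <= D -> 0 <= E -> 0 <= W -> `|p| <= D * W -> `|q| <= E * W ->
      `|p * P1 b - q * P2 b| <= (D + E) * K * W.
    move=> D0 E0 W0 hp hq; apply: (le_trans (ler_normB _ _)); rewrite !normrM.
    have -> : (D + E) * K * W = D * W * K + E * W * K by ring.
    by apply: lerD; apply: ler_pM.
  split; [apply: (le_trans (bd C2 C1 U z y _ _ _ _ _))|apply: (le_trans (bd C4 C3 V z' y' _ _ _ _ _))] => //;
    rewrite ler_wpM2r// ler_wpM2r//; lra.
move=> x x1 x2 e0 e00 [dx dx1 cx2] x0.
have cx : continuous x by move=> s; exact: is_derive1_continuous (dx s).
have cx1 : continuous x1 by move=> s; exact: is_derive1_continuous (dx1 s).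
have wr (s : R) : 0 < s -> bZ k m.+1 s * q1 s - bY k m.+1 s * q2 s = h s / (4 * s).
  move=> s0; have W0 := bW_gt0 m s0; rewrite /q1 /q2.
  have Wn : bW k m s != 0 by rewrite gt_eqF.
  have sn : s != 0 by rewrite gt_eqF.
  have -> : bZ k m.+1 s * (h s * bY k m s / (4 * s * bW k m s)) - bY k m.+1 s * (h s * bZ k m s / (4 * s * bW k m s))
    = h s / (4 * s) * ((bY k m s * bZ k m.+1 s - bY k m.+1 s * bZ k m s) / bW k m s) by field; rewrite Wn sn.
  by rewrite -/(bW k m s) divff// mulr1.
have dg (s : R) : 0 < s -> is_derive s (1 : R) g (g1 s).
  move=> s0; have d := is_dB (is_dM (bZ_d m s0) (dQ1 s)) (is_dM (bY_d m s0) (dQ2 s)).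
  apply: (is_derive_eq d); rewrite /g1 /q1 /q2; ring.
have dg1 (s : R) : 0 < s -> is_derive s (1 : R) g1 (g2 s).
  move=> s0; have d := is_dB (is_dM (bZ_d m.+1 s0) (dQ1 s)) (is_dM (bY_d m.+1 s0) (dQ2 s)).
  apply: (is_derive_eq d); rewrite /g2 -(wr s s0); ring.
have cg (s : R) : 0 < s -> {for s, continuous g} by move=> s0; exact: is_derive1_continuous (dg s s0).
have cg1 (s : R) : 0 < s -> {for s, continuous g1} by move=> s0; exact: is_derive1_continuous (dg1 s s0).
have cg2 (s : R) : 0 < s -> {for s, continuous g2}.
  move=> s0; have d0 : 4 * s != 0 by rewrite mulf_neq0// gt_eqF.
  have cd := cMp (cCp s (4 : R)) (cIp s).
  exact (cDp (cBp (cMp (bZ_c m.+2 s0) (cQ1 s)) (cMp (bY_c m.+2 s0) (cQ2 s)))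
     (cMp (ch s) (cVp (f := fun y : R => 4 * y) d0 cd))).
pose y1 s := x1 s * g s + x s * g1 s.
pose y2 s := x2 s * g s + x1 s * g1 s + (x1 s * g1 s + x s * g2 s).
have y1z (s : R) : s < e0 -> y1 s = 0 by move=> /x0[h1 h2 h3]; rewrite /y1 h1 h2 !mul0r addr0.
have y2z (s : R) : s < e0 -> y2 s = 0 by move=> /x0[h1 h2 h3]; rewrite /y2 h1 h2 h3 !mul0r !addr0.
have nearz (s : R) : s <= 0 -> \forall t \near s, t < e0.
  by move=> s0; apply: lt_nbhsl; apply: le_lt_trans e00.
exists y1, y2; split.
  split=> s.
  - have [s0|s0] := ltP 0 s; first exact: is_dM (dx s) (dg s s0).
    rewrite y1z; last by apply: le_lt_trans e00.
    apply: (near_eq_is_derive (f := fun=> (0:R))).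
    by apply: filterS (nearz s s0) => t /x0[-> _ _]; rewrite mul0r.
  - have [s0|s0] := ltP 0 s.
      exact: is_dD (is_dM (dx1 s) (dg s s0)) (is_dM (dx s) (dg1 s s0)).
    rewrite y2z; last by apply: le_lt_trans e00.
    apply: (near_eq_is_derive (f := fun=> (0:R))).
    by apply: filterS (nearz s s0) => t /y1z.
  - have [s0|s0] := ltP 0 s.
      exact (cDp (cDp (cMp (cx2 s) (cg s s0)) (cMp (cx1 s) (cg1 s s0)))
        (cDp (cMp (cx1 s) (cg1 s s0)) (cMp (cx s) (cg2 s s0)))).
    rewrite /continuous_at y2z; last by apply: le_lt_trans e00.
    apply: cvg_near_cst; apply: filterS (nearz s s0) => t /y2z; by [].
move=> s; have [s0|s0] := ltP 0 s; last first.
  have [h1 h2 h3] : [/\ x s = 0, x1 s = 0 & x2 s = 0] by apply: x0; apply: le_lt_trans e00.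
  rewrite /Mop y1z ?y2z ?h1 ?h2 ?h3; try by apply: le_lt_trans e00.
  by ring.
have sn : s != 0 by rewrite gt_eqF.
have oy := bes_ode k m (or_introl (erefl (Pcos R))) s0.
have oz := bes_ode k m (or_intror (erefl (Psin R))) s0.
have hg : 4 * s * g2 s + (4 * m%:R + 2) * g1 s + k ^+ 2 * g s = h s.
  rewrite /g2 /g1 /g /bY /bZ.
  transitivity (Q1 s * (4 * s * bes k (Psin R) m.+2 s + (4 * m%:R + 2) * bes k (Psin R) m.+1 s + k ^+ 2 * bes k (Psin R) m s)
    - Q2 s * (4 * s * bes k (Pcos R) m.+2 s + (4 * m%:R + 2) * bes k (Pcos R) m.+1 s + k ^+ 2 * bes k (Pcos R) m s) + h s).
    by field.
  by rewrite oy oz !mulr0 subr0 add0r.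
by rewrite /Mop -hg /y1 /y2; ring.
Qed.
End OdeCut.

Section CutoffCalculus.
Variable R : realType.

Lemma C2R_affine (g g1 g2 : R -> R) (c d : R) : C2R g g1 g2 ->
  C2R (fun s => g (c * s + d)) (fun s => c * g1 (c * s + d)) (fun s => c * (c * g2 (c * s + d))).
Proof.
move=> h.
have dl (s : R) : is_derive s (1 : R) (fun s => c * s + d) c.
  by apply: (is_derive_eq (is_dD (is_dZ c (is_derive_id s (1:R))) (is_dC d s (1:R)))); rewrite mulr1 addr0.
have key (f f' : R -> R) (s : R) : (forall s, is_derive s (1 : R) f (f' s)) ->
    is_derive s (1 : R) (fun s => f (c * s + d)) (c * f' (c * s + d)).
  move=> df; have := is_dcomp (f := fun s => c * s + d) (df (c * s + d)) (dl s).
  by rewrite mulrC.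
split=> s.
- exact: key (r_d h).
- exact: is_dZ (key _ _ s (r_d1 h)).
- have cl : continuous (fun s : R => c * s + d) by move=> t; exact: is_derive1_continuous (dl t).
  have cg : continuous (fun s : R => g2 (c * s + d)) by exact: (ccomp (f := fun s : R => c * s + d) (r_c2 h) cl).
  exact (cMp (cCp s c) (cMp (cCp s c) (cg s))).
Qed.

Lemma C2R_mul (f f1 f2 g g1 g2 : R -> R) : C2R f f1 f2 -> C2R g g1 g2 ->
  C2R (fun s => f s * g s) (fun s => f1 s * g s + f s * g1 s)
      (fun s => f2 s * g s + f1 s * g1 s + (f1 s * g1 s + f s * g2 s)).
Proof.
move=> hf hg; split=> s.
- exact: is_dM (r_d hf s) (r_d hg s).
- exact: is_dD (is_dM (r_d1 hf s) (r_d hg s)) (is_dM (r_d hf s) (r_d1 hg s)).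
- have c0 := r_c hf; have c1 := r_c1 hf; have c2 := r_c2 hf.
  have d0 := r_c hg; have d1 := r_c1 hg; have d2 := r_c2 hg.
  exact (cDp (cDp (cMp (c2 s) (d0 s)) (cMp (c1 s) (d1 s))) (cDp (cMp (c1 s) (d1 s)) (cMp (c0 s) (d2 s)))).
Qed.

Lemma C2R_1B (f f1 f2 : R -> R) : C2R f f1 f2 ->
  C2R (fun s => 1 - f s) (fun s => - f1 s) (fun s => - f2 s).
Proof.
move=> hf; split=> s.
- by apply: (is_derive_eq (is_dB (is_dC 1 s (1:R)) (r_d hf s))); rewrite sub0r.
- exact: is_dN (r_d1 hf s).
- by apply: cN; exact: r_c2 hf.
Qed.

Lemma cutoff_C2R (sg sg1 sg2 : R -> R) : cutoff sg sg1 sg2 -> C2R sg sg1 sg2.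
Proof. by case=> h1 h2 h3 *; split. Qed.

Lemma step_exists (a b : R) : a < b -> exists x x1 x2 : R -> R,
  [/\ C2R x x1 x2, forall s, s <= a -> [/\ x s = 0, x1 s = 0 & x2 s = 0],
      forall s, b <= s -> [/\ x s = 1, x1 s = 0 & x2 s = 0] &
      forall s, 0 <= x1 s].
Proof.
move=> ab; have [sg [sg1 [sg2 cu]]] := cutoff_exists R.
have ba0 : 0 < b - a by rewrite subr_gt0.
have i0 : 0 < (b - a)^-1 by rewrite invr_gt0.
pose c := (b - a)^-1; pose d := - (a / (b - a)).
have E s : c * s + d = (s - a) / (b - a) by rewrite /c /d; field; rewrite gt_eqF.
exists (fun s => sg (c * s + d)), (fun s => c * sg1 (c * s + d)), (fun s => c * (c * sg2 (c * s + d))).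
split.
- exact: C2R_affine (cutoff_C2R cu).
- move=> s sa; have h : c * s + d <= 0 by rewrite E pmulr_lle0// subr_le0.
  have [h1 h2] := cut_01 cu (or_introl h).
  by rewrite (cut_0 cu h) h1 h2 !mulr0.
- move=> s bs; have h : 1 <= c * s + d by rewrite E ler_pdivlMr// mul1r lerB.
  have [h1 h2] := cut_01 cu (or_intror h).
  by rewrite (cut_1 cu h) h1 h2 !mulr0.
- by move=> s; rewrite mulr_ge0 ?(cut_ge0 cu)// ltW.
Qed.
End CutoffCalculus.

(** * Functionals that annihilate the radial operator *)

Section Vanishing.
Variables (R : realType) (k : R) (m : nat) (T : (R -> R) -> R).
Hypothesis k0 : 0 < k.

Lemma T_ext (f g : R -> R) : f =1 g -> T f = T g.
Proof. by move=> fg; congr T; apply/funext. Qed.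

Lemma supp_le (h : R -> R) a b a' b' : a' <= a -> b <= b' -> supp h a b -> supp h a' b'.
Proof.
move=> aa bb hs s ns; apply: hs => /andP[h1 h2]; apply: ns.
by rewrite (le_trans aa h1) (le_trans h2 bb).
Qed.

(** Solving from the right end makes g vanish beyond b, and cutting g off between rho / 4 and rho /
    2 makes it admissible for T. The commutator error lives where T is already known to vanish, so T
    kills the part of h kept by the cutoff; the rest of h is supported below rho / 2. *)
Lemma T_interior (s1 rho : R) : 0 < rho -> rho <= s1 ->
  (forall g g1 g2 a b, 0 < a -> b < s1 -> C2R g g1 g2 -> supp g a b -> T (Mop k m g g1 g2) = 0) ->
  (forall h1 h2 a b, 0 < a -> b < s1 -> continuous h1 -> continuous h2 ->
     supp h1 a b -> supp h2 a b -> T (fun s => h1 s + h2 s) = T h1 + T h2) ->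
  (forall h a b, 0 < a -> b < rho -> continuous h -> supp h a b -> T h = 0) ->
  forall h a b, 0 < a -> b < s1 -> continuous h -> supp h a b -> T h = 0.
Proof.
move=> rho0 rs TM TD T0 h a b a0 bs ch hs.
have [ba|ab] := ltP b a.
  apply: (T0 h (rho / 4) (rho / 2)) => //; [lra|lra|].
  by move=> s _; apply: hs => /andP[h1 h2]; lra.
have [g [g1 [gz _ gcut]]] := ode_cut k0 m false a0 ab ch hs.
have r42 : rho / 4 < rho / 2 by lra.
have [x [x1 [x2 [cx xl xr xge]]]] := step_exists r42.
have e0 : 0 < rho / 4 by lra.
have xl' s : s < rho / 4 -> [/\ x s = 0, x1 s = 0 & x2 s = 0] by move=> sr; apply: xl; exact: ltW.
have [y1 [y2 [cy yE]]] := gcut x x1 x2 (rho / 4) e0 cx xl'.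
pose psi s := 8 * s * x1 s * g1 s + (4 * s * x2 s + (4 * m%:R + 2) * x1 s) * g s.
pose xh s := x s * h s.
have cxh : continuous xh by apply: cM => //; exact: r_c cx.
have cMop : continuous (Mop k m (fun s => x s * g s) y1 y2).
  have c1 := r_c cy; have c2 := r_c1 cy; have c3 := r_c2 cy.
  apply: cD; first apply: cD; apply: cM => //; try exact: cC.
  by apply: cM; [exact: cC|move=> s; exact: cvg_id].
have cpsi : continuous psi.
  rewrite (_ : psi = fun s => Mop k m (fun s => x s * g s) y1 y2 s - xh s).
    by apply: cD => //; exact: cN.
  by apply/funext => s; rewrite yE /xh addrAC subrr add0r.
have spsi : supp psi (rho / 4) (rho / 2).
  move=> s ns; rewrite /psi.
  have [sr|sr] := leP s (rho / 4).
    by case: (xl s sr) => _ -> ->; ring.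
  have [rs'|rs'] := leP (rho / 2) s; first by case: (xr s rs') => _ -> ->; ring.
  by exfalso; apply: ns; rewrite !ltW.
have Tpsi : T psi = 0 by apply: (T0 _ (rho / 4) (rho / 2)) => //; lra.
pose a' := Num.min (rho / 4) a; pose b' := Num.max b (rho / 2).
have a'0 : 0 < a' by rewrite lt_min e0 a0.
have b's : b' < s1 by rewrite gt_max bs /=; lra.
have sxh : supp xh a' b'.
  move=> s ns; rewrite /xh hs ?mulr0// => /andP[h1 h2]; apply: ns.
  by rewrite ge_min h1 orbT le_max h2.
have spsi' : supp psi a' b' by apply: supp_le spsi; rewrite ?ge_min ?lexx// le_max lexx orbT.
have T1 : T xh + T psi = 0.
  rewrite -(TD xh psi a' b')// -[RHS](TM (fun s => x s * g s) y1 y2 a' b') //.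
    by apply: T_ext => s; rewrite yE.
  move=> s ns; have [sb|sb] := ltP b s; first by rewrite (proj1 (gz s sb)) mulr0.
  have [|sr] := leP s (rho / 4); first by move=> /xl[-> _ _]; rewrite mul0r.
  by exfalso; apply: ns; rewrite ge_min (ltW sr) le_max sb.
pose rest s := (1 - x s) * h s.
have crest : continuous rest.
  by apply: cM => //; apply: cD; [exact: cC|apply: cN; exact: r_c cx].
have srest : supp rest a (rho / 2).
  move=> s ns; rewrite /rest; have [sa|sa] := ltP s a.
    by rewrite hs ?mulr0// leNgt sa.
  have [rs'|rs'] := leP (rho / 2) s; first by case: (xr s rs') => -> _ _; rewrite subrr mul0r.
  by exfalso; apply: ns; rewrite sa ltW.
have Trest : T rest = 0 by apply: (T0 _ a (rho / 2)) => //; lra.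
have -> : T h = T (fun s => xh s + rest s).
  by apply: T_ext => s; rewrite /xh /rest; ring.
rewrite (TD _ _ a' b')//.
  by rewrite Trest addr0; rewrite Tpsi addr0 in T1.
by apply: supp_le srest; rewrite ?ge_min ?lexx ?orbT// le_max lexx orbT.
Qed.

Lemma exterior_alg (nu Cs C i I M : R) : nu != 0 ->
  8 * (2 * nu) * (Cs / nu) * (C * (i * I)) +
    (4 * (2 * nu) * (Cs / nu / nu) + (4 * M + 2) * (Cs / nu)) * (C * I) =
  Cs * C * I * (16 * i + (8 + 4 * M + 2) * nu^-1).
Proof. by move=> h; field. Qed.

(** Solving from the left end makes g vanish below a; beyond b it decays like s^(-m/2) together with
    the corresponding bound for g'. Cutting off over n^2 <= s <= 2 n^2 creates an error of size
    n^(-m-1) there, which T makes arbitrarily small by hypothesis as n grows. *)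
Lemma T_exterior (s0 : R) : 0 < s0 ->
  (forall g g1 g2 a b, s0 < a -> C2R g g1 g2 -> supp g a b -> T (Mop k m g g1 g2) = 0) ->
  (forall h1 h2 a b, s0 < a -> continuous h1 -> continuous h2 ->
     supp h1 a b -> supp h2 a b -> T (fun s => h1 s + h2 s) = T h1 + T h2) ->
  (forall C e : R, 0 < e -> exists N0 : nat, forall n, (N0 <= n)%N -> forall psi : R -> R,
     continuous psi -> supp psi (n%:R ^+ 2) (2 * n%:R ^+ 2) ->
     (forall s, `|psi s| <= C * n%:R^-1 ^+ m.+1) -> `|T psi| <= e) ->
  forall h a b, s0 < a -> continuous h -> supp h a b -> T h = 0.
Proof.
move=> s00 TM TD TS h a b a0 ch hs.
wlog ab : b hs / a <= b.
  move=> H; apply: (H (Num.max a b)); last by rewrite le_max lexx.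
  by apply: supp_le hs; rewrite ?lexx// le_max lexx orbT.
have ap : 0 < a by apply: lt_trans a0.
have [g [g1 [gz gb gcut]]] := ode_cut k0 m true ap ab ch hs.
have {gb}[C C0 gb] := gb isT.
have [sg [sg1 [sg2 cu]]] := cutoff_exists R.
have [Cs hCs] := cut_bd cu.
have Cs0 : 0 <= Cs by case: (hCs 0) => h1 _ _; exact: le_trans h1.
pose e0 := (s0 + a) / 2.
have e0a : e0 < a by rewrite /e0; lra.
have e00 : 0 < e0 by rewrite /e0; lra.
(* This factor serves only to vanish near 0, as [ode_cut] demands; it equals 1 wherever g is nonzero
   and creates no error. *)
have [l [l1 [l2 [cl ll lr _]]]] := step_exists e0a.
apply/eqP; rewrite -normr_le0; apply/ler_addgt0Pr => e egt0; rewrite add0r.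
(* The error terms contribute 16 / n and (8 + 4 m + 2) / n^2, where 1 / n^2 <= 1 / n; 26 is 16 + 8 +
   2. *)
pose C' := Cs * C * (4 * m%:R + 26).
have [N0 hN] := TS C' e egt0.
pose n := (maxn N0 (Num.truncn b).+1).+1.
have nN : (N0 <= n)%N by rewrite /n leqW// leq_maxl.
have n1 : (1 : R) <= n%:R by rewrite ler1n.
have np : (0 : R) < n%:R by apply: lt_le_trans n1.
have nb : b < n%:R.
  apply: (lt_le_trans (truncnS_gt b)); rewrite ler_nat /n.
  by rewrite leqW// leq_maxr.
pose nu : R := n%:R ^+ 2.
have nu1 : 1 <= nu by rewrite /nu exprn_ege1.
have nup : 0 < nu by apply: lt_le_trans nu1.
have bnu : b < nu.
  by apply: (lt_le_trans nb); rewrite /nu expr2 ler_peMr// ltW.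
pose c := nu^-1.
have cp : 0 < c by rewrite invr_gt0.
have cE s : c * s + -1 = s / nu - 1 by rewrite /c mulrC.
(* The outer cutoff, equal to 1 up to nu = n^2 and to 0 from 2 nu on; each of its derivatives costs
   a factor 1 / nu. *)
have cu2 := C2R_1B (C2R_affine c (-1) (cutoff_C2R cu)).
set u := (fun s : R => 1 - _) in cu2; set u1 := (fun s : R => - _) in cu2; set u2 := (fun s : R => - _) in cu2.
have uL s : s <= nu -> [/\ u s = 1, u1 s = 0 & u2 s = 0].
  move=> sn; have hh : c * s + -1 <= 0 by rewrite cE subr_le0 ler_pdivrMr// mul1r.
  have [h1 h2] := cut_01 cu (or_introl hh).
  by rewrite /u /u1 /u2 (cut_0 cu hh) h1 h2 !mulr0 !oppr0 addr0.
have uR s : 2 * nu <= s -> [/\ u s = 0, u1 s = 0 & u2 s = 0].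
  move=> sn; have hh : 1 <= c * s + -1.
    by rewrite cE lerBrDr ler_pdivlMr// -natr1 /=.
  have [h1 h2] := cut_01 cu (or_intror hh).
  by rewrite /u /u1 /u2 (cut_1 cu hh) h1 h2 !mulr0 !oppr0 subrr.
have cx := C2R_mul cl cu2.
set x := (fun s : R => l s * u s) in cx.
set x1 := (fun s : R => _ + _) in cx; set x2 := (fun s : R => _ + _) in cx.
have xl' s : s < e0 -> [/\ x s = 0, x1 s = 0 & x2 s = 0].
  move=> /ltW /ll[h1 h2 h3]; rewrite /x /x1 /x2 h1 h2 h3; split; ring.
have [y1 [y2 [cy yE]]] := gcut x x1 x2 e0 e00 cx xl'.
pose psi s := 8 * s * x1 s * g1 s + (4 * s * x2 s + (4 * m%:R + 2) * x1 s) * g s.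
pose psi' s := 8 * s * u1 s * g1 s + (4 * s * u2 s + (4 * m%:R + 2) * u1 s) * g s.
have psiE s : psi s = psi' s.
  rewrite /psi /psi'; have [sa|sa] := ltP s a.
    by case: (gz s sa) => -> ->; ring.
  have [h1 h2 h3] := lr s sa.
  have -> : x1 s = u1 s by rewrite /x1 h1 h2; ring.
  by have -> : x2 s = u2 s by rewrite /x2 h1 h2 h3; ring.
have cMop : continuous (Mop k m (fun s => x s * g s) y1 y2).
  have c1 := r_c cy; have c2 := r_c1 cy; have c3 := r_c2 cy.
  apply: cD; first apply: cD; apply: cM => //; try exact: cC.
  by apply: cM; [exact: cC|move=> s; exact: cvg_id].
have cxh : continuous (fun s => x s * h s) by apply: cM => //; exact: r_c cx.
have xhE s : x s * h s = h s.
  have [sa|sa] := ltP s a; first by rewrite hs ?mulr0// leNgt sa.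
  have [bs|bs] := ltP b s; first by rewrite hs ?mulr0// => /andP[_]; rewrite leNgt bs.
  have sn : s <= nu by apply: (le_trans bs); exact: ltW.
  by rewrite /x; case: (uL s sn) => -> _ _; case: (lr s sa) => -> _ _; rewrite !mul1r.
have cpsi : continuous psi.
  rewrite (_ : psi = fun s => Mop k m (fun s => x s * g s) y1 y2 s - x s * h s).
    by apply: cD => //; exact: cN.
  by apply/funext => s; rewrite yE addrAC subrr add0r.
have spsi : supp psi (n%:R ^+ 2) (2 * n%:R ^+ 2).
  move=> s ns; rewrite psiE /psi'.
  have [sr|sr] := leP s nu; first by case: (uL s sr) => _ -> ->; ring.
  have [rs'|rs'] := leP (2 * nu) s; first by case: (uR s rs') => _ -> ->; ring.
  by exfalso; apply: ns; rewrite !ltW.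
have bpsi s : `|psi s| <= C' * n%:R^-1 ^+ m.+1.
  have i0 : 0 <= n%:R^-1 :> R by rewrite invr_ge0 ltW.
  have i1 : n%:R^-1 <= 1 :> R by rewrite invf_le1.
  have im : 0 <= n%:R^-1 ^+ m :> R by exact: exprn_ge0.
  have C'0 : 0 <= C' by rewrite /C' mulr_ge0// ?mulr_ge0// addr_ge0// mulr_ge0.
  have [ns|ns] := pselect (nu <= s <= 2 * nu); last first.
    by rewrite spsi// normr0 mulr_ge0// exprn_ge0.
  case/andP: ns => s1 s2.
  have s1' : 1 <= s by apply: le_trans s1.
  have sb : b < s by apply: lt_le_trans s1.
  have sp : 0 < s by apply: lt_le_trans s1'.
  have rs : n%:R <= Num.sqrt s.
    by rewrite -[leLHS](ger0_norm (ltW np)) -sqrtr_sqr ler_wsqrtr.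
  have vi : (Num.sqrt s)^-1 <= n%:R^-1 :> R by rewrite lef_pV2 ?posrE// (lt_le_trans np).
  have v0 : 0 <= (Num.sqrt s)^-1 by rewrite invr_ge0 sqrtr_ge0.
  have [gb1 gb2] := gb s s1' sb.
  have vm j : (Num.sqrt s)^-1 ^+ j <= n%:R^-1 ^+ j :> R by rewrite lerXn2r// ?nnegrE.
  have G : `|g s| <= C * n%:R^-1 ^+ m by apply: (le_trans gb1); rewrite ler_wpM2l.
  have G1 : `|g1 s| <= C * n%:R^-1 ^+ m.+1 by apply: (le_trans gb2); rewrite ler_wpM2l.
  have [_ b1 b2] := hCs (c * s + -1).
  have U1 : `|u1 s| <= Cs / nu by rewrite /u1 normrN normrM gtr0_norm// mulrC ler_wpM2r// ltW.
  have U2 : `|u2 s| <= Cs / nu / nu.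
    rewrite /u2 normrN !normrM gtr0_norm// -/c mulrA mulrC mulrA ler_wpM2r ?(ltW cp)//.
    by rewrite ler_wpM2r// ltW.
  have nuE : nu^-1 = n%:R^-1 * n%:R^-1 by rewrite /nu expr2 invfM.
  have m0 : (0 : R) <= m%:R by [].
  rewrite psiE /psi'.
  have A1 : `|8 * s * u1 s * g1 s| <= 8 * (2 * nu) * (Cs / nu) * (C * n%:R^-1 ^+ m.+1).
    rewrite !normrM (gtr0_norm sp) [`|8|]ger0_norm//.
    apply: ler_pM => //; first by rewrite !mulr_ge0// ltW.
    by apply: ler_pM => //; [rewrite mulr_ge0// ltW|rewrite ler_wpM2l].
  have A2 : `|(4 * s * u2 s + (4 * m%:R + 2) * u1 s) * g s| <=
     (4 * (2 * nu) * (Cs / nu / nu) + (4 * m%:R + 2) * (Cs / nu)) * (C * n%:R^-1 ^+ m).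
    rewrite normrM; apply: ler_pM => //; apply: (le_trans (ler_normD _ _)); rewrite !normrM.
    rewrite (gtr0_norm sp) [`|4|]ger0_norm// [`|4 * _ + _|]ger0_norm ?addr_ge0 ?mulr_ge0//.
    apply: lerD; last by rewrite ler_wpM2l// addr_ge0// mulr_ge0.
    by apply: ler_pM => //; [rewrite mulr_ge0// ltW|rewrite ler_wpM2l].
  apply: (le_trans (ler_normD _ _)); apply: (le_trans (lerD A1 A2)).
  have nun : nu != 0 by rewrite gt_eqF.
  rewrite [leLHS](_ : _ = Cs * C * n%:R^-1 ^+ m * (16 * n%:R^-1 + (8 + 4 * m%:R + 2) * (n%:R^-1 * n%:R^-1))); last first.
    rewrite exprS -nuE; exact: exterior_alg.
  rewrite /C' exprS.
  have X : 0 <= Cs * C * n%:R^-1 ^+ m by rewrite !mulr_ge0.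
  rewrite [leRHS](_ : _ = Cs * C * n%:R^-1 ^+ m * ((4 * m%:R + 26) * n%:R^-1)); last by ring.
  have ii : n%:R^-1 * n%:R^-1 <= n%:R^-1 :> R by rewrite ler_piMl.
  apply: ler_wpM2l => //; move: (n%:R^-1) (m%:R) i0 i1 m0 ii => i M i0 i1 M0 ii.
  have : (8 + 4 * M + 2) * (i * i) <= (8 + 4 * M + 2) * i.
    by rewrite ler_wpM2l// !addr_ge0// mulr_ge0.
  lra.
have Tp := hN n nN psi cpsi spsi bpsi.
pose b' := Num.max b (2 * nu).
have T1 : T h + T psi = 0.
  rewrite -(TD h psi e0 b')//; last 3 first.
  - by rewrite /e0; lra.
  - by apply: supp_le hs; [exact: ltW|rewrite le_max lexx].
  - apply: supp_le spsi; last by rewrite le_max lexx orbT.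
    by apply: (le_trans (ltW e0a)); apply: (le_trans ab); exact: ltW.
  rewrite -[RHS](TM (fun s => x s * g s) y1 y2 e0 b')//.
  - by apply: T_ext => s; rewrite yE xhE.
  - by rewrite /e0; lra.
  - move=> s ns; have [|sr] := ltP s e0; first by move=> /xl'[-> _ _]; rewrite mul0r.
    have [rs'|rs'] := leP (2 * nu) s.
      by rewrite /x; case: (uR s rs') => -> _ _; rewrite mulr0 mul0r.
    by exfalso; apply: ns; rewrite sr le_max (ltW rs') orbT.
have -> : T h = - T psi by apply/eqP; rewrite -addr_eq0 T1.
by rewrite normrN.
Qed.
End Vanishing.

(** * Moments and interior continuation *)

Section RadialJets.
Variable R : realType.
Local Notation pt := (pt R).

Lemma is_d_exprn n (s : R) : is_derive s (1 : R) (fun t : R => t ^+ n) (n%:R * s ^+ n.-1).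
Proof.
elim: n => [|n IH]; first by rewrite mul0r; exact: (is_dC (1 : R) s (1 : R)).
have h := is_dM (is_derive_id s (1 : R)) IH.
rewrite [X in is_derive _ _ X](_ : _ = fun t : R => t * t ^+ n); last first.
  by apply/funext => t; rewrite exprS.
apply: (is_derive_eq h) => /=; case: (n) => [|p] /=; first by rewrite mul0r mulr0 addr0.
by rewrite exprS -!natr1; ring.
Qed.

Lemma C2R_exprn (n : nat) (c : R) : C2R (fun s => (s - c) ^+ n)
  (fun s => n%:R * (s - c) ^+ n.-1) (fun s => n%:R * (n.-1%:R * (s - c) ^+ n.-2)).
Proof.
have key p (s : R) : is_derive s (1 : R) (fun t : R => (t - c) ^+ p) (p%:R * (s - c) ^+ p.-1).
  have d : is_derive s (1 : R) (fun t : R => t - c) 1.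
    by apply: (is_derive_eq (is_dB (is_derive_id s (1:R)) (is_dC c s (1:R)))); rewrite subr0.
  by have := is_dcomp (f := fun t : R => t - c) (is_d_exprn p (s - c)) d; rewrite mulr1.
split=> s; first exact: key.
  exact: is_dZ (key _ s).
have ck p : continuous (fun t : R => (t - c) ^+ p) by move=> t; exact: is_derive1_continuous (key p t).
exact (cMp (cCp s (n%:R : R)) (cMp (cCp s (n.-1%:R : R)) (ck n.-2 s))).
Qed.

Section Separated.
Variables (f f1 f2 g g1 g2 h h1 h2 : R -> R).
Definition jsep : jet R := Jet (fun x => f x.1.1 * g x.1.2 * h x.2)
  (fun x => f1 x.1.1 * g x.1.2 * h x.2) (fun x => f x.1.1 * g1 x.1.2 * h x.2)
  (fun x => f x.1.1 * g x.1.2 * h1 x.2)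
  (fun x => f2 x.1.1 * g x.1.2 * h x.2) (fun x => f x.1.1 * g2 x.1.2 * h x.2)
  (fun x => f x.1.1 * g x.1.2 * h2 x.2).

Lemma isd_mul3 (a b c : pt -> R) (x v : pt) (a' b' c' : R) : is_derive x v a a' ->
  is_derive x v b b' -> is_derive x v c c' ->
  is_derive x v (fun y => a y * b y * c y) (a' * b x * c x + a x * b' * c x + a x * b x * c').
Proof.
by move=> da db dc; apply: (is_derive_eq (is_dM (is_dM da db) dc)); rewrite mulrDl.
Qed.

Lemma isd_co1 (u u' : R -> R) (x v : pt) : (forall s : R, is_derive s (1 : R) u (u' s)) ->
  is_derive x v (fun y : pt => u y.1.1) (u' x.1.1 * v.1.1).
Proof. by move=> du; exact: (is_dcomp (f := @co1 R) (du (co1 x)) (is_d_co1 x v)). Qed.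
Lemma isd_co2 (u u' : R -> R) (x v : pt) : (forall s : R, is_derive s (1 : R) u (u' s)) ->
  is_derive x v (fun y : pt => u y.1.2) (u' x.1.2 * v.1.2).
Proof. by move=> du; exact: (is_dcomp (f := @co2 R) (du (co2 x)) (is_d_co2 x v)). Qed.
Lemma isd_co3 (u u' : R -> R) (x v : pt) : (forall s : R, is_derive s (1 : R) u (u' s)) ->
  is_derive x v (fun y : pt => u y.2) (u' x.2 * v.2).
Proof. by move=> du; exact: (is_dcomp (f := @co3 R) (du (co3 x)) (is_d_co3 x v)). Qed.

Lemma diff_sep (u v w u' v' w' : R -> R) (x : pt) :
  (forall s : R, is_derive s (1 : R) u (u' s)) -> (forall s : R, is_derive s (1 : R) v (v' s)) ->
  (forall s : R, is_derive s (1 : R) w (w' s)) ->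
  differentiable (fun y : pt => u y.1.1 * v y.1.2 * w y.2) x.
Proof.
move=> du dv dw; apply: diffM; first apply: diffM.
- exact: diffcomp (diff_co1 x) (du _).
- exact: diffcomp (diff_co2 x) (dv _).
- exact: diffcomp (diff_co3 x) (dw _).
Qed.

Lemma c_sep (u v w : R -> R) : continuous u -> continuous v -> continuous w ->
  continuous (fun y : pt => u y.1.1 * v y.1.2 * w y.2).
Proof.
move=> cu cv cw; apply: cM; first apply: cM.
- exact: ccomp cu (@c_co1 R).
- exact: ccomp cv (@c_co2 R).
- exact: ccomp cw (@c_co3 R).
Qed.

Lemma isC2_sep : C2R f f1 f2 -> C2R g g1 g2 -> C2R h h1 h2 -> isC2 jsep.
Proof.
move=> F G H.
have cf := r_c F; have cf1 := r_c1 F; have cf2 := r_c2 F.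
have cg := r_c G; have cg1 := r_c1 G; have cg2 := r_c2 G.
have ch := r_c H; have ch1 := r_c1 H; have ch2 := r_c2 H.
have [F0 F1 _] := F; have [G0 G1 _] := G; have [H0 H1 _] := H.
split; first split; try exact: c_sep.
- by move=> x; exact: diff_sep F0 G0 H0.
- move=> x; apply: (is_derive_eq (isd_mul3 (isd_co1 x (e1 R) F0) (isd_co2 x (e1 R) G0) (isd_co3 x (e1 R) H0))).
  by rewrite /= !(mulr0, mul0r, mulr1, addr0).
- move=> x; apply: (is_derive_eq (isd_mul3 (isd_co1 x (e2 R) F0) (isd_co2 x (e2 R) G0) (isd_co3 x (e2 R) H0))).
  by rewrite /= !(mulr0, mul0r, mulr1, addr0, add0r).
- move=> x; apply: (is_derive_eq (isd_mul3 (isd_co1 x (e3 R) F0) (isd_co2 x (e3 R) G0) (isd_co3 x (e3 R) H0))).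
  by rewrite /= !(mulr0, mul0r, mulr1, addr0, add0r).
- move=> x; apply: (is_derive_eq (isd_mul3 (isd_co1 x (e1 R) F1) (isd_co2 x (e1 R) G0) (isd_co3 x (e1 R) H0))).
  by rewrite /= !(mulr0, mul0r, mulr1, addr0).
- move=> x; apply: (is_derive_eq (isd_mul3 (isd_co1 x (e2 R) F0) (isd_co2 x (e2 R) G1) (isd_co3 x (e2 R) H0))).
  by rewrite /= !(mulr0, mul0r, mulr1, addr0, add0r).
- move=> x; apply: (is_derive_eq (isd_mul3 (isd_co1 x (e3 R) F0) (isd_co2 x (e3 R) G0) (isd_co3 x (e3 R) H1))).
  by rewrite /= !(mulr0, mul0r, mulr1, addr0, add0r).
Qed.
End Separated.

Definition mon (c : pt) (i j e : nat) (x : pt) : R :=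
  (x.1.1 - c.1.1) ^+ i * (x.1.2 - c.1.2) ^+ j * (x.2 - c.2) ^+ e.
Definition sqd (c x : pt) : R := (x.1.1 - c.1.1) ^+ 2 + (x.1.2 - c.1.2) ^+ 2 + (x.2 - c.2) ^+ 2.

Definition jmon (c : pt) (i j e : nat) : jet R :=
  jsep (fun s => (s - c.1.1) ^+ i) (fun s => i%:R * (s - c.1.1) ^+ i.-1) (fun s => i%:R * (i.-1%:R * (s - c.1.1) ^+ i.-2))
       (fun s => (s - c.1.2) ^+ j) (fun s => j%:R * (s - c.1.2) ^+ j.-1) (fun s => j%:R * (j.-1%:R * (s - c.1.2) ^+ j.-2))
       (fun s => (s - c.2) ^+ e) (fun s => e%:R * (s - c.2) ^+ e.-1) (fun s => e%:R * (e.-1%:R * (s - c.2) ^+ e.-2)).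

Lemma isC2_mon c i j e : isC2 (jmon c i j e).
Proof. by apply: isC2_sep; exact: C2R_exprn. Qed.

Lemma c_mon c i j e : continuous (mon c i j e).
Proof. exact: C1c (isC2_mon c i j e). Qed.

Section Radial.
Variables (c : pt) (f f1 f2 : R -> R).
Definition jrad : jet R := Jet (fun x => f (sqd c x))
  (fun x => 2 * (x.1.1 - c.1.1) * f1 (sqd c x)) (fun x => 2 * (x.1.2 - c.1.2) * f1 (sqd c x))
  (fun x => 2 * (x.2 - c.2) * f1 (sqd c x))
  (fun x => 2 * f1 (sqd c x) + 2 * (x.1.1 - c.1.1) * (2 * (x.1.1 - c.1.1) * f2 (sqd c x)))
  (fun x => 2 * f1 (sqd c x) + 2 * (x.1.2 - c.1.2) * (2 * (x.1.2 - c.1.2) * f2 (sqd c x)))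
  (fun x => 2 * f1 (sqd c x) + 2 * (x.2 - c.2) * (2 * (x.2 - c.2) * f2 (sqd c x))).

Lemma isd_lin (p : pt -> R) (a b : R) (x v : pt) (l : R) : is_derive x v p l ->
  is_derive x v (fun y => a * (p y - b)) (a * l).
Proof.
by move=> dp; apply: (is_derive_eq (is_dZ a (is_dB dp (is_dC b x v)))); rewrite subr0.
Qed.

Lemma isd_sqd (x v : pt) : is_derive x v (sqd c)
  (2 * (x.1.1 - c.1.1) * v.1.1 + 2 * (x.1.2 - c.1.2) * v.1.2 + 2 * (x.2 - c.2) * v.2).
Proof.
have key (p : pt -> R) (b l : R) : is_derive x v p l -> is_derive x v (fun y => (p y - b) ^+ 2) (2 * (p x - b) * l).
  move=> dp; have d : is_derive x v (fun y => p y - b) l.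
    by apply: (is_derive_eq (is_dB dp (is_dC b x v))); rewrite subr0.
  by have := is_dcomp (f := fun y => p y - b) (is_d_exprn 2 (p x - b)) d; rewrite /= expr1.
exact: (is_dD (is_dD (key _ c.1.1 _ (is_d_co1 x v)) (key _ c.1.2 _ (is_d_co2 x v))) (key _ c.2 _ (is_d_co3 x v))).
Qed.

Lemma c_co_sub (p : pt -> R) b : continuous p -> continuous (fun y => p y - b).
Proof. by move=> cp; apply: cD => //; exact: cC. Qed.
Lemma c_sqd : continuous (sqd c).
Proof.
apply: cD; [apply: cD|]; apply: cX; apply: c_co_sub; [exact: c_co1|exact: c_co2|exact: c_co3].
Qed.

Lemma isC2_rad : C2R f f1 f2 -> isC2 jrad.
Proof.
move=> F; have [F0 F1 cf2] := F; have cf1 := r_c1 F; have cs := c_sqd.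
have k1 : continuous (fun y : pt => 2 * (y.1.1 - c.1.1)).
  by apply: cM; [exact: cC|apply: c_co_sub; exact: c_co1].
have k2 : continuous (fun y : pt => 2 * (y.1.2 - c.1.2)).
  by apply: cM; [exact: cC|apply: c_co_sub; exact: c_co2].
have k3 : continuous (fun y : pt => 2 * (y.2 - c.2)).
  by apply: cM; [exact: cC|apply: c_co_sub; exact: c_co3].
have g1 : continuous (fun y : pt => f1 (sqd c y)) by exact: ccomp.
have g2 : continuous (fun y : pt => f2 (sqd c y)) by exact: ccomp.
split; first split.
- move=> x; apply: (diffcomp _ (F0 _)).
  apply: diffD; [apply: diffD|]; apply: (diffcomp (g := fun t : R => t ^+ 2) _ (is_d_exprn 2 _));
    apply: diffD; try exact: differentiable_cst; [exact: diff_co1|exact: diff_co2|exact: diff_co3].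
- move=> x; apply: (is_derive_eq (is_dcomp (F0 _) (isd_sqd x (e1 R)))).
  by rewrite /= !(mulr0, mulr1, addr0) mulrC.
- move=> x; apply: (is_derive_eq (is_dcomp (F0 _) (isd_sqd x (e2 R)))).
  by rewrite /= !(mulr0, mulr1, addr0, add0r) mulrC.
- move=> x; apply: (is_derive_eq (is_dcomp (F0 _) (isd_sqd x (e3 R)))).
  by rewrite /= !(mulr0, mulr1, addr0, add0r) mulrC.
- exact: cM.
- exact: cM.
- exact: cM.
- move=> x; have d := is_dM (isd_lin 2 c.1.1 (is_d_co1 x (e1 R))) (is_dcomp (F1 _) (isd_sqd x (e1 R))).
  by apply: (is_derive_eq d); rewrite /= !(mulr0, mulr1, addr0, add0r) [f2 _ * _]mulrC.
- move=> x; have d := is_dM (isd_lin 2 c.1.2 (is_d_co2 x (e2 R))) (is_dcomp (F1 _) (isd_sqd x (e2 R))).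
  by apply: (is_derive_eq d); rewrite /= !(mulr0, mulr1, addr0, add0r) [f2 _ * _]mulrC.
- move=> x; have d := is_dM (isd_lin 2 c.2 (is_d_co3 x (e3 R))) (is_dcomp (F1 _) (isd_sqd x (e3 R))).
  by apply: (is_derive_eq d); rewrite /= !(mulr0, mulr1, addr0, add0r) [f2 _ * _]mulrC.
- by apply: cD; [apply: cM => //; exact: cC|apply: cM => //; exact: cM].
- by apply: cD; [apply: cM => //; exact: cC|apply: cM => //; exact: cM].
- by apply: cD; [apply: cM => //; exact: cC|apply: cM => //; exact: cM].
Qed.
End Radial.

Definition jrm c f f1 f2 i j e := jmul (jrad c f f1 f2) (jmon c i j e).

Lemma euler_pow n (a : R) : n%:R * a ^+ n.-1 * a = n%:R * a ^+ n.
Proof. by case: n => [|n]; rewrite ?mul0r// -mulrA -exprSr. Qed.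

Lemma lap_alg (X Y Z g g1 g2 I0 J0 E0 I1 J1 E1 I2 J2 E2 i j e : R) :
  I1 * X = i * I0 -> J1 * Y = j * J0 -> E1 * Z = e * E0 ->
  (2 * g1 + 2 * X * (2 * X * g2)) * (I0 * J0 * E0) + (2 * X * g1) * (I1 * J0 * E0)
    + ((2 * X * g1) * (I1 * J0 * E0) + g * (I2 * J0 * E0)) +
  ((2 * g1 + 2 * Y * (2 * Y * g2)) * (I0 * J0 * E0) + (2 * Y * g1) * (I0 * J1 * E0)
    + ((2 * Y * g1) * (I0 * J1 * E0) + g * (I0 * J2 * E0))) +
  ((2 * g1 + 2 * Z * (2 * Z * g2)) * (I0 * J0 * E0) + (2 * Z * g1) * (I0 * J0 * E1)
    + ((2 * Z * g1) * (I0 * J0 * E1) + g * (I0 * J0 * E2))) =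
  (4 * (X ^+ 2 + Y ^+ 2 + Z ^+ 2) * g2 + (4 * (i + j + e + 1) + 2) * g1) * (I0 * J0 * E0)
  + (g * (I2 * J0 * E0) + g * (I0 * J2 * E0) + g * (I0 * J0 * E2)).
Proof.
move=> h1 h2 h3.
transitivity ((4 * (X ^+ 2 + Y ^+ 2 + Z ^+ 2) * g2 + 6 * g1) * (I0 * J0 * E0)
   + 4 * g1 * ((I1 * X) * J0 * E0 + I0 * (J1 * Y) * E0 + I0 * J0 * (E1 * Z))
   + (g * (I2 * J0 * E0) + g * (I0 * J2 * E0) + g * (I0 * J0 * E2))); first by ring.
by rewrite h1 h2 h3; ring.
Qed.

(** In the Laplacian of a radial function times a monomial, the mixed term is 4 f' times the Euler
    field applied to the monomial, that is 4 deg f' times the monomial. It joins the radial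
    Laplacian in [Mop]. What remains is f times the Laplacian of the monomial, of degree lower by
    two. *)
Lemma lap_jrm (k : R) c f f1 f2 i j e (x : pt) :
  lap (jrm c f f1 f2 i j e) x + k ^+ 2 * jf (jrm c f f1 f2 i j e) x =
  Mop k (i + j + e).+1 f f1 f2 (sqd c x) * mon c i j e x +
  ((i * i.-1)%:R * (f (sqd c x) * mon c i.-2 j e x) +
   (j * j.-1)%:R * (f (sqd c x) * mon c i j.-2 e x) +
   (e * e.-1)%:R * (f (sqd c x) * mon c i j e.-2 x)).
Proof.
rewrite /lap /jrm /Mop; simpl jf; simpl j11; simpl j22; simpl j33.
rewrite (lap_alg _ _ _ _ _ _ (euler_pow i _) (euler_pow j _) (euler_pow e _)).
rewrite /mon -/(sqd c x) -!natr1 !natrD !natrM; set S := sqd c x.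
move: (_ ^+ i) (_ ^+ j) (_ ^+ e) (_ ^+ i.-2) (_ ^+ j.-2) (_ ^+ e.-2) => I J E I2 J2 E2.
by rewrite -/S; ring.
Qed.
End RadialJets.

Section MonomialTests.
Variables (R : realType) (k : R).
Hypothesis k0 : 0 < k.
Local Notation pt := (pt R).
Variables (N flat : set pt) (m : R * R -> R) (p p1 p2 p3 : pt -> R).
Hypothesis H : hsol k N flat m p p1 p2 p3.
Variable c : pt.

Lemma sqd_ge0 (x : pt) : 0 <= sqd c x.
Proof. by rewrite /sqd !addr_ge0// sqr_ge0. Qed.

Lemma sqd_large (b : R) : exists r, forall x : pt, r <= enorm3 x -> b < sqd c x.
Proof.
exists (3 * (1 + `|b|) + (`|c.1.1| + `|c.1.2| + `|c.2|) + 1) => x rx.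
rewrite ltNge; apply/negP => sb.
have key (a d : R) : (a - d) ^+ 2 <= sqd c x -> `|a| <= 1 + `|b| + `|d|.
  move=> h; have h2 : `|a - d| <= 1 + `|b|.
    have h3 : (a - d) ^+ 2 <= `|b| by apply: (le_trans h); apply: (le_trans sb); exact: ler_norm.
    by rewrite -(real_normK (num_real (a - d))) in h3; have := normr_ge0 (a - d); nra.
  by rewrite -[a](subrK d) (le_trans (ler_normD _ _))// lerD2r.
have := enorm3_le_sum x.
have h1 := @key x.1.1 c.1.1; have h2 := @key x.1.2 c.1.2; have h3 := @key x.2 c.2.
have {}h1 := h1 _; have {}h2 := h2 _; have {}h3 := h3 _.
have q1 := sqr_ge0 (x.1.1 - c.1.1); have q2 := sqr_ge0 (x.1.2 - c.1.2); have q3 := sqr_ge0 (x.2 - c.2).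
have {}h1 : `|x.1.1| <= 1 + `|b| + `|c.1.1| by apply: h1; rewrite /sqd; lra.
have {}h2 : `|x.1.2| <= 1 + `|b| + `|c.1.2| by apply: h2; rewrite /sqd; lra.
have {}h3 : `|x.2| <= 1 + `|b| + `|c.2| by apply: h3; rewrite /sqd; lra.
lra.
Qed.

Lemma supp_csupp (h : R -> R) (a b : R) (g : pt -> R) : supp h a b ->
  exists r, csupp (fun x => h (sqd c x) * g x) r.
Proof.
move=> hs; have [r rb] := sqd_large b.
by exists r => x /rb bx; rewrite hs ?mul0r// => /andP[_]; rewrite leNgt bx.
Qed.

Definition Tm i j e (h : R -> R) : R :=
  J mu3 (fun x => \1_N x * (p x * (h (sqd c x) * mon c i j e x))).

Lemma c_sqd_mon (h : R -> R) i j e : continuous h -> continuous (fun x : pt => h (sqd c x) * mon c i j e x).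
Proof. by move=> ch; apply: cM; [exact: ccomp ch (@c_sqd _ c)|exact: c_mon]. Qed.

Lemma L1_Tm (h : R -> R) a b i j e : continuous h -> supp h a b ->
  L1 mu3 (fun x => \1_N x * (p x * (h (sqd c x) * mon c i j e x))).
Proof.
move=> ch hs; have [r hr] := supp_csupp (mon c i j e) hs.
have L := Lloc_csupp (hs_L H) (@c_sqd_mon h i j e ch) hr.
by apply: (@L1_eq _ _ _ mu3 _ _ _ L) => x; rewrite -mulrA.
Qed.

Lemma Tm_add i j e (h1 h2 : R -> R) a b : continuous h1 -> continuous h2 ->
  supp h1 a b -> supp h2 a b ->
  Tm i j e (fun s => h1 s + h2 s) = Tm i j e h1 + Tm i j e h2.
Proof.
move=> c1 c2 s1 s2; rewrite /Tm -(J_D (L1_Tm i j e c1 s1) (L1_Tm i j e c2 s2)).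
by apply: J_eq => x; rewrite mulrDl mulrDr mulrDr.
Qed.

Lemma C2R_supp (f f1 f2 : R -> R) a b : C2R f f1 f2 -> supp f a b -> supp f1 a b /\ supp f2 a b.
Proof.
move=> F fs.
have op s : ~ (a <= s <= b) -> \forall t \near s, ~ (a <= t <= b).
  move=> ns; have [sa|sa] := ltP s a.
    by have := lt_nbhsl sa; apply: filterS => t ta /andP[]; rewrite leNgt ta.
  have [bs|bs] := ltP b s; last by exfalso; apply: ns; rewrite sa.
  by have := lt_nbhsr bs; apply: filterS => t bt /andP[_]; rewrite leNgt bt.
have s1 : supp f1 a b.
  move=> s ns; apply: is_derive_near0 (r_d F s) _.
  by apply: filterS (op s ns) => t /fs.
split=> // s ns; apply: is_derive_near0 (r_d1 F s) _.
by apply: filterS (op s ns) => t /s1.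
Qed.

Lemma c_Mop n f f1 f2 : C2R f f1 f2 -> continuous (Mop k n f f1 f2).
Proof.
move=> F; have c1 := r_c F; have c2 := r_c1 F; have c3 := r_c2 F.
apply: cD; first apply: cD; apply: cM => //; try exact: cC.
by apply: cM; [exact: cC|move=> s; exact: cvg_id].
Qed.

Lemma supp_Mop n f f1 f2 a b : C2R f f1 f2 -> supp f a b -> supp (Mop k n f f1 f2) a b.
Proof.
move=> F fs; have [s1 s2] := C2R_supp F fs; move=> s ns.
by rewrite /Mop fs// s1// s2// !mulr0 !addr0.
Qed.

Lemma Tm_step i j e f f1 f2 a b : C2R f f1 f2 -> supp f a b ->
  adm N flat (jrm c f f1 f2 i j e) ->
  (forall y, j3 (jrm c f f1 f2 i j e) (y, m y) = 0) ->
  Tm i j e (Mop k (i + j + e).+1 f f1 f2) + ((i * i.-1)%:R * Tm i.-2 j e f +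
    (j * j.-1)%:R * Tm i j.-2 e f + (e * e.-1)%:R * Tm i j e.-2 f) = 0.
Proof.
move=> F fs ad g0; have cf := r_c F.
have hj : isC2 (jrm c f f1 f2 i j e) by apply: isC2_mul; [exact: isC2_rad|exact: isC2_mon].
have [r hr] := supp_csupp (mon c i j e) fs.
have {}hr : csupp (jf (jrm c f f1 f2 i j e)) r by exact: hr.
rewrite -[RHS](hs_dist H hj hr ad g0) /Tm.
have LM := L1_Tm i j e (@c_Mop (i + j + e).+1 _ _ _ F) (supp_Mop _ F fs).
have Li := L1_Tm i.-2 j e cf fs.
have Lj := L1_Tm i j.-2 e cf fs.
have Le := L1_Tm i j e.-2 cf fs.
rewrite -(J_Z (i * i.-1)%:R Li) -(J_Z (j * j.-1)%:R Lj) -(J_Z (e * e.-1)%:R Le).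
have Li' := L1_Z (i * i.-1)%:R Li; have Lj' := L1_Z (j * j.-1)%:R Lj.
have Le' := L1_Z (e * e.-1)%:R Le.
rewrite -(J_D Li' Lj') -(J_D (L1_D Li' Lj') Le') -(J_D LM (L1_D (L1_D Li' Lj') Le')).
apply: J_eq => x; rewrite lap_jrm.
move: (Mop _ _ _ _ _ _) (f _) (mon c i j e x) (mon c i.-2 j e x) (mon c i j.-2 e x) (mon c i j e.-2 x) (\1_N x) (p x) => M F0 m0 m1 m2 m3 I P.
move: (_%:R) (_%:R) (_%:R) => A B C.
ring.
Qed.

(** Induction on the total degree: moments of lower degree vanish, so [Tm_step] says that the
    current moment annihilates the radial operator, and the last hypothesis turns this into
    vanishing. [al] restricts the vertical exponent, and so must be stable under lowering it by two;
    [P] restricts where profiles may be supported. *)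
Lemma Tm_induct (al : pred nat) (P : R -> R -> Prop) :
  (forall e, al e.+2 -> al e) ->
  (forall i j e f f1 f2 a b, al e -> P a b -> C2R f f1 f2 -> supp f a b ->
     adm N flat (jrm c f f1 f2 i j e) /\ forall y, j3 (jrm c f f1 f2 i j e) (y, m y) = 0) ->
  (forall i j e, al e -> (forall f f1 f2 a b, P a b -> C2R f f1 f2 -> supp f a b ->
        Tm i j e (Mop k (i + j + e).+1 f f1 f2) = 0) ->
      forall h a b, P a b -> continuous h -> supp h a b -> Tm i j e h = 0) ->
  forall i j e, al e -> forall h a b, P a b -> continuous h -> supp h a b -> Tm i j e h = 0.
Proof.
move=> al2 ok van i j e; move: {2}(i + j + e)%N (leqnn (i + j + e)) => n.
elim: n i j e => [|n IH] i j e len ae; apply: van => // f f1 f2 a b Pab F fs.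
  have [ad g0] := ok i j e _ _ _ _ _ ae Pab F fs.
  have := Tm_step F fs ad g0.
  have [-> -> ->] : [/\ i = 0, j = 0 & e = 0]%N by split; lia.
  by rewrite !mul0r !addr0.
have [ad g0] := ok i j e _ _ _ _ _ ae Pab F fs.
have := Tm_step F fs ad g0; have cf := r_c F.
(* For exponents 0 and 1 the truncated [.-2] does not name a lower degree, but there the factor q (q
   - 1) is 0. *)
have z (q : nat) (t : R) : ((2 <= q)%N -> t = 0) -> (q * q.-1)%:R * t = 0.
  by case: q => [|[|q]] h; rewrite ?mul0r// ?muln0 ?mul0r// h// mulr0.
rewrite (z i); last by move=> i2; apply: (IH _ _ _ _ ae _ a b) => //; lia.
rewrite (z j); last by move=> j2; apply: (IH _ _ _ _ ae _ a b) => //; lia.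
rewrite (z e); first by rewrite !addr0.
move=> e2; apply: (IH _ _ _ _ _ _ a b) => //; first lia.
by apply: al2; case: e e2 ae {len ad g0} => [|[|e]].
Qed.

Lemma near_sqd (P : set R) (x : pt) : (\forall s \near sqd c x, P s) -> \forall y \near x, P (sqd c y).
Proof. by move=> h; exact: (@c_sqd _ c x) _ h. Qed.

Lemma supp_off (f : R -> R) a b (x : pt) : supp f a b -> ~ (a <= sqd c x <= b) ->
  \forall y \near x, f (sqd c y) = 0.
Proof.
move=> fs ns; apply: (near_sqd (P := fun s => f s = 0)).
have [sa|sa] := ltP (sqd c x) a.
  have := lt_nbhsl sa; apply: filterS => t ta; apply: fs => /andP[]; by rewrite leNgt ta.
have [bs|bs] := ltP b (sqd c x); last by exfalso; apply: ns; rewrite sa.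
by have := lt_nbhsr bs; apply: filterS => t bt; apply: fs => /andP[_]; rewrite leNgt bt.
Qed.

Theorem Tm_interior (s1 rho : R) : 0 < rho -> rho <= s1 ->
  (forall x, sqd c x < s1 -> N x) -> (forall x, sqd c x < rho -> p x = 0) ->
  forall i j e h a b, 0 < a -> b < s1 -> continuous h -> supp h a b -> Tm i j e h = 0.
Proof.
move=> rho0 rs inN p0 i j e h a b a0 bs.
apply: (Tm_induct (al := fun=> true) (P := fun a b => 0 < a /\ b < s1)) => //.
- move=> {a0 bs h a b}{}i {}j {}e f f1 f2 a b _ [a0 bs] F fs.
  have off x : ~ N x -> ~ (a <= sqd c x <= b).
    by move=> xN /andP[_ sb]; apply: xN; apply: inN; exact: le_lt_trans bs.
  split.
    move=> x; have [xN|xN] := pselect (N x); [exact: Or31|apply: Or32].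
    by apply: filterS (supp_off fs (off x xN)) => y /= ->; rewrite mul0r.
  move=> y; have xN : ~ N (y, m y) by move/(hg_graph H); rewrite ltxx.
  have [s1' _] := C2R_supp F fs.
  by rewrite /= (fs _ (off _ xN)) (s1' _ (off _ xN)) mulr0 !mul0r addr0.
- move=> {a0 bs h a b}{}i {}j {}e _ TM h a b [a0 bs].
  apply: (T_interior k0 (m := (i + j + e).+1) rho0 rs _ _ _ a0 bs).
  + by move=> g g1 g2 a' b' a'0 b's C s'; apply: (TM _ _ _ a' b').
  + by move=> h1 h2 a' b' _ _ c1 c2 s1' s2'; apply: (Tm_add _ _ _ c1 c2 s1' s2').
  + move=> g a' b' a'0 b'r cg sg.
    rewrite /Tm -[RHS](J_0 (@mu3 R)); apply: J_eq => x.
    have [sx|sx] := ltP (sqd c x) rho; first by rewrite p0// mul0r mulr0.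
    rewrite sg; first by rewrite mul0r !mulr0.
    by case/andP=> _; rewrite leNgt (lt_le_trans b'r sx).
Qed.
End MonomialTests.

(** * Polynomials concentrating at a point *)

Section Landau.
Variable R : realType.
Local Notation pt := (pt R).

Definition boxn (y : pt) (r : R) : set pt := [set x |
  [/\ `|x.1.1 - y.1.1| <= r, `|x.1.2 - y.1.2| <= r & `|x.2 - y.2| <= r]].

Lemma near_boxn (y : pt) (P : set pt) : (\forall x \near y, P x) ->
  exists2 r : R, 0 < r & boxn y r `<=` P.
Proof.
move=> /nbhs_ballP[e /= e0 eP]; exists (e / 2); first by rewrite divr_gt0.
move=> x [h1 h2 h3]; apply: eP; split; first split; rewrite /ball /= distrC;
  apply: le_lt_trans (_ : e / 2 < e) => //; lra.
Qed.

Lemma boxnE (y : pt) (r : R) : boxn y r =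
  ((`[y.1.1 - r, y.1.1 + r] `*` `[y.1.2 - r, y.1.2 + r]) `*` `[y.2 - r, y.2 + r])%classic.
Proof.
apply/seteqP; split => x; rewrite /boxn /= !in_itv /= !ler_distl.
  by case.
by case=> -[].
Qed.

Lemma meas_boxn (y : pt) (r : R) : measurable (boxn y r).
Proof. by rewrite boxnE; apply: measurableX; [apply: measurableX|]; exact: measurable_itv. Qed.

Lemma mu3_boxn (y : pt) (r : R) : 0 <= r -> mu3 (boxn y r) = ((2 * r) ^+ 3)%:E.
Proof.
move=> r0; rewrite boxnE.
have mi (a : R) : measurable (`[a - r, a + r]%classic : set R) by exact: measurable_itv.
have mB : measurable ((`[y.1.1 - r, y.1.1 + r] `*` `[y.1.2 - r, y.1.2 + r])%classic : set (R * R)).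
  exact: measurableX.
rewrite /mu3 /= product_measure1E// /mu2 /= product_measure1E//.
have E (a : R) : mu1 `[a - r, a + r]%classic = (2 * r)%:E.
  by rewrite mu_itv; [congr EFin; ring|lra].
transitivity ((2 * r)%:E * (2 * r)%:E * (2 * r)%:E)%E; last by rewrite -!EFinM; congr EFin; ring.
by congr (_ * _ * _)%E; exact: E.
Qed.

Lemma geometric_absurd (K C a b : R) : 0 < K -> 0 < a -> a < b ->
  (forall j, K * b ^+ j <= a ^+ j * C) -> False.
Proof.
move=> K0 a0 ab Kj; have b0 : 0 < b by exact: lt_trans ab.
have z1 : `|a / b| < 1 by rewrite ger0_norm ?divr_ge0 ?(ltW a0) ?(ltW b0)// ltr_pdivrMr// mul1r.
have cz : (fun j => (a / b) ^+ j * C) @ \oo --> 0 * C.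
  by apply: cvgM; [exact: cvg_expr|exact: cvg_cst].
rewrite mul0r in cz; move/cvgrPdist_lt/(_ K K0): cz => -[n _ /(_ n (leqnn n))] /=.
rewrite sub0r normrN => h; have := Kj n; rewrite -ler_pdivlMr ?exprn_gt0// => h'.
have := le_lt_trans (ler_norm _) h; rewrite expr_div_n mulrAC; lra.
Qed.

(* Landau's argument: the powers [q ^+ j] concentrate at [y]. *)
Lemma landau (v q : pt -> R) (y : pt) : L1 mu3 v ->
  (forall j, L1 mu3 (fun x => v x * q x ^+ j)) ->
  (forall j, J mu3 (fun x => v x * q x ^+ j) = 0) ->
  (forall x, v x != 0 -> 0 <= q x <= 1) -> q y = 1 -> {for y, continuous q} ->
  {for y, continuous v} ->
  (forall r, 0 < r -> exists2 th, 0 < th < 1 & forall x, v x != 0 -> th < q x -> boxn y r x) ->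
  v y = 0.
Proof.
wlog vy : v / 0 <= v y.
  move=> W Lv Lj Jj q01 qy cq cv pk; have [h|h] := leP 0 (v y); first exact: (W v).
  apply/eqP; rewrite -oppr_eq0; apply/eqP; apply: (W (fun x => - v x)) => //.
  - by rewrite oppr_ge0 ltW.
  - exact: L1_N.
  - by move=> j; apply: (@L1_eq _ _ _ mu3 _ _ _ (L1_N (Lj j))) => x; rewrite mulNr.
  - move=> j; rewrite -[RHS]oppr0 -(Jj j) -(J_N (Lj j)); apply: J_eq => x; by rewrite mulNr.
  - by move=> x; rewrite oppr_eq0; exact: q01.
  - exact: cvgN.
  - by move=> r /pk[th t01 h']; exists th => // x; rewrite oppr_eq0; exact: h'.
move=> Lv Lj Jj q01 qy cq cv pk; apply/eqP; rewrite eq_le vy andbT leNgt; apply/negP => v0.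
have [r r0 rP] : exists2 r : R, 0 < r & boxn y r `<=` [set x | v y / 2 < v x].
  apply: near_boxn; have := cv; move/cvgrPdist_lt => /(_ (v y / 2)).
  rewrite divr_gt0// => /(_ isT); apply: filterS => x /=; rewrite ltr_distlC => /andP[h _]; lra.
have [th /andP[th0 th1] thP] := pk r r0.
(* Between the bound th for q away from y and the value q y = 1, so that (th / t1)^j tends to 0. *)
pose t1 := (th + 1) / 2.
have t1th : th < t1 by rewrite /t1; lra.
have t11 : t1 < 1 by rewrite /t1; lra.
have t10 : 0 < t1 by exact: lt_trans t1th.
have [r' r'0 r'P] : exists2 r' : R, 0 < r' & boxn y r' `<=` [set x | t1 < q x].
  apply: near_boxn; have := cq; move/cvgrPdist_lt => /(_ (1 - t1)); rewrite subr_gt0 => /(_ t11).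
  by apply: filterS => x /=; rewrite qy ltr_distlC => /andP[h _]; lra.
pose s := Num.min r r'; have s0 : 0 < s by rewrite lt_min r0.
have sb x : boxn y s x -> v y / 2 < v x /\ t1 < q x.
  case=> h1 h2 h3; move: h1 h2 h3; rewrite !le_min => /andP[a1 b1] /andP[a2 b2] /andP[a3 b3].
  by split; [exact: rP|exact: r'P].
have mB := meas_boxn y s; have fB : (mu3 (boxn y s) < +oo)%E by rewrite mu3_boxn ?ltry// ltW.
have LB := L1_indic (mu := mu3) mB fB.
have JB : J mu3 \1_(boxn y s) = (2 * s) ^+ 3.
  by apply: (etrans (J_indic mu3 mB)); exact: (congr1 fine (mu3_boxn y (ltW s0))).
have Lnv := L1_norm Lv.
pose K := v y / 2 * (2 * s) ^+ 3.
have K0 : 0 < K by rewrite mulr_gt0 ?divr_gt0// exprn_gt0// mulr_gt0.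
(* On the small box v q^j is at least t1^j times v y / 2. Elsewhere it is at least -th^j |v|: either
   q <= th, or the point lies in the larger box, where v is positive. The total integral is 0, which
   forces this inequality for every j and contradicts th < t1. *)
have Kj j : K * t1 ^+ j <= th ^+ j * J mu3 (fun x => `|v x|).
  have L' := L1_Z (v y / 2 * t1 ^+ j) LB; have L'' := L1_Z (th ^+ j) Lnv.
  have -> : K * t1 ^+ j = J mu3 (fun x => v y / 2 * t1 ^+ j * \1_(boxn y s) x).
    transitivity (v y / 2 * t1 ^+ j * (2 * s) ^+ 3); first by rewrite /K; ring.
    by apply/esym; apply: (etrans (J_Z _ LB)); congr (_ * _); exact: JB.
  rewrite -(J_Z _ Lnv) -subr_le0 -(J_B L' L'') -(Jj j).
  apply: (J_le (mu := mu3)) (L1_B L' L'') (Lj j) _ => x.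
  have i01 := indic01 (boxn y s) x.
  have [vx|vx] := eqVneq (v x) 0.
    rewrite vx normr0 mul0r mulr0 subr0; have [xb|xb] := pselect (boxn y s x).
      by have [] := sb x xb; rewrite vx; lra.
    by rewrite indic0'// mulr0.
  have /andP[q0 q1] := q01 x vx.
  have tj0 : 0 <= t1 ^+ j by rewrite exprn_ge0// ltW.
  have thj0 : 0 <= th ^+ j by rewrite exprn_ge0// ltW.
  have [xb|xb] := pselect (boxn y s x).
    have [h1 h2] := sb x xb; rewrite indic1// mulr1.
    have h3 : t1 ^+ j <= q x ^+ j by apply: lerXn2r; rewrite ?nnegrE//; exact: ltW.
    have h4 : 0 <= th ^+ j * `|v x| by exact: mulr_ge0.
    have h5 : v y / 2 * t1 ^+ j <= v x * q x ^+ j.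
      by apply: ler_pM => //; [rewrite divr_ge0|exact: ltW].
    lra.
  rewrite indic0'// mulr0 sub0r.
  have [qth|qth] := leP (q x) th.
    have h3 : q x ^+ j <= th ^+ j by apply: lerXn2r; rewrite ?nnegrE//; exact: ltW.
    have h4 : 0 <= q x ^+ j by exact: exprn_ge0.
    have h5 := ler_norm (- v x); rewrite normrN in h5.
    have h6 : `|v x| * q x ^+ j <= `|v x| * th ^+ j by rewrite ler_wpM2l.
    nra.
  have [h1 _ _] : [/\ v y / 2 < v x, True & True] by split => //; apply: rP; exact: thP.
  have h4 : 0 <= th ^+ j * `|v x| by exact: mulr_ge0.
  have h5 : 0 <= v x * q x ^+ j by rewrite mulr_ge0 ?exprn_ge0//; lra.
  lra.
exact: geometric_absurd K0 th0 t1th Kj.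
Qed.

Section Polynomials.
Variable c : pt.

(** [al] limits the exponents of the vertical coordinate, because in the exterior only the moments
    of even vertical degree are known to vanish. *)
Inductive polf (al : pred nat) : (pt -> R) -> Prop :=
| pol_mon i j e : al e -> polf al (mon c i j e)
| pol_add P Q : polf al P -> polf al Q -> polf al (fun x => P x + Q x)
| pol_scale a P : polf al P -> polf al (fun x => a * P x).

Lemma pol_eq al (P Q : pt -> R) : P =1 Q -> polf al P -> polf al Q.
Proof. by move=> /funext ->. Qed.

Lemma pol_mul (al : pred nat) P Q : (forall e e', al e -> al e' -> al (e + e')%N) ->
  polf al P -> polf al Q -> polf al (fun x => P x * Q x).
Proof.
move=> ald hP; elim=> [i j e ae|Q1 Q2 _ h1 _ h2|a Q1 _ h].
- elim: hP => [i' j' e' ae'|P1 P2 _ h1 _ h2|a P1 _ h1].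
  + apply: (pol_eq (P := mon c (i' + i) (j' + j) (e' + e))); last by apply: pol_mon; exact: ald.
    by move=> x; rewrite /mon !exprD; ring.
  + by apply: pol_eq (pol_add h1 h2) => x; rewrite mulrDl.
  + by apply: pol_eq (pol_scale a h1) => x; rewrite mulrA.
- by apply: pol_eq (pol_add h1 h2) => x; rewrite mulrDr.
- by apply: pol_eq (pol_scale a h) => x; rewrite mulrCA.
Qed.

Lemma pol_cst (al : pred nat) a : al 0%N -> polf al (fun=> a).
Proof.
move=> a0; apply: pol_eq (pol_scale a (pol_mon 0 0 a0)) => x.
by rewrite /mon !expr0 !mulr1.
Qed.

Lemma pol_exp (al : pred nat) P n : al 0%N -> (forall e e', al e -> al e' -> al (e + e')%N) ->
  polf al P -> polf al (fun x => P x ^+ n).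
Proof.
move=> a0 ald hP; elim: n => [|n IH]; first by apply: pol_eq (pol_cst 1 a0) => x; rewrite expr0.
by apply: pol_eq (pol_mul ald hP IH) => x; rewrite exprS.
Qed.

Lemma pol_cont al P : polf al P -> continuous P.
Proof.
elim=> [i j e _|P1 P2 _ h1 _ h2|a P1 _ h]; [exact: c_mon|exact: cD|].
by apply: cM => //; exact: cC.
Qed.

Variables (k : R) (N flat : set pt) (m : R * R -> R) (p p1 p2 p3 : pt -> R).
Hypothesis H : hsol k N flat m p p1 p2 p3.

Lemma pol_vanish (al : pred nat) (h : R -> R) a b P : continuous h -> supp h a b ->
  (forall i j e, al e -> Tm N p c i j e h = 0) -> polf al P ->
  L1 mu3 (fun x => \1_N x * p x * h (sqd c x) * P x) /\
  J mu3 (fun x => \1_N x * p x * h (sqd c x) * P x) = 0.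
Proof.
move=> ch hs T0 hP; have L Q : polf al Q -> L1 mu3 (fun x => \1_N x * p x * h (sqd c x) * Q x).
  move=> hQ; have [r hr] := supp_csupp c Q hs.
  have cQ : continuous (fun x => h (sqd c x) * Q x).
    by apply: cM; [exact: ccomp ch (@c_sqd _ c)|exact: pol_cont hQ].
  have L := Lloc_csupp (hs_L H) cQ hr.
  by apply: (@L1_eq _ _ _ mu3 _ _ _ L) => x; rewrite mulrA.
split; first exact: L.
elim: hP => [i j e ae|P1 P2 q1 h1 q2 h2|a' P1 q1 h1].
- by rewrite -[RHS](T0 i j e ae); apply: J_eq => x; rewrite -!mulrA.
- have <- : J mu3 (fun x => \1_N x * p x * h (sqd c x) * P1 x) +
           J mu3 (fun x => \1_N x * p x * h (sqd c x) * P2 x) = 0 by rewrite h1 h2 addr0.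
  rewrite -(J_D (L _ q1) (L _ q2)); by apply: J_eq => x; rewrite mulrDr.
- have <- : a' * J mu3 (fun x => \1_N x * p x * h (sqd c x) * P1 x) = 0 by rewrite h1 mulr0.
  by rewrite -(J_Z _ (L _ q1)); apply: J_eq => x; rewrite mulrCA.
Qed.

Lemma bump_exists (a s b : R) : a < s < b -> exists h : R -> R,
  [/\ continuous h, supp h a b & 0 < h s].
Proof.
move=> /andP[sa bs]; pose e := Num.min (s - a) (b - s).
have e0 : 0 < e by rewrite lt_min !subr_gt0 sa.
exists (fun t => ppart (e ^+ 2 - (t - s) ^+ 2)); split.
- apply: ccomp; first exact: ppart_cont.
  apply: cD; first exact: cC.
  by apply: cN; apply: cX; apply: cD; [move=> t; exact: cvg_id|exact: cC].
- move=> t ns; apply/eqP; rewrite /ppart; apply/eqP/max_idPl; rewrite subr_le0.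
  have ea : e <= s - a by rewrite /e ge_min lexx.
  have eb : e <= b - s by rewrite /e ge_min lexx orbT.
  have [ta|ta] := ltP t a; first by nra.
  have [bt|bt] := ltP b t; first by nra.
  by exfalso; apply: ns; rewrite ta.
- by rewrite subrr expr0n /= subr0 /ppart lt_max exprn_gt0 ?orbT.
Qed.
End Polynomials.

Section Interior.
Variables (k : R) (N flat : set pt) (m : R * R -> R) (p p1 p2 p3 : pt -> R).
Hypothesis k0 : 0 < k.
Hypothesis H : hsol k N flat m p p1 p2 p3.

Lemma landau_pol (al : pred nat) (c y : pt) (h : R -> R) (a b : R) (q : pt -> R) :
  al 0%N -> (forall e e', al e -> al e' -> al (e + e')%N) ->
  continuous h -> supp h a b -> (forall i j e, al e -> Tm N p c i j e h = 0) ->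
  polf c al q -> N y -> 0 < h (sqd c y) -> q y = 1 ->
  (forall x, N x -> h (sqd c x) != 0 -> 0 <= q x <= 1) ->
  (forall r, 0 < r -> exists2 th, 0 < th < 1 & forall x, N x -> h (sqd c x) != 0 -> th < q x -> boxn y r x) ->
  p y = 0.
Proof.
move=> a0 ald ch hs T0 hq Ny hy qy q01 pk.
pose v x := \1_N x * p x * h (sqd c x).
have vn0 x : v x != 0 -> N x /\ h (sqd c x) != 0.
  move=> vx; split.
    by apply: contrapT => xN; move: vx; rewrite /v indic0'// !mul0r eqxx.
  by apply: contraNneq vx; rewrite /v => ->; rewrite mulr0.
have V j := pol_vanish H ch hs T0 (pol_exp j a0 ald hq).
have cp := hs_c H Ny.
have cv : {for y, continuous v}.
  have nN : \forall x \near y, N x by apply: open_nbhs_nbhs; split => //; exact: hg_open H.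
  have chs : continuous (fun x : pt => h (sqd c x)) by exact: ccomp ch (@c_sqd _ c).
  have c1 := cMp cp (chs y).
  have vy : v y = p y * h (sqd c y) by rewrite /v indic1// mul1r.
  rewrite /prop_for /continuous_at vy; apply: cvg_trans c1; apply: near_eq_cvg.
  by apply: filterS nN => x Nx; rewrite /v indic1// mul1r.
have vy0 : v y = 0.
  apply: (@landau v q y) => //.
  - by have [L _] := V 0%N; apply: (@L1_eq _ _ _ mu3 _ _ _ L) => x; rewrite expr0 mulr1.
  - by move=> j; case: (V j).
  - by move=> j; case: (V j).
  - by move=> x /vn0[]; exact: q01.
  - exact: pol_cont hq y.
  - by move=> r /pk[th t01 h']; exists th => // x /vn0[]; exact: h'.
by apply/eqP; move/eqP: vy0; rewrite /v indic1// mul1r mulf_eq0 (gt_eqF hy) orbF.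
Qed.

Theorem interior_continuation (c : pt) (s1 rho : R) : 0 < rho -> rho <= s1 ->
  (forall x, sqd c x < s1 -> N x) -> (forall x, sqd c x < rho -> p x = 0) ->
  forall x, sqd c x < s1 -> p x = 0.
Proof.
move=> rho0 rs inN p0 y ys.
have [yr|ry] := ltP (sqd c y) rho; first exact: p0.
have ab : rho / 2 < sqd c y < (sqd c y + s1) / 2 by apply/andP; split; lra.
have [h [ch hs hy]] := bump_exists ab.
have bs1 : (sqd c y + s1) / 2 < s1 by lra.
have a0 : 0 < rho / 2 by lra.
have T0 i j e : Tm N p c i j e h = 0.
  exact: (Tm_interior k0 H rho0 rs inN p0 _ _ _ a0 bs1 ch hs).
(* From |x - y|^2 <= 2 |x - c|^2 + 2 |y - c|^2, this bounds |x - y|^2 on the support of the profile,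
   so that 1 - |x - y|^2 / M lies in [0, 1] there. *)
pose M := 2 * s1 + 2 * sqd c y + 1.
have M0 : 0 < M by rewrite /M; lra.
have supN x : h (sqd c x) != 0 -> sqd c x < s1.
  move=> hx; apply: contraNT hx; rewrite -leNgt => sx; apply/eqP; apply: hs => /andP[_]; lra.
have sM x : h (sqd c x) != 0 -> sqd y x <= M.
  move=> /supN sx; have : sqd y x <= 2 * sqd c x + 2 * sqd c y.
    rewrite /sqd; have q1 := sqr_ge0 ((x.1.1 - c.1.1) + (y.1.1 - c.1.1)).
    have q2 := sqr_ge0 ((x.1.2 - c.1.2) + (y.1.2 - c.1.2)).
    have q3 := sqr_ge0 ((x.2 - c.2) + (y.2 - c.2)).
    move: (x.1.1) (x.1.2) (x.2) (y.1.1) (y.1.2) (y.2) (c.1.1) (c.1.2) (c.2) q1 q2 q3 => *; nra.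
  by rewrite /M; lra.
pose q x := 1 - sqd y x / M.
apply: (@landau_pol (fun=> true) c y h (rho / 2) ((sqd c y + s1) / 2) q) => //.
- have sq1 : polf c (fun=> true) (fun x : pt => (x.1.1 - y.1.1) ^+ 2).
    apply: pol_eq (pol_exp (P := fun x : pt => x.1.1 - y.1.1) 2 _ _ _) => //.
    apply: pol_eq (pol_add (pol_mon c (al := fun=> true) 1 0 (e := 0) isT) (pol_cst c (c.1.1 - y.1.1) isT)) => x.
    by rewrite /mon !expr0 expr1; ring.
  have sq2 : polf c (fun=> true) (fun x : pt => (x.1.2 - y.1.2) ^+ 2).
    apply: pol_eq (pol_exp (P := fun x : pt => x.1.2 - y.1.2) 2 _ _ _) => //.
    apply: pol_eq (pol_add (pol_mon c (al := fun=> true) 0 1 (e := 0) isT) (pol_cst c (c.1.2 - y.1.2) isT)) => x.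
    by rewrite /mon !expr0 expr1; ring.
  have sq3 : polf c (fun=> true) (fun x : pt => (x.2 - y.2) ^+ 2).
    apply: pol_eq (pol_exp (P := fun x : pt => x.2 - y.2) 2 _ _ _) => //.
    apply: pol_eq (pol_add (pol_mon c (al := fun=> true) 0 0 (e := 1) isT) (pol_cst c (c.2 - y.2) isT)) => x.
    by rewrite /mon !expr0 expr1; ring.
  have := pol_add (pol_cst c 1 (al := fun=> true) isT) (pol_scale (- M^-1) (pol_add (pol_add sq1 sq2) sq3)).
  by apply: pol_eq => x; rewrite /q /sqd; ring.
- exact: inN.
- by rewrite /q /sqd !subrr expr0n /= !addr0 mul0r subr0.
- move=> x _ /sM sx; have s0 := sqd_ge0 y x.
  by rewrite /q subr_ge0 ler_pdivrMr// mul1r sx /= lerBlDr lerDl divr_ge0// ltW.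
(* The inequality q x > 1 - r^2 / M means |x - y| < r; the maximum with 1 / 2 only keeps th
   positive. *)
- move=> r r0; pose th := Num.max (1 / 2) (1 - r ^+ 2 / M).
  have rM : 0 < r ^+ 2 / M by rewrite divr_gt0// exprn_gt0.
  exists th; first by rewrite /th lt_max gt_max; apply/andP; split; [|apply/andP; split]; lra.
  move=> x _ _; rewrite /th gt_max => /andP[_]; rewrite /q ltrD2l ltrN2 ltr_pM2r ?invr_gt0// => sr.
  have key (d : R) : d ^+ 2 <= sqd y x -> `|d| <= r.
    move=> hd; have h0 := normr_ge0 d; have h1 : `|d| ^+ 2 <= r ^+ 2.
      by rewrite real_normK ?num_real//; exact: le_trans hd (ltW sr).
    by nra.
  have q1 := sqr_ge0 (x.1.1 - y.1.1); have q2 := sqr_ge0 (x.1.2 - y.1.2); have q3 := sqr_ge0 (x.2 - y.2).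
  by split; apply: key; rewrite /sqd; lra.
Qed.
End Interior.
End Landau.

(** * Vanishing in the exterior *)

Section Exterior.
Variables (R : realType) (k : R).
Hypothesis k0 : 0 < k.
Local Notation pt := (pt R).
Variables (N flat : set pt) (m : R * R -> R) (p p1 p2 p3 : pt -> R).
Hypothesis H : hsol k N flat m p p1 p2 p3.

Lemma sqr_le_norm (d t : R) : 0 < t -> d ^+ 2 <= t ^+ 2 -> `|d| <= t.
Proof.
move=> t0; rewrite -[d ^+ 2]real_normK ?num_real//; have := normr_ge0 d.
move: `|d| => a a0 h; nra.
Qed.

Lemma sqd0 (x : pt) : sqd (mkpt 0 0 0) x = nrm2 x.
Proof. by rewrite /sqd /nrm2 /= !subr0. Qed.

(** The set where the outer cutoff at scale n varies: squared radii from n^2 to 2 n^2. *)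
Definition shell (n : nat) : set pt := [set x | n%:R ^+ 2 <= nrm2 x <= 2 * n%:R ^+ 2].

Lemma meas_shell n : measurable (shell n).
Proof.
rewrite (_ : shell n = ~` ([set x | nrm2 x < n%:R ^+ 2] `|` [set x | 2 * n%:R ^+ 2 < nrm2 x])).
  apply: measurableC; apply: measurableU; apply: open_measurable3.
    rewrite (_ : [set x | _] = (@nrm2 R) @^-1` [set t | t < n%:R ^+ 2])//.
    by apply: open_comp; [move=> x _; exact: c_nrm2|exact: open_lt].
  rewrite (_ : [set x | _] = (@nrm2 R) @^-1` [set t | 2 * n%:R ^+ 2 < t])//.
  by apply: open_comp; [move=> x _; exact: c_nrm2|exact: open_gt].
apply/seteqP; split=> x; rewrite /shell /=.
  by move=> /andP[h1 h2] []; rewrite ltNge ?h1 ?h2.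
by move=> h; apply/andP; split; rewrite leNgt; apply/negP => h'; apply: h; [left|right].
Qed.

Lemma shell_bounded n : exists r, forall x, r <= enorm3 x -> \1_(shell n) x = 0 :> R.
Proof.
have [r hr] := sqd_large (mkpt 0 0 0 : pt) (2 * n%:R ^+ 2).
exists r => x /hr; rewrite sqd0 => h; rewrite indic0'// => /andP[_]; by rewrite leNgt h.
Qed.

Lemma L1_shell n : L1 mu3 (fun x => \1_N x * p x * \1_(shell n) x).
Proof.
have [r hr] := shell_bounded n.
apply: (Lloc_L1 (hs_L H) (measurable_indic (meas_shell n)) (C := 1) _ hr).
by move=> x; have /andP[a b] := indic01 (shell n) x; rewrite ger0_norm.
Qed.

Lemma mon_le n i j e (x : pt) : shell n x ->
  `|mon (mkpt 0 0 0) i j e x| <= (2 * n%:R) ^+ (i + j + e).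
Proof.
move=> /andP[_ h]; have [h1 h2 h3] := co_le_enorm3 x.
have hn : enorm3 x <= 2 * n%:R.
  rewrite enorm3_le ?mulr_ge0//; apply: (le_trans h); rewrite exprMn.
  by have := sqr_ge0 (n%:R : R); lra.
have n0 : 0 <= (2 * n%:R : R) by rewrite mulr_ge0.
rewrite /mon /= !subr0 !normrM !normrX !exprD.
have key (t : R) l : `|t| <= enorm3 x -> `|t| ^+ l <= (2 * n%:R) ^+ l.
  by move=> ht; rewrite lerXn2r ?nnegrE// (le_trans ht).
by apply: ler_pM; rewrite ?mulr_ge0 ?exprn_ge0//; [apply: ler_pM; rewrite ?exprn_ge0//|]; exact: key.
Qed.

Hypothesis decay : forall e : R, 0 < e -> exists n0 : nat, forall n, (n0 <= n)%N ->
  J mu3 (fun x => `|\1_N x * p x * \1_(shell n) x|) <= e * n%:R ^+ 2.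

(** With d = i + j + e, the profile is O(n^(-d-2)), the monomial O(n^d), and the L^1 norm of p over
    the shell o(n^2); the powers of n balance exactly. This is where the decay rate required of p
    comes from. *)
Lemma Tm_small i j e (C ep : R) : 0 < ep -> exists n0 : nat, forall n, (n0 <= n)%N ->
  forall psi : R -> R, continuous psi -> supp psi (n%:R ^+ 2) (2 * n%:R ^+ 2) ->
  (forall s, `|psi s| <= C * n%:R^-1 ^+ (i + j + e).+2) ->
  `|Tm N p (mkpt 0 0 0) i j e psi| <= ep.
Proof.
move=> ep0; pose d := (i + j + e)%N; pose K := (`|C| + 1) * 2 ^+ d.
have K0 : 0 < K by rewrite mulr_gt0 ?exprn_gt0// ltr_wpDl.
have [n0 hn0] := decay (divr_gt0 ep0 K0).
exists (maxn n0 1) => n; rewrite geq_max => /andP[n0n n1] psi cpsi spsi bpsi.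
have np : (0 : R) < n%:R by rewrite ltr0n.
have L := L1_Tm H (mkpt 0 0 0) i j e cpsi spsi.
apply: (le_trans (J_norm L)).
have L' := L1_norm (L1_shell n).
have Cb x : `|\1_N x * (p x * (psi (sqd (mkpt 0 0 0) x) * mon (mkpt 0 0 0) i j e x))| <=
   K * n%:R^-1 ^+ 2 * `|\1_N x * p x * \1_(shell n) x|.
  have i0 : 0 <= n%:R^-1 :> R by rewrite invr_ge0.
  have [xs|xs] := pselect (shell n x); last first.
    rewrite spsi ?sqd0// mul0r !mulr0 normr0 mulr_ge0// mulr_ge0 ?(ltW K0)// exprn_ge0//.
  rewrite (indic1 xs) mulr1.
  have -> (a b c : R) : `|a * (b * c)| = `|c| * `|a * b| by rewrite -normrM; congr (`|_|); ring.
  apply: ler_wpM2r => //; rewrite normrM.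
  have hb := bpsi (sqd (mkpt 0 0 0) x); have hm := mon_le i j e xs.
  apply: (le_trans (ler_pM _ _ hb hm)) => //; rewrite -/d exprMn.
  have -> : C * n%:R^-1 ^+ d.+2 * (2 ^+ d * n%:R ^+ d) = C * 2 ^+ d * n%:R^-1 ^+ 2 * (n%:R^-1 * n%:R) ^+ d.
    by rewrite exprMn -[d.+2]addn2 exprD; ring.
  rewrite mulVf ?gt_eqF// expr1n mulr1 /K ler_wpM2r ?exprn_ge0// ler_wpM2r ?exprn_ge0//.
  by have := ler_norm C; lra.
apply: (le_trans (J_le (mu := mu3) (L1_norm L) (L1_Z _ L') Cb)).
rewrite (J_Z _ L'); apply: (le_trans (ler_wpM2l _ (hn0 n n0n))).
  by rewrite mulr_ge0 ?(ltW K0)// exprn_ge0// invr_ge0.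
rewrite le_eqVlt; apply/orP; left; apply/eqP; field; by rewrite !gt_eqF.
Qed.

Variable s0 : R.
Hypothesis s00 : 0 < s0.
Hypothesis half : forall x, s0 <= nrm2 x -> N x <-> 0 < x.2.
Hypothesis flatx : forall x, s0 <= nrm2 x -> flat x.
Hypothesis graph0 : forall y, s0 <= nrm2 ((y, m y) : pt) -> m y = 0.

(** For even e the test function is an even function of x3, so its vertical derivative vanishes on
    the plane x3 = 0: the radial factor contributes a factor x3, and x3^e has derivative 0 there. *)
Lemma Tm_exterior i j e h a b : ~~ odd e -> s0 < a -> continuous h -> supp h a b ->
  Tm N p (mkpt 0 0 0) i j e h = 0.
Proof.
move=> oe a0; apply: (@Tm_induct R k k0 N flat m p p1 p2 p3 H (mkpt 0 0 0) (fun e => ~~ odd e) (fun a _ => s0 < a)) => //.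
- by move=> e'; rewrite /= negbK.
- move=> {oe a0 h a b}{}i {}j {}e f f1 f2 a b oe a0 F fs.
  have [s1' _] := C2R_supp F fs; split.
    move=> x; have [xN|xN] := pselect (N x); first exact: Or31.
    have [xs|xs] := ltP (nrm2 x) s0; last by apply: Or33; exact: flatx.
    apply: Or32; have off : ~ (a <= sqd (mkpt 0 0 0) x <= b).
      by rewrite sqd0 => /andP[h _]; have := lt_trans a0 (le_lt_trans h xs); rewrite ltxx.
    by apply: filterS (supp_off fs off) => y /= ->; rewrite mul0r.
  move=> y; have [ys|ys] := ltP (nrm2 ((y, m y) : pt)) s0.
    have off : ~ (a <= sqd (mkpt 0 0 0) ((y, m y) : pt) <= b).
      by rewrite sqd0 => /andP[h _]; have := lt_trans a0 (le_lt_trans h ys); rewrite ltxx.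
    by rewrite /= (fs _ off) (s1' _ off) mulr0 !mul0r addr0.
  rewrite /= (graph0 ys) subrr mulr0 mul0r mul0r add0r.
  case: (e) oe => [|[|e']] oe //; first by rewrite !mul0r !mulr0.
  by rewrite /= exprS mul0r !mulr0.
- move=> {oe a0 h a b}{}i {}j {}e oe TM h a b a0.
  apply: (T_exterior k0 (m := (i + j + e).+1) s00 _ _ _ a0).
  + by move=> g g1 g2 a' b' a'0 C s'; apply: (TM _ _ _ a' b').
  + by move=> h1 h2 a' b' _ c1 c2 s1' s2'; apply: (Tm_add H (mkpt 0 0 0) i j e c1 c2 s1' s2').
  + exact: Tm_small.
Qed.

Theorem exterior_vanishing (y : pt) : s0 < nrm2 y -> 0 < y.2 -> p y = 0.
Proof.
move=> ys y0.
have ab : (s0 + nrm2 y) / 2 < nrm2 y < nrm2 y + 1 by apply/andP; split; lra.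
have [h [ch hs hy]] := bump_exists ab.
have a0 : s0 < (s0 + nrm2 y) / 2 by lra.
have T0 i j e : ~~ odd e -> Tm N p (mkpt 0 0 0) i j e h = 0.
  by move=> oe; exact: Tm_exterior oe a0 ch hs.
pose n2 := nrm2 y + 1; have n20 : 1 <= n2 by rewrite /n2 lerDr nrm2_ge0.
(* A squared distance in the coordinates (x1, x2, x3^2). It is even in x3, as the available moments
   require, and on the upper half-space it still vanishes only at y. *)
pose g (x : pt) := (x.1.1 - y.1.1) ^+ 2 + (x.1.2 - y.1.2) ^+ 2 + (x.2 ^+ 2 - y.2 ^+ 2) ^+ 2.
pose M := 8 * n2 + n2 ^+ 2.
have M0 : 0 < M by rewrite /M; nra.
have supN x : h (sqd (mkpt 0 0 0) x) != 0 -> s0 <= nrm2 x <= n2.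
  move=> hx; apply: contraNT hx; rewrite sqd0 => ns; apply/eqP; apply: hs => /andP[h1 h2].
  by move: ns; rewrite h2 andbT => /negP; apply; lra.
have g0 x : 0 <= g x by rewrite /g !addr_ge0// sqr_ge0.
have gM x : nrm2 x <= n2 -> g x <= M.
  have : nrm2 y <= n2 by rewrite /n2 lerDl.
  rewrite /g /M /nrm2; move: (x.1.1) (x.1.2) (x.2) (y.1.1) (y.1.2) (y.2) => x1 x2 x3 y1 y2 y3 hY hX.
  have q1 := sqr_ge0 (x1 + y1); have q2 := sqr_ge0 (x2 + y2).
  have r1 := sqr_ge0 x1; have r2 := sqr_ge0 x2; have r3 := sqr_ge0 x3.
  have t1 := sqr_ge0 y1; have t2 := sqr_ge0 y2; have t3 := sqr_ge0 y3.
  have u1 : (x1 - y1) ^+ 2 <= 4 * n2 by nra.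
  have u2 : (x2 - y2) ^+ 2 <= 4 * n2 by nra.
  have u3 : (x3 ^+ 2 - y3 ^+ 2) ^+ 2 <= n2 ^+ 2.
    have a1 : x3 ^+ 2 <= n2 by lra.
    have a2 : y3 ^+ 2 <= n2 by lra.
    by move: (x3 ^+ 2) (y3 ^+ 2) r3 t3 a1 a2 => A B *; nra.
  lra.
pose q x := 1 - g x / M.
apply: (@landau_pol _ k N flat m p p1 p2 p3 H (fun e => ~~ odd e) (mkpt 0 0 0) y h _ _ q _ _ ch hs) => //.
- by move=> e e'; rewrite oddD; case: (odd e); case: (odd e').
- pose al := fun e => ~~ odd e.
  have al0 : al 0%N by [].
  have ald e e' : al e -> al e' -> al (e + e')%N by rewrite /al oddD; case: (odd e); case: (odd e').
  have sq1 : polf (mkpt 0 0 0) al (fun x : pt => (x.1.1 - y.1.1) ^+ 2).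
    apply: (pol_exp (P := fun x : pt => x.1.1 - y.1.1) 2 al0 ald).
    apply: pol_eq (pol_add (pol_mon _ (al := al) 1 0 (e := 0) isT) (pol_cst _ (- y.1.1) al0)) => x.
    by rewrite /mon !expr0 expr1 /=; ring.
  have sq2 : polf (mkpt 0 0 0) al (fun x : pt => (x.1.2 - y.1.2) ^+ 2).
    apply: (pol_exp (P := fun x : pt => x.1.2 - y.1.2) 2 al0 ald).
    apply: pol_eq (pol_add (pol_mon _ (al := al) 0 1 (e := 0) isT) (pol_cst _ (- y.1.2) al0)) => x.
    by rewrite /mon !expr0 expr1 /=; ring.
  have sq3 : polf (mkpt 0 0 0) al (fun x : pt => (x.2 ^+ 2 - y.2 ^+ 2) ^+ 2).
    apply: (pol_exp (P := fun x : pt => x.2 ^+ 2 - y.2 ^+ 2) 2 al0 ald).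
    apply: pol_eq (pol_add (pol_mon _ (al := al) 0 0 (e := 2) isT) (pol_cst _ (- y.2 ^+ 2) al0)) => x.
    by rewrite /mon !expr0 /= subr0 !mul1r.
  have := pol_add (pol_cst (mkpt 0 0 0) 1 al0) (pol_scale (- M^-1) (pol_add (pol_add sq1 sq2) sq3)).
  by apply: pol_eq => x; rewrite /q /g; ring.
- by apply/(half (ltW ys)).
- by rewrite sqd0.
- by rewrite /q /g !subrr expr0n /= !addr0 mul0r subr0.
- move=> x _ /supN/andP[_ /gM gx].
  by rewrite /q subr_ge0 ler_pdivrMr// mul1r gx /= lerBlDr lerDl divr_ge0// ltW.
(* The second entry controls the vertical distance: |x3^2 - y3^2| = |x3 - y3| (x3 + y3) >= |x3 - y3|
   y3 for positive x3, so a value below r y3 gives |x3 - y3| <= r. *)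
- move=> r r0; pose de := Num.min (r ^+ 2) ((r * y.2) ^+ 2).
  have de0 : 0 < de by rewrite lt_min !exprn_gt0// mulr_gt0.
  pose th := Num.max (1 / 2) (1 - de / M).
  have rM : 0 < de / M by rewrite divr_gt0.
  exists th; first by rewrite /th lt_max gt_max; apply/andP; split; [|apply/andP; split]; lra.
  move=> x Nx /supN/andP[xs _]; rewrite /th gt_max => /andP[_]; rewrite /q ltrD2l ltrN2 ltr_pM2r ?invr_gt0// lt_min.
  have x0 : 0 < x.2 by apply/(half xs).
  rewrite /g /boxn /= => /andP[]; move: (x.1.1) (x.1.2) (x.2) (y.1.1) (y.1.2) (y.2) x0 y0 => x1 x2 x3 y1 y2 y3 x0 y0 hr hr'.
  have q1 := sqr_ge0 (x1 - y1); have q2 := sqr_ge0 (x2 - y2); have q3 := sqr_ge0 (x3 ^+ 2 - y3 ^+ 2).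
  split.
  + by apply: sqr_le_norm => //; lra.
  + by apply: sqr_le_norm => //; lra.
  + have ry : 0 < r * y3 by rewrite mulr_gt0.
    have h3 : `|x3 ^+ 2 - y3 ^+ 2| <= r * y3 by apply: sqr_le_norm => //; lra.
    have E : `|x3 ^+ 2 - y3 ^+ 2| = `|x3 - y3| * (x3 + y3).
      by rewrite subr_sqr normrM [`|x3 + y3|]gtr0_norm// addr_gt0.
    rewrite E in h3; have h0 := normr_ge0 (x3 - y3).
    have h4 : `|x3 - y3| * y3 <= `|x3 - y3| * (x3 + y3) by rewrite ler_wpM2l// lerDr ltW.
    by rewrite -(ler_pM2r y0) (le_trans h4).
Qed.
End Exterior.

(** * The reflected mean value formula *)

Section AffineMaps.
Variable R : realType.
Local Notation pt := (pt R).
Variables (a : R) (a0 : 0 < a).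

Definition aff1 (c t : R) : R := a * t + c.
Definition aff2 (c t : R * R) : R * R := (aff1 c.1 t.1, aff1 c.2 t.2).
Definition aff3 (c t : pt) : pt := (aff2 c.1 t.1, aff1 c.2 t.2).

Lemma c_aff1 c : continuous (aff1 c).
Proof. by apply: cD; [apply: cM; [exact: cC|move=> t; exact: cvg_id]|exact: cC]. Qed.

Lemma m_aff1 c : measurable_fun setT (aff1 c).
Proof. by apply: continuous_measurable_fun; exact: c_aff1. Qed.
Lemma m_aff2 c : measurable_fun setT (aff2 c).
Proof.
by apply: measurable_fun_pair; apply: (measurableT_comp (m_aff1 _)); [exact: measurable_fst|exact: measurable_snd].
Qed.
Lemma m_aff3 c : measurable_fun setT (aff3 c).
Proof.
apply: measurable_fun_pair; first exact: (measurableT_comp (m_aff2 _) measurable_fst).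
exact: (measurableT_comp (m_aff1 _) measurable_snd).
Qed.

Lemma aff_nneg n : 0 <= a ^+ n. Proof. by rewrite exprn_ge0// ltW. Qed.

Definition scaled d (T : measurableType d) (mu : {measure set T -> \bar R}) (phi : T -> T)
    (mphi : measurable_fun setT phi) n : {measure set T -> \bar R} :=
  mscale (NngNum (aff_nneg n)) (measure_function_pushforward__canonical__measure_function_Measure mu mphi).

Lemma scaledE d (T : measurableType d) (mu : {measure set T -> \bar R}) (phi : T -> T)
    (mphi : measurable_fun setT phi) n A : scaled mu mphi n A = ((a ^+ n)%:E * mu (phi @^-1` A))%E.
Proof. by []. Qed.

(** Change of variables by uniqueness of measures: the rescaled image measure agrees with Lebesgue
    measure on intervals, and in higher dimension with the product measure on rectangles. *)
Lemma aff1_mu c (A : set R) : measurable A -> mu1 A = (a%:E * mu1 (aff1 c @^-1` A))%E.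
Proof.
move=> mA; rewrite -[a]expr1 -(scaledE mu1 (m_aff1 c)).
apply: lebesgue_measure_unique A mA => /= _ [[x y] _ <-].
have E : aff1 c @^-1` `]x, y]%classic = `](x - c) / a, (y - c) / a]%classic.
  apply/seteqP; split=> t; rewrite /aff1 /= !in_itv /=.
    by rewrite -ltrBlDr -lerBrDr ltr_pdivrMr// ler_pdivlMr// [t * a]mulrC.
  by rewrite -ltrBlDr -lerBrDr ltr_pdivrMr// ler_pdivlMr// [t * a]mulrC.
have main : lebesgue_measure `]x, y]%classic = (a%:E * lebesgue_measure (aff1 c @^-1` `]x, y]%classic))%E.
  rewrite E !lebesgue_measure_itv /= !lte_fin ltr_pM2r ?invr_gt0// ltrD2r.
  case: ifP => _; last by rewrite mule0.
  by rewrite -!EFinD -EFinM; congr EFin; field; rewrite gt_eqF.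
by rewrite -[a in RHS]expr1 in main; exact: main.
Qed.

Lemma aff2_mu c (A : set (R * R)) : measurable A -> mu2 A = ((a ^+ 2)%:E * mu2 (aff2 c @^-1` A))%E.
Proof.
move=> mA; rewrite -(scaledE mu2 (m_aff2 c)).
apply: (@product_measure_unique _ _ _ _ R mu1 mu1 (scaled mu2 (m_aff2 c) 2) _ A mA) => B C mB mC.
rewrite scaledE (_ : aff2 c @^-1` _ = (aff1 c.1 @^-1` B) `*` (aff1 c.2 @^-1` C)); last by [].
have mB' : measurable (aff1 c.1 @^-1` B) by rewrite -[X in measurable X]setTI; exact: m_aff1.
have mC' : measurable (aff1 c.2 @^-1` C) by rewrite -[X in measurable X]setTI; exact: m_aff1.
rewrite [X in (_ * X)%E](product_measure1E mu1 mu1 mB' mC').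
by rewrite (aff1_mu c.1 mB) (aff1_mu c.2 mC) expr2 EFinM muleACA.
Qed.

Lemma aff3_mu c (A : set pt) : measurable A -> mu3 A = ((a ^+ 3)%:E * mu3 (aff3 c @^-1` A))%E.
Proof.
move=> mA; rewrite -(scaledE mu3 (m_aff3 c)).
have h := @product_measure_unique _ _ _ _ R mu2 mu1 (scaled mu3 (m_aff3 c) 3).
apply: (h _ A mA) => B C mB mC.
rewrite scaledE (_ : aff3 c @^-1` _ = (aff2 c.1 @^-1` B) `*` (aff1 c.2 @^-1` C)); last by [].
have mB' : measurable (aff2 c.1 @^-1` B) by rewrite -[X in measurable X]setTI; exact: m_aff2.
have mC' : measurable (aff1 c.2 @^-1` C) by rewrite -[X in measurable X]setTI; exact: m_aff1.
rewrite [X in (_ * X)%E](product_measure1E mu2 mu1 mB' mC').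
by rewrite (aff2_mu c.1 mB) (aff1_mu c.2 mC) exprSr EFinM muleACA.
Qed.

Lemma lty_of_mul (b : R) (I : \bar R) : 0 < b -> (0 <= I)%E -> (b%:E * I < +oo)%E -> (I < +oo)%E.
Proof. by move=> b0; case: I => [r| |] //; rewrite ?ltry// mulry gtr0_sg// mul1e. Qed.

Section Transfer.
Context d (T : measurableType d) (mu : {measure set T -> \bar R}) (phi : T -> T) (n : nat).
Hypothesis mphi : measurable_fun setT phi.
Hypothesis E : forall A, measurable A -> mu A = ((a ^+ n)%:E * mu (phi @^-1` A))%E.

Lemma transfer_ge0 (f : T -> R) : measurable_fun setT f -> (forall x, 0 <= f x) ->
  (\int[mu]_x (f x)%:E = (a ^+ n)%:E * \int[mu]_x (f (phi x))%:E)%E.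
Proof.
move=> mf f0; have mf' : measurable_fun setT (EFin \o f) by exact/measurable_EFinP.
rewrite (@eq_measure_integral _ _ _ setT (scaled mu mphi n)); last first.
  by move=> A mA _; rewrite scaledE; exact: E.
rewrite /scaled ge0_integral_mscale//; last by move=> x _; rewrite lee_fin.
by congr (_ * _)%E; rewrite ge0_integral_pushforward// => x _; rewrite lee_fin.
Qed.

Lemma L1_transfer (f : T -> R) : L1 mu f -> L1 mu (fun x => f (phi x)).
Proof.
move=> Lf; have mf := L1_meas Lf; apply/integrableP; split.
  by apply/measurable_EFinP; exact: measurableT_comp mf mphi.
have [_] := integrableP _ _ _ Lf.
have mn : measurable_fun setT (fun x => `|f x|) by exact: measurableT_comp.
rewrite [X in (X < _)%E -> _](transfer_ge0 mn (fun=> normr_ge0 _)).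
by apply: lty_of_mul; [rewrite exprn_gt0|apply: integral_ge0].
Qed.

(** Reduced to nonnegative functions by writing f = (f + |f|) - |f|. *)
Lemma J_transfer (f : T -> R) : L1 mu f -> J mu f = a ^+ n * J mu (fun x => f (phi x)).
Proof.
move=> Lf; have Ln := L1_norm Lf; have Lp := L1_D Lf Ln.
have key (g : T -> R) : L1 mu g -> (forall x, 0 <= g x) -> J mu g = a ^+ n * J mu (fun x => g (phi x)).
  move=> Lg g0; apply: EFin_inj; rewrite EFinM -!J_EFin//; last exact: L1_transfer.
  exact: transfer_ge0 (L1_meas Lg) g0.
have k1 := key _ Ln (fun=> normr_ge0 _).
have k2 : J mu (fun x => f x + `|f x|) = a ^+ n * J mu (fun x => f (phi x) + `|f (phi x)|).
  by apply: (key _ Lp) => x; have := ler_norm (- f x); rewrite normrN; lra.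
rewrite (J_D Lf Ln) (J_D (L1_transfer Lf) (L1_transfer Ln)) in k2.
by move: k2; rewrite k1 mulrDr => /addIr.
Qed.
End Transfer.

Lemma L1_aff3 c (f : pt -> R) : L1 mu3 f -> L1 mu3 (fun x => f (aff3 c x)).
Proof. exact: (L1_transfer (mu := mu3) (m_aff3 c) (@aff3_mu c)). Qed.

Lemma J_aff3 c (f : pt -> R) : L1 mu3 f -> J mu3 f = a ^+ 3 * J mu3 (fun x => f (aff3 c x)).
Proof. exact: (J_transfer (mu := mu3) (m_aff3 c) (@aff3_mu c)). Qed.
End AffineMaps.

Section SmoothBump.
Variable R : realType.

Lemma ppart_exp_d n (t : R) : is_derive t (1 : R) (fun s => ppart s ^+ n.+2) (n.+2%:R * ppart t ^+ n.+1).
Proof.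
elim: n t => [|n IH] t; first by rewrite expr1; exact: ppart_sqr_d.
have E s : ppart s ^+ n.+3 = s * ppart s ^+ n.+2 :> R.
  rewrite exprS; have [s0|s0] := leP s 0; last by rewrite /ppart max_r// ltW.
  have -> : ppart s = 0 by apply/max_idPl.
  by rewrite expr0n /= !mulr0.
rewrite [X in is_derive _ _ X](_ : _ = fun s => s * ppart s ^+ n.+2); last by apply/funext => s; exact: E.
apply: (is_derive_eq (is_dM (is_derive_id t (1 : R)) (IH t))).
have -> : t * (n.+2%:R * ppart t ^+ n.+1) = n.+2%:R * (t * ppart t ^+ n.+1) by ring.
have -> : t * ppart t ^+ n.+1 = ppart t ^+ n.+2 :> R.
  rewrite [RHS]exprS; have [s0|s0] := leP t 0; last by rewrite /ppart max_r// ltW.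
  have -> : ppart t = 0 by apply/max_idPl.
  by rewrite exprS !mul0r mulr0.
by rewrite -[n.+3]addn1 natrD; ring.
Qed.

Lemma C2R_ppart n : C2R (fun s : R => ppart s ^+ n.+3) (fun s => n.+3%:R * ppart s ^+ n.+2)
  (fun s => n.+3%:R * (n.+2%:R * ppart s ^+ n.+1)).
Proof.
split=> s; first exact: ppart_exp_d.
  exact: is_dZ (ppart_exp_d _ s).
have cp : continuous (fun t : R => ppart t ^+ n.+1) by apply: cX; exact: ppart_cont.
exact (cMp (cCp s (n.+3%:R : R)) (cMp (cCp s (n.+2%:R : R)) (cp s))).
Qed.

Lemma C2R_comp (f f1 f2 w w1 w2 : R -> R) : C2R f f1 f2 -> C2R w w1 w2 ->
  C2R (fun s => f (w s)) (fun s => f1 (w s) * w1 s) (fun s => f2 (w s) * w1 s * w1 s + f1 (w s) * w2 s).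
Proof.
move=> F W; have cw := r_c W; have cw1 := r_c1 W; have cw2 := r_c2 W.
have cf1 := ccomp (r_c1 F) cw; have cf2 := ccomp (r_c2 F) cw.
split=> s.
- exact: is_dcomp (r_d F _) (r_d W s).
- exact: is_dM (is_dcomp (r_d1 F _) (r_d W s)) (r_d1 W s).
- exact (cDp (cMp (cMp (cf2 s) (cw1 s)) (cw1 s)) (cMp (cf1 s) (cw2 s))).
Qed.

Lemma C2R_add (f f1 f2 g g1 g2 : R -> R) : C2R f f1 f2 -> C2R g g1 g2 ->
  C2R (fun s => f s + g s) (fun s => f1 s + g1 s) (fun s => f2 s + g2 s).
Proof.
move=> F G; have c1 := r_c2 F; have c2 := r_c2 G; split=> s.
- exact: is_dD (r_d F s) (r_d G s).
- exact: is_dD (r_d1 F s) (r_d1 G s).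
- exact (cDp (c1 s) (c2 s)).
Qed.

Lemma C2R_scale (a : R) (f f1 f2 : R -> R) : C2R f f1 f2 ->
  C2R (fun s => a * f s) (fun s => a * f1 s) (fun s => a * f2 s).
Proof.
move=> F; have c1 := r_c2 F; split=> s.
- exact: is_dZ (r_d F s).
- exact: is_dZ (r_d1 F s).
- exact (cMp (cCp s a) (c1 s)).
Qed.

Lemma C2R_sub (f f1 f2 g g1 g2 : R -> R) : C2R f f1 f2 -> C2R g g1 g2 ->
  C2R (fun s => f s - g s) (fun s => f1 s - g1 s) (fun s => f2 s - g2 s).
Proof.
move=> F G; have c1 := r_c2 F; have c2 := r_c2 G; split=> s.
- exact: is_dB (r_d F s) (r_d G s).
- exact: is_dB (r_d1 F s) (r_d1 G s).
- exact (cBp (c1 s) (c2 s)).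
Qed.

Lemma C2R_id : C2R (fun s : R => s) (fun=> 1) (fun=> 0).
Proof.
by split=> s; [exact: is_derive_id|exact: (is_dC (1 : R) s (1 : R))|exact: cCp].
Qed.

Lemma C2R_cst (a : R) : C2R (fun _ : R => a) (fun=> 0) (fun=> 0).
Proof.
by split=> s; [exact: (is_dC a s (1 : R))|exact: (is_dC (0 : R) s (1 : R))|exact: cCp].
Qed.

(** b is the sixth power of the positive part of (s - 1/2)(4 - s), which is at least 1 on [1, 2],
    and V is its primitive. The high power is needed because the kernel built from b and b' must
    itself be C^2. *)
Lemma bump3_exists : exists V b b1 b2 b3 : R -> R,
  [/\ C2R V b b1, C2R b b1 b2 /\ C2R b1 b2 b3,
      (forall s, s <= 1 / 2 -> V s = 0) /\ (forall s, 4 <= s -> V s = V 4),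
      supp b (1 / 2) 4 /\ (forall s, 0 <= b s) & forall s, 1 <= s <= 2 -> 1 <= b s].
Proof.
pose w (s : R) := (s - 1 / 2) * (4 - s).
pose w1 (s : R) := 9 / 2 - 2 * s.
have W : C2R w w1 (fun=> - 2).
  have h := C2R_mul (C2R_sub C2R_id (C2R_cst (1 / 2))) (C2R_sub (C2R_cst 4) C2R_id).
  split=> s.
  - by apply: (is_derive_eq (r_d h s)); rewrite /w1; lra.
  - apply: (is_derive_eq (is_dB (is_dC (9 / 2 : R) s (1 : R)) (is_dZ 2 (is_derive_id s (1 : R))))).
    by rewrite mulr1 sub0r.
  - exact: cCp.
have W1 : C2R w1 (fun=> -2) (fun=> 0).
  split=> s; [exact: r_d1 W s|exact: (is_dC (- 2 : R) s (1 : R))|exact: cCp].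
have B := C2R_comp (C2R_ppart 3) W.
have B1 := C2R_mul (C2R_comp (C2R_scale 6 (C2R_ppart 2)) W) W1.
set b := (fun s => _) in B; set b1 := (fun s => 6 * _ * _) in B.
set b2 := (fun s => _ + _) in B1; set b3 := (fun s => _ + _ + _) in B1.
have {}B1 : C2R b1 b2 b3 by exact: B1.
have {}B : C2R b b1 b2.
  by split; [exact: r_d B|exact: r_d B1|exact: r_c1 B1].
have pw s : ~ (1 / 2 <= s <= 4) -> ppart (w s) = 0.
  move=> ns; apply/max_idPl; rewrite /w.
  have [s1|s1] := ltP s (1 / 2); first by nra.
  have [s4|s4] := ltP 4 s; first by nra.
  by exfalso; apply: ns; rewrite s1.
have sb : supp b (1 / 2) 4 by move=> s /pw; rewrite /b => ->; rewrite expr0n.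
have b0 s : 0 <= b s by rewrite /b exprn_ge0// /ppart le_max lexx.
have [V [dV V0]] := primitive (r_c B) sb.
exists V, b, b1, b2, b3; split=> //.
- by split; [exact: dV|exact: r_d B|exact: r_c1 B].
- split=> s.
    rewrite le_eqVlt => /orP[/eqP ->|]; last exact: V0.
    rewrite -(V0 0); last by rewrite divr_gt0.
    apply/esym/(derive_eq0_cst dV); first by rewrite divr_ge0.
    by move=> t /andP[_ t1]; apply: sb => /andP[]; rewrite leNgt t1.
  move=> s4; apply/esym/(derive_eq0_cst dV) => // t /andP[t4 _].
  by apply: sb => /andP[_]; rewrite leNgt t4.
- move=> s /andP[s1 s2]; rewrite /b exprn_ege1// /ppart le_max; apply/orP; right.
  rewrite /w; nra.
Qed.
End SmoothBump.

(** * A singular radial solution, its truncations and their mass *)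

Section Singular.
Variables (R : realType) (k : R).
Hypothesis k0 : 0 < k.

Lemma cut_C2R (x x1 x2 g g1 g2 : R -> R) (a0 : R) : 0 < a0 -> C2R x x1 x2 ->
  (forall s, s < a0 -> [/\ x s = 0, x1 s = 0 & x2 s = 0]) ->
  (forall s : R, 0 < s -> is_derive s (1 : R) g (g1 s)) ->
  (forall s : R, 0 < s -> is_derive s (1 : R) g1 (g2 s)) ->
  (forall s : R, 0 < s -> {for s, continuous g2}) ->
  C2R (fun s => x s * g s) (fun s => x1 s * g s + x s * g1 s)
      (fun s => x2 s * g s + x1 s * g1 s + (x1 s * g1 s + x s * g2 s)).
Proof.
move=> a00 X x0 dg dg1 cg2.
have cx := r_c X; have cx1 := r_c1 X; have cx2 := r_c2 X; have [dx dx1 _] := X.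
have cg s : 0 < s -> {for s, continuous g} by move=> s0; exact: is_derive1_continuous (dg s s0).
have cg1 s : 0 < s -> {for s, continuous g1} by move=> s0; exact: is_derive1_continuous (dg1 s s0).
have near0 (s : R) : s <= 0 -> \forall t \near s, t < a0.
  by move=> s0; apply: lt_nbhsl; apply: le_lt_trans a00.
have xs (s : R) : s <= 0 -> [/\ x s = 0, x1 s = 0 & x2 s = 0].
  by move=> s0; apply: x0; apply: le_lt_trans a00.
split=> s; have [s0|s0] := ltP 0 s.
- exact: is_dM (dx s) (dg s s0).
- have [-> -> _] := xs s s0; rewrite !mul0r addr0.
  apply: (near_eq_is_derive (f := fun=> (0:R))).
  by apply: filterS (near0 s s0) => t /x0[-> _ _]; rewrite mul0r.
- exact: is_dD (is_dM (dx1 s) (dg s s0)) (is_dM (dx s) (dg1 s s0)).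
- have [-> -> ->] := xs s s0; rewrite !mul0r !addr0.
  apply: (near_eq_is_derive (f := fun=> (0:R))).
  by apply: filterS (near0 s s0) => t /x0[-> -> _]; rewrite !mul0r addr0.
- exact (cDp (cDp (cMp (cx2 s) (cg s s0)) (cMp (cx1 s) (cg1 s s0)))
        (cDp (cMp (cx1 s) (cg1 s s0)) (cMp (cx s) (cg2 s s0)))).
- rewrite /continuous_at; have [-> -> ->] := xs s s0; rewrite !mul0r !addr0.
  apply: cvg_near_cst; apply: filterS (near0 s s0) => t /x0[-> -> ->].
  by rewrite !mul0r !addr0.
Qed.

(** One derivative in s takes sin(k r) from dimension one to dimension three, where it becomes a
    radial solution with a 1 / |x| singularity. *)
Definition G0 (s : R) := bZ k 1 s.
Definition G1 (s : R) := bZ k 2 s.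

Lemma G0E (s : R) : G0 s = k / 2 * (Num.sqrt s)^-1 * cos (k * Num.sqrt s).
Proof.
by rewrite /G0 /bZ /bes /bval /bstep /= !poly.derivE !hornerE /=; ring.
Qed.

Lemma G1E (s : R) : 0 < s -> G1 s = - (k / 4) * (Num.sqrt s)^-1 ^+ 3 *
   (cos (k * Num.sqrt s) + k * Num.sqrt s * sin (k * Num.sqrt s)).
Proof.
move=> s0; have r0 : Num.sqrt s != 0 by rewrite gt_eqF// sqrtr_gt0.
rewrite /G1 /bZ /bes /bval /bstep /= !poly.derivE !hornerE /=.
by field.
Qed.

(** [G0] solves the homogeneous equation, so only the commutator with the cutoff survives. *)
Lemma solution_cut (x x1 x2 : R -> R) (a0 : R) : 0 < a0 -> C2R x x1 x2 ->
  (forall s, s < a0 -> [/\ x s = 0, x1 s = 0 & x2 s = 0]) ->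
  exists y1 y2, C2R (fun s => x s * G0 s) y1 y2 /\
    forall s, Mop k 1 (fun s => x s * G0 s) y1 y2 s =
      8 * s * x1 s * G1 s + (4 * s * x2 s + 6 * x1 s) * G0 s.
Proof.
move=> a00 X x0.
have d0 (s : R) : 0 < s -> is_derive s (1 : R) G0 (G1 s) by exact: bZ_d.
have d1 (s : R) : 0 < s -> is_derive s (1 : R) G1 (bZ k 3 s) by exact: bZ_d.
have c2 (s : R) : 0 < s -> {for s, continuous (bZ k 3)} by exact: bZ_c.
have C := cut_C2R a00 X x0 d0 d1 c2.
eexists; eexists; split; first exact: C.
move=> s; rewrite /Mop; have [s0|s0] := ltP 0 s; last first.
  have [-> -> ->] : [/\ x s = 0, x1 s = 0 & x2 s = 0] by apply: x0; apply: le_lt_trans a00.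
  by ring.
have oz := bes_ode k 1 (or_intror (erefl (Psin R))) s0.
rewrite -/(bZ k 3) -/(bZ k 2) -/(bZ k 1) -/G0 -/G1 in oz.
transitivity (x s * (4 * s * bZ k 3 s + (4 * 1%:R + 2) * G1 s + k ^+ 2 * G0 s) +
  (8 * s * x1 s * G1 s + (4 * s * x2 s + 6 * x1 s) * G0 s)); first by ring.
by rewrite oz mulr0 add0r.
Qed.

Lemma G0_bound (s : R) : 0 < s -> `|G0 s| <= k / 2 * (Num.sqrt s)^-1.
Proof.
move=> s0; rewrite G0E normrM ger0_norm; last by rewrite mulr_ge0 ?invr_ge0 ?sqrtr_ge0// divr_ge0// ltW.
rewrite ler_piMr//; first by rewrite mulr_ge0 ?invr_ge0 ?sqrtr_ge0// divr_ge0// ltW.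
by rewrite ler_norml cos_geN1 cos_le1.
Qed.

Lemma G1_bound (s : R) : 0 < s -> s <= 1 -> `|G1 s| <= k * (1 + k) * (Num.sqrt s)^-1 ^+ 3.
Proof.
move=> s0 s1; rewrite G1E// normrM normrM normrN.
have r0 : 0 <= Num.sqrt s by exact: sqrtr_ge0.
have r1 : Num.sqrt s <= 1 by rewrite -sqrtr1 ler_wsqrtr.
have h0 : 0 <= (Num.sqrt s)^-1 ^+ 3 by rewrite exprn_ge0// invr_ge0.
rewrite [X in _ * X * _]ger0_norm// [X in X * _ * _]ger0_norm; last by rewrite divr_ge0// ltW.
rewrite mulrAC ler_wpM2r//.
have hc : `|cos (k * Num.sqrt s)| <= 1 by rewrite ler_norml cos_geN1 cos_le1.
have hs : `|sin (k * Num.sqrt s)| <= 1 by rewrite ler_norml sin_geN1 sin_le1.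
have : `|cos (k * Num.sqrt s) + k * Num.sqrt s * sin (k * Num.sqrt s)| <= 1 + k.
  apply: (le_trans (ler_normD _ _)); apply: lerD => //; rewrite !normrM (gtr0_norm k0) (ger0_norm r0).
  by rewrite -[leRHS]mulr1; apply: ler_pM; rewrite ?mulr_ge0 ?(ltW k0)// ler_piMr// ltW.
move: (_ + _ * _) => c hcc.
have := normr_ge0 c; have k1 := k0; nra.
Qed.

(** With t = k sqrt s, [G1] is -(k / 4) s^(-3/2) (cos t + t sin t). The bracket tends to 1, hence
    exceeds 1/2 for small s; this gives k / 8. *)
Lemma G1_neg : exists2 r : R, 0 < r & forall s, 0 < s -> s <= r -> k / 8 * (Num.sqrt s)^-1 ^+ 3 <= - G1 s.
Proof.
pose phi (t : R) := cos t + t * sin t.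
have cphi : {for (0 : R), continuous phi}.
  exact (cDp (@continuous_cos R 0) (cMp (cIp (0 : R)) (@continuous_sin R 0))).
have phi0 : phi 0 = 1 by rewrite /phi cos0 mul0r addr0.
have [d /= d0 hd] : exists2 d : R, 0 < d & forall t, `|t| < d -> 1 / 2 < phi t.
  move/cvgrPdist_lt: cphi => /(_ (1 / 2)); rewrite divr_gt0// => /(_ isT) /nbhs_ballP[d /= d0 dP].
  exists d => // t td; have : ball (0 : R) d t by rewrite /ball /= sub0r normrN.
  move/dP => /=; rewrite phi0 ltr_distlC => /andP[h _]; lra.
pose r := (d / (2 * k)) ^+ 2.
have r0 : 0 < r by rewrite exprn_gt0// divr_gt0// mulr_gt0.
exists r => // s s0 sr; rewrite G1E// -mulNr -mulNr opprK.
have h0 : 0 <= (Num.sqrt s)^-1 ^+ 3 by rewrite exprn_ge0// invr_ge0 sqrtr_ge0.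
have st : Num.sqrt s <= d / (2 * k).
  rewrite -[leRHS]ger0_norm; last by rewrite divr_ge0 ?mulr_ge0// ltW.
  by rewrite -sqrtr_sqr ler_wsqrtr.
have : 1 / 2 < phi (k * Num.sqrt s).
  apply: hd; rewrite ger0_norm ?mulr_ge0 ?sqrtr_ge0 ?(ltW k0)//.
  have : k * Num.sqrt s <= k * (d / (2 * k)) by rewrite ler_wpM2l// ltW.
  have -> : k * (d / (2 * k)) = d / 2 by field; rewrite gt_eqF.
  lra.
rewrite /phi; move: (cos _ + _) => c hc.
rewrite [leLHS](_ : _ = k / 4 * (Num.sqrt s)^-1 ^+ 3 * (1 / 2)); last by field; rewrite gt_eqF// sqrtr_gt0.
by rewrite ler_wpM2l// ?mulr_ge0// ?divr_ge0// ltW.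
Qed.
End Singular.

Section Numeric.
Variable R : realType.
Implicit Types r s t : R.
Lemma num1 r s : 0 < r -> r <= 1 / 2 -> 0 < s -> s <= 4 -> r ^+ 2 * s <= 1.
Proof.
move=> r0 r1 s0 s4; have h : r ^+ 2 <= 1 / 4 by nra.
have := sqr_ge0 r; nra.
Qed.
Lemma num4 r s t : 0 < r -> r <= 1 / 2 -> r <= t / 4 -> 0 < s -> s <= 4 -> r ^+ 2 * s <= t.
Proof.
move=> r0 r1 rt s0 s4; have h : r ^+ 2 <= r by nra.
have h2 : r ^+ 2 * s <= r * s by rewrite ler_wpM2r// ltW.
have h3 : r * s <= r * 4 by rewrite ler_wpM2l// ltW.
lra.
Qed.
Lemma num2 t : - (1 / 20) <= t -> t <= 1 / 20 -> 0 <= t ^+ 2 <= 1 / 100.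
Proof. by move=> t1 t2; rewrite sqr_ge0 /=; nra. Qed.
Lemma num3 (r s t : R) : - (1 / 20) <= r - 6 / 5 -> r - 6 / 5 <= 1 / 20 -> - (1 / 20) <= s -> s <= 1 / 20 ->
  - (1 / 20) <= t -> t <= 1 / 20 -> 1 <= r ^+ 2 + s ^+ 2 + t ^+ 2 /\ r ^+ 2 + s ^+ 2 + t ^+ 2 <= 2.
Proof.
move=> r1 r2 s1 s2 t1 t2; have /andP[h1 h2] := num2 s1 s2; have /andP[h3 h4] := num2 t1 t2.
move: (s ^+ 2) (t ^+ 2) h1 h2 h3 h4 => u v *; split; nra.
Qed.
Lemma num5 s t : 1 <= s -> 1 <= t -> 4 <= 4 * s * t.
Proof. move=> s1 t1; nra. Qed.
End Numeric.

Section Kernel.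
Variables (R : realType) (k : R).
Hypothesis k0 : 0 < k.
Local Notation pt := (pt R).

Record bump (V b b1 b2 b3 : R -> R) : Prop := Bump {
  bu_V : C2R V b b1; bu_b : C2R b b1 b2; bu_b1 : C2R b1 b2 b3;
  bu_0 : forall s, s <= 1 / 2 -> V s = 0; bu_4 : forall s, 4 <= s -> V s = V 4;
  bu_s : supp b (1 / 2) 4; bu_ge0 : forall s, 0 <= b s;
  bu_1 : forall s, 1 <= s <= 2 -> 1 <= b s }.

Lemma bump_ex : exists V b b1 b2 b3, bump V b b1 b2 b3.
Proof.
have [V [b [b1 [b2 [b3 [h1 [h2 h3] [h4 h5] [h6 h7] h8]]]]]] := bump3_exists R.
by exists V, b, b1, b2, b3.
Qed.

Variables (V b b1 b2 b3 : R -> R).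
Hypothesis B : bump V b b1 b2 b3.

Lemma bump_supp1 : supp b1 (1 / 2) 4.
Proof. by have [h _] := C2R_supp (bu_b B) (bu_s B). Qed.
Lemma bump_supp2 : supp b2 (1 / 2) 4.
Proof. by have [_ h] := C2R_supp (bu_b B) (bu_s B). Qed.
Lemma bump_supp3 : supp b3 (1 / 2) 4.
Proof. by have [_ h] := C2R_supp (bu_b1 B) bump_supp1. Qed.

Lemma C2R_dil (c : R) (f f1 f2 : R -> R) : C2R f f1 f2 ->
  C2R (fun s => f (c * s)) (fun s => c * f1 (c * s)) (fun s => c * (c * f2 (c * s))).
Proof.
move=> F; have := C2R_affine c 0 F.
by congr C2R; apply/funext => s; rewrite addr0.
Qed.

Lemma supp_dil_lt (f : R -> R) (c s : R) : supp f (1 / 2) 4 -> 0 < c -> s < (2 * c)^-1 -> f (c * s) = 0.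
Proof.
move=> fs c0 sc; apply: fs => /andP[h _].
have : c * s < c * (2 * c)^-1 by rewrite ltr_pM2l.
have -> : c * (2 * c)^-1 = 1 / 2 by field; rewrite gt_eqF.
by rewrite ltNge h.
Qed.

(* The value at |x|^2 = s of (Lap + k^2)(V(c |x|^2) G0(|x|^2)), where V' = b and
   G0(|x|^2) = k cos(k |x|) / (2 |x|) is a fundamental solution up to a factor. *)
Definition Hk (c s : R) : R :=
  8 * s * (c * b (c * s)) * G1 k s + (4 * s * (c * (c * b1 (c * s))) + 6 * (c * b (c * s))) * G0 k s.

Lemma d0G (s : R) : 0 < s -> is_derive s (1 : R) (G0 k) (G1 k s). Proof. exact: bZ_d. Qed.
Lemma d1G (s : R) : 0 < s -> is_derive s (1 : R) (G1 k) (bZ k 3 s). Proof. exact: bZ_d. Qed.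
Lemma d2G (s : R) : 0 < s -> is_derive s (1 : R) (bZ k 3) (bZ k 4 s). Proof. exact: bZ_d. Qed.
Lemma c3G (s : R) : 0 < s -> {for s, continuous (bZ k 3)}. Proof. exact: bZ_c. Qed.
Lemma c4G (s : R) : 0 < s -> {for s, continuous (bZ k 4)}. Proof. exact: bZ_c. Qed.

Lemma cut_b (c : R) : 0 < c -> C2R (fun s => b (c * s) * G0 k s)
  (fun s => c * b1 (c * s) * G0 k s + b (c * s) * G1 k s)
  (fun s => c * (c * b2 (c * s)) * G0 k s + c * b1 (c * s) * G1 k s +
     (c * b1 (c * s) * G1 k s + b (c * s) * bZ k 3 s)).
Proof.
move=> c0; apply: (@cut_C2R _ _ _ _ _ _ _ (2 * c)^-1 _ (C2R_dil c (bu_b B)) _ d0G d1G c3G).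
  by rewrite invr_gt0 mulr_gt0.
move=> s sc; rewrite (supp_dil_lt (bu_s B) c0 sc) (supp_dil_lt bump_supp1 c0 sc) (supp_dil_lt bump_supp2 c0 sc).
by rewrite !mulr0.
Qed.

Lemma C2R_ex_eq (f f1 f2 g : R -> R) : f =1 g -> C2R f f1 f2 -> exists H1 H2, C2R g H1 H2.
Proof. by move=> /funext <- F; exists f1, f2. Qed.

Lemma Hk_C2R (c : R) : 0 < c -> exists H1 H2, C2R (Hk c) H1 H2.
Proof.
move=> c0; have i0 : 0 < (2 * c)^-1 by rewrite invr_gt0 mulr_gt0.
have v s : s < (2 * c)^-1 -> [/\ b (c * s) = 0, b1 (c * s) = 0, b2 (c * s) = 0 & b3 (c * s) = 0].
  move=> sc; rewrite (supp_dil_lt (bu_s B) c0 sc) (supp_dil_lt bump_supp1 c0 sc).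
  by rewrite (supp_dil_lt bump_supp2 c0 sc) (supp_dil_lt bump_supp3 c0 sc).
have X1 := cut_b c0.
have X2 := @cut_C2R _ _ _ _ (G1 k) _ _ (2 * c)^-1 i0 (C2R_dil c (bu_b B)) _ d1G d2G c4G.
have {}X2 := X2 _; have X3 := @cut_C2R _ _ _ _ (G0 k) _ _ (2 * c)^-1 i0 (C2R_dil c (bu_b1 B)) _ d0G d1G c3G.
have {}X3 := X3 _.
have {}X2 := X2 (fun s sc => let: And4 h1 h2 h3 h4 := v s sc in
  And3 h1 (etrans (congr1 (fun t => c * t) h2) (mulr0 c)) (etrans (congr1 (fun t => c * (c * t)) h3) (etrans (congr1 (fun t => c * t) (mulr0 c)) (mulr0 c)))).
have {}X3 := X3 (fun s sc => let: And4 h1 h2 h3 h4 := v s sc in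
  And3 h2 (etrans (congr1 (fun t => c * t) h3) (mulr0 c)) (etrans (congr1 (fun t => c * (c * t)) h4) (etrans (congr1 (fun t => c * t) (mulr0 c)) (mulr0 c)))).
have Y := C2R_add (C2R_add (C2R_mul (C2R_scale (8 * c) (C2R_id R)) X2)
   (C2R_mul (C2R_scale (4 * c * c) (C2R_id R)) X3)) (C2R_scale (6 * c) X1).
by apply: C2R_ex_eq Y => s; rewrite /Hk /=; ring.
Qed.

Lemma Hk_cont (c : R) : 0 < c -> continuous (Hk c).
Proof. by move=> /Hk_C2R[H1 [H2 h]]; exact: r_c h. Qed.

Lemma Hk_supp (c : R) : 0 < c -> supp (Hk c) (2 * c)^-1 (4 / c).
Proof.
move=> c0 s ns; have h : ~ (1 / 2 <= c * s <= 4).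
  move=> /andP[h1 h2]; apply: ns; apply/andP; split.
    rewrite -(ler_pM2l c0) (le_trans _ h1)// le_eqVlt; apply/orP; left; apply/eqP; field; by rewrite gt_eqF.
  by rewrite ler_pdivlMr// mulrC.
by rewrite /Hk (bu_s B h) (bump_supp1 h); ring.
Qed.

Lemma L1_csupp (f : pt -> R) r : continuous f -> csupp f r -> L1 mu3 f.
Proof.
move=> cf fr; have L := Lloc_csupp (@Lloc_cst R 1) cf fr.
by apply: (@L1_eq _ _ _ mu3 _ _ _ L) => x; rewrite mul1r.
Qed.

Lemma sqd_csupp (z : pt) (h : R -> R) (a d : R) : supp h a d -> exists r, csupp (fun y => h (sqd z y)) r.
Proof.
move=> hs; have [r hr] := supp_csupp z (fun=> 1) hs.
by exists r => y /hr; rewrite mulr1.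
Qed.

Lemma L1_rad (z : pt) (h : R -> R) (a d : R) : continuous h -> supp h a d -> L1 mu3 (fun y => h (sqd z y)).
Proof.
move=> ch hs; have [r hr] := sqd_csupp z hs.
by apply: L1_csupp hr; exact: ccomp ch (@c_sqd _ z).
Qed.

Lemma J_rad_translate (z : pt) (h : R -> R) (a d : R) : continuous h -> supp h a d ->
  J mu3 (fun y => h (sqd z y)) = J mu3 (fun y => h (nrm2 y)).
Proof.
move=> ch hs; rewrite (J_aff3 ltr01 z (L1_rad z ch hs)) expr1n mul1r.
apply: J_eq => y; congr (h _).
by rewrite /sqd /nrm2 /aff3 /aff2 /aff1 /= !mul1r !addrK.
Qed.

Lemma nrm2_aff (r : R) (y : pt) : nrm2 (aff3 r (mkpt 0 0 0) y) = r ^+ 2 * nrm2 y.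
Proof. by rewrite /nrm2 /aff3 /aff2 /aff1 /= !addr0; ring. Qed.

Lemma J_rad_scale (r : R) (h : R -> R) (a d : R) : 0 < r -> continuous h -> supp h a d ->
  L1 mu3 (fun y : pt => h (r ^+ 2 * nrm2 y)) /\
  J mu3 (fun y : pt => h (nrm2 y)) = r ^+ 3 * J mu3 (fun y : pt => h (r ^+ 2 * nrm2 y)).
Proof.
move=> r0 ch hs; have L := L1_rad (mkpt 0 0 0) ch hs.
have {}L : L1 mu3 (fun y : pt => h (nrm2 y)).
  by apply: (@L1_eq _ _ _ mu3 _ _ _ L) => y; rewrite sqd0.
split.
  by apply: (@L1_eq _ _ _ mu3 _ _ _ (L1_aff3 r0 (mkpt 0 0 0) L)) => y; rewrite nrm2_aff.
by rewrite (J_aff3 r0 (mkpt 0 0 0) L); congr (_ * _); apply: J_eq => y; rewrite nrm2_aff.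
Qed.

(** The integrand is the divergence of the compactly supported field f(|y|^2) y. *)
Lemma J_divergence (f f1 f2 : R -> R) (a d : R) : C2R f f1 f2 -> supp f a d ->
  L1 mu3 (fun y : pt => 3 * f (nrm2 y) + 2 * nrm2 y * f1 (nrm2 y)) /\
  J mu3 (fun y : pt => 3 * f (nrm2 y) + 2 * nrm2 y * f1 (nrm2 y)) = 0.
Proof.
move=> F fs; have [s1 s2] := C2R_supp F fs.
have [r hr] := sqd_csupp (mkpt 0 0 0) fs; have [r1 hr1] := sqd_csupp (mkpt 0 0 0) s1.
pose M := Num.max r r1.
have z0 (x : pt) (t : R) : `|t| <= enorm3 x -> M <= `|t| -> f (sqd (mkpt 0 0 0) x) = 0 /\ f1 (sqd (mkpt 0 0 0) x) = 0.
  move=> h1; rewrite ge_max => /andP[h2 h3].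
  by split; [apply: hr|apply: hr1]; apply: le_trans h1.
have C := isC2_rad (mkpt 0 0 0) F; set j := jrad _ _ _ _ in C.
have cj := C1c C.
have key (co : pt -> R) (jd : pt -> R) (e : pt) : continuous co -> continuous jd ->
   (forall x, is_derive x e co 1) -> (forall x, is_derive x e (jf j) (jd x)) ->
   (forall x, f1 (sqd (mkpt 0 0 0) x) = 0 -> jd x = 0) ->
   [/\ forall x, is_derive x e (fun y => co y * jf j y) (1 * jf j x + co x * jd x) &
       L1 mu3 (fun x => 1 * jf j x + co x * jd x)].
  move=> cco cjd dco dj j0; split; first by move=> x; exact: is_dM.
  apply: (L1_csupp (r := M)); first by apply: cD; apply: cM => //; exact: cC.
  move=> x xM; have h := z0 x (enorm3 x); have [] := h _ _.
  - by rewrite ger0_norm ?enorm3_ge0.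
  - by rewrite ger0_norm ?enorm3_ge0.
  by move=> h1 h2; rewrite /= h1 (j0 _ h2) !mulr0 addr0.
have j10 x : f1 (sqd (mkpt 0 0 0) x) = 0 -> j1 j x = 0 by move=> h; rewrite /= h mulr0.
have j20 x : f1 (sqd (mkpt 0 0 0) x) = 0 -> j2 j x = 0 by move=> h; rewrite /= h mulr0.
have j30 x : f1 (sqd (mkpt 0 0 0) x) = 0 -> j3 j x = 0 by move=> h; rewrite /= h mulr0.
have [D1 L1'] := key _ _ _ (@c_co1 R) (C1c1 C) (fun x => is_d_co1 x (e1 R)) (C1d1 C) j10.
have [D2 L2'] := key _ _ _ (@c_co2 R) (C1c2 C) (fun x => is_d_co2 x (e2 R)) (C1d2 C) j20.
have [D3 L3'] := key _ _ _ (@c_co3 R) (C1c3 C) (fun x => is_d_co3 x (e3 R)) (C1d3 C) j30.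
have J1 : J mu3 (fun x => 1 * jf j x + co1 x * j1 j x) = 0.
  apply: (J3_derive1 (F := fun y => co1 y * jf j y) (M := M) L1' D1) => x xM.
  have [h1 _ _] := co_le_enorm3 x; have [g0 g1] := z0 x _ h1 xM.
  by rewrite j10//= g0 !mulr0 addr0.
have J2 : J mu3 (fun x => 1 * jf j x + co2 x * j2 j x) = 0.
  apply: (J3_derive2 (F := fun y => co2 y * jf j y) (M := M) L2' D2) => x xM.
  have [_ h1 _] := co_le_enorm3 x; have [g0 g1] := z0 x _ h1 xM.
  by rewrite j20//= g0 !mulr0 addr0.
have J3 : J mu3 (fun x => 1 * jf j x + co3 x * j3 j x) = 0.
  apply: (J3_derive3 (F := fun y => co3 y * jf j y) (M := M) L3' D3) => x xM.
  have [_ _ h1] := co_le_enorm3 x; have [g0 g1] := z0 x _ h1 xM.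
  by rewrite j30//= g0 !mulr0 addr0.
have LL := L1_D (L1_D L1' L2') L3'.
have E x : 1 * jf j x + co1 x * j1 j x + (1 * jf j x + co2 x * j2 j x) + (1 * jf j x + co3 x * j3 j x) =
   3 * f (nrm2 x) + 2 * nrm2 x * f1 (nrm2 x).
  by rewrite /= sqd0 !subr0 /co1 /co2 /co3; move: (f _) (f1 _) => u v; rewrite /nrm2; ring.
split; first by apply: (@L1_eq _ _ _ mu3 _ _ _ LL).
by rewrite -(J_eq mu3 E) (J_D (L1_D L1' L2') L3') (J_D L1' L2') J1 J2 J3 !addr0.
Qed.

Definition Dk (c : R) : R := J mu3 (fun y : pt => Hk c (nrm2 y)).

Lemma sqrt_scale (r s : R) : 0 < r -> Num.sqrt (r ^+ 2 * s) = r * Num.sqrt s.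
Proof. by move=> r0; rewrite sqrtrM ?sqr_ge0// sqrtr_sqr gtr0_norm. Qed.

(** With c = r^(-2), the kernel lives where |y| is comparable to r and has size r^(-3), because [G0]
    is O(1 / |y|) and [G1] is O(1 / |y|^3). Rescaling by r gives an L^1 bound independent of r. *)
Lemma J_Hk_bound : exists C : R, forall r, 0 < r -> r <= 1 / 2 ->
  J mu3 (fun y : pt => `|Hk (r^-1 ^+ 2) (nrm2 y)|) <= C.
Proof.
have [Cb Cb0 hb] := cont_csupp_bounded (r_c (bu_b B)) (bu_s B).
have [Cc Cc0 hc] := cont_csupp_bounded (r_c (bu_b1 B)) bump_supp1.
pose M := 8 * 4 * Cb * (k * (1 + k) * 8) + (4 * 4 * Cc + 6 * Cb) * (k / 2 * 2).
have M0 : 0 <= M by rewrite /M !addr_ge0 ?mulr_ge0 ?addr_ge0 ?mulr_ge0 ?divr_ge0 ?addr_ge0// ltW.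
have LB := L1_indic (mu := mu3) (meas_ball0 (3 : R)) (mu3_ball0_fin _).
exists (M * J mu3 (\1_(ball0 (3 : R)))) => r r0 r1.
have c0 : 0 < r^-1 ^+ 2 by rewrite exprn_gt0// invr_gt0.
have cH : continuous (fun s => `|Hk (r^-1 ^+ 2) s|).
  by move=> s; apply: cvg_norm; exact: Hk_cont.
have sH : supp (fun s => `|Hk (r^-1 ^+ 2) s|) (2 * r^-1 ^+ 2)^-1 (4 / r^-1 ^+ 2).
  by move=> s /(Hk_supp c0) ->; rewrite normr0.
have [L ->] := J_rad_scale r0 cH sH.
rewrite -(J_Z _ L) -(J_Z _ LB).
apply: (J_le (mu := mu3)) (L1_Z _ L) (L1_Z _ LB) _ => y.
have rn : r != 0 by rewrite gt_eqF.
have E s : r^-1 ^+ 2 * (r ^+ 2 * s) = s by field.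
have [sy|sy] := pselect (1 / 2 <= nrm2 y <= 4); last first.
  rewrite /Hk E (bu_s B sy) (bump_supp1 sy) !(mulr0, mul0r, addr0) normr0 mulr0 mulr_ge0//.
have yb : ball0 3 y.
  by rewrite /ball0 /= enorm3_lt//; case/andP: sy => _ h; apply: (le_lt_trans h); rewrite -natrX ltr_nat.
rewrite (indic1 yb) mulr1; move: (nrm2 y) sy => s /andP[s1 s4].
have sp : 0 < s by lra.
have rs0 : 0 < r ^+ 2 * s by rewrite mulr_gt0// exprn_gt0.
have rs1 : r ^+ 2 * s <= 1 by exact: num1.
have g0 := G0_bound k0 rs0; have g1 := G1_bound k0 rs0 rs1.
rewrite sqrt_scale// in g0 g1.
have q0 : 1 / 2 <= Num.sqrt s.
  rewrite -[leLHS]ger0_norm ?divr_ge0// -sqrtr_sqr ler_wsqrtr//; lra.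
have q1 : (Num.sqrt s)^-1 <= 2 by rewrite -[leRHS]invrK lef_pV2 ?posrE ?invr_gt0 ?sqrtr_gt0//; lra.
have qi0 : 0 <= (Num.sqrt s)^-1 by rewrite invr_ge0 sqrtr_ge0.
have ri0 : 0 <= r^-1 by rewrite invr_ge0 ltW.
have {}g0 : `|G0 k (r ^+ 2 * s)| <= k / 2 * 2 * r^-1.
  by apply: (le_trans g0); rewrite invfM [_^-1 * _]mulrC mulrA ler_wpM2r// ler_wpM2l// divr_ge0// ltW.
have {}g1 : `|G1 k (r ^+ 2 * s)| <= k * (1 + k) * 8 * r^-1 ^+ 3.
  apply: (le_trans g1); rewrite invfM exprMn [_^-1 ^+ 3 * _]mulrC mulrA ler_wpM2r ?exprn_ge0//.
  rewrite ler_wpM2l ?mulr_ge0 ?addr_ge0 ?(ltW k0)//.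
  by have -> : 8 = 2 ^+ 3 :> R; [by rewrite -natrX|rewrite lerXn2r ?nnegrE].
have hbs := hb s; have hcs := hc s.
rewrite /Hk E; move: (G0 k _) (G1 k _) g0 g1 => g g' g0 g1.
rewrite -[X in X * _](ger0_norm (x := r ^+ 3)) ?exprn_ge0 ?(ltW r0)// -normrM.
have -> : r ^+ 3 * (8 * (r ^+ 2 * s) * (r^-1 ^+ 2 * b s) * g' +
   (4 * (r ^+ 2 * s) * (r^-1 ^+ 2 * (r^-1 ^+ 2 * b1 s)) + 6 * (r^-1 ^+ 2 * b s)) * g) =
   8 * s * b s * (r ^+ 3 * g') + (4 * s * b1 s + 6 * b s) * (r * g) by field.
have e1 : `|r ^+ 3 * g'| <= k * (1 + k) * 8.
  rewrite normrM ger0_norm ?exprn_ge0 ?(ltW r0)//.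
  have -> : k * (1 + k) * 8 = r ^+ 3 * (k * (1 + k) * 8 * r^-1 ^+ 3) by field.
  by rewrite ler_wpM2l// exprn_ge0// ltW.
have e2 : `|r * g| <= k / 2 * 2.
  rewrite normrM gtr0_norm//; have -> : k / 2 * 2 = r * (k / 2 * 2 * r^-1) by field.
  by rewrite ler_wpM2l// ltW.
apply: (le_trans (ler_normD _ _)); rewrite /M; apply: lerD; rewrite normrM; apply: ler_pM => //.
  rewrite !normrM ger0_norm// (gtr0_norm sp) -!mulrA ler_wpM2l// ler_pM// ltW//.
apply: (le_trans (ler_normD _ _)); rewrite !normrM ![`|_%:R|]ger0_norm// (gtr0_norm sp).
by apply: lerD; rewrite -?mulrA ler_wpM2l// ler_pM// ltW.
Qed.

(** The terms of the kernel have no common sign. Subtracting the divergence of 2 c b(c |y|^2)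
    G0(|y|^2) y, whose integral is 0, leaves 4 c |y|^2 b G1, which is nonpositive near the origin by
    [G1_neg]; it is then bounded on one fixed box after rescaling. *)
Lemma Dk_lower : exists2 c0 : R, 0 < c0 & exists2 r1 : R, 0 < r1 &
  forall r, 0 < r -> r <= r1 -> c0 <= - Dk (r^-1 ^+ 2).
Proof.
have [rs rs0 hneg] := G1_neg k0.
(* The box of half-side 1/20 about this point lies in 1 <= |y|^2 <= 2, where b is at least 1. *)
pose y0 : pt := mkpt (6 / 5) 0 0.
have mB := meas_boxn y0 (1 / 20); have fB : (mu3 (boxn y0 (1 / 20)) < +oo)%E by rewrite mu3_boxn ?ltry// divr_ge0.
pose r1 := Num.min (1 / 2) (rs / 4).
have r10 : 0 < r1 by rewrite lt_min !divr_gt0.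
exists (k / 16 * (2 * (1 / 20)) ^+ 3); first by rewrite mulr_gt0 ?divr_gt0// exprn_gt0.
exists r1 => // r r0; rewrite le_min => /andP[rh rr].
set c := r^-1 ^+ 2; have c0 : 0 < c by rewrite exprn_gt0// invr_gt0.
have rn : r != 0 by rewrite gt_eqF.
have E s : c * (r ^+ 2 * s) = s by rewrite /c; field.
(* The factor 2 c makes the divergence match the [G0] terms of the kernel, including the one with
   [b1]. *)
have F := C2R_scale (2 * c) (cut_b c0).
set f := (fun s => 2 * c * _) in F.
have fs : supp f (2 * c)^-1 (4 / c).
  move=> s ns; have h : ~ (1 / 2 <= c * s <= 4).
    move=> /andP[h1 h2]; apply: ns; apply/andP; split.
      rewrite -(ler_pM2l c0) (le_trans _ h1)// le_eqVlt; apply/orP; left; apply/eqP; field; by rewrite gt_eqF.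
    by rewrite ler_pdivlMr// mulrC.
  by rewrite /f (bu_s B h) mul0r mulr0.
have [Ld Jd] := J_divergence F fs.
pose q s := - (4 * s * (c * b (c * s)) * G1 k s).
have Hq s : Hk c s = (3 * f s + 2 * s * (2 * c * (c * b1 (c * s) * G0 k s + b (c * s) * G1 k s))) - q s.
  by rewrite /Hk /f /q; ring.
have LH : L1 mu3 (fun y : pt => Hk c (nrm2 y)).
  have L := L1_rad (mkpt 0 0 0) (Hk_cont c0) (Hk_supp c0).
  by apply: (@L1_eq _ _ _ mu3 _ _ _ L) => y; rewrite sqd0.
have Lq : L1 mu3 (fun y : pt => q (nrm2 y)).
  by apply: (@L1_eq _ _ _ mu3 _ _ _ (L1_B Ld LH)) => y; rewrite Hq; ring.
have -> : - Dk c = J mu3 (fun y : pt => q (nrm2 y)).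
  rewrite /Dk -[LHS]add0r -Jd -(J_B Ld LH); apply: J_eq => y; rewrite Hq; ring.
rewrite (J_aff3 r0 (mkpt 0 0 0) Lq) -(J_Z _ (L1_aff3 r0 (mkpt 0 0 0) Lq)).
have -> : (2 * (1 / 20)) ^+ 3 = fine (mu3 (boxn y0 (1 / 20))) :> R by rewrite mu3_boxn// divr_ge0.
have r30 : 0 <= r ^+ 3 by rewrite exprn_ge0// ltW.
have low (y : pt) : nrm2 y <= 4 -> 0 < nrm2 y -> k / 8 * (Num.sqrt (nrm2 y))^-1 ^+ 3 * (4 * nrm2 y * b (nrm2 y)) <=
    r ^+ 3 * q (nrm2 (aff3 r (mkpt 0 0 0) y)).
  move=> y4 yp; rewrite nrm2_aff /q E; have hb0 := bu_ge0 B (nrm2 y).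
  have sp : 0 < r ^+ 2 * nrm2 y by rewrite mulr_gt0// exprn_gt0.
  have sr : r ^+ 2 * nrm2 y <= rs.
    exact: num4.
  have := hneg _ sp sr; rewrite sqrt_scale//; move: (G1 k _) => g hg.
  have -> : r ^+ 3 * - (4 * (r ^+ 2 * nrm2 y) * (c * b (nrm2 y)) * g) = r ^+ 3 * (- g) * (4 * nrm2 y * b (nrm2 y)).
    by rewrite /c; field.
  apply: ler_wpM2r; first by rewrite !mulr_ge0// ltW.
  apply: (le_trans _ (ler_wpM2l r30 hg)); rewrite le_eqVlt; apply/orP; left; apply/eqP.
  by field; rewrite rn gt_eqF// sqrtr_gt0.
apply: (J_ge_indic (mu := mu3) mB fB (L1_Z _ (L1_aff3 r0 (mkpt 0 0 0) Lq))).
  move=> y; have [y4|y4] := leP (nrm2 y) 4; last first.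
    rewrite nrm2_aff /q E (bu_s B) ?mulr0 ?mul0r ?oppr0 ?mulr0// => /andP[_]; by rewrite leNgt y4.
  have [yp|yp] := ltP 0 (nrm2 y); last first.
    rewrite nrm2_aff /q E (bu_s B) ?mulr0 ?mul0r ?oppr0 ?mulr0// => /andP[h _].
    by have := le_trans h yp; rewrite leNgt divr_gt0.
  apply: le_trans (low y y4 yp); rewrite mulr_ge0//.
    by rewrite mulr_ge0 ?divr_ge0 ?exprn_ge0 ?invr_ge0 ?sqrtr_ge0// ltW.
  by rewrite !mulr_ge0 ?(bu_ge0 B)// ltW.
move=> y [/= h1 h2 h3]; move: h1 h2 h3; rewrite !subr0 !ler_norml => /andP[a1 a2] /andP[a3 a4] /andP[a5 a6].
have n1 : 1 <= nrm2 y /\ nrm2 y <= 2.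
  exact: num3.
have [n1' n2] := n1.
apply: (le_trans _ (low y _ _)); [|lra|lra].
have b1' : 1 <= b (nrm2 y) by apply: (bu_1 B); rewrite n1'.
have s2 : Num.sqrt (nrm2 y) <= 2.
  have -> : 2 = Num.sqrt (2 ^+ 2) :> R by rewrite sqrtr_sqr ger0_norm.
  by rewrite ler_wsqrtr//; lra.
have sp : 0 < Num.sqrt (nrm2 y) by rewrite sqrtr_gt0; lra.
have i2 : 2^-1 <= (Num.sqrt (nrm2 y))^-1 by rewrite lef_pV2 ?posrE.
have i3 : 2^-1 ^+ 3 <= (Num.sqrt (nrm2 y))^-1 ^+ 3 by rewrite lerXn2r ?nnegrE ?invr_ge0// ltW.
have -> : k / 16 = k / 8 * 2^-1 ^+ 3 * 4 by field.
apply: ler_pM; rewrite ?mulr_ge0 ?divr_ge0 ?(ltW k0) ?exprn_ge0 ?invr_ge0//.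
  by rewrite ler_wpM2l// divr_ge0// ltW.
exact: num5.
Qed.
End Kernel.

(** * The mean value formula next to the flat boundary *)

Section MeanValue.
Variables (R : realType) (k : R).
Hypothesis k0 : 0 < k.
Local Notation pt := (pt R).
Variables (N flat : set pt) (m : R * R -> R) (p p1 p2 p3 : pt -> R).
Hypothesis H : hsol k N flat m p p1 p2 p3.
Variable s0 : R.
Hypothesis half : forall x : pt, s0 <= nrm2 x -> N x <-> 0 < x.2.
Hypothesis flatx : forall x : pt, s0 <= nrm2 x -> flat x.
Hypothesis graph0 : forall y, s0 <= nrm2 ((y, m y) : pt) -> m y = 0.

Definition sg (z : pt) : pt := (z.1, - z.2).
(** The closed unit ball about z avoids the perturbed region, so kernels supported in it, and by
    symmetry their mirror images, meet at most the flat part of the boundary. *)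
Definition ext (z : pt) := forall y, sqd z y <= 1 -> s0 <= nrm2 y.

Lemma sqd_sg (z y : pt) : sqd (sg z) y = sqd z (sg y).
Proof. by rewrite /sqd /sg /=; ring. Qed.
Lemma nrm2_sg (y : pt) : nrm2 (sg y) = nrm2 y.
Proof. by rewrite /nrm2 /sg /= sqrrN. Qed.
Lemma ext_sg (z y : pt) : ext z -> sqd (sg z) y <= 1 -> s0 <= nrm2 y.
Proof. by move=> ez; rewrite sqd_sg -(nrm2_sg y); exact: ez. Qed.
Lemma sqdxx (z : pt) : sqd z z = 0.
Proof. by rewrite /sqd !subrr expr0n /= !addr0. Qed.

(* Adding the mirror image makes the vertical derivative of the test function vanish
   on the flat part of the boundary. *)
Definition TT (z : pt) (h : R -> R) : R :=
  J mu3 (fun y => \1_N y * (p y * (h (sqd z y) + h (sqd (sg z) y)))).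

Lemma c_two (z : pt) (h : R -> R) : continuous h ->
  continuous (fun y : pt => h (sqd z y) + h (sqd (sg z) y)).
Proof.
by move=> ch; apply: cD; [exact: ccomp ch (@c_sqd _ z)|exact: ccomp ch (@c_sqd _ (sg z))].
Qed.

Lemma csupp_two (z : pt) (h : R -> R) (a d : R) : supp h a d ->
  exists r, csupp (fun y : pt => h (sqd z y) + h (sqd (sg z) y)) r.
Proof.
move=> hs; have [r hr] := sqd_csupp z hs; have [r' hr'] := sqd_csupp (sg z) hs.
exists (Num.max r r') => y; rewrite ge_max => /andP[/hr h1 /hr' h2].
by rewrite h1 h2 addr0.
Qed.

Lemma L1_TT (z : pt) (h : R -> R) (a d : R) : continuous h -> supp h a d ->
  L1 mu3 (fun y => \1_N y * (p y * (h (sqd z y) + h (sqd (sg z) y)))).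
Proof.
move=> ch hs; have [r hr] := csupp_two z hs.
have L := Lloc_csupp (hs_L H) (@c_two z h ch) hr.
by apply: (@L1_eq _ _ _ mu3 _ _ _ L) => x; rewrite -mulrA.
Qed.

Lemma TT_B (z : pt) (g h : R -> R) (a d a' d' : R) : continuous g -> supp g a d ->
  continuous h -> supp h a' d' -> TT z (fun s => g s - h s) = TT z g - TT z h.
Proof.
move=> cg sg' ch sh; rewrite /TT -(J_B (L1_TT z cg sg') (L1_TT z ch sh)).
by apply: J_eq => y; rewrite -mulrBr -mulrBr; congr (_ * (_ * _)); ring.
Qed.

Lemma lap_jrad (c : pt) f f1 f2 (x : pt) :
  lap (jrad c f f1 f2) x + k ^+ 2 * jf (jrad c f f1 f2) x = Mop k 1 f f1 f2 (sqd c x).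
Proof.
rewrite /lap /Mop /=; move: (f (sqd c x)) (f1 (sqd c x)) (f2 (sqd c x)) => u u1 u2.
by rewrite /sqd; ring.
Qed.

Lemma TT_Mop (z : pt) (f f1 f2 : R -> R) (a d : R) : ext z -> C2R f f1 f2 -> supp f a d -> d <= 1 ->
  TT z (Mop k 1 f f1 f2) = 0.
Proof.
move=> ez F fs d1; have [s1 _] := C2R_supp F fs.
pose j := jadd (jrad z f f1 f2) (jrad (sg z) f f1 f2).
have C : isC2 j by apply: isC2_add; exact: isC2_rad.
have [r hr] := csupp_two z fs.
have off (c x : pt) : ~ (sqd c x <= 1) -> ~ (a <= sqd c x <= d).
  by move=> n1 /andP[_ h]; apply: n1; exact: le_trans d1.
have ad : adm N flat j.
  move=> x; have [e1|e1] := pselect (sqd z x <= 1); first by apply: Or33; apply: flatx; exact: ez.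
  have [e2|e2] := pselect (sqd (sg z) x <= 1); first by apply: Or33; apply: flatx; exact: ext_sg e2.
  apply: Or32; apply: filterS2 (supp_off fs (off _ _ e1)) (supp_off fs (off _ _ e2)) => y /= -> ->.
  by rewrite addr0.
have g0 y : j3 j (y, m y) = 0.
  rewrite /=; set S1 := sqd z _; set S2 := sqd (sg z) _.
  have fl : s0 <= nrm2 ((y, m y) : pt) ->
      2 * (m y - z.2) * f1 S1 + 2 * (m y - (sg z).2) * f1 S2 = 0.
    move=> /graph0 my; have -> : S2 = S1 by rewrite /S1 /S2 /sqd /= my; ring.
    by rewrite my /=; ring.
  have [e1|e1] := pselect (S1 <= 1); first by apply: fl; exact: ez.
  have [e2|e2] := pselect (S2 <= 1); first by apply: fl; exact: ext_sg e2.
  by rewrite (s1 _ (off _ _ e1)) (s1 _ (off _ _ e2)) !mulr0 addr0.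
rewrite -[RHS](hs_dist H C (r := r) hr ad g0) /TT; apply: J_eq => y.
rewrite -(lap_jrad z) -(lap_jrad (sg z)); congr (_ * (_ * _)).
rewrite /lap /j /jadd; simpl jf; simpl j11; simpl j22; simpl j33; ring.
Qed.

Variables (V b b1 b2 b3 : R -> R).
Hypothesis B : bump V b b1 b2 b3.
Local Notation Hkb := (Hk k b b1).

(** The difference of the two kernels is the operator applied to (V(c s) - V(c' s)) G0(s). The
    bracket vanishes near s = 0, removing the singularity, and for s >= 1, where both terms equal V
    4 because c, c' >= 4. So [TT_Mop] applies. *)
Lemma TT_indep (z : pt) (c c' : R) : ext z -> 4 <= c -> 4 <= c' -> TT z (Hkb c) = TT z (Hkb c').
Proof.
move=> ez c4 c4'; have c0 : 0 < c by lra.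
have c0' : 0 < c' by lra.
have X := C2R_sub (C2R_dil c (bu_V B)) (C2R_dil c' (bu_V B)).
set x := (fun s => _ - _) in X; set x1 := (fun s => _ - _) in X; set x2 := (fun s => _ - _) in X.
(* For s below this both c s and c' s are less than 1/2, where V vanishes. *)
pose a0 := (2 * (c + c'))^-1.
have a00 : 0 < a0 by rewrite invr_gt0 mulr_gt0// addr_gt0.
have lt_ s t : s < a0 -> 0 < t -> t <= c + c' -> t * s < 1 / 2.
  move=> sa t0 tc; apply: (lt_le_trans (y := t * a0)); first by rewrite ltr_pM2l.
  have -> : 1 / 2 = (c + c') * a0 by rewrite /a0; field; rewrite gt_eqF// addr_gt0.
  by rewrite ler_wpM2r// ltW.
have x0 s : s < a0 -> [/\ x s = 0, x1 s = 0 & x2 s = 0].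
  move=> sa; have h := lt_ s c sa c0 _; have h' := lt_ s c' sa c0' _.
  have {}h : c * s < 1 / 2 by apply: h; lra.
  have {}h' : c' * s < 1 / 2 by apply: h'; lra.
  have n1 : ~ (1 / 2 <= c * s <= 4) by rewrite leNgt h.
  have n2 : ~ (1 / 2 <= c' * s <= 4) by rewrite leNgt h'.
  rewrite /x /x1 /x2 (bu_0 B (ltW h)) (bu_0 B (ltW h')) (bu_s B n1) (bu_s B n2).
  by rewrite (bump_supp1 B n1) (bump_supp1 B n2) !mulr0 !subrr.
have [y1 [y2 [Y YE]]] := solution_cut k a00 X x0.
have fs : supp (fun s => x s * G0 k s) a0 1.
  move=> s ns; have [sa|sa] := ltP s a0; first by have [-> _ _] := x0 s sa; rewrite mul0r.
  have s1 : 1 < s by rewrite ltNge; apply/negP => h; apply: ns; rewrite sa.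
  rewrite /x (bu_4 B (s := c * s)); last by have := ler_pM _ _ c4 (ltW s1); rewrite mulr1; apply; lra.
  rewrite (bu_4 B (s := c' * s)); last by have := ler_pM _ _ c4' (ltW s1); rewrite mulr1; apply; lra.
  by rewrite subrr mul0r.
have T0 := TT_Mop ez Y fs (lexx 1).
have cH : continuous (Hkb c) by apply: (Hk_cont B c0).
have cH' : continuous (Hkb c') by apply: (Hk_cont B c0').
have sH : supp (Hkb c) (2 * c)^-1 (4 / c) by exact: (@Hk_supp _ k _ _ _ _ _ B c c0).
have sH' : supp (Hkb c') (2 * c')^-1 (4 / c') by exact: (@Hk_supp _ k _ _ _ _ _ B c' c0').
apply/eqP; rewrite -subr_eq0 -(TT_B z cH sH cH' sH').
apply/eqP; rewrite -[RHS]T0; congr TT; apply/funext => s.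
by rewrite YE /x1 /x2 /Hk; ring.
Qed.

Lemma sqd_box (z y : pt) (t : R) : 0 < t -> sqd z y <= t ^+ 2 -> boxn z t y.
Proof.
move=> t0 h; have q1 := sqr_ge0 (y.1.1 - z.1.1); have q2 := sqr_ge0 (y.1.2 - z.1.2).
have q3 := sqr_ge0 (y.2 - z.2); move: h; rewrite /sqd => h.
by split; apply: sqr_le_norm => //; lra.
Qed.

(** The kernel concentrates in the ball of radius 2 r about z, where p is nearly constant, and its
    L^1 norm is bounded uniformly in r; the mirror image falls below the plane and contributes
    nothing. *)
Lemma TT_limit (z : pt) (eta : R) : ext z -> 0 < z.2 -> 0 < eta ->
  exists2 r1 : R, 0 < r1 & forall r, 0 < r -> r <= r1 ->
    `|TT z (Hkb (r^-1 ^+ 2)) - p z * Dk k b b1 (r^-1 ^+ 2)| <= eta.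
Proof.
move=> ez z0 eta0; have [C hC] := J_Hk_bound k0 B.
have Nz : N z by apply/half => //; apply: ez; rewrite sqdxx.
pose C' := `|C| + 1; have C'0 : 0 < C' by rewrite ltr_wpDl.
have e0 : 0 < eta / C' by rewrite divr_gt0.
have [rho rho0 hrho] : exists2 r : R, 0 < r & boxn z r `<=` [set y | N y /\ `|p y - p z| <= eta / C'].
  apply: near_boxn; have cp := hs_c H Nz.
  have n1 : \forall y \near z, N y by apply: open_nbhs_nbhs; split => //; exact: hg_open H.
  move/cvgrPdist_le: cp => /(_ _ e0) n2; apply: filterS2 n1 n2 => y h1 h2; split => //.
  by rewrite distrC.
(* 1/4 keeps the ball of radius 2 r within unit distance, rho / 2 keeps it where p is close to p z,
   and z.2 / 3 keeps the mirror ball below the plane. *)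
pose r1 := Num.min (1 / 4) (Num.min (rho / 2) (z.2 / 3)).
have r10 : 0 < r1 by rewrite !lt_min !divr_gt0.
exists r1 => // r r0; rewrite !le_min => /andP[r4 /andP[rr rz]].
set c := r^-1 ^+ 2; have c0 : 0 < c by rewrite exprn_gt0// invr_gt0.
have rn : r != 0 by rewrite gt_eqF.
have cE : 4 / c = (2 * r) ^+ 2 by rewrite /c; field.
have r21 : (2 * r) ^+ 2 <= 1 by apply: exprn_ile1; lra.
have cH : continuous (Hkb c) by apply: (Hk_cont B c0).
have sH : supp (Hkb c) (2 * c)^-1 (4 / c) by exact: (@Hk_supp _ k _ _ _ _ _ B c c0).
have Hz s : (2 * r) ^+ 2 < s -> Hkb c s = 0.
  by move=> hs; apply: sH => /andP[_]; rewrite cE leNgt hs.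
have LT := L1_TT z cH sH; have LR := L1_rad z cH sH.
have LRn := L1_norm LR.
have ref y : \1_N y * Hkb c (sqd (sg z) y) = 0.
  have [Ny|Ny] := pselect (N y); last by rewrite indic0' ?mul0r.
  have [h|h] := leP (sqd (sg z) y) ((2 * r) ^+ 2); last by rewrite Hz// mulr0.
  have y0 : 0 < y.2 by apply/half => //; apply: (ext_sg ez); exact: le_trans r21.
  have [_ _] := sqd_box (mulr_gt0 (ltr0n _ 2) r0) h; rewrite /= opprK gtr0_norm ?addr_gt0//; lra.
have key y : `|\1_N y * (p y * (Hkb c (sqd z y) + Hkb c (sqd (sg z) y))) - p z * Hkb c (sqd z y)| <=
   eta / C' * `|Hkb c (sqd z y)|.
  have -> : \1_N y * (p y * (Hkb c (sqd z y) + Hkb c (sqd (sg z) y))) =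
     \1_N y * p y * Hkb c (sqd z y) + p y * (\1_N y * Hkb c (sqd (sg z) y)).
    by move: (\1_N y) (p y) (Hkb c (sqd z y)) (Hkb c (sqd (sg z) y)) => *; ring.
  rewrite ref mulr0 addr0; have [h|h] := leP (sqd z y) ((2 * r) ^+ 2); last first.
    by rewrite Hz// !mulr0 subrr normr0 mulr0.
  have [] := hrho y.
    by have [h1 h2 h3] := sqd_box (mulr_gt0 (ltr0n _ 2) r0) h; split; lra.
  by move=> Ny py; rewrite indic1// mul1r -mulrBl normrM ler_wpM2r.
have -> : TT z (Hkb c) - p z * Dk k b b1 c =
   J mu3 (fun y => \1_N y * (p y * (Hkb c (sqd z y) + Hkb c (sqd (sg z) y))) - p z * Hkb c (sqd z y)).
  rewrite (J_B LT (L1_Z (p z) LR)) (J_Z (p z) LR) /Dk.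
  by rewrite (J_rad_translate z cH sH).
have LD := L1_B LT (L1_Z (p z) LR).
apply: (le_trans (J_norm LD)).
apply: (le_trans (J_le (mu := mu3) (L1_norm LD) (L1_Z _ LRn) key)).
rewrite (J_Z _ LRn).
have cHn : continuous (fun s => `|Hkb c s|) by move=> s; apply: cvg_norm; exact: cH.
have sHn : supp (fun s => `|Hkb c s|) (2 * c)^-1 (4 / c) by move=> s /sH ->; rewrite normr0.
rewrite (J_rad_translate z cHn sHn).
have rh : r <= 1 / 2 by lra.
apply: (le_trans (ler_wpM2l (ltW e0) (hC r r0 rh))).
rewrite mulrAC ler_pdivrMr// ler_wpM2l ?(ltW eta0)//.
by rewrite /C'; have := ler_norm C; lra.
Qed.

(** The masses [Dk] are only known to stay away from 0, not to converge. For one and the same r, the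
    values [TT] at z and at a reference point w are close to p z D and p w D with a common D;
    eliminating D gives p w TT z = p z TT w exactly. The lower bound on |D| makes TT w nonzero. If p
    vanishes identically on the region, any constant serves. *)
Theorem mean_value : exists c : R, forall z, ext z -> 0 < z.2 -> p z = c * TT z (Hkb 8).
Proof.
have [D0 D00 [rD rD0 hD]] := Dk_lower k0 B.
have lim (z : pt) eta : ext z -> 0 < z.2 -> 0 < eta -> exists2 r1 : R, 0 < r1 &
    forall r, 0 < r -> r <= r1 -> `|TT z (Hkb 8) - p z * Dk k b b1 (r^-1 ^+ 2)| <= eta.
  move=> ez z0 e0; have [r1 r10 h] := TT_limit ez z0 e0.
  exists (Num.min r1 (1 / 2)); first by rewrite lt_min r10 divr_gt0.
  move=> r r0; rewrite le_min => /andP[h1 h2].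
  rewrite (@TT_indep z 8 (r^-1 ^+ 2)) ?ler_nat//; first exact: h.
  have ri : 2 <= r^-1 by rewrite -[leLHS]invrK lef_pV2 ?posrE ?invr_gt0//; lra.
  by have -> : 4 = 2 ^+ 2 :> R; [rewrite -natrX|rewrite lerXn2r ?nnegrE//; lra].
have [[w [ew w0 pw]]|none] := pselect (exists w : pt, [/\ ext w, 0 < w.2 & p w != 0]); last first.
  exists 0 => z ez z0; rewrite mul0r; apply/eqP/negPn/negP => pz.
  by apply: none; exists z.
have pair (z : pt) eta : ext z -> 0 < z.2 -> 0 < eta -> exists2 D : R, D0 <= `|D| &
    `|TT z (Hkb 8) - p z * D| <= eta /\ `|TT w (Hkb 8) - p w * D| <= eta.
  move=> ez z0 e0; have [r1 r10 h1] := lim z eta ez z0 e0; have [r2 r20 h2] := lim w eta ew w0 e0.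
  pose r := Num.min rD (Num.min r1 r2).
  have r0 : 0 < r by rewrite !lt_min rD0 r10 r20.
  exists (Dk k b b1 (r^-1 ^+ 2)); last by split; [apply: h1|apply: h2] => //; rewrite /r !ge_min lexx ?orbT.
  have := hD r r0; rewrite -normrN => h; apply: (le_trans _ (ler_norm _)); apply: h.
  by rewrite /r ge_min lexx.
have pwp : 0 < `|p w| by rewrite normr_gt0.
have I0 : TT w (Hkb 8) != 0.
  have [|D hDl [_ h]] := pair w (`|p w| * D0 / 2) ew w0; first by rewrite divr_gt0// mulr_gt0.
  apply/eqP => E; move: h; rewrite E sub0r normrN normrM => h.
  have : `|p w| * D0 <= `|p w| * `|D| by rewrite ler_wpM2l.
  have := mulr_gt0 pwp D00; lra.
exists (p w / TT w (Hkb 8)) => z ez z0.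
have E : p w * TT z (Hkb 8) = p z * TT w (Hkb 8).
  apply/eqP; rewrite -subr_eq0 -normr_le0; apply/ler_addgt0Pr => e e0; rewrite add0r.
  pose K := `|p w| + `|p z| + 1; have K0 : 0 < K by rewrite /K; have := normr_ge0 (p z); lra.
  have [|D _ [h1 h2]] := pair z (e / K) ez z0; first by rewrite divr_gt0.
  have -> : p w * TT z (Hkb 8) - p z * TT w (Hkb 8) =
     p w * (TT z (Hkb 8) - p z * D) - p z * (TT w (Hkb 8) - p w * D).
    by move: (TT z _) (TT w _) => u v; ring.
  apply: (le_trans (ler_normB _ _)); rewrite !normrM.
  apply: (le_trans (lerD (ler_wpM2l (normr_ge0 _) h1) (ler_wpM2l (normr_ge0 _) h2))).
  rewrite -mulrDl mulrA ler_pdivrMr// mulrC ler_wpM2l ?(ltW e0)//; rewrite /K; lra.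
by rewrite mulrAC E mulfK.
Qed.
End MeanValue.

(** * Extension across the flat boundary, flux and decay *)

Section Potential.
Variable R : realType.
Local Notation pt := (pt R).

Lemma mvt_sym (F F1 : R -> R) (t : R) : (forall s, is_derive s (1 : R) F (F1 s)) ->
  exists2 c, `|c| <= `|t| & F t - F 0 = F1 c * t.
Proof.
move=> dF; have cF a b : {within `[a, b], continuous F}.
  by apply: continuous_subspaceT => s; exact: is_derive1_continuous (dF s).
have [t0|t0] := leP 0 t.
  have [c] := MVT_segment t0 (fun x _ => dF x) (cF _ _).
  rewrite in_itv /= subr0 => /andP[c0 ct] E; exists c => //.
  by rewrite !ger0_norm.
have [c] := MVT_segment (ltW t0) (fun x _ => dF x) (cF _ _).
rewrite in_itv /= sub0r => /andP[c0 ct] E; exists c.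
  by rewrite ler0_norm// ltr0_norm// lerN2.
by rewrite -[LHS]opprB E mulrN opprK.
Qed.

Lemma taylor_two (F F1 F2 : R -> R) (C : R) : (forall s, is_derive s (1 : R) F (F1 s)) ->
  (forall s, is_derive s (1 : R) F1 (F2 s)) -> (forall s, `|F2 s| <= C) ->
  `|F 1 - F 0 - F1 0| <= C.
Proof.
move=> d d1 h; have C0 : 0 <= C by apply: le_trans (h 0).
have [c c1 E] := mvt_sym 1 d; have [c' c2 E'] := mvt_sym c d1.
rewrite E mulr1 E' normrM -[leRHS]mulr1; apply: ler_pM => //.
by move: c1; rewrite normr1.
Qed.

Section OneCentre.
Variables (h h1 h2 : R -> R) (a d C1 C2 : R).
Hypothesis (Hh : C2R h h1 h2) (hs : supp h a 1).
Hypotheses (b1 : forall s, `|h1 s| <= C1) (b2 : forall s, `|h2 s| <= C2).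

Definition dotp (e y z : pt) : R :=
  e.1.1 * (z.1.1 - y.1.1) + e.1.2 * (z.1.2 - y.1.2) + e.2 * (z.2 - y.2).

Lemma dotp_le (e y z : pt) : dotp e y z ^+ 2 <= nrm2 e * sqd y z.
Proof.
rewrite /dotp /nrm2 /sqd; move: (z.1.1 - _) (z.1.2 - _) (z.2 - _) (e.1.1) (e.1.2) (e.2) => u v w p q r.
have h3 := sqr_ge0 (p * v - q * u); have h4 := sqr_ge0 (p * w - r * u); have h5 := sqr_ge0 (q * w - r * v).
rewrite -subr_ge0 [leRHS](_ : _ = (p * v - q * u) ^+ 2 + (p * w - r * u) ^+ 2 + (q * w - r * v) ^+ 2).
  by rewrite !addr_ge0.
by ring.
Qed.

Definition ln (z e : pt) (t : R) : pt := aff3 t z e.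
Lemma lnE z e t : ln z e t = z + t *: e.
Proof. by case: z e => [[z1 z2] z3] [[e1 e2] e3]; congr (_, _, _); rewrite /aff1 addrC. Qed.

Lemma sqd_ln y z e t : sqd y (ln z e t) = sqd y z + 2 * t * dotp e y z + t ^+ 2 * nrm2 e.
Proof. by rewrite /sqd /dotp /nrm2 /=; rewrite /aff1; ring. Qed.

Lemma dotp_ln e' y z e t : dotp e' y (ln z e t) = dotp e' y z + t * dotp e' 0 e.
Proof. by rewrite /dotp /= /aff1; rewrite !subr0; ring. Qed.

Lemma dotpee e : dotp e 0 e = nrm2 e.
Proof. by rewrite /dotp /nrm2 /= !subr0; ring. Qed.

Lemma sqd_ln_d y z e (t : R) : is_derive t (1 : R) (fun s => sqd y (ln z e s)) (2 * dotp e y (ln z e t)).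
Proof.
rewrite [X in is_derive _ _ X](_ : _ = fun s => sqd y z + dotp e y z * (2 * s) + nrm2 e * s ^+ 2); last first.
  by apply/funext => s; rewrite sqd_ln; ring.
have dd := is_dD (is_dD (is_dC (sqd y z) t (1 : R)) (is_dZ (dotp e y z) (is_dZ 2 (is_derive_id t (1 : R)))))
   (is_dZ (nrm2 e) (is_d_exprn 2 t)).
by apply: (is_derive_eq dd); rewrite dotp_ln dotpee /= expr1; ring.
Qed.

Lemma dotp_ln_d e' y z e (t : R) : is_derive t (1 : R) (fun s => dotp e' y (ln z e s)) (dotp e' 0 e).
Proof.
rewrite [X in is_derive _ _ X](_ : _ = fun s => dotp e' y z + dotp e' 0 e * s); last first.
  by apply/funext => s; rewrite dotp_ln; ring.
apply: (is_derive_eq (is_dD (is_dC (dotp e' y z) t (1 : R)) (is_dZ (dotp e' 0 e) (is_derive_id t (1 : R))))).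
by ring.
Qed.

Lemma hs1 : supp h1 a 1. Proof. by have [] := C2R_supp Hh hs. Qed.
Lemma hs2 : supp h2 a 1. Proof. by have [] := C2R_supp Hh hs. Qed.
Lemma C2_ge0 : 0 <= C2. Proof. exact: le_trans (normr_ge0 _) (b2 0). Qed.

(** [h2] vanishes beyond unit distance, and within it Cauchy-Schwarz bounds the dot products. Thus
    the estimates below are uniform in the centre y. *)
Lemma prod_bound (e e' y z : pt) : `|dotp e y z * dotp e' y z * h2 (sqd y z)| <= enorm3 e * enorm3 e' * C2.
Proof.
have [s1|s1] := leP (sqd y z) 1; last first.
  rewrite hs2; last by move=> /andP[_]; rewrite leNgt s1.
  by rewrite mulr0 normr0 !mulr_ge0// ?C2_ge0// enorm3_ge0.
have key (u : pt) : `|dotp u y z| <= enorm3 u.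
  rewrite -sqrtr_sqr ler_wsqrtr//; apply: (le_trans (dotp_le u y z)).
  by rewrite ler_piMr// nrm2_ge0.
by rewrite !normrM; apply: ler_pM; rewrite ?mulr_ge0//; apply: ler_pM.
Qed.

Lemma kernel_taylor (y z e : pt) :
  `|h (sqd y (z + e)) - h (sqd y z) - 2 * dotp e y z * h1 (sqd y z)| <= (4 * C2 + 2 * C1) * nrm2 e.
Proof.
pose F t := h (sqd y (ln z e t)).
pose F1 t := h1 (sqd y (ln z e t)) * (2 * dotp e y (ln z e t)).
pose F2 t := (h2 (sqd y (ln z e t)) * (2 * dotp e y (ln z e t))) * (2 * dotp e y (ln z e t)) +
   h1 (sqd y (ln z e t)) * (2 * dotp e 0 e).
have dF t : is_derive t (1 : R) F (F1 t) by exact: is_dcomp (r_d Hh _) (sqd_ln_d y z e t).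
have dF1 t : is_derive t (1 : R) F1 (F2 t).
  exact: is_dM (is_dcomp (r_d1 Hh _) (sqd_ln_d y z e t)) (is_dZ 2 (dotp_ln_d e y z e t)).
have B t : `|F2 t| <= (4 * C2 + 2 * C1) * nrm2 e.
  rewrite /F2 dotpee; have hp := prod_bound e e y (ln z e t).
  apply: (le_trans (ler_normD _ _)); rewrite [leRHS]mulrDl; apply: lerD.
    rewrite [X in `|X|](_ : _ = 4 * (dotp e y (ln z e t) * dotp e y (ln z e t) * h2 (sqd y (ln z e t)))); last by ring.
    rewrite normrM ger0_norm// -[4 * C2 * _]mulrA ler_wpM2l// [leRHS]mulrC.
    by rewrite -enorm3_sqr expr2; exact: hp.
  rewrite normrM mulrC -[2 * C1 * _]mulrA [C1 * _]mulrC mulrA; apply: ler_pM => //.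
  by rewrite ger0_norm// mulr_ge0// nrm2_ge0.
have := taylor_two dF dF1 B; rewrite /F /F1.
have -> : ln z e 1 = z + e by rewrite lnE scale1r.
have -> : ln z e 0 = z by rewrite lnE scale0r addr0.
by rewrite [h1 _ * _]mulrC.
Qed.

Lemma kernel_lipschitz (e' y z e : pt) :
  `|2 * dotp e' y (z + e) * h1 (sqd y (z + e)) - 2 * dotp e' y z * h1 (sqd y z)| <=
  (4 * C2 + 2 * C1) * (enorm3 e' * enorm3 e).
Proof.
pose F t := 2 * dotp e' y (ln z e t) * h1 (sqd y (ln z e t)).
pose F1 t := 2 * dotp e' 0 e * h1 (sqd y (ln z e t)) + 2 * dotp e' y (ln z e t) * (h2 (sqd y (ln z e t)) * (2 * dotp e y (ln z e t))).
have dF t : is_derive t (1 : R) F (F1 t).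
  exact: is_dM (is_dZ 2 (dotp_ln_d e' y z e t)) (is_dcomp (r_d1 Hh _) (sqd_ln_d y z e t)).
have [c _] := mvt_sym 1 dF; rewrite /F mulr1.
have -> : ln z e 1 = z + e by rewrite lnE scale1r.
have -> : ln z e 0 = z by rewrite lnE scale0r addr0.
move=> ->; rewrite /F1 addrC; have hp := prod_bound e e' y (ln z e c).
apply: (le_trans (ler_normD _ _)); rewrite [leRHS]mulrDl; apply: lerD.
  rewrite [X in `|X|](_ : _ = 4 * (dotp e y (ln z e c) * dotp e' y (ln z e c) * h2 (sqd y (ln z e c)))); last by ring.
  rewrite normrM ger0_norm// -[4 * C2 * _]mulrA ler_wpM2l// [leRHS]mulrC.
  by rewrite [enorm3 e' * _]mulrC.
rewrite -[2 * dotp e' 0 e * _]mulrA normrM ger0_norm// -[2 * C1 * _]mulrA ler_wpM2l//.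
rewrite normrM [leRHS]mulrC; apply: ler_pM => //.
have s0e : sqd 0 e = nrm2 e by rewrite /sqd /nrm2 /= !subr0.
rewrite -sqrtr_sqr /enorm3 -sqrtrM ?nrm2_ge0// ler_wsqrtr//.
by apply: (le_trans (dotp_le e' 0 e)); rewrite s0e.
Qed.
End OneCentre.

Lemma co_le_norm (e : pt) : nrm2 e <= 3 * `|e| ^+ 2.
Proof.
have h1 : `|e.1| <= `|e| by rewrite [leRHS]prod_normE le_max lexx.
have h2 : `|e.2| <= `|e| by rewrite [leRHS]prod_normE le_max lexx orbT.
have h3 : `|e.1.1| <= `|e| by apply: le_trans h1; rewrite [leRHS]prod_normE le_max lexx.
have h4 : `|e.1.2| <= `|e| by apply: le_trans h1; rewrite [leRHS]prod_normE le_max lexx orbT.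
have key (t : R) : `|t| <= `|e| -> t ^+ 2 <= `|e| ^+ 2.
  by move=> h; rewrite -[t ^+ 2]real_normK ?num_real// lerXn2r ?nnegrE.
rewrite /nrm2; have := key _ h2; have := key _ h3; have := key _ h4; lra.
Qed.

Lemma diff_of_quadratic (f : pt -> R) (z : pt) (l1 l2 l3 K : R) :
  (forall e, `|f (z + e) - f z - (e.1.1 * l1 + e.1.2 * l2 + e.2 * l3)| <= K * nrm2 e) ->
  differentiable f z /\ forall e, is_derive z e f (e.1.1 * l1 + e.1.2 * l2 + e.2 * l3).
Proof.
move=> hf; pose L (e : pt) := e.1.1 * l1 + e.1.2 * l2 + e.2 * l3.
have cL : continuous L.
  apply: cD; [apply: cD|]; apply: cM; try exact: cC; [exact: c_co1|exact: c_co2|exact: c_co3].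
have lL : linear L.
  by move=> t x y; rewrite /L /= /GRing.scale /=; ring.
pose F : {linear pt -> R} := HB.pack L (GRing.isLinear.Build _ _ _ _ L lL).
have K0 : 0 <= `|K| by [].
have oF : f \o shift z = cst (f z) + F +o_ (0 : pt) id.
  apply/eqaddoP => _/posnumP[eps].
  have d0 : 0 < eps%:num / (3 * `|K| + 1) by rewrite divr_gt0// ltr_wpDl// mulr_ge0.
  have n0 : \forall e \near (0 : pt), `|e| < eps%:num / (3 * `|K| + 1) by apply: nbhs0_lt.
  apply: filterS n0 => e he.
  rewrite /= [X in `|X|](_ : _ = f (z + e) - f z - L e); last first.
    by rewrite [z + e]addrC -addrA -opprD.
  apply: (le_trans (hf e)); apply: (le_trans (ler_wpM2r (nrm2_ge0 e) (ler_norm K))).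
  apply: (le_trans (ler_wpM2l K0 (co_le_norm e))).
  move: he; rewrite ltr_pdivlMr ?ltr_wpDl ?mulr_ge0// => he.
  have e0 := normr_ge0 e; rewrite expr2 !mulrA ler_wpM2r//.
  by move: he; rewrite mulrDr mulr1 => he; rewrite [`|K| * 3]mulrC; lra.
have dE := @diff_unique R pt R f F z cL oF.
have df : differentiable f z by apply/diff_locallyP; rewrite dE.
split => // e; apply: DeriveDef; first exact: diff_derivable.
by rewrite deriveE// dE.
Qed.

Section OfDensity.
Variables (q : pt -> R) (cc : pt -> pt) (h h1 h2 : R -> R) (a : R).
Hypotheses (Lq : L1 mu3 q) (ccc : continuous cc) (Hh : C2R h h1 h2) (hs : supp h a 1).

(** The map [cc] moves the centres and will be the identity or the reflection [sg]. The second-order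
    fields are placeholders, since only [isC1] is claimed. *)
Definition jpot : jet R := Jet (fun z => J mu3 (fun y => q y * h (sqd (cc y) z)))
  (fun z => J mu3 (fun y => q y * (2 * dotp (e1 R) (cc y) z * h1 (sqd (cc y) z))))
  (fun z => J mu3 (fun y => q y * (2 * dotp (e2 R) (cc y) z * h1 (sqd (cc y) z))))
  (fun z => J mu3 (fun y => q y * (2 * dotp (e3 R) (cc y) z * h1 (sqd (cc y) z))))
  (fun=> 0) (fun=> 0) (fun=> 0).

Lemma L1_bdd (g : pt -> R) C : continuous g -> (forall y, `|g y| <= C) -> L1 mu3 (fun y => q y * g y).
Proof.
move=> cg gC; apply: (L1_le (mu := mu3) (g := fun y => C * `|q y|)).
- by apply: measurable_funM; [exact: L1_meas Lq|exact: continuous_measurable3].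
- by move=> y; rewrite normrM mulrC ler_wpM2r.
- exact: L1_Z (L1_norm Lq).
Qed.

Lemma c_sqd_cc z : continuous (fun y => sqd (cc y) z).
Proof.
have E y : sqd (cc y) z = sqd z (cc y) by rewrite /sqd; ring.
rewrite (_ : (fun y => _) = fun y => sqd z (cc y)); last by apply/funext.
by move=> y; apply: continuous_comp; [exact: ccc|exact: c_sqd].
Qed.

Lemma c_dotp_cc e z : continuous (fun y => dotp e (cc y) z).
Proof.
have cc' (p : pt -> R) : continuous p -> continuous (fun y => p (cc y)).
  by move=> cp y; apply: continuous_comp; [exact: ccc|exact: cp].
apply: cD; [apply: cD|]; (apply: cM; first exact: cC); (apply: cD; first exact: cC); apply: cN.
- exact: cc' (@c_co1 R).
- exact: cc' (@c_co2 R).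
- exact: cc' (@c_co3 R).
Qed.

(** Taylor and Lipschitz estimates for the kernel, uniform in the centre, are integrated against
    |q|. They yield differentiability and continuity of the derivatives without a theorem on
    differentiation under the integral. *)
Lemma isC1_pot : isC1 jpot.
Proof.
have s1 := hs1 Hh hs; have s2 := hs2 Hh hs.
have [C0 C00 hC0] := cont_csupp_bounded (r_c Hh) hs.
have [C1 C10 hC1] := cont_csupp_bounded (r_c1 Hh) s1.
have [C2 C20 hC2] := cont_csupp_bounded (r_c2 Hh) s2.
pose K := 4 * C2 + 2 * C1.
have cq z : continuous (fun y => h (sqd (cc y) z)).
  exact: ccomp (r_c Hh) (@c_sqd_cc z).
have L z : L1 mu3 (fun y => q y * h (sqd (cc y) z)).
  by apply: (L1_bdd (C := C0)).
have Ld e z : L1 mu3 (fun y => q y * (2 * dotp e (cc y) z * h1 (sqd (cc y) z))).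
  apply: (L1_bdd (C := 2 * (enorm3 e * C1))).
    apply: cM; first by apply: cM; [exact: cC|exact: c_dotp_cc].
    exact: ccomp (r_c1 Hh) (@c_sqd_cc z).
  move=> y; rewrite -mulrA normrM ger0_norm// ler_wpM2l//.
  have [sy|sy] := leP (sqd (cc y) z) 1; last first.
    rewrite s1; last by move=> /andP[_]; rewrite leNgt sy.
    by rewrite mulr0 normr0 mulr_ge0// enorm3_ge0.
  rewrite normrM; apply: ler_pM => //; rewrite -sqrtr_sqr ler_wsqrtr//.
  by apply: (le_trans (dotp_le e (cc y) z)); rewrite ler_piMr// nrm2_ge0.
have Ln := L1_norm Lq.
have split_dot (e y z : pt) : dotp e y z = e.1.1 * dotp (e1 R) y z + e.1.2 * dotp (e2 R) y z + e.2 * dotp (e3 R) y z.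
  by rewrite /dotp /=; ring.
have tay z e : `|jf jpot (z + e) - jf jpot z - (e.1.1 * j1 jpot z + e.1.2 * j2 jpot z + e.2 * j3 jpot z)| <=
     (K * J mu3 (fun y => `|q y|)) * nrm2 e.
  have E : e.1.1 * j1 jpot z + e.1.2 * j2 jpot z + e.2 * j3 jpot z =
      J mu3 (fun y => q y * (2 * dotp e (cc y) z * h1 (sqd (cc y) z))).
    rewrite /= -(J_Z _ (Ld _ z)) -(J_Z _ (Ld _ z)) -(J_Z _ (Ld _ z)).
    rewrite -(J_D (L1_Z _ (Ld _ z)) (L1_Z _ (Ld _ z))) -(J_D (L1_D (L1_Z _ (Ld _ z)) (L1_Z _ (Ld _ z))) (L1_Z _ (Ld _ z))).
    by apply: J_eq => y; rewrite (split_dot e); ring.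
  rewrite E /= -(J_B (L _) (L _)) -(J_B (L1_B (L _) (L _)) (Ld e z)).
  apply: (le_trans (J_norm (L1_B (L1_B (L _) (L _)) (Ld e z)))).
  have -> : K * J mu3 (fun y => `|q y|) * nrm2 e = J mu3 (fun y => K * nrm2 e * `|q y|).
    by rewrite (J_Z _ Ln); ring.
  apply: (J_le (mu := mu3)) (L1_norm (L1_B (L1_B (L _) (L _)) (Ld e z))) (L1_Z _ Ln) _ => y.
  rewrite -!mulrBr normrM mulrC ler_wpM2r//.
  exact: kernel_taylor Hh hs hC1 hC2 _ _ _.
have [dz dd] : (forall z, differentiable (jf jpot) z) /\
   (forall z e, is_derive z e (jf jpot) (e.1.1 * j1 jpot z + e.1.2 * j2 jpot z + e.2 * j3 jpot z)).
  by split=> z; have [h3 h4] := diff_of_quadratic (tay z).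
have lip (e' : pt) (f := fun z => J mu3 (fun y => q y * (2 * dotp e' (cc y) z * h1 (sqd (cc y) z)))) : continuous f.
  pose K' := K * enorm3 e' * J mu3 (fun y => `|q y|) + 1.
  have K'0 : 0 < K'.
    by rewrite ltr_wpDl// !mulr_ge0 ?enorm3_ge0 ?addr_ge0 ?mulr_ge0//; exact: J_ge0.
  have bd z e : `|f (z + e) - f z| <= K' * enorm3 e.
    rewrite /f -(J_B (Ld _ _) (Ld _ _)); apply: (le_trans (J_norm (L1_B (Ld _ _) (Ld _ _)))).
    apply: (le_trans (y := J mu3 (fun y => K * (enorm3 e' * enorm3 e) * `|q y|))).
      apply: (J_le (mu := mu3)) (L1_norm (L1_B (Ld _ _) (Ld _ _))) (L1_Z _ Ln) _ => y.
      rewrite -!mulrBr normrM mulrC ler_wpM2r//.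
      exact: kernel_lipschitz Hh hs hC1 hC2 _ _ _ _.
    rewrite (J_Z _ Ln) /K'; move: (J mu3 _) => I; rewrite -subr_ge0.
    by rewrite [leRHS](_ : _ = enorm3 e) ?enorm3_ge0//; ring.
  move=> z; apply/cvgrPdist_lt => eps eps0.
  have ce : {for (0 : pt), continuous (@enorm3 R)} by exact: c_enorm3.
  have e00 : enorm3 (0 : pt) = 0 by rewrite /enorm3 /= expr0n /= !addr0 sqrtr0.
  have n0 : \forall e \near (0 : pt), enorm3 e < eps / K'.
    move/cvgrPdist_lt: ce => /(_ (eps / K')); rewrite divr_gt0// => /(_ isT).
    by apply: filterS => e; rewrite e00 sub0r normrN ger0_norm ?enorm3_ge0.
  have cz : (fun w => w - z) @ z --> (0 : pt).
    by rewrite -[X in _ --> X](subrr z); apply: cvgB; [exact: cvg_id|exact: cvg_cst].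
  have nz : \forall w \near z, enorm3 (w - z) < eps / K' by exact: cz _ n0.
  apply: filterS nz => w /= hw; rewrite distrC -[w](subrK z) [_ + z]addrC.
  apply: (le_lt_trans (bd z (w - z))); rewrite mulrC -ltr_pdivlMr//.
split; rewrite ?/jpot.
- exact: dz.
- by move=> z; apply: (is_derive_eq (dd z (e1 R))); rewrite /= !mul0r mul1r !addr0.
- by move=> z; apply: (is_derive_eq (dd z (e2 R))); rewrite /= !mul0r mul1r !addr0 add0r.
- by move=> z; apply: (is_derive_eq (dd z (e3 R))); rewrite /= !mul0r mul1r !add0r.
- exact: lip.
- exact: lip.
- exact: lip.
Qed.
End OfDensity.
End Potential.

Section Extension.
Variables (R : realType) (k : R).
Hypothesis k0 : 0 < k.
Local Notation pt := (pt R).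
Variables (N flat : set pt) (m : R * R -> R) (s0 : R).
Hypothesis s00 : 0 < s0.
Hypothesis half : forall x : pt, s0 <= nrm2 x -> N x <-> 0 < x.2.
Hypothesis flatx : forall x : pt, s0 <= nrm2 x -> flat x.
Hypothesis graph0 : forall y, s0 <= nrm2 ((y, m y) : pt) -> m y = 0.

(** From |z|^2 <= 2 |y|^2 + 2 |z - y|^2. *)
Lemma ext_large (z : pt) : 2 * s0 + 2 < nrm2 z -> ext s0 z.
Proof.
move=> hz y; rewrite /sqd => h; move: hz; rewrite /nrm2.
have q1 := sqr_ge0 (y.1.1 - z.1.1 + y.1.1); have q2 := sqr_ge0 (y.1.2 - z.1.2 + y.1.2).
have q3 := sqr_ge0 (y.2 - z.2 + y.2).
move: (y.1.1) (y.1.2) (y.2) (z.1.1) (z.1.2) (z.2) h q1 q2 q3 => *; nra.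
Qed.

Lemma near_gtc (f : pt -> R) (z : pt) (c : R) : {for z, continuous f} -> c < f z -> \forall y \near z, c < f y.
Proof.
move=> /cvgrPdist_lt/(_ (f z - c)); rewrite subr_gt0 => h /h; apply: filterS => y.
by rewrite ltr_distlC => /andP[h' _]; lra.
Qed.
Lemma near_ltc (f : pt -> R) (z : pt) (c : R) : {for z, continuous f} -> f z < c -> \forall y \near z, f y < c.
Proof.
move=> /cvgrPdist_lt/(_ (c - f z)); rewrite subr_gt0 => h /h; apply: filterS => y.
by rewrite ltr_distlC => /andP[_ h']; lra.
Qed.

Lemma s0_le (t : R) : 2 * s0 + 2 < t -> s0 <= t.
Proof. by move=> h; have h0 := s00; lra. Qed.

Definition reg (M : R) (z : pt) := [/\ 2 * s0 + 2 < nrm2 z, 0 < z.2 & enorm3 z < M].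

Lemma reg_near (M : R) (z : pt) : reg M z -> \forall y \near z, reg M y.
Proof.
case=> h1 h2 h3.
have o1 : \forall y \near z, 2 * s0 + 2 < nrm2 y.
  exact: (near_gtc (f := @nrm2 R) (@c_nrm2 R z) h1).
have o2 : \forall y \near z, 0 < y.2 by exact: (near_gtc (f := @co3 R) (@c_co3 R z) h2).
have o3 : \forall y \near z, enorm3 y < M by exact: (near_ltc (f := @enorm3 R) (@c_enorm3 R z) h3).
by apply: filterS3 o1 o2 o3 => y *; split.
Qed.

Lemma reg_N (M : R) (z : pt) : reg M z -> N z.
Proof. by case=> h1 h2 _; apply/half => //; exact: s0_le. Qed.

Lemma c_sg : continuous (@sg R).
Proof.
move=> z.
have h1 : (fun x : pt => x.1) @ z --> z.1 by exact: c_fst.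
have h2 : (fun x : pt => - x.2) @ z --> - z.2 by apply: cvgN; exact: (@c_co3 R).
exact: (cvg_pair h1 h2).
Qed.

Variables (p p1 p2 p3 : pt -> R).
Hypothesis H : hsol k N flat m p p1 p2 p3.

(** The right side of the mean value formula makes sense for every z, and is C^1 in z as a sum of
    two potentials. Moving the reflection from the centre z to the integration variable puts it into
    the form [jpot]. *)
Lemma C1_extension (M : R) : exists2 j : jet R, isC1 j & forall z, reg M z -> jf j z = p z.
Proof.
have [V [b [b1 [b2 [b3 B]]]]] := bump_ex R.
have [c hc] := mean_value k0 H half flatx graph0 B.
have c8 : (0 : R) < 8 by [].
have [h1 [h2 C]] := Hk_C2R k B c8.
have hs : supp (Hk k b b1 8) (2 * 8)^-1 1.
  by apply: supp_le (@Hk_supp _ k _ _ _ _ _ B 8 c8) => //; rewrite ler_pdivrMr// mul1r ler_nat.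
(* Truncation makes the density integrable. For |z| < M neither z nor its mirror image is within
   unit distance of a point outside the ball of radius M + 2, so the formula is unaffected. *)
pose q y := c * (\1_(ball0 (M + 2)) y * (\1_N y * p y)).
have Lq : L1 mu3 q by apply: (L1_Z (mu := mu3)); exact: hs_L H _.
have cid : continuous (fun y : pt => y) by move=> y; exact: cvg_id.
exists (jadd (jpot q (fun y => y) (Hk k b b1 8) h1) (jpot q (@sg R) (Hk k b b1 8) h1)).
  by apply: isC1_add; [exact: isC1_pot Lq cid C hs|exact: isC1_pot Lq c_sg C hs].
move=> z [z1 z2 zM]; rewrite (hc z (ext_large z1) z2) /=.
have cq (cc : pt -> pt) : continuous cc -> L1 mu3 (fun y => q y * Hk k b b1 8 (sqd (cc y) z)).
  move=> ccc; have [C0 _ hC] := cont_csupp_bounded (r_c C) hs.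
  by apply: (L1_bdd Lq (C := C0)) => //; apply: ccomp (r_c C) _; exact: c_sqd_cc.
rewrite -(J_D (cq _ cid) (cq _ c_sg)) /TT.
have LT := L1_TT H z (r_c C) hs.
rewrite -(J_Z c LT); apply: J_eq => y.
have e1 : sqd y z = sqd z y by rewrite /sqd; ring.
have e2 : sqd (sg y) z = sqd (sg z) y by rewrite /sqd /sg /=; ring.
rewrite e1 e2 /q; have [yb|yb] := pselect (ball0 (M + 2) y).
  by rewrite indic1//; move: (Hk _ _ _ _ _) (Hk _ _ _ _ _) => *; ring.
have far : 1 < sqd z y /\ 1 < sqd (sg z) y.
  have zy (w : pt) : enorm3 w < M -> 1 < sqd w y.
    move=> wM; rewrite ltNge; apply/negP => h; apply: yb; rewrite /ball0 /=.
    have M0 : 0 < M by apply: le_lt_trans wM; exact: enorm3_ge0.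
    rewrite enorm3_lt ?addr_gt0//; move: wM; rewrite enorm3_lt// => wM.
    have d0 : dotp y 0 w ^+ 2 <= nrm2 y * nrm2 w.
      by have := dotp_le y 0 w; rewrite [sqd 0 w](_ : _ = nrm2 w)//; rewrite /sqd /nrm2 /= !subr0.
    have E : nrm2 y = sqd w y + 2 * dotp y 0 w - nrm2 w.
      by rewrite /nrm2 /sqd /dotp /= !subr0; ring.
    have n0 := nrm2_ge0 y; have nw := nrm2_ge0 w; have := enorm3_ge0 y.
    have := enorm3_sqr y; move: (enorm3 y) (nrm2 y) (nrm2 w) (sqd w y) (dotp y 0 w) wM d0 E n0 nw h.
    move=> e Y W S D wM d0 E n0 nw h eY e0.
    rewrite ltNge; apply/negP => hY.
    have h1' : (Y + W - 1) ^+ 2 <= 4 * (Y * W) by nra.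
    have h3 : (Y - W) ^+ 2 <= 2 * (Y + W) by nra.
    have h4 : 4 * M + 4 < Y - W by nra.
    nra.
  split; apply: zy => //; by rewrite /enorm3 /sg /= sqrrN.
rewrite (indic0' yb) hs; last by move=> /andP[_]; rewrite leNgt (proj1 far).
rewrite hs; last by move=> /andP[_]; rewrite leNgt (proj2 far).
by rewrite !(mulr0, mul0r, addr0).
Qed.

Lemma jet_extension (M : R) : exists2 j : jet R, isC1 j & forall z, reg M z ->
  [/\ jf j z = p z, j1 j z = p1 z, j2 j z = p2 z & j3 j z = p3 z].
Proof.
have [j C jE] := C1_extension M; exists j => // z rz.
have nz : \forall y \near z, jf j y = p y by apply: filterS (reg_near rz) => y; exact: jE.
have Nz := reg_N rz.
have uniq (e : pt) (l l' : R) : is_derive z e p l -> is_derive z e (jf j) l' -> l' = l.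
  by move=> d1 d2; have [_ <-] := near_eq_is_derive nz d2; have [_ <-] := d1.
split; first exact: jE.
- exact: uniq (hs_d1 H Nz) (C1d1 C z).
- exact: uniq (hs_d2 H Nz) (C1d2 C z).
- exact: uniq (hs_d3 H Nz) (C1d3 C z).
Qed.

Lemma supp_radial_reg (h : R -> R) (a d : R) : supp h a d -> 2 * s0 + 2 < a ->
  exists M, forall z, N z -> h (nrm2 z) != 0 -> reg M z.
Proof.
move=> hs sa; have [M hM] := sqd_large (mkpt 0 0 0 : pt) d.
exists M => z Nz hz; have /andP[h1 h2] : a <= nrm2 z <= d.
  by apply: contraNT hz => /negP n; apply/eqP; exact: hs.
split; first exact: lt_le_trans h1.
  by apply/half => //; apply: s0_le; exact: lt_le_trans h1.
by rewrite ltNge; apply/negP => /hM; rewrite sqd0 ltNge h2.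
Qed.
End Extension.

(** * Conservation of the flux through shells *)

Section Flux.
Variables (R : realType) (k : R).
Hypothesis k0 : 0 < k.
Local Notation pt := (pt R).
Variables (N flat : set pt) (m : R * R -> R) (s0 : R).
Hypothesis s00 : 0 < s0.
Hypothesis half : forall x : pt, s0 <= nrm2 x -> N x <-> 0 < x.2.
Hypothesis flatx : forall x : pt, s0 <= nrm2 x -> flat x.
Hypothesis graph0 : forall y, s0 <= nrm2 ((y, m y) : pt) -> m y = 0.
Variables (A A1 A2 A3 B B1 B2 B3 : pt -> R).
Hypotheses (HA : hsol k N flat m A A1 A2 A3) (HB : hsol k N flat m B B1 B2 B3).

Definition xgrad (p1 p2 p3 : pt -> R) (x : pt) : R := x.1.1 * p1 x + x.1.2 * p2 x + x.2 * p3 x.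
(** With w = A + i B this is -Im(conj(w) x.grad w), a radial flux density. *)
Definition Qf (x : pt) : R := B x * xgrad A1 A2 A3 x - A x * xgrad B1 B2 B3 x.

Lemma csupp_rad (h : R -> R) (a d : R) : supp h a d -> exists r, forall x : pt, r <= enorm3 x -> h (nrm2 x) = 0.
Proof.
by move=> hs; have [r hr] := sqd_csupp (mkpt 0 0 0) hs; exists r => x /hr; rewrite sqd0.
Qed.

(** Products of two locally integrable functions need not be integrable; here the undifferentiated
    factor is replaced by its C^1 extension, which is bounded on the support of the radial
    weight. *)
Lemma L1_Qf (h : R -> R) (a d : R) : continuous h -> supp h a d -> 2 * s0 + 2 < a ->
  L1 mu3 (fun x => \1_N x * (h (nrm2 x) * Qf x)).
Proof.
move=> ch hs sa; have [M hM] := supp_radial_reg s00 half hs sa.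
have [jA CA eA] := jet_extension k0 s00 half flatx graph0 HA M.
have [jB CB eB] := jet_extension k0 s00 half flatx graph0 HB M.
have [r hr] := csupp_rad hs.
have chn : continuous (fun x : pt => h (nrm2 x)) by exact: ccomp ch (@c_nrm2 R).
have T (q : pt -> R) (co : pt -> R) (j : jet R) : Lloc (fun x => \1_N x * q x) -> continuous co ->
    isC1 j -> L1 mu3 (fun x => \1_N x * q x * (h (nrm2 x) * (co x * jf j x))).
  move=> Lq cco Cj; apply: (Lloc_csupp (r := r) Lq).
    by apply: cM => //; apply: cM => //; exact: C1c Cj.
  by move=> x /hr ->; rewrite mul0r.
have LA := L1_D (L1_D (T _ _ _ (hs_L1 HA) (@c_co1 R) CB) (T _ _ _ (hs_L2 HA) (@c_co2 R) CB)) (T _ _ _ (hs_L3 HA) (@c_co3 R) CB).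
have LB := L1_D (L1_D (T _ _ _ (hs_L1 HB) (@c_co1 R) CA) (T _ _ _ (hs_L2 HB) (@c_co2 R) CA)) (T _ _ _ (hs_L3 HB) (@c_co3 R) CA).
apply: (@L1_eq _ _ _ mu3 _ _ _ (L1_B LA LB)) => x.
have [xN|xN] := pselect (N x); last by rewrite (indic0' xN) !mul0r !addr0 subrr.
have [h0|h0] := eqVneq (h (nrm2 x)) 0; first by rewrite h0 !(mul0r, mulr0, addr0) subrr.
have [-> _ _ _] := eA x (hM x xN h0); have [-> _ _ _] := eB x (hM x xN h0).
by rewrite /Qf /xgrad /co1 /co2 /co3; ring.
Qed.

Lemma flux_alg (g g1 x1 x2 x3 a a1 a2 a3 b b1 b2 b3 : R) :
  (a1 * (2 * (x1 - 0) * g1 * b + g * b1) + a2 * (2 * (x2 - 0) * g1 * b + g * b2) +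
   a3 * (2 * (x3 - 0) * g1 * b + g * b3) - k ^+ 2 * a * (g * b)) -
  (b1 * (2 * (x1 - 0) * g1 * a + g * a1) + b2 * (2 * (x2 - 0) * g1 * a + g * a2) +
   b3 * (2 * (x3 - 0) * g1 * a + g * a3) - k ^+ 2 * b * (g * a)) =
  2 * (g1 * (b * (x1 * a1 + x2 * a2 + x3 * a3) - a * (x1 * b1 + x2 * b2 + x3 * b3))).
Proof. ring. Qed.

(** Green's identity: the equation for A is tested with g B and that for B with g A, the extensions
    making both products legitimate C^1 tests. The symmetric terms cancel, and the gradient of g
    leaves 2 g' times the flux density. *)
Lemma flux_zero (g g1 g2 : R -> R) (a d : R) : C2R g g1 g2 -> supp g a d -> 2 * s0 + 2 < a ->
  J mu3 (fun x => \1_N x * (g1 (nrm2 x) * Qf x)) = 0.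
Proof.
move=> G gs sa; have [s1 _] := C2R_supp G gs.
have [M0 hM0] := supp_radial_reg s00 half gs sa; have [M1 hM1] := supp_radial_reg s00 half s1 sa.
pose M := Num.max M0 M1.
have regM (M' : R) z : M' <= M -> reg s0 M' z -> reg s0 M z.
  by move=> MM [h1 h2 h3]; split => //; exact: lt_le_trans MM.
have [jA CA eA] := jet_extension k0 s00 half flatx graph0 HA M.
have [jB CB eB] := jet_extension k0 s00 half flatx graph0 HB M.
pose jg := jrad (mkpt 0 0 0) g g1 g2.
have Cg : isC1 jg := C2C1 (isC2_rad (mkpt 0 0 0) G).
have ad j : isC1 j -> adm N flat (jmul jg j).
  move=> Cj x; have [xs|xs] := leP s0 (nrm2 x); first by apply: Or33; exact: flatx.
  have [xN|xN] := pselect (N x); first exact: Or31.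
  apply: Or32; have off : ~ (a <= sqd (mkpt 0 0 0) x <= d) by rewrite sqd0 => /andP[h _]; have h0 := s00; lra.
  by apply: filterS (supp_off gs off) => y /= ->; rewrite mul0r.
have [rA hrA] := supp_csupp (mkpt 0 0 0) (jf jA) gs; have [rB hrB] := supp_csupp (mkpt 0 0 0) (jf jB) gs.
have CgA := isC1_mul Cg CA; have CgB := isC1_mul Cg CB.
have WA := hs_weak HA CgB (r := rB) hrB (ad _ CB); have WB := hs_weak HB CgA (r := rA) hrA (ad _ CA).
have LA := L1_Wf HA CgB (r := rB) hrB; have LB := L1_Wf HB CgA (r := rA) hrA.
have L := L1_Qf (r_c1 G) s1 sa.
have E : J mu3 (fun x => \1_N x * Wf k A A1 A2 A3 (jmul jg jB) x - \1_N x * Wf k B B1 B2 B3 (jmul jg jA) x) =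
   2 * J mu3 (fun x => \1_N x * (g1 (nrm2 x) * Qf x)).
  rewrite -(J_Z 2 L); apply: J_eq => x; rewrite -mulrBr.
  have [xN|xN] := pselect (N x); last by rewrite (indic0' xN) !mul0r mulr0.
  rewrite (indic1 xN) !mul1r /Wf; simpl jf; simpl j1; simpl j2; simpl j3; rewrite !sqd0.
  have [r0|r0] := pselect (reg s0 M x); last first.
    have g0 : g (nrm2 x) = 0.
      apply/eqP/negPn/negP => h; apply: r0; apply: regM (hM0 x xN h).
      by rewrite /M le_max lexx.
    have g10 : g1 (nrm2 x) = 0.
      apply/eqP/negPn/negP => h; apply: r0; apply: regM (hM1 x xN h).
      by rewrite /M le_max lexx orbT.
    by rewrite g0 g10 !(mul0r, mulr0, addr0) subrr.
  have [-> -> -> ->] := eA x r0; have [-> -> -> ->] := eB x r0.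
  exact: flux_alg.
have {}E : 2 * J mu3 (fun x => \1_N x * (g1 (nrm2 x) * Qf x)) = 0.
  by rewrite -E (J_B LA LB) WA WB subrr.
by move/eqP: E; rewrite mulf_eq0 pnatr_eq0 /= => /eqP.
Qed.

Variables (V b b1 b2 b3 : R -> R).
Hypothesis Bu : bump V b b1 b2 b3.

(** V(c s) - V(c' s) is compactly supported, both terms being V 4 for large s. Its derivative is the
    difference of the two weights. *)
Lemma flux_indep (c c' : R) : 0 < c -> 0 < c' -> 2 * s0 + 2 < (2 * c)^-1 -> 2 * s0 + 2 < (2 * c')^-1 ->
  J mu3 (fun x => \1_N x * (c * b (c * nrm2 x) * Qf x)) =
  J mu3 (fun x => \1_N x * (c' * b (c' * nrm2 x) * Qf x)).
Proof.
move=> c0 c0' sc sc'.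
have X := C2R_sub (C2R_dil c (bu_V Bu)) (C2R_dil c' (bu_V Bu)).
have nb (t s : R) : 0 < t -> ~ ((2 * t)^-1 <= s <= 4 / t) -> ~ (1 / 2 <= t * s <= 4).
  move=> t0 ns /andP[h1 h2]; apply: ns; apply/andP; split.
    rewrite -(ler_pM2l t0) (le_trans _ h1)// le_eqVlt; apply/orP; left; apply/eqP; field; by rewrite gt_eqF.
  by rewrite ler_pdivlMr// mulrC.
have fs : supp (fun s => V (c * s) - V (c' * s)) (Num.min (2 * c)^-1 (2 * c')^-1) (Num.max (4 / c) (4 / c')).
  move=> s ns; have [sl|sl] := ltP s (Num.min (2 * c)^-1 (2 * c')^-1).
    have low (t : R) : 0 < t -> s < (2 * t)^-1 -> V (t * s) = 0.
      move=> t0 st; apply: (bu_0 Bu); have : t * s <= t * (2 * t)^-1 by rewrite ler_wpM2l// ltW.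
      by have -> : t * (2 * t)^-1 = 1 / 2 by field; rewrite gt_eqF.
    by move: sl; rewrite lt_min => /andP[h1 h2]; rewrite !low// subrr.
  have sr : Num.max (4 / c) (4 / c') < s by rewrite ltNge; apply/negP => h; apply: ns; rewrite sl.
  have high (t : R) : 0 < t -> 4 / t < s -> V (t * s) = V 4.
    by move=> t0 st; apply: (bu_4 Bu); rewrite mulrC -ler_pdivrMr// ltW.
  by move: sr; rewrite gt_max => /andP[h1 h2]; rewrite !high// subrr.
have a1 : 2 * s0 + 2 < Num.min (2 * c)^-1 (2 * c')^-1 by rewrite lt_min sc.
have F := flux_zero X fs a1.
have L (t : R) : 0 < t -> 2 * s0 + 2 < (2 * t)^-1 -> L1 mu3 (fun x => \1_N x * (t * b (t * nrm2 x) * Qf x)).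
  move=> t0 st; apply: (L1_Qf (h := fun s => t * b (t * s)) (d := 4 / t) _ _ st).
    exact: r_c1 (C2R_dil t (bu_V Bu)).
  by move=> s ns; rewrite (bu_s Bu (nb _ _ t0 ns)) mulr0.
apply/eqP; rewrite -subr_eq0 -(J_B (L c c0 sc) (L c' c0' sc')); apply/eqP; rewrite -[RHS]F.
apply: J_eq => x; move: (b _) (b _) (\1_N x) (Qf x) => *; ring.
Qed.
End Flux.

(** * Growth of the L^2 norm over shells *)

Section Growth.
Variables (R : realType) (k : R).
Hypothesis k0 : 0 < k.
Local Notation pt := (pt R).
Variables (N flat : set pt) (m : R * R -> R) (s0 : R).
Hypothesis s00 : 0 < s0.
Hypothesis half : forall x : pt, s0 <= nrm2 x -> N x <-> 0 < x.2.
Hypothesis flatx : forall x : pt, s0 <= nrm2 x -> flat x.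
Hypothesis graph0 : forall y, s0 <= nrm2 ((y, m y) : pt) -> m y = 0.
Variables (A A1 A2 A3 B B1 B2 B3 : pt -> R).
Hypotheses (HA : hsol k N flat m A A1 A2 A3) (HB : hsol k N flat m B B1 B2 B3).
Hypothesis rad : exists r0 : R, forall x, N x -> r0 < enorm3 x ->
  `|xgrad A1 A2 A3 x + k * enorm3 x * B x| <= 1 /\ `|xgrad B1 B2 B3 x - k * enorm3 x * A x| <= 1.

(** Radiation says X is close to -k r b and Y to k r a, so -(b X - a Y) is close to k r (a^2 + b^2).
    The errors |a| and |b| are absorbed by |t| <= (K / 2) t^2 + 1 / (2 K), at the cost of half of
    the main term. *)
Lemma radiation_alg (K r a b X Y : R) : 0 < K -> K <= k * r -> `|X + k * r * b| <= 1 -> `|Y - k * r * a| <= 1 ->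
  K / 2 * (a ^+ 2 + b ^+ 2) <= - (b * X - a * Y) + K^-1.
Proof.
move=> K0 Kr; move: (k * r) Kr => kr Kr h1 h2.
have e1 : b * (X + kr * b) <= `|b|.
  by apply: (le_trans (ler_norm _)); rewrite normrM ler_piMr.
have e2 : - (a * (Y - kr * a)) <= `|a|.
  by apply: (le_trans (ler_norm _)); rewrite normrN normrM ler_piMr.
have am (t : R) : `|t| <= K / 2 * t ^+ 2 + (2 * K)^-1.
  rewrite -[t ^+ 2]real_normK ?num_real//; move: `|t| => u.
  rewrite -subr_ge0 [leRHS](_ : _ = (K * u - 1) ^+ 2 / (2 * K)).
    by rewrite divr_ge0 ?sqr_ge0// mulr_ge0// ltW.
  by field; rewrite gt_eqF.
have a1 := am a; have a2 := am b.
have E : K^-1 = (2 * K)^-1 + (2 * K)^-1 by field; rewrite gt_eqF.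
have w1 : K * a ^+ 2 <= kr * a ^+ 2 by rewrite ler_wpM2r// sqr_ge0.
have w2 : K * b ^+ 2 <= kr * b ^+ 2 by rewrite ler_wpM2r// sqr_ge0.
have E1 : b * (X + kr * b) = b * X + kr * b ^+ 2 by ring.
have E2 : a * (Y - kr * a) = a * Y - kr * a ^+ 2 by ring.
rewrite E1 in e1; rewrite E2 in e2; rewrite E mulrDr.
move: (a ^+ 2) (b ^+ 2) (b * X) (a * Y) e1 e2 a1 a2 w1 w2 => *; lra.
Qed.

Lemma L1_W (h : R -> R) (a d : R) : continuous h -> supp h a d -> 2 * s0 + 2 < a ->
  L1 mu3 (fun x => \1_N x * (h (nrm2 x) * (A x ^+ 2 + B x ^+ 2))).
Proof.
move=> ch hs sa; have [M hM] := supp_radial_reg s00 half hs sa.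
have [jA CA eA] := jet_extension k0 s00 half flatx graph0 HA M.
have [jB CB eB] := jet_extension k0 s00 half flatx graph0 HB M.
have [r hr] := csupp_rad hs.
have chn : continuous (fun x : pt => h (nrm2 x)) by exact: ccomp ch (@c_nrm2 R).
have T (q : pt -> R) (j : jet R) : Lloc (fun x => \1_N x * q x) ->
    isC1 j -> L1 mu3 (fun x => \1_N x * q x * (h (nrm2 x) * jf j x)).
  move=> Lq Cj; apply: (Lloc_csupp (r := r) Lq); first by apply: cM => //; exact: C1c Cj.
  by move=> x /hr ->; rewrite mul0r.
have LL := L1_D (T _ _ (hs_L HA) CA) (T _ _ (hs_L HB) CB).
apply: (@L1_eq _ _ _ mu3 _ _ _ LL) => x.
have [xN|xN] := pselect (N x); last by rewrite (indic0' xN) !mul0r !addr0.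
have [h0|h0] := eqVneq (h (nrm2 x)) 0; first by rewrite h0 !(mul0r, mulr0, addr0).
have [-> _ _ _] := eA x (hM x xN h0); have [-> _ _ _] := eB x (hM x xN h0).
by move: (\1_N x) (h _) (A x) (B x) => *; ring.
Qed.

(** The weight h(s) = c b(c s) with c = n^(-2) has integral of order n, and its flux is a constant
    [ka]. By [radiation_alg] with K of order n, the h-weighted integral of A^2 + B^2 is O(1 / n); on
    the shell h is at least n^(-2), which leaves O(n). *)
Lemma l2_shell : exists C : R, exists n1 : nat, 0 <= C /\ forall n, (n1 <= n)%N ->
  L1 mu3 (fun x => \1_N x * ((A x ^+ 2 + B x ^+ 2) * \1_(shell n) x)) /\
  J mu3 (fun x => \1_N x * ((A x ^+ 2 + B x ^+ 2) * \1_(shell n) x)) <= C * n%:R.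
Proof.
have [V [b [b1 [b2 [b3 Bu]]]]] := bump_ex R.
have [r0 hr0] := rad.
(* Large enough for the support of the weight to lie in the far region and beyond the radius [r0] of
   the radiation bound. *)
pose n1 := (Num.truncn (2 * `|r0| + 4 * s0 + 5)).+1.
have n1b n : (n1 <= n)%N -> 2 * `|r0| + 4 * s0 + 5 < n%:R.
  by move=> h; apply: (lt_le_trans (truncnS_gt _)); rewrite ler_nat.
have s0p := s00; have r0p := normr_ge0 r0.
have nge n : (n1 <= n)%N -> 1 <= n%:R :> R by move=> /n1b h; lra.
have hc n : (n1 <= n)%N -> 0 < n%:R^-1 ^+ 2 :> R /\ 2 * s0 + 2 < (2 * n%:R^-1 ^+ 2)^-1.
  move=> nn; have h1 := nge n nn; have h2 := n1b n nn.
  have np : (0 : R) < n%:R by lra.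
  split; first by rewrite exprn_gt0// invr_gt0.
  have -> : (2 * n%:R^-1 ^+ 2)^-1 = n%:R ^+ 2 / 2 :> R by field; rewrite gt_eqF.
  have : n%:R <= n%:R ^+ 2 :> R by rewrite expr2 ler_peMl// ltW.
  lra.
pose ka := J mu3 (fun x => \1_N x * (n1%:R^-1 ^+ 2 * b (n1%:R^-1 ^+ 2 * nrm2 x) * Qf A A1 A2 A3 B B1 B2 B3 x)).
pose Jb := J mu3 (fun x : pt => b (nrm2 x)).
have Jb0 : 0 <= Jb by apply: J_ge0 => x; exact: bu_ge0 Bu _.
have [c10 c1s] := hc n1 (leqnn n1).
exists (4 / k * (`|ka| + 2 / k * Jb)), n1; split.
  have ki : 0 <= k^-1 by rewrite invr_ge0 ltW.
  by rewrite mulr_ge0 ?mulr_ge0// addr_ge0// !mulr_ge0.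
move=> n nn; have [c0 cs] := hc n nn; have ng := nge n nn; have nb := n1b n nn.
have np : (0 : R) < n%:R by lra.
have nn0 : n%:R != 0 :> R by rewrite gt_eqF.
set c := n%:R^-1 ^+ 2 in c0 cs.
pose h s := c * b (c * s).
have ch : continuous h by exact: r_c1 (C2R_dil c (bu_V Bu)).
have bsupp s : ~ ((2 * c)^-1 <= s <= 4 / c) -> ~ (1 / 2 <= c * s <= 4).
  move=> ns /andP[h1 h2]; apply: ns; apply/andP; split.
    rewrite -(ler_pM2l c0) (le_trans _ h1)// le_eqVlt; apply/orP; left; apply/eqP; field; by rewrite gt_eqF.
  by rewrite ler_pdivlMr// mulrC.
have hs : supp h (2 * c)^-1 (4 / c) by move=> s ns; rewrite /h (bu_s Bu (bsupp s ns)) mulr0.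
have LW := L1_W ch hs cs.
have LQ := L1_Qf k0 s00 half flatx graph0 HA HB ch hs cs.
have Jka : J mu3 (fun x => \1_N x * (h (nrm2 x) * Qf A A1 A2 A3 B B1 B2 B3 x)) = ka.
  exact: (flux_indep k0 s00 half flatx graph0 HA HB Bu c0 c10 cs c1s).
have Lh : L1 mu3 (fun x : pt => h (nrm2 x)).
  by apply: (@L1_eq _ _ _ mu3 _ _ _ (L1_rad (mkpt 0 0 0) ch hs)) => y; rewrite sqd0.
have Jh : J mu3 (fun x : pt => h (nrm2 x)) = n%:R * Jb.
  have [_ ->] := J_rad_scale np ch hs.
  have Lb : L1 mu3 (fun x : pt => b (nrm2 x)).
    by apply: (@L1_eq _ _ _ mu3 _ _ _ (L1_rad (mkpt 0 0 0) (r_c (bu_b Bu)) (bu_s Bu))) => y; rewrite sqd0.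
  rewrite [J _ _](_ : _ = c * Jb).
    by rewrite /c; field.
  rewrite /Jb -(J_Z c Lb); apply: J_eq => y; rewrite /h; congr (c * b _).
  by rewrite /c; field.
have h0 s : 0 <= h s by rewrite mulr_ge0 ?(bu_ge0 Bu)// ltW.
(* On the support of the weight |x|^2 >= n^2 / 2, hence |x| >= n / 2 and k |x| >= K. *)
pose K := k * n%:R / 2; have K0 : 0 < K by rewrite divr_gt0// mulr_gt0.
have main : K / 2 * J mu3 (fun x => \1_N x * (h (nrm2 x) * (A x ^+ 2 + B x ^+ 2))) <= `|ka| + 2 / k * Jb.
  have L1' := L1_N LQ; have L2' := L1_Z K^-1 Lh.
  apply: (le_trans (y := - ka + K^-1 * (n%:R * Jb))); last first.
    apply: lerD; first by rewrite -normrN ler_norm.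
    by rewrite le_eqVlt; apply/orP; left; apply/eqP; rewrite /K; field; rewrite nn0 gt_eqF.
  rewrite -Jh -(J_Z _ Lh) -Jka -(J_N LQ) -(J_D L1' L2') -(J_Z _ LW).
  apply: (J_le (mu := mu3)) (L1_Z _ LW) (L1_D L1' L2') _ => x.
  have Ki : 0 <= K^-1 by rewrite invr_ge0 ltW.
  have [xN|xN] := pselect (N x); last by rewrite (indic0' xN) !mul0r mulr0 oppr0 add0r mulr_ge0.
  rewrite (indic1 xN) !mul1r.
  have [sx|sx] := pselect (1 / 2 <= c * nrm2 x <= 4); last first.
    by rewrite /h (bu_s Bu sx) !(mulr0, mul0r) oppr0 addr0.
  have rn : n%:R / 2 <= enorm3 x.
    have e0 := enorm3_ge0 x; rewrite leNgt; apply/negP => hlt.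
    have : enorm3 x ^+ 2 < (n%:R / 2) ^+ 2 by rewrite ltr_pXn2r ?nnegrE ?divr_ge0// ltW.
    rewrite enorm3_sqr => hlt2; case/andP: sx; rewrite /c => sx _.
    have : n%:R^-1 ^+ 2 * nrm2 x < n%:R^-1 ^+ 2 * (n%:R / 2) ^+ 2 by rewrite ltr_pM2l.
    have -> : n%:R^-1 ^+ 2 * (n%:R / 2) ^+ 2 = 1 / 4 :> R by field.
    lra.
  have rr : r0 < enorm3 x.
    have := ler_norm r0; lra.
  have [h1 h2] := hr0 x xN rr.
  have Kr : K <= k * enorm3 x by rewrite /K -mulrA ler_wpM2l// ltW.
  have := radiation_alg K0 Kr h1 h2; move/(ler_wpM2l (h0 (nrm2 x))).
  rewrite /Qf; move: (h _) (K^-1) (K / 2) (B x * _ - _) (_ + _ ^+ 2) => H Ki' K2 q w hh.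
  have -> : K2 * (H * w) = H * (K2 * w) by ring.
  by have -> : - (H * q) + Ki' * H = H * (- q + Ki') by ring.
have low x : \1_N x * ((A x ^+ 2 + B x ^+ 2) * \1_(shell n) x) <= n%:R ^+ 2 * (\1_N x * (h (nrm2 x) * (A x ^+ 2 + B x ^+ 2))).
  have w0 : 0 <= A x ^+ 2 + B x ^+ 2 by rewrite addr_ge0// sqr_ge0.
  have /andP[i0 _] := indic01 N x.
  have [xs|xs] := pselect (shell n x); last first.
    by rewrite (indic0' xs) !mulr0 mulr_ge0 ?sqr_ge0// mulr_ge0// mulr_ge0.
  rewrite (indic1 xs) mulr1.
  have bx : 1 <= b (c * nrm2 x).
    apply: (bu_1 Bu); case/andP: xs => x1 x2; apply/andP; split.
      have -> : 1 = c * n%:R ^+ 2 by rewrite /c; field.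
      by rewrite ler_wpM2l// ltW.
    have -> : 2 = c * (2 * n%:R ^+ 2) by rewrite /c; field.
    by rewrite ler_wpM2l// ltW.
  have -> : n%:R ^+ 2 * (\1_N x * (h (nrm2 x) * (A x ^+ 2 + B x ^+ 2))) = \1_N x * (b (c * nrm2 x) * (A x ^+ 2 + B x ^+ 2)).
    by rewrite /h /c; field.
  by rewrite ler_wpM2l// ler_peMl.
have Ls : L1 mu3 (fun x => \1_N x * ((A x ^+ 2 + B x ^+ 2) * \1_(shell n) x)).
  apply: (L1_le (mu := mu3) _ _ (L1_Z (n%:R ^+ 2) LW)); last first.
    move=> x; rewrite ger0_norm; first exact: low.
    have /andP[i0 _] := indic01 N x; have /andP[i1 _] := indic01 (shell n) x.
    by rewrite mulr_ge0// mulr_ge0// addr_ge0// sqr_ge0.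
  have mA := Lloc_meas (hs_L HA); have mB := Lloc_meas (hs_L HB).
  rewrite (_ : (fun x => _) = fun x => ((\1_N x * A x) ^+ 2 + (\1_N x * B x) ^+ 2) * \1_(shell n) x).
    apply: measurable_funM; last exact: measurable_indic (meas_shell n).
    by apply: measurable_funD; exact: measurable_funX.
  apply/funext => x; have [xN|xN] := pselect (N x); first by rewrite (indic1 xN) !mul1r.
  by rewrite (indic0' xN) !mul0r expr0n /= addr0 mul0r.
split => //; apply: (le_trans (J_le (mu := mu3) Ls (L1_Z _ LW) low)).
rewrite (J_Z _ LW); move: main; move: (J mu3 _) (`|ka| + _) => I T main.
have -> : 4 / k * T * n%:R = n%:R ^+ 2 * ((K / 2)^-1 * T) by rewrite /K; field; rewrite nn0 gt_eqF.
apply: ler_wpM2l; first exact: sqr_ge0.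
have K20 : 0 < K / 2 by rewrite divr_gt0.
by rewrite ler_pdivlMl.
Qed.
End Growth.

(** * From limits along rays to decay of the L^1 norm *)

Section Decay.
Variables (R : realType).
Local Notation pt := (pt R).
Variables (N : set pt) (s0 : R) (p : pt -> R) (C : R) (n1 : nat).
Hypothesis half : forall x : pt, s0 <= nrm2 x -> N x <-> 0 < x.2.
Hypothesis Lp : Lloc (fun x => \1_N x * p x).
Hypothesis C0 : 0 <= C.
Hypothesis sq : forall n, (n1 <= n)%N ->
  L1 mu3 (fun x => \1_N x * (p x ^+ 2 * \1_(shell n) x)) /\
  J mu3 (fun x => \1_N x * (p x ^+ 2 * \1_(shell n) x)) <= C * n%:R.
Hypothesis ray : forall y : pt, 0 < y.2 -> (fun n : nat => n%:R * p (aff3 n%:R (mkpt 0 0 0) y)) @ \oo --> (0 : R).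

Lemma shell_aff n (y : pt) : (0 < n)%N -> shell n (aff3 n%:R (mkpt 0 0 0) y) <-> shell 1 y.
Proof.
move=> n0; have np : (0 : R) < n%:R ^+ 2 by rewrite exprn_gt0// ltr0n.
rewrite /shell /= nrm2_aff expr1n mulr1 -[X in X <= _]mulr1 ler_pM2l//.
by rewrite [2 * _ ^+ 2]mulrC ler_pM2l.
Qed.

Lemma indic_shell_aff n (y : pt) : (0 < n)%N -> \1_(shell n) (aff3 n%:R (mkpt 0 0 0) y) = \1_(shell 1) y :> R.
Proof.
move=> n0; have [ys|ys] := pselect (shell 1 y); first by rewrite !indic1//; apply/shell_aff.
by rewrite !indic0'//; apply/shell_aff.
Qed.

Lemma mu3_shell1 : (mu3 (shell 1 : set pt) < +oo)%E.
Proof.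
apply: le_lt_trans (mu3_ball0_fin (2 : R)); apply: le_measure; rewrite ?inE.
- exact: meas_shell.
- exact: meas_ball0.
- move=> x /andP[_]; rewrite expr1n mulr1 /ball0 /= enorm3_lt// => h; apply: (le_lt_trans h).
  by rewrite -natrX ltr_nat.
Qed.

Lemma nrm2_far (y : pt) : shell 1 y -> \forall n \near \oo, s0 <= nrm2 (aff3 n%:R (mkpt 0 0 0) y).
Proof.
move=> /andP[y1 _]; rewrite expr1n in y1; near=> n.
have n1' : 1 <= n%:R :> R by rewrite ler1n; near: n; exact: nbhs_infty_gt.
have ns : `|s0| <= n%:R by near: n; exact: nbhs_infty_ger.
have h := ler_norm s0; rewrite nrm2_aff.
have h2 : n%:R <= n%:R ^+ 2 :> R by rewrite expr2 ler_peMl.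
have h3 : n%:R ^+ 2 <= n%:R ^+ 2 * nrm2 y by rewrite ler_peMr// sqr_ge0.
lra.
Unshelve. all: by end_near. Qed.

(** All shells are rescaled to the first one. The functions n |p(n y)| tend to 0 pointwise and are
    bounded in L^2. Truncated at height M they are dominated, so their integrals tend to 0; above M
    the L^2 bound makes the remainder at most C / M. *)
Lemma L1_decay : forall e : R, 0 < e -> exists n0 : nat, forall n, (n0 <= n)%N ->
  J mu3 (fun x => `|\1_N x * p x * \1_(shell n) x|) <= e * n%:R ^+ 2.
Proof.
move=> e e0; pose M := 2 * (C + 1) / e; have M0 : 0 < M by rewrite divr_gt0// mulr_gt0// ltr_wpDl.
pose f n (y : pt) := Num.min (n%:R * `|\1_N (aff3 n%:R (mkpt 0 0 0) y) * p (aff3 n%:R (mkpt 0 0 0) y)|) M * \1_(shell 1) y.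
have mS := meas_shell 1 : measurable (shell 1 : set pt).
have LS := L1_indic (mu := mu3) mS mu3_shell1.
have mN (n : nat) : (0 < n)%N -> measurable_fun setT (fun y => \1_N (aff3 n%:R (mkpt 0 0 0) y) * p (aff3 n%:R (mkpt 0 0 0) y)).
  move=> n0; have np : (0 : R) < n%:R by rewrite ltr0n.
  exact: (measurableT_comp (Lloc_meas Lp) (m_aff3 n%:R (mkpt 0 0 0))).
have mf n : measurable_fun setT (f n).
  apply: measurable_funM; last exact: measurable_indic mS.
  apply: measurable_minr; last exact: measurable_cst.
  case: n => [|n].
    by rewrite (_ : (fun y => _) = fun=> 0); [exact: measurable_cst|apply/funext => y; rewrite mul0r].
  apply: measurable_funM; first exact: measurable_cst.
  by apply: measurableT_comp; [exact: normr_measurable|exact: mN].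
have fM n y : 0 <= f n y <= M * \1_(shell 1) y.
  have /andP[i0 _] := indic01 (shell 1 : set pt) y.
  apply/andP; split; first by rewrite mulr_ge0// le_min (ltW M0) andbT mulr_ge0.
  by rewrite ler_wpM2r// ge_min lexx orbT.
have f0 y : (fun n => f n y) @ \oo --> (0 : R).
  have [ys|ys] := pselect (shell 1 y); last first.
    by apply: cvg_near_cst; apply: nearW => n; rewrite /f (indic0' ys) mulr0.
  have nf := nrm2_far ys.
  have [y0|y0] := ltP 0 y.2; last first.
    apply: cvg_near_cst; near=> n; rewrite /f indic0' ?mul0r ?normr0 ?mulr0; last first.
      have h : s0 <= nrm2 (aff3 n%:R (mkpt 0 0 0) y) by near: n.
      move/(half h) => /=; rewrite /aff1 addr0 => h'.
      have h2 : n%:R * y.2 <= 0 by apply: mulr_ge0_le0 => //; exact: ler0n.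
      by have := lt_le_trans h' h2; rewrite ltxx.
    by rewrite min_l ?mul0r// ltW.
  apply/cvgrPdist_lt => eps eps0; have := ray y0; move/cvgrPdist_lt/(_ eps eps0); apply: filterS => n.
  rewrite !sub0r !normrN => h; have /andP[g0 _] := fM n y.
  rewrite ger0_norm//; apply: le_lt_trans h; rewrite /f (indic1 ys) mulr1 ge_min; apply/orP; left.
  rewrite [leRHS]normrM (ger0_norm (ler0n _ n)) ler_wpM2l//; exact: norm_indicM.
have LM := L1_Z M LS.
have fMn n y : `|f n y| <= M * \1_(shell 1) y by have /andP[h1 h2] := fM n y; rewrite ger0_norm.
have [_ cJ] := @J_dominated R _ _ mu3 f (fun=> 0) _ mf LM f0 fMn.
have {}cJ : (fun n => J mu3 (f n)) @ \oo --> (0 : R) by move: cJ; rewrite J_0.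
move/cvgrPdist_lt: cJ => /(_ (e / 2)); rewrite divr_gt0// => /(_ isT) [n2 _ hn2].
exists (maxn (maxn n1 n2) 1) => n; rewrite !geq_max => /andP[/andP[nn1 nn2] n0].
have np : (0 : R) < n%:R by rewrite ltr0n.
have nn0 : n%:R != 0 :> R by rewrite gt_eqF.
have Jf : J mu3 (f n) <= e / 2.
  have := hn2 n nn2; rewrite /= sub0r normrN => h; apply: ltW; exact: le_lt_trans (ler_norm _) h.
have Lf : L1 mu3 (f n) by apply: (L1_le (mu := mu3) (mf n) (fMn n) LM).
have [Lsq Jsq] := sq nn1.
have Lsh : L1 mu3 (fun x => `|\1_N x * p x * \1_(shell n) x|).
  apply: L1_norm; have [r hr] := shell_bounded R n.
  apply: (Lloc_L1 Lp (measurable_indic (meas_shell n)) (C := 1) _ hr).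
  by move=> x; have /andP[i0 i1] := indic01 (shell n) x; rewrite ger0_norm.
have La := L1_aff3 np (mkpt 0 0 0) Lsh; have Lb := L1_aff3 np (mkpt 0 0 0) Lsq.
rewrite (J_aff3 np (mkpt 0 0 0) Lsh); rewrite (J_aff3 np (mkpt 0 0 0) Lsq) in Jsq.
(* With t = n |p(n y)| this is t <= min(t, M) + t^2 / M, integrable term by term. *)
have key y : n%:R * `|\1_N (aff3 n%:R (mkpt 0 0 0) y) * p (aff3 n%:R (mkpt 0 0 0) y) * \1_(shell n) (aff3 n%:R (mkpt 0 0 0) y)| <=
   f n y + n%:R ^+ 2 / M * (\1_N (aff3 n%:R (mkpt 0 0 0) y) * (p (aff3 n%:R (mkpt 0 0 0) y) ^+ 2 * \1_(shell n) (aff3 n%:R (mkpt 0 0 0) y))).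
  rewrite /f indic_shell_aff//; have [ys|ys] := pselect (shell 1 y); last first.
    by rewrite (indic0' ys) !mulr0 normr0 mulr0 addr0.
  rewrite (indic1 ys) !mulr1.
  set i := \1_N _; set q := p _.
  have i2 : i * q ^+ 2 = `|i * q| ^+ 2.
    rewrite real_normK ?num_real// exprMn /i.
    by have [xN|xN] := pselect (N (aff3 n%:R (mkpt 0 0 0) y)); rewrite ?(indic1 xN) ?(indic0' xN) ?expr1n ?mul1r// expr0n /= !mul0r.
  rewrite i2; move: `|i * q| (normr_ge0 (i * q)) => u u0.
  have -> : n%:R ^+ 2 / M * u ^+ 2 = (n%:R * u) ^+ 2 / M by field; rewrite gt_eqF.
  have : 0 <= n%:R * u by rewrite mulr_ge0.
  move: (n%:R * u) => t t0; have [tM|tM] := leP t M; first by rewrite lerDl divr_ge0 ?sqr_ge0// ltW.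
  apply: (le_trans (y := t ^+ 2 / M)); last by rewrite lerDr ltW.
  by rewrite expr2 ler_pdivlMr// ler_wpM2l// ltW.
have := J_le (mu := mu3) (L1_Z n%:R La) (L1_D Lf (L1_Z (n%:R ^+ 2 / M) Lb)) key.
rewrite (J_Z _ La) (J_D Lf (L1_Z (n%:R ^+ 2 / M) Lb)) (J_Z _ Lb).
move: (J mu3 (f n)) Jf (J mu3 _) (J mu3 _) Jsq => F hF I1 I2 hI2 hI1.
have h3 : n%:R ^+ 2 / M * I2 <= e / 2.
  have : n%:R ^+ 2 * I2 <= C by rewrite -(ler_pM2l np) mulrA -exprS [n%:R * C]mulrC.
  move=> h; have -> : n%:R ^+ 2 / M * I2 = (n%:R ^+ 2 * I2) / M by ring.
  rewrite ler_pdivrMr//; apply: (le_trans h).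
  have -> : e / 2 * M = C + 1 by rewrite /M; field; rewrite gt_eqF.
  by rewrite lerDl.
rewrite exprSr -mulrA [e * _]mulrC ler_wpM2l ?sqr_ge0//; lra.
Unshelve. all: by end_near. Qed.
End Decay.

(** * The difference of two scattered fields *)

Section TwoSurfaces.
Variables (R : realType) (k : R) (f1 f2 : R * R -> R) (d : pt R).
Local Notation pt := (pt R).
Variables (us1 us2 : pt -> cplx R).
Hypotheses (lp1 : locally_perturbed f1) (lp2 : locally_perturbed f2).
Hypotheses (sol1 : scat_sol_N k f1 d us1) (sol2 : scat_sol_N k f2 d us2).

Definition N12 : set pt := Omega f1 `&` Omega f2.
Definition m12 (y : R * R) : R := Num.max (f1 y) (f2 y).
(** Both regions must coincide with the half-space near x. The common region alone looking flat
    would not do, since each weak equation is posed on its own region. *)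
Definition flat12 (x : pt) : Prop :=
  \forall y \near x, (Omega f1 y <-> 0 < y.2) /\ (Omega f2 y <-> 0 < y.2).
Definition w12 (b : bool) (x : pt) : R := pr b (us1 x) - pr b (us2 x).
Definition dw12 (e : pt) (b : bool) (x : pt) : R := pr b (pd e us1 x) - pr b (pd e us2 x).

Let cf1 := locally_perturbed_continuous lp1.
Let cf2 := locally_perturbed_continuous lp2.

Lemma open_N12 : open N12.
Proof. by apply: openI; apply: open_Omega; [exact: cf1|exact: cf2]. Qed.

Lemma hgeom12 : hgeom N12 flat12 m12.
Proof.
split.
- exact: open_N12.
- by move=> x; rewrite /N12 /m12 /Omega /=; split=> [[h1 h2]|]; rewrite gt_max; [rewrite h1|move=> /andP].
- move=> x; apply: filterS => y [h1 h2]; split; first by move=> [/h1].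
  by move=> h; split; [apply/h1|apply/h2].
- have [_ [r1 [b1 _]]] := lp1; have [_ [r2 [b2 _]]] := lp2.
  exists (Num.max r1 r2) => y; rewrite /m12 lt_max.
  by have [h|h] := leP (f1 y) (f2 y); rewrite ?b1 ?b2 ?orbT.
Qed.

(** A point in exactly one of the two regions cannot be flat, since there both regions agree. So the
    test function vanishes nearby, as [weak_one] requires. *)
Lemma adm12 (j : jet R) : adm N12 flat12 j -> forall x, ~ N12 x ->
  Omega f1 x \/ Omega f2 x -> \forall y \near x, jf j y = 0.
Proof.
move=> ad x xN O; case: (ad x) => // /nbhs_singleton[h1 h2]; exfalso; apply: xN.
by case: O => [/h1|/h2] h; split; [apply/h1|apply/h2|apply/h1|apply/h2].
Qed.

Lemma Wf_sub_alg (i a a1 a2 a3 b b1 b2 b3 j j1 j2 j3 : R) :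
  i * ((a1 - b1) * j1 + (a2 - b2) * j2 + (a3 - b3) * j3 - k ^+ 2 * (a - b) * j) =
  i * (a1 * j1 + a2 * j2 + a3 * j3 - k ^+ 2 * a * j) - i * (b1 * j1 + b2 * j2 + b3 * j3 - k ^+ 2 * b * j).
Proof. ring. Qed.

Lemma J_Wf_sub (N : set pt) (p p1 p2 p3 q q1 q2 q3 : pt -> R) (j : jet R) :
  L1 mu3 (fun x => \1_N x * Wf k p p1 p2 p3 j x) -> L1 mu3 (fun x => \1_N x * Wf k q q1 q2 q3 j x) ->
  J mu3 (fun x => \1_N x * Wf k (fun x => p x - q x) (fun x => p1 x - q1 x) (fun x => p2 x - q2 x)
    (fun x => p3 x - q3 x) j x) =
  J mu3 (fun x => \1_N x * Wf k p p1 p2 p3 j x) - J mu3 (fun x => \1_N x * Wf k q q1 q2 q3 j x).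
Proof. by move=> Lp Lq; rewrite -(J_B Lp Lq); apply: J_eq => x; rewrite /Wf; exact: Wf_sub_alg. Qed.

Lemma hsol12 b : hsol k N12 flat12 m12 (w12 b) (dw12 (e1 R) b) (dw12 (e2 R) b) (dw12 (e3 R) b).
Proof.
have oN := open_N12.
have NO1 : N12 `<=` Omega f1 by move=> x [].
have NO2 : N12 `<=` Omega f2 by move=> x [].
have LB (p q : pt -> R) : Lloc (fun x => \1_N12 x * p x) -> Lloc (fun x => \1_N12 x * q x) ->
    Lloc (fun x => \1_N12 x * (p x - q x)).
  move=> Lp Lq; have L := Lloc_D Lp (Lloc_N Lq).
  by rewrite (_ : (fun x => _) = fun x => \1_N12 x * p x - \1_N12 x * q x)//; apply/funext => x; rewrite mulrBr.
have U1 := us_Lloc cf1 sol1 oN NO1 b; have U2 := us_Lloc cf2 sol2 oN NO2 b.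
have D1 e he := @dus_Lloc _ _ _ _ _ _ cf1 sol1 oN NO1 b e he.
have D2 e he := @dus_Lloc _ _ _ _ _ _ cf2 sol2 oN NO2 b e he.
have E1 : e1 R = e1 R \/ e1 R = e2 R \/ e1 R = e3 R by left.
have E2 : e2 R = e1 R \/ e2 R = e2 R \/ e2 R = e3 R by right; left.
have E3 : e3 R = e1 R \/ e3 R = e2 R \/ e3 R = e3 R by right; right.
split; first exact: hgeom12.
- move=> x /[dup] /NO1 h1 /NO2 h2.
  have c1 : {for x, continuous (fun x : pt => pr b (us1 x))} by exact: (@us_pr_c _ _ _ _ _ sol1 b x h1).
  have c2 : {for x, continuous (fun x : pt => pr b (us2 x))} by exact: (@us_pr_c _ _ _ _ _ sol2 b x h2).
  exact: cBp c1 c2.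
- by move=> x /[dup] /NO1 h1 /NO2 h2; exact: is_dB (us_pr_d sol1 b (e1 R) h1) (us_pr_d sol2 b (e1 R) h2).
- by move=> x /[dup] /NO1 h1 /NO2 h2; exact: is_dB (us_pr_d sol1 b (e2 R) h1) (us_pr_d sol2 b (e2 R) h2).
- by move=> x /[dup] /NO1 h1 /NO2 h2; exact: is_dB (us_pr_d sol1 b (e3 R) h1) (us_pr_d sol2 b (e3 R) h2).
- exact: LB.
- by apply: LB; [exact: D1|exact: D2].
- by apply: LB; [exact: D1|exact: D2].
- by apply: LB; [exact: D1|exact: D2].
- move=> j r hj hs ad.
  have a1 x : Omega f1 x -> ~ N12 x -> \forall y \near x, jf j y = 0.
    by move=> h n; apply: adm12 ad _ n _; left.
  have a2 x : Omega f2 x -> ~ N12 x -> \forall y \near x, jf j y = 0.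
    by move=> h n; apply: adm12 ad _ n _; right.
  have W1 := weak_one cf1 sol1 oN NO1 b hj hs a1; have W2 := weak_one cf2 sol2 oN NO2 b hj hs a2.
  have LL1 := L1_Wf_of k U1 (D1 _ E1) (D1 _ E2) (D1 _ E3) hj hs.
  have LL2 := L1_Wf_of k U2 (D2 _ E1) (D2 _ E2) (D2 _ E3) hj hs.
  (* Both identities begin with the same plane-wave integral over the common region; cancelling it
     equates the integrals of the two scattered fields. *)
  have E := @addrI _ _ _ _ (etrans W1 (esym W2)).
  exact: (etrans (J_Wf_sub LL1 LL2) (etrans (congr1 (fun t => t - _) E) (subrr _))).
Qed.

(** If |x|^2 > 2 r^2, either the horizontal part exceeds the radius of the perturbation, so that f
    is 0, or |x3| > r > |f|. In both cases the position relative to the surface is decided by the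
    sign of x3. *)
Lemma far_geometry : exists2 s0 : R, 0 < s0 &
  [/\ (forall x : pt, s0 <= nrm2 x -> N12 x <-> 0 < x.2),
      (forall x : pt, s0 <= nrm2 x -> flat12 x) &
      (forall y, s0 <= nrm2 ((y, m12 y) : pt) -> m12 y = 0)].
Proof.
have [_ [r1 [b1 z1]]] := lp1; have [_ [r2 [b2 z2]]] := lp2.
pose r := Num.max r1 r2.
have r0 : 0 < r by rewrite lt_max (le_lt_trans (normr_ge0 _) (b1 0)).
have bb (f : R * R -> R) ri : ri <= r -> (forall y, `|f y| < ri) -> (forall y, ri < enorm2 y -> f y = 0) ->
    forall x : pt, 2 * r ^+ 2 < nrm2 x -> (f x.1 = 0 \/ r < `|x.2|).
  move=> rr fb fz x hx; have [h|h] := ltP ri (enorm2 x.1); first by left; apply: fz.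
  right; have e0 : 0 <= enorm2 x.1 by exact: sqrtr_ge0.
  have h2 : x.1.1 ^+ 2 + x.1.2 ^+ 2 <= r ^+ 2.
    rewrite -[leLHS]sqr_sqrtr ?addr_ge0 ?sqr_ge0// -/(enorm2 x.1).
    by rewrite lerXn2r ?nnegrE ?(ltW r0)// (le_trans h).
  have h3 : r ^+ 2 < x.2 ^+ 2 by move: hx; rewrite /nrm2; lra.
  rewrite -[x.2 ^+ 2]real_normK ?num_real// in h3.
  by rewrite -(ltr_pXn2r (n := 2)) ?nnegrE// ltW.
have hf (f : R * R -> R) ri : ri <= r -> (forall y, `|f y| < ri) -> (forall y, ri < enorm2 y -> f y = 0) ->
    forall x : pt, 2 * r ^+ 2 < nrm2 x -> Omega f x <-> 0 < x.2.
  move=> rr fb fz x hx; rewrite /Omega /=; case: (bb f ri rr fb fz x hx) => [->//|h].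
  have := lt_le_trans (fb x.1) rr; rewrite ltr_norml => /andP[g1 g2].
  have [x0|x0] := ltP 0 x.2.
    by split => // _; apply: (lt_trans g2); rewrite gtr0_norm in h.
  by rewrite ler0_norm// in h; split => // h'; lra.
have rr1 : r1 <= r by rewrite /r le_max lexx.
have rr2 : r2 <= r by rewrite /r le_max lexx orbT.
have r20 : 0 < r ^+ 2 by rewrite exprn_gt0.
exists (2 * r ^+ 2 + 1); first by lra.
split.
- move=> x hx; have hx' : 2 * r ^+ 2 < nrm2 x by lra.
  have h1 := hf f1 r1 rr1 b1 z1 x hx'; have h2 := hf f2 r2 rr2 b2 z2 x hx'.
  by split; [move=> [/h1]|move=> h; split; [apply/h1|apply/h2]].
- move=> x hx; have hx' : 2 * r ^+ 2 < nrm2 x by lra.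
  apply: filterS (near_gtc (f := @nrm2 R) (@c_nrm2 R x) hx') => y hy.
  by split; [exact: hf rr1 b1 z1 y hy|exact: hf rr2 b2 z2 y hy].
- move=> y hy; have hy' : 2 * r ^+ 2 < nrm2 ((y, m12 y) : pt) by lra.
  have mr : `|m12 y| < r.
    have h1 := lt_le_trans (b1 y) rr1; have h2 := lt_le_trans (b2 y) rr2.
    by rewrite /m12; have [h|h] := leP (f1 y) (f2 y).
  have k1 : f1 y = 0.
    by case: (bb f1 r1 rr1 b1 z1 _ hy') => //= h; have := lt_trans mr h; rewrite ltxx.
  have k2 : f2 y = 0.
    by case: (bb f2 r2 rr2 b2 z2 _ hy') => //= h; have := lt_trans mr h; rewrite ltxx.
  by rewrite /m12 k1 k2 maxxx.
Qed.

Lemma comp_le_cabs (z : cplx R) : `|z.1| <= cabs z /\ `|z.2| <= cabs z.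
Proof.
by split; rewrite -sqrtr_sqr /cabs /enorm2 ler_wsqrtr// ?lerDl ?lerDr sqr_ge0.
Qed.

Lemma radial_derivative (us : pt -> cplx R) (x : pt) (b : bool) : differentiable us x -> enorm3 x != 0 ->
  enorm3 x * pr b ('D_((enorm3 x)^-1 *: x) us x) =
  xgrad (fun x => pr b (pd (e1 R) us x)) (fun x => pr b (pd (e2 R) us x)) (fun x => pr b (pd (e3 R) us x)) x.
Proof.
move=> du r0; rewrite /xgrad /pd !deriveE//.
have E : x = x.1.1 *: e1 R + x.1.2 *: e2 R + x.2 *: e3 R.
  case: x {du r0} => [[x1 x2] x3]; congr (_, _, _);
    by rewrite /= /GRing.scale /= !(mulr1, mulr0, addr0, add0r).
have -> : 'd us x ((enorm3 x)^-1 *: x) = (enorm3 x)^-1 *: 'd us x (x.1.1 *: e1 R + x.1.2 *: e2 R + x.2 *: e3 R).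
  by rewrite -E linearZ.
rewrite !linearD !linearZ /=.
move: ('d us x (e1 R)) ('d us x (e2 R)) ('d us x (e3 R)) => u v w.
by case: (b); rewrite /= /GRing.scale /=; field.
Qed.

Lemma xgrad_B (p1 p2 p3 q1 q2 q3 : pt -> R) (x : pt) :
  xgrad (fun x => p1 x - q1 x) (fun x => p2 x - q2 x) (fun x => p3 x - q3 x) x =
  xgrad p1 p2 p3 x - xgrad q1 q2 q3 x.
Proof. rewrite /xgrad; ring. Qed.

Lemma rad12 : 0 < k -> exists r0 : R, forall x, N12 x -> r0 < enorm3 x ->
  `|xgrad (dw12 (e1 R) true) (dw12 (e2 R) true) (dw12 (e3 R) true) x + k * enorm3 x * w12 false x| <= 1 /\
  `|xgrad (dw12 (e1 R) false) (dw12 (e2 R) false) (dw12 (e3 R) false) x - k * enorm3 x * w12 true x| <= 1.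
Proof.
move=> k0; have [[dif1 _] [_ ra1]] := sol1; have [[dif2 _] [_ ra2]] := sol2.
have h2 : 0 < 1 / 2 :> R by rewrite divr_gt0.
have [q1 hq1] := ra1 _ h2; have [q2 hq2] := ra2 _ h2.
exists (Num.max 0 (Num.max q1 q2)); move=> x [h1 h3]; rewrite !gt_max => /andP[r0 /andP[x1 x2]].
have rn : enorm3 x != 0 by rewrite gt_eqF.
have := hq1 x h1 x1; have := hq2 x h3 x2; cbv zeta.
set z2 := (X in cabs X < _); move=> hz2; set z1 := (X in cabs X < _); move=> hz1.
have [a1 a2] := comp_le_cabs z1; have [a3 a4] := comp_le_cabs z2.
have X b : xgrad (dw12 (e1 R) b) (dw12 (e2 R) b) (dw12 (e3 R) b) x =
   enorm3 x * pr b ('D_((enorm3 x)^-1 *: x) us1 x) - enorm3 x * pr b ('D_((enorm3 x)^-1 *: x) us2 x).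
  apply: (etrans (xgrad_B _ _ _ _ _ _ _)).
  exact: (congr2 (fun s t : R => s - t) (esym (radial_derivative b (dif1 x h1) rn))
    (esym (radial_derivative b (dif2 x h3) rn))).
have g (u v : R) (c1 c2 : R) : `|u| <= c1 -> `|v| <= c2 -> c1 < 1 / 2 -> c2 < 1 / 2 -> `|u - v| <= 1.
  by move=> hu hv hc1 hc2; apply: (le_trans (ler_normB _ _)); lra.
have := g _ _ _ _ a1 a3 hz1 hz2; have := g _ _ _ _ a2 a4 hz1 hz2.
rewrite !X /w12 /z1 /z2 /=.
move: (enorm3 x) ('D_(_) us1 x) ('D_(_) us2 x) (us1 x) (us2 x) => r D1 D2 u1 u2 g1 g2; split.
  by rewrite [X in `|X|](_ : _ = r * (D1.1 + k * u1.2) - r * (D2.1 + k * u2.2)) //; ring.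
by rewrite [X in `|X|](_ : _ = r * (D1.2 - k * u1.1) - r * (D2.2 - k * u2.1)) //; ring.
Qed.

(** The difference of the rotated fields has components at most 2 c; undoing the rotation combines
    them with cos t and sin t, whence 4 c. *)
Lemma rot_bound (r t c : R) (u v F : cplx R) : 0 <= r ->
  cabs (cmul (r, 0) (cmul (cexpi t) u) - F) <= c ->
  cabs (cmul (r, 0) (cmul (cexpi t) v) - F) <= c ->
  `|r * (u.1 - v.1)| <= 4 * c /\ `|r * (u.2 - v.2)| <= 4 * c.
Proof.
move=> r0; set z := _ - F => hu; set z' := _ - F => hv.
have [a1 a2] := comp_le_cabs z; have [a3 a4] := comp_le_cabs z'.
have b1 := le_trans a1 hu; have b2 := le_trans a2 hu; have b3 := le_trans a3 hv; have b4 := le_trans a4 hv.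
have hc : `|cos t| <= 1 by rewrite ler_norml cos_geN1 cos_le1.
have hs : `|sin t| <= 1 by rewrite ler_norml sin_geN1 sin_le1.
have d1 : `|z.1 - z'.1| <= 2 * c by apply: (le_trans (ler_normB _ _)); lra.
have d2 : `|z.2 - z'.2| <= 2 * c by apply: (le_trans (ler_normB _ _)); lra.
have cs := cos2Dsin2 t.
have e1 : r * (u.1 - v.1) = cos t * (z.1 - z'.1) + sin t * (z.2 - z'.2).
  rewrite /z /z' /cmul /cexpi /= -[r * (u.1 - v.1)]mul1r -cs; ring.
have e2 : r * (u.2 - v.2) = cos t * (z.2 - z'.2) - sin t * (z.1 - z'.1).
  rewrite /z /z' /cmul /cexpi /= -[r * (u.2 - v.2)]mul1r -cs; ring.
have pb (a x : R) : `|a| <= 1 -> `|x| <= 2 * c -> `|a * x| <= 2 * c.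
  by move=> ha hx; rewrite normrM; apply: (le_trans _ hx); rewrite ler_piMl.
split.
  rewrite e1; apply: (le_trans (ler_normD _ _)).
  have := pb _ _ hc d1; have := pb _ _ hs d2; lra.
rewrite e2; apply: (le_trans (ler_normB _ _)).
have := pb _ _ hc d2; have := pb _ _ hs d1; lra.
Qed.

Variables (F1 F2 : pt -> cplx R).
Hypotheses (ff1 : far_field k us1 F1) (ff2 : far_field k us2 F2).
Hypothesis FE : forall xh, S2plus xh -> F1 xh = F2 xh.

Lemma aff3_scale (r : R) (y : pt) : aff3 r (mkpt 0 0 0) y = r *: y.
Proof. by case: y => [[y1 y2] y3]; congr (_, _, _); rewrite /aff1 addr0. Qed.

Lemma ray12 b (y : pt) : 0 < y.2 -> (fun n : nat => n%:R * w12 b (aff3 n%:R (mkpt 0 0 0) y)) @ \oo --> (0 : R).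
Proof.
move=> y0; have [_ _ h3] := co_le_enorm3 y.
have e0 : 0 < enorm3 y by apply: lt_le_trans h3; rewrite normr_gt0 gt_eqF.
have en : enorm3 y != 0 by rewrite gt_eqF.
pose th : pt := (enorm3 y)^-1 *: y.
have th1 : S2plus th.
  split; last by rewrite /th /= /GRing.scale /= mulr_gt0// invr_gt0.
  rewrite enorm3E (_ : nrm2 th = 1) ?sqrtr1//.
  have -> : nrm2 th = (enorm3 y)^-1 ^+ 2 * nrm2 y by rewrite /th /nrm2 /= /GRing.scale /=; ring.
  by rewrite -enorm3_sqr -exprMn mulVf// expr1n.
have [C1 [q1 hq1]] := ff1 th1; have [C2 [q2 hq2]] := ff2 th1.
pose C := `|C1| + `|C2|.
apply/cvgrPdist_lt => eps eps0; near=> n.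
have nq1 : q1 / enorm3 y <= n%:R by near: n; exact: nbhs_infty_ger.
have nq2 : q2 / enorm3 y <= n%:R by near: n; exact: nbhs_infty_ger.
have ne : 4 * C / (enorm3 y ^+ 2 * eps) < n%:R by near: n; exact: nbhs_infty_gtr.
have n0 : (0 : R) < n%:R by rewrite ltr0n; near: n; exact: nbhs_infty_gt.
pose r := n%:R * enorm3 y.
have r0 : 0 < r by rewrite mulr_gt0.
have rq1 : q1 <= r by rewrite -ler_pdivrMr.
have rq2 : q2 <= r by rewrite -ler_pdivrMr.
have rth : r *: th = aff3 n%:R (mkpt 0 0 0) y by rewrite aff3_scale /th scalerA /r mulfK.
have b1 := hq1 r rq1 r0; have b2 := hq2 r rq2 r0; rewrite -(FE th1) rth in b2; rewrite rth in b1.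
have C1C : C1 / r <= C / r by rewrite ler_wpM2r ?invr_ge0 ?(ltW r0)// /C (le_trans (ler_norm C1))// lerDl.
have C2C : C2 / r <= C / r by rewrite ler_wpM2r ?invr_ge0 ?(ltW r0)// /C (le_trans (ler_norm C2))// lerDr.
have [k1 k2] := rot_bound (ltW r0) (le_trans b1 C1C) (le_trans b2 C2C).
have kb : `|r * w12 b (aff3 n%:R (mkpt 0 0 0) y)| <= 4 * (C / r) by rewrite /w12; case: (b).
rewrite sub0r normrN.
have E : r * w12 b (aff3 n%:R (mkpt 0 0 0) y) = enorm3 y * (n%:R * w12 b (aff3 n%:R (mkpt 0 0 0) y)).
  by rewrite /r; move: (w12 _ _) => t; ring.
rewrite E normrM (gtr0_norm e0) in kb.
move: (`|n%:R * _|) kb => t kb; rewrite -(ltr_pM2l e0); apply: (le_lt_trans kb).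
rewrite /r; move: ne; rewrite ltr_pdivrMr ?mulr_gt0 ?exprn_gt0// => ne.
rewrite mulrA ltr_pdivrMr ?mulr_gt0//.
by have -> : enorm3 y * eps * (n%:R * enorm3 y) = n%:R * (enorm3 y ^+ 2 * eps) by ring.
Unshelve. all: by end_near. Qed.

Hypothesis k0 : 0 < k.

Lemma far_zero : exists s1 : R, forall b x, s1 < nrm2 x -> 0 < x.2 -> w12 b x = 0.
Proof.
have [s0 s00 [half flx gr]] := far_geometry.
have [C [n1 [C0 hC]]] := l2_shell k0 s00 half flx gr (hsol12 true) (hsol12 false) (rad12 k0).
exists s0 => b; apply: (exterior_vanishing k0 (hsol12 b) _ s00 half flx gr).
have LN := hs_L (hsol12 b); apply: (L1_decay half LN C0 (n1 := n1) _ (@ray12 b)) => n nn.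
have [LW JW] := hC n nn.
have le x : `|\1_N12 x * (w12 b x ^+ 2 * \1_(shell n) x)| <=
   \1_N12 x * ((w12 true x ^+ 2 + w12 false x ^+ 2) * \1_(shell n) x).
  have /andP[i0 _] := indic01 N12 x; have /andP[i1 _] := indic01 (shell n) x.
  rewrite ger0_norm; last by rewrite mulr_ge0// mulr_ge0// sqr_ge0.
  by rewrite ler_wpM2l// ler_wpM2r//; case: (b); rewrite ?lerDl ?lerDr sqr_ge0.
have L : L1 mu3 (fun x => \1_N12 x * (w12 b x ^+ 2 * \1_(shell n) x)).
  apply: (L1_le (mu := mu3) _ le LW); have mA := Lloc_meas LN.
  rewrite (_ : (fun x => _) = fun x => (\1_N12 x * w12 b x) ^+ 2 * \1_(shell n) x).
    by apply: measurable_funM; [exact: measurable_funX|exact: measurable_indic (meas_shell n)].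
  apply/funext => x; have [xN|xN] := pselect (N12 x); first by rewrite (indic1 xN) !mul1r.
  by rewrite (indic0' xN) !mul0r expr0n /= mul0r.
split => //; apply: le_trans JW; apply: (J_le (mu := mu3) L LW) => x.
exact: le_trans (ler_norm _) (le x).
Qed.

(* A chain of overlapping balls descending vertically from the region far
   above the surfaces, where [w] is already known to vanish. *)
Lemma descend (p p1 p2 p3 : pt -> R) (s1 : R) : hsol k N12 flat12 m12 p p1 p2 p3 ->
  (forall x, s1 < nrm2 x -> 0 < x.2 -> p x = 0) -> forall x, N12 x -> p x = 0.
Proof.
move=> H far x xN.
have [de de0 deN] : exists2 r : R, 0 < r & boxn x r `<=` N12.
  by apply: near_boxn; apply: open_nbhs_nbhs; split => //; exact: open_N12.
(* Centres spaced by de / 2 above x, for balls of radius de. The ball about the next higher centre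
   contains the ball of radius de / 2 about the current one, and this is the start that continuation
   needs. *)
pose ctr (n : nat) : pt := (x.1, x.2 + n%:R * (de / 2)).
have h0 : 0 < de / 2 by rewrite divr_gt0.
(* The ball about x lies in the common region, which is closed under moving up. *)
have inN n y : sqd (ctr n) y < de ^+ 2 -> N12 y.
  move=> /ltW /(sqd_box de0)[b1 b2 b3].
  have yN : N12 (y.1, y.2 - n%:R * (de / 2)).
    by apply: deN; split => //=; move: b3; rewrite /= opprD addrA addrAC.
  have le0 : y.2 - n%:R * (de / 2) <= y.2 by rewrite gerBl mulr_ge0// ltW.
  by case: yN => /= y1 y2; split; [exact: lt_le_trans y1 le0|exact: lt_le_trans y2 le0].
have step n : (forall y, sqd (ctr n.+1) y < de ^+ 2 -> p y = 0) -> forall y, sqd (ctr n) y < de ^+ 2 -> p y = 0.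
  move=> IH; apply: (interior_continuation k0 H (rho := (de / 2) ^+ 2)).
  - by rewrite exprn_gt0.
  - by rewrite lerXn2r ?nnegrE ?(ltW h0) ?(ltW de0)//; lra.
  - exact: inN.
  - move=> y hy; apply: IH; move: hy; rewrite /sqd /ctr /= -[n.+1%:R]natr1.
    have q1 := sqr_ge0 (y.1.1 - x.1.1); have q2 := sqr_ge0 (y.1.2 - x.1.2).
    have -> : y.2 - (x.2 + (n%:R + 1) * (de / 2)) = y.2 - (x.2 + n%:R * (de / 2)) - de / 2 by ring.
    move: (y.2 - (x.2 + _)) q1 q2 => t q1 q2 hy.
    have tb : `|t| <= de / 2 by apply: sqr_le_norm => //; lra.
    move: tb; rewrite ler_norml => /andP[t1 t2]; nra.
(* High enough that every point of the top ball has height above |s1| + 1; its squared norm then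
   exceeds s1. *)
pose n0 := (Num.truncn ((`|s1| + 1 + de + `|x.2|) / (de / 2))).+1.
have top y : sqd (ctr n0) y < de ^+ 2 -> p y = 0.
  move=> /ltW /(sqd_box de0)[_ _]; rewrite /= ler_norml => /andP[h1 _].
  have : `|s1| + 1 + de + `|x.2| < n0%:R * (de / 2) by rewrite -ltr_pdivrMr// truncnS_gt.
  move=> h2; have h3 := ler_norm (- x.2); rewrite normrN in h3; have h4 := ler_norm s1; have h5 := normr_ge0 s1.
  have y1 : `|s1| + 1 < y.2 by lra.
  apply: far; last by lra.
  have y2 : y.2 <= y.2 ^+ 2 by rewrite expr2 ler_peMl//; lra.
  have q1 := sqr_ge0 y.1.1; have q2 := sqr_ge0 y.1.2; rewrite /nrm2; lra.
have all n : (forall y, sqd (ctr n) y < de ^+ 2 -> p y = 0) -> forall y, sqd (ctr 0) y < de ^+ 2 -> p y = 0.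
  by elim: n => [//|n IH] h; apply: IH; exact: step.
apply: (all n0 top).
by rewrite /sqd /ctr /= mul0r addr0 !subrr expr0n /= !addr0 exprn_gt0.
Qed.

Lemma us_equal (x : pt) : N12 x -> us1 x = us2 x.
Proof.
move=> xN; have [s1 hs] := far_zero.
have e b := descend (hsol12 b) (hs b) xN.
have := e true; have := e false; rewrite /w12 /= => /eqP; rewrite subr_eq0 => /eqP h2 /eqP; rewrite subr_eq0 => /eqP h1.
by move: h1 h2; case: (us1 x) (us2 x) => [a b] [a' b'] /= -> ->.
Qed.
End TwoSurfaces.

Theorem mainTheorem7 (R : realType) (k : R) (f1 f2 : R * R -> R) (d : pt R)
    (us1 us2 : pt R -> cplx R) (F1 F2 : pt R -> cplx R) :
  0 < k ->
  locally_perturbed f1 -> locally_perturbed f2 ->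
  S2minus d ->
  scat_sol_N k f1 d us1 -> scat_sol_N k f2 d us2 ->
  far_field k us1 F1 -> far_field k us2 F2 ->
  (forall xh, S2plus xh -> F1 xh = F2 xh) ->
  forall x, (Omega f1 `&` Omega f2) x -> us1 x = us2 x.
Proof.
move=> k0 lp1 lp2 _ sol1 sol2 ff1 ff2 FE x xN.
exact: (us_equal lp1 lp2 sol1 sol2 ff1 ff2 FE k0 xN).
Qed.
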